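(* Let $G=(A,\Delta)$ be a regular locally compact quantum group and let $\alpha$ be a weak right action of $G$ on a C*-algebra $D$. Then $\alpha$ is a continuous action, i.e. there exists $\widetilde\alpha\in\mathrm{Mor}(D,D\otimes A)$ such that $\alpha(\omega,d)=(\mathrm{id}_D\otimes\omega)\widetilde\alpha(d)$ for all $\omega\in A_*$, $d\in D$, and $\widetilde\alpha(D)(1_D\otimes A)=D\otimes A$.
   Context: Conventions. For a C*-algebra $X$, $M(X)$ is its multiplier algebra, $1_X$ the unit of $M(X)$, $\mathrm{id}_X$ the identity map. $\otimes$ is the minimal tensor product of C*-algebras. $B(K)$, $B_0(K)$ are the bounded, resp. compact, operators on a Hilbert space $K$, $B(K)_*$ the normal functionals on $B(K)$; index $K$ is used for $B_0(K)$ in $1_K$, $\mathrm{id}_K$. For norm closed subsets $X,Y$ of a C*-algebra, $XY$ is the norm closed linear span of $\{xy:x\in X,y\in Y\}$. $\mathrm{Mor}(X,Y)$ is the set of *-homomorphisms $\varphi:X\to M(Y)$ with $\varphi(X)Y=Y$; each extends uniquely to a unital *-homomorphism $M(X)\to M(Y)$, and this extension is used for compositions. $\mathrm{Rep}(X,K)=\mathrm{Mor}(X,B_0(K))$. Slice maps are extended to multiplier algebras. ''C*-algebra generated by a set'' means the smallest C*-algebra containing it. Leg numbering. A numerical index indicates the tensor position in which a leg is placed; a morphism as index means that it is applied to that leg (placed in its target); remaining legs are filled with units. E.g. $V_{\hat\sigma 3}=1\otimes(\hat\sigma\otimes\mathrm{id}_A)V$, $V_{1\sigma}=(\mathrm{id}_{\hat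 A}\otimes\sigma)V\otimes 1_A$. Quantum groups. A locally compact quantum group is a pair $G=(A,\Delta)$ constructed from a manageable (modular) multiplicative unitary in the sense of Woronowicz: $W$ is a unitary on $H\otimes H$ with $W_{23}W_{12}=W_{12}W_{13}W_{23}$ for which there are a positive selfadjoint $Q$ on $H$ with $\ker Q=0$ and a unitary $\widetilde W$ on $\overline H\otimes H$ such that $W^*(Q\otimes Q)W=Q\otimes Q$ and $(x\otimes u|W|z\otimes y)=(\bar z\otimes Qu|\widetilde W|\bar x\otimes Q^{-1}y)$ for $x,z\in H$, $u\in\mathrm{dom}\,Q$, $y\in\mathrm{dom}\,Q^{-1}$ (modular unitaries are a variant yielding the same class of quantum groups). Then $A$ is the norm closure of $\{(\omega\otimes\mathrm{id})W:\omega\in B(H)_*\}$, $\Delta(a)=W(a\otimes1)W^*$, $\hat A$ is the norm closure of $\{(\mathrm{id}\otimes\omega)W:\omega\in B(H)_*\}$, $\hat\Delta(\hat a)=\mathrm{flip}(W^*(1\otimes\hat a)W)$, and $\hat G=(\hat A,\hat\Delta)$ is the dual. $W$ comes from a unitary $V\in M(\hat A\otimes A)$ (the canonical bicharacter) with $(\mathrm{id}\otimes\Delta)V=V_{12}V_{13}$, $(\hat\Delta\otimes\mathrm{id})V=V_{23}V_{13}$. A Heisenberg pair on $H$ is $\sigma\in\mathrm{Rep}(A,H)$, $\hat\sigma\in\mathrm{Rep}(\hat A,H)$ with $V_{\hat\sigma3}V_{1\sigma}=V_{1\sigma}V_{13}V_{\hat\sigma3}$. $A_*=\{\mu\circ\sigma:\mu\in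 B(H)_*\}$ (independent of the Heisenberg pair $(\sigma,\hat\sigma)$), and $\omega*\omega'=(\omega\otimes\omega')\circ\Delta\in A_*$ for $\omega,\omega'\in A_*$. $G$ is regular if $(\hat A\otimes1_A)V(1_{\hat A}\otimes A)=\hat A\otimes A$. Weak actions. A bilinear map $\alpha:A_*\times D\to D$ is faithful if for each nonzero $d\in D$ there is $\omega\in A_*$ with $\alpha(\omega,d)\ne0$. A faithful presentation of $\alpha$ on $K$ is a pair $(\pi,\widetilde\pi)$ with $\pi\in\mathrm{Rep}(D,K)$ faithful, $\widetilde\pi\in\mathrm{Mor}(D,B_0(K)\otimes A)$ and $\pi(\alpha(\omega,d))=(\mathrm{id}_K\otimes\omega)\widetilde\pi(d)$ for all $d\in D,\omega\in A_*$. A weak right action of $G$ on $D$ is a faithful bilinear map $\alpha:A_*\times D\to D$ such that: (WA0) $\alpha$ admits a faithful presentation; (WA1) the C*-algebra $D$ is generated by the norm closed linear span of $\{\alpha(\omega,d):\omega\in A_*,d\in D\}$; (WA2) $\alpha(\omega,\alpha(\omega',d))=\alpha(\omega*\omega',d)$ for all $d\in D$, $\omega,\omega'\in A_*$. *)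

(* Defs.v *)
From HB Require Import structures.
From mathcomp Require Import all_boot all_order all_algebra.
From mathcomp Require Import complex.
From mathcomp Require Import boolp classical_sets functions reals topology normedtype.

Set Implicit Arguments.
Unset Strict Implicit.
Unset Printing Implicit Defensive.

Import Order.TTheory GRing.Theory Num.Theory.
Import numFieldNormedType.Exports.

Local Open Scope classical_set_scope.
Local Open Scope ring_scope.
Local Open Scope complex_scope.

(* The inner product is linear in the second variable. *)
HB.mixin Record isHilbert (R : realType) H & CompleteNormedModule R[i] H := {
  ip : H -> H -> R[i];
  ipPr : forall (c : R[i]) (u v w : H), ip u (c *: v + w) = c * ip u v + ip u w;
  ipC : forall u v : H, ip v u = (ip u v)^*%C;
  ip_norm : forall u : H, `|u| ^+ 2 = ip u u
}.

#[short(type="hilbertType")]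
HB.structure Definition Hilbert (R : realType) :=
  {H of CompleteNormedModule R[i] H & isHilbert R H}.

(* Not necessarily unital; hence the product is not that of a ringType. *)
HB.mixin Record isCStarAlgebra (R : realType) X & CompleteNormedModule R[i] X := {
  cmul : X -> X -> X;
  cstar : X -> X;
  cmulA : associative cmul;
  cmulPl : forall (c : R[i]) (x y z : X),
    cmul (c *: x + y) z = c *: cmul x z + cmul y z;
  cmulPr : forall (c : R[i]) (x y z : X),
    cmul z (c *: x + y) = c *: cmul z x + cmul z y;
  cstarP : forall (c : R[i]) (x y : X),
    cstar (c *: x + y) = c^*%C *: cstar x + cstar y;
  cstarM : forall x y : X, cstar (cmul x y) = cmul (cstar y) (cstar x);
  cstarK : involutive cstar;
  cnormM : forall x y : X, `|cmul x y| <= `|x| * `|y|;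
  cnorm_star : forall x : X, `|cmul (cstar x) x| = `|x| ^+ 2
}.

#[short(type="cstarType")]
HB.structure Definition CStarAlgebra (R : realType) :=
  {X of CompleteNormedModule R[i] X & isCStarAlgebra R X}.

Definition lin_span (K : pzRingType) (V : lmodType K) (S : set V) : set V :=
  [set v | exists (n : nat) (c : 'I_n -> K) (s : 'I_n -> V),
     (forall i, S (s i)) /\ v = \sum_i c i *: s i].

Definition cstar_sub (R : realType) (D : cstarType R) (B : set D) : Prop :=
  [/\ closed B, lin_span B `<=` B,
      (forall x y, B x -> B y -> B (cmul x y)) &
      (forall x, B x -> B (cstar x))].

Section Operators.
Variable R : realType.
Implicit Types H K : hilbertType R.

(* Bounded operators are functions H -> H satisfying bop. *)
Definition bop H (T : H -> H) : Prop := linear T /\ continuous T.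

(* Closure for the operator norm. *)
Definition op_closure H (S : set (H -> H)) : set (H -> H) :=
  [set T | bop T /\ forall e : R[i], 0 < e ->
     exists2 s, S s & forall x, `|T x - s x| <= e * `|x|].

Definition op_cspan H (S : set (H -> H)) : set (H -> H) :=
  op_closure (lin_span S).

(* The operator T with (u | T v) = b u v. *)
Definition form_op H (b : H -> H -> R[i]) : H -> H :=
  xget (fun=> 0) [set T : H -> H | forall u v, ip u (T v) = b u v].

Definition adj H (T : H -> H) : H -> H := form_op (fun u v => ip (T u) v).

Definition unitary_op H (U : H -> H) : Prop :=
  [/\ bop U, cancel U (adj U) & cancel (adj U) U].

Definition compact_ops H : set (H -> H) :=
  [set T | bop T /\ precompact (T @` [set x | `|x| <= 1])].

(* M(X) for a C*-algebra X acting nondegenerately on H. *)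
Definition multiplier H (X : set (H -> H)) : set (H -> H) :=
  [set m | bop m /\ forall x, X x -> X (m \o x) /\ X (x \o m)].

(* Mor(D, Y) for a C*-algebra Y acting nondegenerately on H. *)
Definition Mor (D : cstarType R) H (Y : set (H -> H)) (phi : D -> H -> H) :=
  [/\ linear phi,
      (forall a b, phi (cmul a b) = phi a \o phi b),
      (forall a, phi (cstar a) = adj (phi a)),
      (forall a, multiplier Y (phi a)) &
      op_cspan [set T | exists d y, Y y /\ T = phi d \o y] = Y].

Definition Rep (D : cstarType R) H (phi : D -> H -> H) : Prop :=
  Mor (@compact_ops H) phi.

(* B(H)_*: the ultraweakly continuous functionals, that is
   T |-> \sum_n (xi_n | T eta_n) with square summable xi and eta. *)
Definition normal_functional H (mu : (H -> H) -> R[i]) : Prop :=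
  exists xi eta : nat -> H,
    [/\ (exists M : R[i], forall n, \sum_(k < n) `|xi k| ^+ 2 <= M),
        (exists M : R[i], forall n, \sum_(k < n) `|eta k| ^+ 2 <= M) &
        forall T, bop T ->
          (fun n => \sum_(k < n) ip (xi k) (T (eta k)) : R[i]^o) @ \oo --> (mu T : R[i]^o)].

(* The Hilbert space tensor product and the conjugate Hilbert space are given
   by their characterizations up to a unique unitary. *)
Record htensor H K := HTensor {
  ht_sort :> hilbertType R;
  ht_map : H -> K -> ht_sort;
  ht_linl : forall y, linear (ht_map^~ y);
  ht_linr : forall x, linear (ht_map x);
  ht_ip : forall x y x' y', ip (ht_map x y) (ht_map x' y') = ip x x' * ip y y';
  ht_dense : closure (lin_span [set ht_map p.1 p.2 | p in [set: H * K]]) = setT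
}.

Record hconj H := HConj {
  hc_sort :> hilbertType R;
  hc_map : H -> hc_sort;
  hc_lin : forall (c : R[i]) x y, hc_map (c *: x + y) = c^*%C *: hc_map x + hc_map y;
  hc_surj : forall z, exists x, hc_map x = z;
  hc_ip : forall x y, ip (hc_map x) (hc_map y) = ip y x
}.

Section Tensor.
Variables (H K : hilbertType R) (t : htensor H K).

Definition op_tensor (S : H -> H) (T : K -> K) : t -> t :=
  xget (fun=> 0) [set U : t -> t | bop U /\
    forall x y, U (ht_map t x y) = ht_map t (S x) (T y)].

(* The minimal tensor product of C*-algebras acting on H and K. *)
Definition min_tensor (X : set (H -> H)) (Y : set (K -> K)) : set (t -> t) :=
  op_cspan [set U | exists x y, [/\ X x, Y y & U = op_tensor x y]].

(* slice_l w T = (w (x) id) T and slice_r w T = (id (x) w) T, determined by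
   (x | (w (x) id)T y) = w ((id (x) (x | . y)) T), and symmetrically. *)
Definition slice_l (w : (H -> H) -> R[i]) (T : t -> t) : K -> K :=
  form_op (fun x y =>
    w (form_op (fun u v => ip (ht_map t u x) (T (ht_map t v y))))).

Definition slice_r (w : (K -> K) -> R[i]) (T : t -> t) : H -> H :=
  form_op (fun u v =>
    w (form_op (fun x y => ip (ht_map t u x) (T (ht_map t v y))))).

End Tensor.

Section MultiplicativeUnitary.
Variables (H : hilbertType R) (H2 : htensor H H) (W : H2 -> H2).
Local Notation "x *o y" := (ht_map H2 x y) (at level 40).

Section Legs.
Variable H3 : htensor H2 H.
Local Notation "x *o3 y" := (ht_map H3 x y) (at level 40).

Definition is_leg12 (T : H3 -> H3) : Prop := bop T /\ forall x y z x' y' z',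
  ip ((x *o y) *o3 z) (T ((x' *o y') *o3 z')) = ip (x *o y) (W (x' *o y')) * ip z z'.
Definition is_leg13 (T : H3 -> H3) : Prop := bop T /\ forall x y z x' y' z',
  ip ((x *o y) *o3 z) (T ((x' *o y') *o3 z')) = ip (x *o z) (W (x' *o z')) * ip y y'.
Definition is_leg23 (T : H3 -> H3) : Prop := bop T /\ forall x y z x' y' z',
  ip ((x *o y) *o3 z) (T ((x' *o y') *o3 z')) = ip (y *o z) (W (y' *o z')) * ip x x'.
End Legs.

Definition multiplicative_unitary : Prop :=
  unitary_op W /\
  exists (H3 : htensor H2 H) (W12 W13 W23 : H3 -> H3),
    [/\ is_leg12 W12, is_leg13 W13, is_leg23 W23 &
        W23 \o W12 = W12 \o W13 \o W23].

(* An unbounded operator is a function Q used only on its domain dom. *)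
Definition selfadjoint (dom : set H) (Q : H -> H) : Prop :=
  [/\ lin_span dom `<=` dom,
      closure dom = setT,
      (forall (c : R[i]) x y, dom x -> dom y -> Q (c *: x + y) = c *: Q x + Q y) &
      forall u v, (dom u /\ Q u = v) <-> (forall x, dom x -> ip (Q x) u = ip x v)].

Definition graph_tensor (dom : set H) (Q : H -> H) : set (H2 * H2) :=
  closure (lin_span
    [set p | exists x y, [/\ dom x, dom y & p = (x *o y, Q x *o Q y)]]).

(* W^*(Q (x) Q)W = Q (x) Q is read on graphs, and y in dom Q^-1 is written
   Q v with v in dom Q. *)
Definition manageable : Prop :=
  exists (Hb : hconj H) (HbH : htensor Hb H) (dom : set H) (Q : H -> H)
         (Wt : HbH -> HbH),
    [/\ selfadjoint dom Q,
        (forall x, dom x -> 0 <= ip x (Q x)) /\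
        (forall x, dom x -> Q x = 0 -> x = 0),
        unitary_op Wt,
        (forall xi eta, graph_tensor dom Q (xi, eta) <->
                        graph_tensor dom Q (W xi, W eta)) &
        forall x z u v, dom u -> dom v ->
          ip (x *o u) (W (z *o Q v)) =
          ip (ht_map HbH (hc_map Hb z) (Q u)) (Wt (ht_map HbH (hc_map Hb x) v))].

End MultiplicativeUnitary.
End Operators.

Arguments op_tensor {R H K} t S T _.
Arguments min_tensor {R H K} t X Y _.

(* The quantum group is realized on the space of its multiplicative unitary:
   the inclusions of A and of its dual in B(H) form a Heisenberg pair, by the
   pentagon equation, and identify the canonical bicharacter with W. *)
Record lcqg (R : realType) := LCQG {
  qgH : hilbertType R;
  qgH2 : htensor qgH qgH;
  qgW : qgH2 -> qgH2;
  qgW_mult : multiplicative_unitary qgW;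
  qgW_manageable : manageable qgW
}.

Section QuantumGroup.
Variables (R : realType) (G : lcqg R).
Local Notation H := (qgH G).
Local Notation H2 := (qgH2 G).
Local Notation W := (@qgW R G).

Definition qgA : set (H -> H) :=
  op_closure [set slice_l w W | w in @normal_functional R H].

Definition qgAhat : set (H -> H) :=
  op_closure [set slice_r w W | w in @normal_functional R H].

Definition qgDelta (a : H -> H) : H2 -> H2 :=
  W \o op_tensor H2 a id \o adj W.

Definition regular : Prop :=
  op_cspan [set T | exists b a, [/\ qgAhat b, qgA a &
              T = op_tensor H2 b id \o W \o op_tensor H2 id a]]
  = min_tensor H2 qgAhat qgA.

Definition restrA (mu : (H -> H) -> R[i]) : qgA -> R[i] := fun a => mu (set_val a).

Definition qgAstar : set (qgA -> R[i]) :=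
  [set restrA mu | mu in @normal_functional R H].

(* a |-> (mu (x) nu)(Delta a) *)
Definition conv (mu nu : (H -> H) -> R[i]) (a : H -> H) : R[i] :=
  mu (slice_r nu (qgDelta a)).

Section Action.
Variables (D : cstarType R).
(* Only the values of alpha on qgAstar are relevant. *)
Variable alpha : (qgA -> R[i]) -> D -> D.

Definition action_bilinear : Prop :=
  (forall (c : R[i]) w w' d, qgAstar w -> qgAstar w' ->
     alpha (fun a => c * w a + w' a) d = c *: alpha w d + alpha w' d) /\
  (forall w, qgAstar w -> linear (alpha w)).

Definition action_faithful : Prop :=
  forall d, d != 0 -> exists2 w, qgAstar w & alpha w d != 0.

Definition faithful_presentation (K : hilbertType R) (KH : htensor K H)
    (pi : D -> K -> K) (pit : D -> KH -> KH) : Prop :=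
  [/\ Rep pi, injective pi,
      Mor (min_tensor KH (@compact_ops R K) qgA) pit &
      forall d mu, normal_functional mu ->
        pi (alpha (restrA mu) d) = slice_r mu (pit d)].

Definition action_image : set D :=
  [set x | exists w d, qgAstar w /\ x = alpha w d].

Definition weak_right_action : Prop :=
  [/\ action_bilinear, action_faithful,
      (exists (K : hilbertType R) (KH : htensor K H) pi pit,
         faithful_presentation (KH := KH) pi pit),
      (forall B : set D, cstar_sub B ->
         closure (lin_span action_image) `<=` B -> B = setT) &
      (forall d mu nu, normal_functional mu -> normal_functional nu ->
         alpha (restrA mu) (alpha (restrA nu) d) = alpha (restrA (conv mu nu)) d)].

(* D (x) A and its multipliers are realized on L (x) H, for an arbitrary
   faithful representation rho of D on L. *)
Definition continuous_action : Prop :=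
  forall (L : hilbertType R) (LH : htensor L H) (rho : D -> L -> L),
    Rep rho -> injective rho ->
    exists alphat : D -> LH -> LH,
      [/\ Mor (min_tensor LH (range rho) qgA) alphat,
          (forall d mu, normal_functional mu ->
             rho (alpha (restrA mu) d) = slice_r mu (alphat d)) &
          op_cspan [set T | exists d a, qgA a /\ T = alphat d \o op_tensor LH id a]
          = min_tensor LH (range rho) qgA].

End Action.
End QuantumGroup.

Arguments qgA {R} G _.
Arguments qgAhat {R} G _.

(* Main.v *)
(* For the faithful presentation (pi, pit) of alpha, condition (WA2) says that
   the slices of pit (alpha (w, d)) arise from those of pit d by the map
   t |-> W (t (x) 1) W^*.  Manageability provides a partner Wt of W on the tensor
   product of H with its conjugate Hb, and transposing legs of the pentagon
   equation produces from it a unitary U on Hb (x) H (x) H such that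
   U^* (1 (x) t (x) 1) U implements this map; the same relations show that A is
   selfadjoint.  Regularity implies that U and U^* preserve the closed span of
   the operators |z> a with a in A, and that so does (1 (x) A) U |z>.
   Evaluating (U |z>)^* (pit d) (|z'> a) on both sides therefore gives
   [pit(E) (1 (x) A)] = [pi(E) (x) A], where E is the closed span of the image of
   alpha.  Hence E is a C*-subalgebra, which is D by (WA1).

   It remains to pass from pi to an arbitrary faithful representation rho.  Any
   operator all of whose slices lie in pi(D) has a counterpart with the
   corresponding slices in rho(D): on finitely many vectors of H this is the
   isometry of *-homomorphisms on matrices over D, and the bounds are uniform. *)

From HB Require Import structures.
Require Import Defs.
From mathcomp Require Import all_boot all_order all_algebra.
From mathcomp Require Import complex.
From mathcomp Require Import boolp classical_sets functions reals topology normedtype sequences.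
From mathcomp Require Import zify ring lra.

Set Implicit Arguments.
Unset Strict Implicit.
Unset Printing Implicit Defensive.

Import Order.TTheory GRing.Theory Num.Theory.
Import numFieldNormedType.Exports.

Local Open Scope classical_set_scope.
Local Open Scope ring_scope.
Local Open Scope complex_scope.

(** * Norms, sequences and linear spans *)

(** The obstacle is the position of t. Slicing pit d over K leaves t on the leg H that the
    functional evaluates, whereas in W (t (x) 1) W^* it sits on the leg that remains. The leg Hb
    lets t change places. With X the conjugate of Wt by the antiunitary c x (x) y |-> c y (x) x, the
    unitary Z = Wt^* X exchanges slices of W on H for slices of X on Hb. On legs a, s, b, where s
    carries Hb, conjugation by the adjoint of UU = Z_as^* Wt_bs^* Z_as moves t from a to s,
    conjugates it by Wt on s and b, which treats slices of X as W treats slices of W, and moves the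
    result back to a.

    The two closed spans are compared through a third, in which UU stands in front of only one of
    the two kets. Inserting UU on the other side leads to pit; removing it leads to pi and requires
    an element of A next to it, which regularity then absorbs.

    As Q is unbounded, no operator Q S Q^-1 is formed: transposition is a relation between matrix
    elements on dom Q, and it determines the transposed operator because dom Q and the range of Q
    are total. *)

Notation cj := (@conjc _).

Section RealNorm.
Variable R : realType.
Local Notation C := R[i].

(** Norms over [R[i]] take values in [R[i]]; the real part puts all estimates in the ordered field
    [R], within reach of [lra] and [nra]. *)
Definition nr (V : normedZmodType C) (x : V) : R := complex.Re `|x|.

Lemma nrE (V : normedZmodType C) (x : V) : `|x| = (nr x)%:C.
Proof. by rewrite /nr RRe_real// ger0_real. Qed.

Lemma nr_ge0 (V : normedZmodType C) (x : V) : 0 <= nr x.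
Proof. by rewrite -ler0c -nrE. Qed.

Lemma nrD (V : normedZmodType C) (x y : V) : nr (x + y) <= nr x + nr y.
Proof. by rewrite -lecR rmorphD/= -!nrE ler_normD. Qed.

Lemma nrN (V : normedZmodType C) (x : V) : nr (- x) = nr x.
Proof. by rewrite /nr normrN. Qed.

Lemma nr0 (V : normedZmodType C) : nr (0 : V) = 0.
Proof. by rewrite /nr normr0. Qed.

Lemma nr0_eq0 (V : normedZmodType C) (x : V) : nr x = 0 -> x = 0.
Proof. by move=> x0; apply/normr0_eq0; rewrite nrE x0. Qed.

Lemma nr_eq0 (V : normedZmodType C) (x : V) : (nr x == 0) = (x == 0).
Proof. by apply/eqP/eqP => [/nr0_eq0//|->]; rewrite nr0. Qed.

Lemma nr_gt0 (V : normedZmodType C) (x : V) : (0 < nr x) = (x != 0).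
Proof. by rewrite lt_neqAle nr_ge0 andbT eq_sym nr_eq0. Qed.

Lemma nrBC (V : normedZmodType C) (x y : V) : nr (x - y) = nr (y - x).
Proof. by rewrite -nrN opprB. Qed.

Lemma nrB (V : normedZmodType C) (x y : V) : nr (x - y) <= nr x + nr y.
Proof. by rewrite -(nrN y) nrD. Qed.

Lemma nr_tri (V : normedZmodType C) (x y z : V) :
  nr (x - z) <= nr (x - y) + nr (y - z).
Proof. by apply: le_trans (nrD _ _); rewrite addrA subrK. Qed.

Lemma nr_sum (V : normedZmodType C) (I : Type) (s : seq I) (P : pred I) (F : I -> V) :
  nr (\sum_(i <- s | P i) F i) <= \sum_(i <- s | P i) nr (F i).
Proof.
elim/big_ind2 : _ => //; first by rewrite nr0.
by move=> x1 x2 y1 y2 h1 h2; apply: le_trans (nrD _ _) (lerD h1 h2).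
Qed.

Lemma nrZ (V : normedModType C) (c : C) (x : V) : nr (c *: x) = nr c * nr x.
Proof. by apply/complexI; rewrite rmorphM/= -!nrE normrZ. Qed.

Lemma nrM (c d : C) : nr (c * d) = nr c * nr d.
Proof. by apply/complexI; rewrite rmorphM/= -!nrE normrM. Qed.

Lemma nrC (a : R) : nr (a%:C : C) = `|a|.
Proof. by rewrite /nr normc_def/= expr0n addr0 sqrtr_sqr. Qed.

Lemma nr1 : nr (1 : C) = 1. Proof. by rewrite -[1]/(1%:C) nrC normr1. Qed.

Lemma nr_conj (c : C) : nr (cj c) = nr c.
Proof. by rewrite /nr !normc_def; case: c => a b /=; rewrite sqrrN. Qed.

Lemma Re_le_nr (c : C) : complex.Re c <= nr c.
Proof.
rewrite /nr normc_def; case: c => a b /=.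
apply: le_trans (ler_norm a) _; rewrite -sqrtr_sqr ler_wsqrtr//.
by rewrite lerDl sqr_ge0.
Qed.

Lemma conj_mul_nr (c : C) : cj c * c = (nr c ^+ 2)%:C.
Proof.
rewrite /nr normc_def/= sqr_sqrtr ?addr_ge0 ?sqr_ge0//; case: c => a b /=.
by apply/eqP; rewrite eq_complex/=; apply/andP; split; apply/eqP; ring.
Qed.

Lemma nr_le_eps (x y : R) : (forall e, 0 < e -> x <= y + e) -> x <= y.
Proof. by move=> h; apply/ler_addgt0Pr. Qed.

Lemma gtc0P (e : C) : 0 < e -> exists2 r : R, 0 < r & e = r%:C.
Proof.
by case: e => a b; rewrite ltcE/= => /andP[/eqP b0 a0]; exists a => //; rewrite b0.
Qed.

Definition tends (V : normedZmodType C) (u : nat -> V) (l : V) :=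
  forall e : R, 0 < e -> exists N, forall n, (N <= n)%N -> nr (u n - l) <= e.

Definition cauchys (V : normedZmodType C) (u : nat -> V) :=
  forall e : R, 0 < e -> exists N, forall n m, (N <= n)%N -> (N <= m)%N -> nr (u n - u m) <= e.

Lemma cvg_tends (V : normedModType C) (u : nat -> V) (l : V) :
  (u @ \oo --> l) <-> tends u l.
Proof.
split.
  move=> /cvgrPdist_le h e e0; have e0c : 0 < e%:C :> C by rewrite ltcR.
  have [N _ hN] := h _ e0c; exists N => n nN; have := hN n nN.
  by rewrite nrE lecR nrBC.
move=> h; apply/cvgrPdist_le => e /gtc0P[r r0 ->].
have [N hN] := h r r0; exists N => // n /= nN.
by rewrite nrE lecR nrBC; apply: hN.
Qed.

Lemma tends_complete (V : completeNormedModType C) (u : nat -> V) :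
  cauchys u -> exists l, tends u l.
Proof.
move=> cu; have : cvg (u @ \oo).
  apply/cauchy_cvgP/cauchy_exP => e /gtc0P[r r0 ->].
  have [N hN] := cu (r / 2) (divr_gt0 r0 (ltr0Sn _ _)).
  exists (u N); exists N => // n /= nN.
  rewrite /= -ball_normE/= nrE ltcR; apply: le_lt_trans (hN _ _ (leqnn _) nN) _.
  lra.
by move=> c; exists (lim (u @ \oo)); apply/cvg_tends.
Qed.

Lemma tends_uniq (V : normedZmodType C) (u : nat -> V) l l' :
  tends u l -> tends u l' -> l = l'.
Proof.
move=> h h'; apply/eqP; rewrite -subr_eq0 -nr_eq0; apply/eqP/le_anti.
rewrite nr_ge0 andbT; apply: nr_le_eps => e e0; rewrite add0r.
have e20 : 0 < e / 2 by lra.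
have [N hN] := h _ e20; have [N' hN'] := h' _ e20.
have := hN (N + N')%N (leq_addr _ _); have := hN' (N + N')%N (leq_addl _ _).
move=> a b; apply: le_trans (nr_tri _ (u (N + N')%N) _) _; rewrite nrBC; lra.
Qed.

Lemma tendsD (V : normedZmodType C) (u v : nat -> V) l m :
  tends u l -> tends v m -> tends (fun n => u n + v n) (l + m).
Proof.
move=> h h' e e0; have e20 : 0 < e / 2 by lra.
have [N hN] := h _ e20; have [N' hN'] := h' _ e20.
exists (N + N')%N => n nn; have := hN n (leq_trans (leq_addr _ _) nn).
have := hN' n (leq_trans (leq_addl _ _) nn) => a b.
by rewrite opprD addrACA; apply: le_trans (nrD _ _) _; lra.
Qed.

Lemma tends_cst (V : normedZmodType C) (l : V) : tends (fun=> l) l.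
Proof. by move=> e e0; exists 0%N => n _; rewrite subrr nr0 ltW. Qed.

Lemma tends_bnd (V W : normedZmodType C) (u : nat -> V) l (w : nat -> W) k M :
  0 <= M -> tends u l -> (forall n, nr (w n - k) <= M * nr (u n - l)) -> tends w k.
Proof.
move=> M0 h hM e e0.
have M1 : 0 < M + 1 by lra.
have [N hN] := h (e / (M + 1)) (divr_gt0 e0 M1).
exists N => n /hN hn; apply: le_trans (hM n) _.
apply: le_trans (ler_wpM2l M0 hn) _.
rewrite mulrA ler_pdivrMr//; nra.
Qed.

Lemma tends_le (V : normedZmodType C) (u : nat -> V) l M :
  tends u l -> (forall n, nr (u n) <= M) -> nr l <= M.
Proof.
move=> h hM; apply: nr_le_eps => e e0; have [N hN] := h _ e0.
have := hN N (leqnn _); have := hM N.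
have := nrD (u N) (l - u N); rewrite addrC subrK (nrBC l); lra.
Qed.

Lemma closure_nrP (V : normedModType C) (S : set V) (x : V) :
  closure S x <-> forall e : R, 0 < e -> exists2 s, S s & nr (x - s) <= e.
Proof.
split.
  move=> h e e0; have e0c : 0 < e%:C :> C by rewrite ltcR.
  have [s [Ss]] := h _ (nbhsx_ballx x _ e0c).
  by rewrite -ball_normE/= nrE ltcR => ?; exists s => //; apply: ltW.
move=> h B /nbhs_ballP[e /= /gtc0P[r r0 ->] hB].
have [s Ss hs] := h (r / 2) (divr_gt0 r0 (ltr0Sn _ _)).
exists s; split=> //; apply: hB; rewrite -ball_normE/= nrE ltcR; lra.
Qed.

End RealNorm.

Section LinSpan.
Variables (K : pzRingType) (V : lmodType K).
Implicit Types S : set V.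

Lemma lin_span_sub S : S `<=` lin_span S.
Proof.
move=> v Sv; exists 1%N, (fun=> 1), (fun=> v); split=> //.
by rewrite big_ord1 scale1r.
Qed.

Lemma lin_span0 S : lin_span S 0.
Proof. by exists 0%N, (fun=> 0), (fun=> 0); split=> [[]//|]; rewrite big_ord0. Qed.

Lemma lin_spanZ S (a : K) u : lin_span S u -> lin_span S (a *: u).
Proof.
move=> [n [c [s [hs ->]]]]; exists n, (fun i => a * c i), s; split=> //.
by rewrite scaler_sumr; apply: eq_bigr => i _; rewrite scalerA.
Qed.

Lemma lin_spanD S u v : lin_span S u -> lin_span S v -> lin_span S (u + v).
Proof.
move=> [n [c [s [hs ->]]]] [m [d [t [ht ->]]]].
exists (n + m)%N, (fun i : 'I_(n+m) => match fintype.split i with inl j => c j | inr k => d k end),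
  (fun i : 'I_(n+m) => match fintype.split i with inl j => s j | inr k => t k end); split.
  by move=> i; case: fintype.split.
rewrite big_split_ord/=; congr (_ + _); apply: eq_bigr => i _.
  by rewrite (unsplitK (inl i)).
by rewrite (unsplitK (inr i)).
Qed.

Lemma lin_span_sum S (I : Type) (r : seq I) (P : pred I) (F : I -> V) :
  (forall i, P i -> lin_span S (F i)) -> lin_span S (\sum_(i <- r | P i) F i).
Proof.
by move=> h; elim/big_ind : _ => //; [exact: lin_span0|move=> *; exact: lin_spanD].
Qed.

Lemma lin_span_ind S (P : V -> Prop) : P 0 ->
  (forall a u v, S u -> P v -> P (a *: u + v)) -> forall v, lin_span S v -> P v.
Proof.
move=> P0 PD v [n [c [s [hs ->]]]].
elim: n c s hs => [|n IH] c s hs; first by rewrite big_ord0.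
by rewrite big_ord_recl; apply: PD => //; apply: IH => i; apply: hs.
Qed.

Lemma lin_span_le S S' : S `<=` lin_span S' -> lin_span S `<=` lin_span S'.
Proof.
move=> h; apply: lin_span_ind; first exact: lin_span0.
by move=> a u v /h Su Sv; apply: lin_spanD => //; apply: lin_spanZ.
Qed.

End LinSpan.

Lemma cjK (R : realType) (a : R[i]) : cj (cj a) = a.
Proof. exact: conjcK. Qed.

(** * Bounded operators between Hilbert spaces *)

Section InnerProduct.
Variable R : realType.
Local Notation C := R[i].
Implicit Types H K : hilbertType R.

Lemma conjR (a : R) : cj a%:C = a%:C :> C. Proof. exact: conjc_real. Qed.

Lemma ipDr H (u v w : H) : ip u (v + w) = ip u v + ip u w.
Proof. by have := ipPr 1 u v w; rewrite scale1r mul1r. Qed.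

Lemma ip0r H (u : H) : ip u 0 = 0.
Proof. by apply: (addrI (ip u 0)); rewrite -ipDr !addr0. Qed.

Lemma ipZr H (c : C) (u v : H) : ip u (c *: v) = c * ip u v.
Proof. by have := ipPr c u v 0; rewrite !addr0 ip0r addr0. Qed.

Lemma ipNr H (u v : H) : ip u (- v) = - ip u v.
Proof. by rewrite -scaleN1r ipZr mulN1r. Qed.

Lemma ipBr H (u v w : H) : ip u (v - w) = ip u v - ip u w.
Proof. by rewrite ipDr ipNr. Qed.

Lemma ip_sumr H (I : Type) (s : seq I) (P : pred I) (F : I -> H) u :
  ip u (\sum_(i <- s | P i) F i) = \sum_(i <- s | P i) ip u (F i).
Proof. exact: (big_morph _ (ipDr u) (ip0r u)). Qed.

Lemma ipDl H (u v w : H) : ip (u + v) w = ip u w + ip v w.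
Proof. by rewrite (ipC w) ipDr rmorphD/= -!ipC. Qed.

Lemma ip0l H (u : H) : ip 0 u = 0.
Proof. by rewrite (ipC u) ip0r rmorph0. Qed.

Lemma ipZl H (c : C) (u v : H) : ip (c *: u) v = cj c * ip u v.
Proof. by rewrite (ipC v) ipZr rmorphM/= -!ipC. Qed.

Lemma ipNl H (u v : H) : ip (- u) v = - ip u v.
Proof. by rewrite (ipC v) ipNr rmorphN/= -!ipC. Qed.

Lemma ipBl H (u v w : H) : ip (u - v) w = ip u w - ip v w.
Proof. by rewrite ipDl ipNl. Qed.

Lemma ip_suml H (I : Type) (s : seq I) (P : pred I) (F : I -> H) u :
  ip (\sum_(i <- s | P i) F i) u = \sum_(i <- s | P i) ip (F i) u.
Proof. by apply: (big_morph (ip^~ u) _ (ip0l u)) => x y; rewrite ipDl. Qed.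

Lemma ip_nr H (u : H) : ip u u = (nr u ^+ 2)%:C.
Proof. by rewrite -ip_norm nrE rmorphXn. Qed.

Lemma nrDsq H (u v : H) :
  nr (u + v) ^+ 2 = nr u ^+ 2 + nr v ^+ 2 + 2 * complex.Re (ip u v).
Proof.
apply: complexI; rewrite -ip_nr ipDl !ipDr !ip_nr (ipC u v).
rewrite !rmorphD/= rmorphM/=; case: (ip u v) => a b /=.
by apply/eqP; rewrite eq_complex/=; apply/andP; split; apply/eqP; ring.
Qed.

Lemma CauchySchwarz H (u v : H) : nr (ip u v) <= nr u * nr v.
Proof.
have [->|u0] := eqVneq u 0; first by rewrite ip0l !nr0 mul0r.
have p0 : 0 < nr u by rewrite nr_gt0.
set c := ip u v; set a := (nr u ^+ 2).
have h := sqr_ge0 (nr (a%:C *: v - c *: u)).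
have E : nr (a%:C *: v - c *: u) ^+ 2 = a * (a * nr v ^+ 2 - nr c ^+ 2).
  apply: complexI; rewrite -ip_nr ipBl !ipBr !ipZl !ipZr !(conjR a) !ip_nr.
  rewrite -/a -/c (ipC u v) -/c.
  have -> : (a * (a * nr v ^+ 2 - nr c ^+ 2))%:C =
      a%:C * (a%:C * (nr v ^+ 2)%:C - cj c * c) :> C.
    by rewrite conj_mul_nr -rmorphM -rmorphB -rmorphM.
  by rewrite -/a; ring.
rewrite E pmulr_rge0 ?exprn_gt0// subr_ge0 /a -exprMn in h.
by rewrite -ler_sqr ?nnegrE ?mulr_ge0 ?nr_ge0.
Qed.

Lemma ip_ext H (v w : H) : (forall u, ip u v = ip u w) -> v = w.
Proof.
move=> h; apply/eqP; rewrite -subr_eq0 -nr_eq0 -sqrf_eq0; apply/eqP/complexI.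
by rewrite -ip_nr ipBr h subrr.
Qed.

Lemma ip_extl H (v w : H) : (forall u, ip v u = ip w u) -> v = w.
Proof. by move=> h; apply: ip_ext => u; rewrite (ipC v) h -ipC. Qed.

End InnerProduct.

Section Operators.
Variable R : realType.
Local Notation C := R[i].

Definition blin (V W : normedModType C) (T : V -> W) :=
  linear T /\ exists M : R, forall x, nr (T x) <= M * nr x.

(** Source and target may differ, so that kets and bras are operators like any other and slices are
    mere compositions. *)
Record op (V W : normedModType C) := Op { opf :> V -> W; opP : blin opf }.

Lemma op_ext (V W : normedModType C) (S T : op V W) : (forall x, S x = T x) -> S = T.
Proof.
case: S T => [f hf] [g hg] /= /funext fg; subst g.
by rewrite (Prop_irrelevance hf hg).
Qed.

HB.instance Definition _ (V W : normedModType C) := gen_eqMixin (op V W).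
HB.instance Definition _ (V W : normedModType C) := gen_choiceMixin (op V W).

HB.instance Definition _ (V W : normedModType C) (T : op V W) :=
  GRing.isLinear.Build C V W *:%R (opf T) (opP T).1.

Lemma op_bound (V W : normedModType C) (T : op V W) :
  exists2 M : R, 0 <= M & forall x, nr (T x) <= M * nr x.
Proof.
case: T => T [? [M hM]] /=; exists `|M| => // x; apply: le_trans (hM x) _.
by rewrite ler_wpM2r ?nr_ge0// ler_norm.
Qed.

(** Some bound of T, not its norm: estimates only ever need a finite constant. *)
Definition opb (V W : normedModType C) (T : op V W) : R := sval (cid2 (op_bound T)).

Lemma opb_ge0 (V W : normedModType C) (T : op V W) : 0 <= opb T.
Proof. by rewrite /opb; case: cid2. Qed.

Lemma opbP (V W : normedModType C) (T : op V W) x : nr (T x) <= opb T * nr x.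
Proof. by rewrite /opb; case: cid2. Qed.

Section Ops.
Variables V W X : normedModType C.
Implicit Types S T : op V W.

Lemma blin0 : blin (fun _ : V => 0 : W).
Proof.
split=> [a u v|]; first by rewrite scaler0 addr0.
by exists 0 => x; rewrite nr0 mul0r.
Qed.

Lemma blinD S T : blin (fun x => S x + T x).
Proof.
split=> [a u v|]; first by rewrite !linearP scalerDr addrACA.
exists (opb S + opb T) => x; rewrite mulrDl.
by apply: le_trans (nrD _ _) (lerD _ _); apply: opbP.
Qed.

Lemma blinN S : blin (fun x => - S x).
Proof.
split=> [a u v|]; first by rewrite linearP opprD scalerN.
by exists (opb S) => x; rewrite nrN opbP.
Qed.

Lemma blinZ (c : C) S : blin (fun x => c *: S x).
Proof.
split=> [a u v|]; first by rewrite linearP scalerDr !scalerA mulrC.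
by exists (nr c * opb S) => x; rewrite nrZ -mulrA ler_wpM2l ?nr_ge0// opbP.
Qed.

Lemma blin_comp (S : op W X) T : blin (fun x => S (T x)).
Proof.
split=> [a u v|]; first by rewrite !linearP.
exists (opb S * opb T) => x; apply: le_trans (opbP _ _) _.
by rewrite -mulrA ler_wpM2l ?opb_ge0// opbP.
Qed.

End Ops.

Lemma blin_id (V : normedModType C) : blin (fun x : V => x).
Proof. by split=> //; exists 1 => x; rewrite mul1r. Qed.

Definition op0 (V W : normedModType C) : op V W := Op (blin0 V W).
Definition opD (V W : normedModType C) (S T : op V W) : op V W := Op (blinD S T).
Definition opN (V W : normedModType C) (S : op V W) : op V W := Op (blinN S).
Definition opZ (V W : normedModType C) (c : C) (S : op V W) : op V W := Op (blinZ c S).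
Definition oc (V W X : normedModType C) (S : op W X) (T : op V W) : op V X :=
  Op (blin_comp S T).
Definition oid (V : normedModType C) : op V V := Op (blin_id V).

Section OpMod.
Variables V W : normedModType C.
Let addA : associative (@opD V W).
Proof. by move=> S T U; apply: op_ext => x /=; rewrite addrA. Qed.
Let addC : commutative (@opD V W).
Proof. by move=> S T; apply: op_ext => x /=; rewrite addrC. Qed.
Let add0 : left_id (op0 V W) (@opD V W).
Proof. by move=> S; apply: op_ext => x /=; rewrite add0r. Qed.
Let addN : left_inverse (op0 V W) (@opN V W) (@opD V W).
Proof. by move=> S; apply: op_ext => x /=; rewrite addNr. Qed.
HB.instance Definition _ := GRing.isZmodule.Build (op V W) addA addC add0 addN.
Let scA (a b : C) (S : op V W) : opZ a (opZ b S) = opZ (a * b) S.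
Proof. by apply: op_ext => x /=; rewrite scalerA. Qed.
Let sc1 : left_id 1 (@opZ V W).
Proof. by move=> S; apply: op_ext => x /=; rewrite scale1r. Qed.
Let scDr : right_distributive (@opZ V W) +%R.
Proof. by move=> a S T; apply: op_ext => x /=; rewrite scalerDr. Qed.
Let scDl (S : op V W) : {morph (@opZ V W)^~ S : a b / a + b}.
Proof. by move=> a b; apply: op_ext => x /=; rewrite scalerDl. Qed.
HB.instance Definition _ := GRing.Zmodule_isLmodule.Build C (op V W) scA sc1 scDr scDl.

Lemma opDE (S T : op V W) x : (S + T) x = S x + T x. Proof. by []. Qed.
Lemma opNE (S : op V W) x : (- S) x = - S x. Proof. by []. Qed.
Lemma opBE (S T : op V W) x : (S - T) x = S x - T x. Proof. by []. Qed.
Lemma opZE c (S : op V W) x : (c *: S) x = c *: S x. Proof. by []. Qed.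
Lemma op0E x : (0 : op V W) x = 0. Proof. by []. Qed.
Lemma op_sumE (I : Type) (r : seq I) (P : pred I) (F : I -> op V W) x :
  (\sum_(i <- r | P i) F i) x = \sum_(i <- r | P i) F i x.
Proof. exact: (big_morph (fun T : op V W => T x)). Qed.

Lemma opLP (T : op V W) a u v : T (a *: u + v) = a *: T u + T v.
Proof. exact: linearP. Qed.
Lemma opLB (T : op V W) u v : T (u - v) = T u - T v. Proof. exact: linearB. Qed.
Lemma opLZ (T : op V W) a u : T (a *: u) = a *: T u. Proof. exact: linearZ. Qed.
Lemma opL0 (T : op V W) : T 0 = 0. Proof. exact: linear0. Qed.
Lemma opL_sum (T : op V W) (I : Type) (r : seq I) (P : pred I) (F : I -> V) :
  T (\sum_(i <- r | P i) F i) = \sum_(i <- r | P i) T (F i).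
Proof. exact: linear_sum. Qed.
End OpMod.

End Operators.

Notation "S ** T" := (oc S T) (at level 40, left associativity).

Section OpAlg.
Variable R : realType.
Local Notation C := R[i].
Implicit Types V W X Y : normedModType C.

Lemma ocE V W X (S : op W X) (T : op V W) x : (S ** T) x = S (T x). Proof. by []. Qed.
Lemma oidE V (x : V) : oid V x = x. Proof. by []. Qed.
Lemma ocA V W X Y (S : op X Y) (T : op W X) (U : op V W) : S ** (T ** U) = S ** T ** U.
Proof. exact: op_ext. Qed.
Lemma oc1 V W (S : op V W) : S ** oid V = S. Proof. exact: op_ext. Qed.
Lemma o1c V W (S : op V W) : oid W ** S = S. Proof. exact: op_ext. Qed.
Lemma ocDl V W X (S T : op W X) (U : op V W) : (S + T) ** U = S ** U + T ** U.
Proof. exact: op_ext. Qed.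
Lemma ocDr V W X (S T : op V W) (U : op W X) : U ** (S + T) = U ** S + U ** T.
Proof. by apply: op_ext => x; rewrite /= linearD. Qed.
Lemma ocZl V W X (c : C) (S : op W X) (U : op V W) : (c *: S) ** U = c *: (S ** U).
Proof. exact: op_ext. Qed.
Lemma ocZr V W X (c : C) (S : op V W) (U : op W X) : U ** (c *: S) = c *: (U ** S).
Proof. by apply: op_ext => x; rewrite /= linearZ. Qed.
Lemma ocNr V W X (S : op V W) (U : op W X) : U ** (- S) = - (U ** S).
Proof. by apply: op_ext => x; rewrite /= linearN. Qed.
Lemma oc0l V W X (U : op V W) : (0 : op W X) ** U = 0.
Proof. exact: op_ext. Qed.
Lemma oc0r V W X (U : op W X) : U ** (0 : op V W) = 0.
Proof. by apply: op_ext => x; rewrite /= linear0. Qed.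

(** The norm closed linear span, with closeness expressed pointwise because [op] carries no norm. *)
Definition ocl V W (S : set (op V W)) : set (op V W) :=
  [set T | forall e : R, 0 < e ->
     exists2 s, lin_span S s & forall x, nr (T x - s x) <= e * nr x].

Lemma ocl_sub V W (S : set (op V W)) : S `<=` ocl S.
Proof.
move=> T ST e e0; exists T; first exact: lin_span_sub.
by move=> x; rewrite subrr nr0 mulr_ge0 ?nr_ge0 ?ltW.
Qed.

Lemma ocl_lin V W (S : set (op V W)) : lin_span S `<=` ocl S.
Proof.
move=> T ST e e0; exists T => //.
by move=> x; rewrite subrr nr0 mulr_ge0 ?nr_ge0 ?ltW.
Qed.

Lemma ocl0 V W (S : set (op V W)) : ocl S 0.
Proof. by apply: ocl_lin; apply: lin_span0. Qed.

Lemma oclD V W (S : set (op V W)) T U : ocl S T -> ocl S U -> ocl S (T + U).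
Proof.
move=> hT hU e e0; have e2 : 0 < e / 2 by lra.
have [s Ss hs] := hT _ e2; have [t St ht] := hU _ e2.
exists (s + t); first exact: lin_spanD.
move=> x; rewrite !opDE opprD addrACA; apply: le_trans (nrD _ _) _.
by have := hs x; have := ht x; lra.
Qed.

Lemma oclZ V W (S : set (op V W)) c T : ocl S T -> ocl S (c *: T).
Proof.
move=> hT e e0; have c1 : 0 < nr c + 1 by have := nr_ge0 c; lra.
have [s Ss hs] := hT _ (divr_gt0 e0 c1); exists (c *: s); first exact: lin_spanZ.
move=> x; rewrite !opZE -scalerBr nrZ; apply: le_trans (ler_wpM2l (nr_ge0 c) (hs x)) _.
rewrite mulrA; apply: ler_wpM2r; first exact: nr_ge0.
by rewrite mulrA ler_pdivrMr//; have := nr_ge0 c; nra.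
Qed.

Lemma ocl_span V W (S : set (op V W)) : lin_span (ocl S) `<=` ocl S.
Proof.
apply: lin_span_ind; first exact: ocl0.
by move=> a u v hu hv; apply: oclD => //; apply: oclZ.
Qed.

Lemma ocl_sum V W (S : set (op V W)) (I : Type) (r : seq I) (P : pred I) (F : I -> op V W) :
  (forall i, P i -> ocl S (F i)) -> ocl S (\sum_(i <- r | P i) F i).
Proof. by move=> h; elim/big_ind : _ => //; [exact: ocl0|move=> *; exact: oclD]. Qed.

Lemma ocl_lim V W (S : set (op V W)) (T : op V W) :
  (forall e : R, 0 < e -> exists2 s, ocl S s & forall x, nr (T x - s x) <= e * nr x) ->
  ocl S T.
Proof.
move=> h e e0; have e2 : 0 < e / 2 by lra.
have [s Ss hs] := h _ e2; have [t St ht] := Ss _ e2; exists t => // x.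
by apply: le_trans (nr_tri _ (s x) _) _; have := hs x; have := ht x; lra.
Qed.

Lemma ocl_le V W (S S' : set (op V W)) : S `<=` ocl S' -> ocl S `<=` ocl S'.
Proof.
move=> h T hT; apply: ocl_lim => e e0; have [s Ss hs] := hT e e0.
by exists s => //; apply: ocl_span; move: s Ss {hs}; apply: lin_span_le => s /h hs; apply: lin_span_sub.
Qed.

Lemma ocl_map V W V' W' (S : set (op V W)) (S' : set (op V' W'))
    (s : {rmorphism C -> C}) (F : op V W -> op V' W') (M : R) :
  (forall a T U, F (a *: T + U) = s a *: F T + F U) ->
  (forall (T : op V W) (e : R), 0 <= e -> (forall x, nr (T x) <= e * nr x) ->
     forall x, nr (F T x) <= M * e * nr x) ->
  (forall T, S T -> ocl S' (F T)) -> forall T, ocl S T -> ocl S' (F T).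
Proof.
move=> lF hM hS T hT; apply: ocl_lim => e e0.
have M1 : 0 < `|M| + 1 by have := normr_ge0 M; lra.
have [t St ht] := hT _ (divr_gt0 e0 M1).
have F0 : F 0 = 0 by have := lF (-1) 0 0; rewrite scaleN1r oppr0 addr0 rmorphN1 scaleN1r addNr.
have FB a b : F (a - b) = F a - F b.
  by rewrite addrC -scaleN1r lF rmorphN1 scaleN1r addrC.
exists (F t).
  elim/lin_span_ind: t / St {ht} => [|a u v Su hv]; first by rewrite F0; exact: ocl0.
  by rewrite lF; apply: oclD => //; apply: oclZ; apply: hS.
move=> x; rewrite -opBE -FB.
have := hM (T - t) _ (ltW (divr_gt0 e0 M1)) ht x => h; apply: le_trans h _.
apply: ler_wpM2r; first exact: nr_ge0.
rewrite mulrA ler_pdivrMr//; have := ler_norm M; nra.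
Qed.

Lemma ocl_compl V W X (U : op W X) (S : set (op V W)) (S' : set (op V X)) :
  (forall T, S T -> ocl S' (U ** T)) -> forall T, ocl S T -> ocl S' (U ** T).
Proof.
move=> h; apply: (@ocl_map _ _ _ _ _ _ idfun _ (opb U)) => //.
  by move=> a S1 T1; rewrite ocDr ocZr.
move=> T e e0 hT x; rewrite ocE; apply: le_trans (opbP _ _) _.
by rewrite -mulrA ler_wpM2l ?opb_ge0.
Qed.

Lemma ocl_compr V W X (U : op V W) (S : set (op W X)) (S' : set (op V X)) :
  (forall T, S T -> ocl S' (T ** U)) -> forall T, ocl S T -> ocl S' (T ** U).
Proof.
move=> h; apply: (@ocl_map _ _ _ _ _ _ idfun _ (opb U)) => //.
  by move=> a S1 T1; rewrite ocDl ocZl.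
move=> T e e0 hT x; rewrite ocE; apply: le_trans (hT _) _.
rewrite [_ * e]mulrC -mulrA; apply: ler_wpM2l => //; exact: opbP.
Qed.

End OpAlg.

(** * Riesz representation and total sets *)

Section Riesz.
Variable R : realType.
Local Notation C := R[i].
Implicit Types H K : hilbertType R.

Lemma le0_eps (x M : R) : (forall e, 0 < e -> x <= M * e) -> x <= 0.
Proof.
move=> h; apply: nr_le_eps => e e0; rewrite add0r.
have M1 : 0 < `|M| + 1 by have := normr_ge0 M; lra.
apply: le_trans (h _ (divr_gt0 e0 M1)) _.
by rewrite mulrA ler_pdivrMr//; have := ler_norm M; nra.
Qed.

Lemma eq_eps (V : normedZmodType C) (u v : V) (M : R) :
  (forall e, 0 < e -> nr (u - v) <= M * e) -> u = v.
Proof.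
move=> h; apply/eqP; rewrite -subr_eq0 -nr_eq0; apply/eqP/le_anti.
by rewrite nr_ge0 andbT (le0_eps h).
Qed.

Lemma inv_small (e : R) : 0 < e -> exists N, forall n, (N <= n)%N -> n.+1%:R^-1 <= e.
Proof.
move=> e0; exists (Num.trunc e^-1) => n; rewrite truncn_le_nat => h.
by rewrite invf_ple ?posrE ?ltr0Sn// ltW.
Qed.

Lemma seq_tends (V : normedZmodType C) (u : nat -> V) x (M : R) :
  0 <= M -> (forall n, nr (u n - x) <= M * n.+1%:R^-1) -> tends u x.
Proof.
move=> M0 h e e0; have M1 : 0 < M + 1 by lra.
have [N hN] := inv_small (divr_gt0 e0 M1); exists N => n /hN hn.
apply: le_trans (h n) _; apply: le_trans (ler_wpM2l M0 hn) _.
by rewrite mulrA ler_pdivrMr//; nra.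
Qed.

Lemma seq_cauchy (V : normedZmodType C) (u : nat -> V) (M : R) :
  0 <= M -> (forall n m, nr (u n - u m) <= M * (n.+1%:R^-1 + m.+1%:R^-1)) -> cauchys u.
Proof.
move=> M0 h e e0; have M1 : 0 < 2 * M + 1 by lra.
have [N hN] := inv_small (divr_gt0 e0 M1); exists N => n m /hN hn /hN hm.
apply: le_trans (h n m) _; apply: le_trans (ler_wpM2l M0 (lerD hn hm)) _.
rewrite -mulrDl mulrA ler_pdivrMr//; nra.
Qed.

Lemma ip_tendsl H (u : nat -> H) x v : tends u x -> tends (fun n => ip (u n) v) (ip x v).
Proof.
move=> h; apply: (tends_bnd (nr_ge0 v) h) => n.
by rewrite -ipBl mulrC CauchySchwarz.
Qed.

Lemma Re_tends (u : nat -> C) (x : C) (M : R) (b : nat -> R) :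
  tends u x -> (forall e, 0 < e -> exists N, forall n, (N <= n)%N -> b n <= e) ->
  (forall n, complex.Re (u n) <= M + b n) -> complex.Re x <= M.
Proof.
move=> h hb hu; apply: nr_le_eps => e e0; have e2 : 0 < e / 2 by lra.
have [N hN] := h _ e2; have [N' hN'] := hb _ e2.
have := hN _ (leq_addr N' N); have := hN' _ (leq_addl N N').
have := hu (N + N')%N; have := Re_le_nr (x - u (N + N')%N); rewrite nrBC raddfB/=.
by move: (complex.Re _) (complex.Re _) => a c; lra.
Qed.

(* Minimize [nr x ^+ 2 - 2 Re (phi x)] over the subspace S. *)
Lemma Riesz_sub H (S : set H) (phi : H -> C) (M : R) :
  lin_span S `<=` S -> (forall a u v, phi (a *: u + v) = a * phi u + phi v) ->
  (forall v, nr (phi v) <= M * nr v) ->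
  exists2 w, closure S w & forall v, S v -> phi v = ip w v.
Proof.
move=> hS lphi hphi.
have phi0 : phi 0 = 0.
  by have := lphi 1 0 0; rewrite scale1r mul1r addr0 => h; apply: (addrI (phi 0)); rewrite addr0.
have phiZ a u : phi (a *: u) = a * phi u by have := lphi a u 0; rewrite phi0 !addr0.
have phiD u v : phi (u + v) = phi u + phi v by have := lphi 1 u v; rewrite scale1r mul1r.
have S0 : S 0 by apply: hS; apply: lin_span0.
have SD u v : S u -> S v -> S (u + v).
  by move=> Su Sv; apply: hS; apply: lin_spanD; apply: lin_span_sub.
have SZ a u : S u -> S (a *: u) by move=> Su; apply: hS; apply: lin_spanZ; apply: lin_span_sub.
pose J x := nr x ^+ 2 - 2 * complex.Re (phi x).
pose E := [set J x | x in S].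
have lE : has_lbound E.
  (* This bound is (nr x - M)^2 >= 0, since Re (phi x) <= M * nr x. *)
  exists (- M ^+ 2) => _ [x Sx <-]; rewrite /J.
  have := Re_le_nr (phi x); have := hphi x; have := sqr_ge0 (nr x - M); nra.
have iE : has_inf E by split=> //; exists (J 0); exists 0.
pose m := inf E.
have mle x : S x -> m <= J x by move=> Sx; apply: ge_inf => //; exists x.
have mx n : exists x, S x /\ J x <= m + n.+1%:R^-1.
  have n0 : 0 < n.+1%:R^-1 :> R by rewrite invr_gt0.
  by have [_ [x Sx <-] hx] := inf_adherent n0 iE; exists x; split=> //; apply: ltW.
have [x hx] := choice mx.
(* Parallelogram law: J is at least m at the midpoint of two near minimizers, so these are close to
   each other. *)
have xc n k : nr (x n - x k) ^+ 2 <= 2 * n.+1%:R^-1 + 2 * k.+1%:R^-1.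
  have [Sn Jn] := hx n; have [Sk Jk] := hx k.
  have h0 := mle _ (SZ (2^-1)%:C _ (SD _ _ Sn Sk)).
  move: Jn Jk h0; rewrite /J phiZ phiD !nrZ nrC.
  have := nrDsq (x n) (x k); have := nrDsq (x n) (- x k).
  rewrite ipNr nrN raddfN/=; move: (ip _ _) (phi _) (phi _) => [p p'] [q q'] [s s'] /=.
  rewrite ger0_norm ?invr_ge0//.
  move: (n.+1%:R^-1) (k.+1%:R^-1) (nr (x n)) (nr (x k)) (nr (x n + x k)) (nr (x n - x k)) => *.
  nra.
have cx : cauchys x.
  move=> e e0; have e4 : 0 < e ^+ 2 / 4 by rewrite divr_gt0 ?exprn_gt0.
  have [N hN] := inv_small e4; exists N => n k /hN hn /hN hk.
  suff : nr (x n - x k) ^+ 2 <= e ^+ 2.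
    by rewrite ler_pXn2r// ?nnegrE ?nr_ge0 ?ltW.
  apply: le_trans (xc n k) _; move: hn hk.
  by move: (n.+1%:R^-1) (k.+1%:R^-1) (e ^+ 2) => a b c; lra.
have [w hw] := tends_complete cx.
have Cw : closure S w.
  apply/closure_nrP => e /hw[N hN]; exists (x N); first exact: (hx N).1.
  by rewrite nrBC hN.
exists w => // v Sv.
have var u : S u -> 2 * complex.Re (phi u - ip w u) <= nr u ^+ 2.
  move=> Su.
  have t1 : tends (fun n => phi u - ip (x n) u) (phi u - ip w u).
    apply: tendsD; first exact: tends_cst.
    by apply: (tends_bnd ler01 (ip_tendsl u hw)) => n; rewrite mul1r -opprD nrN.
  have : complex.Re (phi u - ip w u) <= nr u ^+ 2 / 2; last by lra.
  apply: (Re_tends (b := fun n => n.+1%:R^-1) t1 (@inv_small)) => n.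
  have [Sn Jn] := hx n; have := mle _ (SD _ _ Sn Su).
  rewrite /J nrDsq phiD raddfB raddfD/=; move: Jn; rewrite /J.
  have : 0 < n.+1%:R^-1 :> R by rewrite invr_gt0.
  by move: (n.+1%:R^-1) (complex.Re _) (complex.Re _) (complex.Re _) => *; lra.
set z := phi v - ip w v; apply/eqP; rewrite -subr_eq0 -/z -nr_eq0 -sqrf_eq0.
apply/eqP/le_anti; rewrite sqr_ge0 andbT; apply: (le0_eps (M := nr z ^+ 2 * nr v ^+ 2)) => t t0.
(* In the direction conj(z) v with step t the linear term is t |z|^2 and the quadratic one is of
   order t^2; letting t tend to 0 forces z = 0. *)
have := var _ (SZ (t%:C * cj z) _ Sv).
have -> : phi ((t%:C * cj z) *: v) - ip w ((t%:C * cj z) *: v) = (t * nr z ^+ 2)%:C.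
  by rewrite phiZ ipZr -mulrBr -/z rmorphM -mulrA conj_mul_nr.
rewrite /= !nrZ nrM nr_conj nrC gtr0_norm//.
rewrite !exprMn; have := sqr_ge0 (nr z); have := sqr_ge0 (nr v).
move: (nr z ^+ 2) (nr v ^+ 2) => a b a0 b0.
have -> : t ^+ 2 * a * b = t * (t * (a * b)) by ring.
have -> : 2 * (t * a) = t * (2 * a) by ring.
by rewrite ler_pM2l//; nra.
Qed.

Lemma Riesz H (phi : H -> C) (M : R) :
  (forall a u v, phi (a *: u + v) = a * phi u + phi v) ->
  (forall v, nr (phi v) <= M * nr v) -> exists w, forall v, phi v = ip w v.
Proof.
move=> lphi hphi; have [|w _ hw] := @Riesz_sub _ setT phi M _ lphi hphi => //.
by exists w => v; apply: hw.
Qed.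

Definition total (V : normedModType C) (S : set V) := closure (lin_span S) = setT.

Lemma totalP (V : normedModType C) (S : set V) : total S <->
  forall x (e : R), 0 < e -> exists2 s, lin_span S s & nr (x - s) <= e.
Proof.
split=> [tS x e e0|h].
  by have [] := (closure_nrP (lin_span S) x).1 _ e e0; [rewrite tS|move=> s; exists s].
by apply/seteqP; split=> // x _; apply/closure_nrP => e e0; apply: h.
Qed.

(** The Riesz vector of [ip x] relative to the span of S is the projection of x onto its closure,
    and x minus it is orthogonal to S. *)
Lemma total_orth H (S : set H) :
  (forall v, (forall s, S s -> ip s v = 0) -> v = 0) -> total S.
Proof.
move=> h; apply/seteqP; split=> // x _.
have [|||w Cw hw] := @Riesz_sub _ (lin_span S) (ip x) (nr x).
- exact: (lin_span_le (S' := S)).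
- by move=> a u v; rewrite ipDr ipZr.
- by move=> v; apply: CauchySchwarz.
suff -> : x = w by [].
apply/eqP; rewrite -subr_eq0; apply/eqP/h => s Ss.
rewrite (ipC (x - w)) ipBl hw ?subrr ?rmorph0//; exact: lin_span_sub.
Qed.

Lemma op_eq_span (V W : normedModType C) (S : set V) (A B : op V W) :
  (forall s, S s -> A s = B s) -> forall s, lin_span S s -> A s = B s.
Proof.
move=> h; apply: lin_span_ind; first by rewrite !opL0.
by move=> a u v /h hu hv; rewrite !opLP hu hv.
Qed.

Lemma op_eq_total (V W : normedModType C) (S : set V) (A B : op V W) :
  total S -> (forall s, S s -> A s = B s) -> A = B.
Proof.
move=> /totalP tS h; apply: op_ext => x.
apply: (eq_eps (M := opb A + opb B)) => e e0; have [s Ss hs] := tS x e e0.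
apply: le_trans (nr_tri _ (A s) _) _; rewrite {2}(op_eq_span h Ss) mulrDl lerD//.
  by rewrite -opLB; apply: le_trans (opbP _ _) _; rewrite ler_wpM2l ?opb_ge0.
by rewrite nrBC -opLB; apply: le_trans (opbP _ _) _; rewrite ler_wpM2l ?opb_ge0.
Qed.

Lemma ip_eq_total H (S : set H) (v w : H) :
  total S -> (forall s, S s -> ip s v = ip s w) -> v = w.
Proof.
move=> /totalP tS h; apply: ip_ext => u; apply: (eq_eps (M := nr (v - w))) => e e0.
have [s Ss hs] := tS u e e0.
have E : ip s (v - w) = 0.
  elim/lin_span_ind: s / Ss {hs} => [|a x y Sx hy]; first by rewrite ip0l.
  by rewrite ipDl ipZl hy ipBr h// subrr mulr0 addr0.
rewrite -ipBr -[u](subrK s) ipDl E addr0 mulrC.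
apply: le_trans (CauchySchwarz _ _) _; exact: ler_wpM2r (nr_ge0 _) _ _ hs.
Qed.

End Riesz.

Section Adjoint.
Variable R : realType.
Local Notation C := R[i].
Implicit Types H K L : hilbertType R.

Lemma ad_exists H K (T : op H K) (y : K) : exists w, forall x, ip y (T x) = ip w x.
Proof.
apply: (@Riesz _ _ (fun x => ip y (T x)) (nr y * opb T)).
  by move=> a u v; rewrite opLP ipDr ipZr.
move=> v; apply: le_trans (CauchySchwarz _ _) _.
by rewrite -mulrA ler_wpM2l ?nr_ge0// opbP.
Qed.

Definition adf H K (T : op H K) (y : K) : H := sval (cid (ad_exists T y)).

Lemma adfP H K (T : op H K) y x : ip (adf T y) x = ip y (T x).
Proof. by rewrite /adf; case: cid => w /= ->. Qed.

Lemma adf_bnd H K (T : op H K) M : 0 <= M -> (forall x, nr (T x) <= M * nr x) ->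
  forall y, nr (adf T y) <= M * nr y.
Proof.
move=> M0 hM y; have [->|n0] := eqVneq (adf T y) 0; first by rewrite nr0 mulr_ge0 ?nr_ge0.
have p0 : 0 < nr (adf T y) by rewrite nr_gt0.
rewrite -(ler_pM2r p0) -expr2 -[_ ^+ 2]ger0_norm ?sqr_ge0// -nrC -ip_nr adfP.
apply: le_trans (CauchySchwarz _ _) _; rewrite [M * _]mulrC -mulrA.
by rewrite ler_wpM2l ?nr_ge0.
Qed.

Lemma adf_blin H K (T : op H K) : blin (adf T).
Proof.
split=> [a u v|].
  by apply: ip_extl => x; rewrite adfP !ipDl !ipZl !adfP.
by exists (opb T); apply: adf_bnd (opb_ge0 _) (opbP _).
Qed.

Definition ad H K (T : op H K) : op K H := Op (adf_blin T).

Lemma adl H K (T : op H K) y x : ip (ad T y) x = ip y (T x). Proof. exact: adfP. Qed.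
Lemma adr H K (T : op H K) y x : ip x (ad T y) = ip (T x) y.
Proof. by rewrite (ipC (ad T y)) adl -ipC. Qed.

Lemma ad_bnd H K (T : op H K) M : 0 <= M -> (forall x, nr (T x) <= M * nr x) ->
  forall y, nr (ad T y) <= M * nr y.
Proof. exact: adf_bnd. Qed.

Lemma ad_uniq H K (T : op H K) (S : op K H) :
  (forall x y, ip x (S y) = ip (T x) y) -> S = ad T.
Proof. by move=> h; apply: op_ext => y; apply: ip_ext => x; rewrite h adr. Qed.

Lemma adK H K (T : op H K) : ad (ad T) = T.
Proof. by apply/esym/ad_uniq => x y; rewrite adl. Qed.

Lemma adM H K L (S : op K L) (T : op H K) : ad (S ** T) = ad T ** ad S.
Proof. by apply/esym/ad_uniq => x y; rewrite ocE !adr. Qed.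

Lemma adD H K (S T : op H K) : ad (S + T) = ad S + ad T.
Proof. by apply/esym/ad_uniq => x y; rewrite !opDE ipDr !adr ipDl. Qed.

Lemma adZ H K (c : C) (T : op H K) : ad (c *: T) = cj c *: ad T.
Proof. by apply/esym/ad_uniq => x y; rewrite !opZE ipZr adr ipZl. Qed.

Lemma adN H K (T : op H K) : ad (- T) = - ad T.
Proof. by apply/esym/ad_uniq => x y; rewrite !opNE ipNr adr ipNl. Qed.

Lemma adB H K (S T : op H K) : ad (S - T) = ad S - ad T.
Proof. by rewrite adD adN. Qed.

Lemma ad0 H K : ad (0 : op H K) = 0.
Proof. by apply/esym/ad_uniq => x y; rewrite !op0E ip0l ip0r. Qed.

Lemma ad1 H : ad (oid H) = oid H.
Proof. by apply/esym/ad_uniq => x y. Qed.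

Lemma ad_sum H K (I : Type) (r : seq I) (P : pred I) (F : I -> op H K) :
  ad (\sum_(i <- r | P i) F i) = \sum_(i <- r | P i) ad (F i).
Proof. by apply: (big_morph _ (@adD _ _)); exact: ad0. Qed.

Lemma op_ext_ip H K (S T : op H K) : (forall x y, ip x (S y) = ip x (T y)) -> S = T.
Proof. by move=> h; apply: op_ext => y; apply: ip_ext => x. Qed.

Lemma op_eq_mx H K (A : set K) (B : set H) (S T : op H K) : total A -> total B ->
  (forall a b, A a -> B b -> ip a (S b) = ip a (T b)) -> S = T.
Proof.
move=> tA tB h; apply: (op_eq_total tB) => b Bb.
by apply: (ip_eq_total tA) => a Aa; apply: h.
Qed.

Lemma rk_blin H K (x : K) (y : H) : blin (fun v => ip y v *: x).
Proof.
split=> [a u v|]; first by rewrite ipDr ipZr scalerDl scalerA.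
exists (nr y * nr x) => v; rewrite nrZ mulrAC; apply: ler_wpM2r; first exact: nr_ge0.
exact: CauchySchwarz.
Qed.

Definition rk H K (x : K) (y : H) : op H K := Op (rk_blin x y).

Lemma ad_rk H K (x : K) (y : H) : ad (rk x y) = rk y x.
Proof. by apply/esym/ad_uniq => u v; rewrite /= ipZr ipZl -(ipC y) mulrC. Qed.

End Adjoint.

(** * Gram-Schmidt orthonormalization *)

Section GramSchmidt.
Variable R : realType.
Local Notation C := R[i].
Variable H : hilbertType R.
Implicit Types (g f : nat -> H).

(** As 0^-1 = 0, the zero vector is kept. A vector depending on its predecessors thus leaves a zero
    in the orthonormalized sequence, and [onf] allows such zeros so that nothing has to be
    reindexed. *)
Definition gs_norm (x : H) : H := ((nr x)^-1)%:C *: x.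

Fixpoint gs_seq g n : seq H :=
  if n is k.+1 then
    rcons (gs_seq g k) (gs_norm (g k - \sum_(e <- gs_seq g k) ip e (g k) *: e))
  else [::].

Definition gs g n : H := nth 0 (gs_seq g n.+1) n.

Lemma size_gs_seq g n : size (gs_seq g n) = n.
Proof. by elim: n => //= n IH; rewrite size_rcons IH. Qed.

Lemma gs_seqE g n : gs_seq g n = [seq gs g k | k <- iota 0 n].
Proof.
elim: n => // n IH; rewrite -[n.+1]addn1 iotaD map_cat addn1 /= cats1 add0n.
by rewrite -IH /gs /= nth_rcons size_gs_seq ltnn eqxx.
Qed.

Lemma gsE g n : gs g n = gs_norm (g n - \sum_(k < n) ip (gs g k) (g n) *: gs g k).
Proof.
rewrite {1}/gs /= nth_rcons size_gs_seq ltnn eqxx gs_seqE big_map.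
by rewrite -(big_mkord xpredT (fun k => ip (gs g k) (g n) *: gs g k)) /index_iota subn0.
Qed.

Definition onf f := (forall i j, i != j -> ip (f i) (f j) = 0) /\
  (forall i, f i = 0 \/ ip (f i) (f i) = 1).

Lemma gs_norm_unit (x : H) : x != 0 -> ip (gs_norm x) (gs_norm x) = 1.
Proof.
move=> x0; have n0 : nr x != 0 by rewrite nr_eq0.
rewrite /gs_norm ipZl ipZr (conjR _) ip_nr -!rmorphM/= expr2.
by rewrite mulKf// mulVf.
Qed.

Lemma gs_normK (x : H) : (nr x)%:C *: gs_norm x = x.
Proof.
have [->|x0] := eqVneq x 0; first by rewrite /gs_norm !scaler0.
by rewrite /gs_norm scalerA -rmorphM/= mulfV ?nr_eq0// scale1r.
Qed.

Lemma gs_onf g : onf (gs g).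
Proof.
have U i : gs g i = 0 \/ ip (gs g i) (gs g i) = 1.
  rewrite gsE; set x := (X in gs_norm X); have [->|x0] := eqVneq x 0.
    by left; rewrite /gs_norm scaler0.
  by right; apply: gs_norm_unit.
split=> //.
suff h n i : (i < n)%N -> ip (gs g i) (gs g n) = 0.
  move=> i j; rewrite neq_ltn => /orP[/h//|/h ij].
  by rewrite (ipC (gs g j)) ij rmorph0.
have [m] := ubnP n; elim: m n i => // m IH n i; rewrite ltnS => nm ni.
rewrite [gs g n]gsE /gs_norm ipZr; set c := (_^-1)%:C.
rewrite ipBr ip_sumr (bigD1 (Ordinal ni))//= big1.
  rewrite addr0 ipZr; case: (U i) => ->; first by rewrite !ip0l mulr0 subr0 mulr0.
  by rewrite mulr1 subrr mulr0.
move=> k /eqP ki; rewrite ipZr.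
have : i != k by apply/eqP => ik; apply: ki; apply: val_inj.
rewrite neq_ltn => /orP[ik|ki'].
  by rewrite (IH k i) ?mulr0// (leq_trans (ltn_ord k)).
by rewrite (ipC (gs g k)) (IH i k) ?rmorph0 ?mulr0// (leq_trans ni).
Qed.

(** The coefficients of index above n vanish, so m is free and all vectors of a finite list are
    expanded over one common family. *)
Lemma gs_span g n m : (n < m)%N -> g n = \sum_(k < m) ip (gs g k) (g n) *: gs g k.
Proof.
have [O U] := gs_onf g; move=> nm.
set x := g n - \sum_(k < n) ip (gs g k) (g n) *: gs g k.
have gx : gs g n = gs_norm x by rewrite gsE.
have E : g n = \sum_(k < n) ip (gs g k) (g n) *: gs g k + (nr x)%:C *: gs g n.
  by rewrite gx gs_normK /x addrC subrK.
have I j : (n <= j)%N -> ip (gs g j) (g n) = (if j == n then (nr x)%:C * ip (gs g n) (gs g n) else 0).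
  move=> nj; rewrite {1}E ipDr ip_sumr big1 ?add0r.
    by rewrite ipZr; case: eqP => [->//|/eqP jn]; rewrite O// mulr0.
  by move=> k _; rewrite ipZr O ?mulr0// gtn_eqF// (leq_trans (ltn_ord k)).
rewrite {1}E -(subnKC nm) big_split_ord/= big_ord_recr/= -addrA; congr (_ + _).
rewrite I// eqxx big1 ?addr0.
  by case: (U n) => ->; rewrite ?scaler0 ?mulr1.
move=> k _; rewrite I; last by rewrite addSn ltnW// ltnS leq_addr.
by rewrite addSn gtn_eqF ?scale0r// ltnS leq_addr.
Qed.

End GramSchmidt.

(** * Extension by continuity *)

Section Extension.
Variable R : realType.
Local Notation C := R[i].

(** G is a relation because a vector may be a linear combination in many ways; the bound makes it
    single valued. The automorphism s covers linear and conjugate linear maps at once. *)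
Lemma ext_rel (V : normedModType C) (W : completeNormedModType C)
    (s : {rmorphism C -> C}) (G : V -> W -> Prop) (M : R) :
  (forall c, nr (s c) = nr c) -> 0 <= M ->
  (forall a u w u' w', G u w -> G u' w' -> G (a *: u + u') (s a *: w + w')) ->
  (forall u w, G u w -> nr w <= M * nr u) ->
  (forall x (e : R), 0 < e -> exists u w, G u w /\ nr (x - u) <= e) ->
  exists F : V -> W, [/\ (forall u w, G u w -> F u = w),
    (forall a u v, F (a *: u + v) = s a *: F u + F v) &
    (forall x, nr (F x) <= M * nr x)].
Proof.
move=> ns M0 Gl Gb Gd.
have GB u w u' w' : G u w -> G u' w' -> nr (w - w') <= M * nr (u - u').
  move=> h h'; have := Gl (-1) _ _ _ _ h' h; rewrite rmorphN1 !scaleN1r => /Gb.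
  by rewrite addrC [- u' + u]addrC.
have ex x : exists y, forall u w, G u w -> nr (y - w) <= M * nr (x - u).
  have [un hun] : exists un : nat -> V * W,
      forall n, G (un n).1 (un n).2 /\ nr (x - (un n).1) <= n.+1%:R^-1.
    suff : forall n, exists p : V * W, G p.1 p.2 /\ nr (x - p.1) <= n.+1%:R^-1.
      by move=> /choice[f hf]; exists f.
    move=> n; have n0 : 0 < n.+1%:R^-1 :> R by rewrite invr_gt0.
    by have [u [w [h1 h2]]] := Gd x _ n0; exists (u, w).
  have cw : cauchys (fun n => (un n).2).
    apply: (seq_cauchy M0) => n m; apply: le_trans (GB _ _ _ _ (hun n).1 (hun m).1) _.
    apply: ler_wpM2l => //; apply: le_trans (nr_tri _ x _) _.
    by apply: lerD; [rewrite nrBC; exact: (hun n).2|exact: (hun m).2].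
  have [y hy] := tends_complete cw; exists y => u w Guw.
  apply: nr_le_eps => e e0.
  have e2 : 0 < e / 2 by lra.
  have M1 : 0 < 2 * M + 1 by lra.
  have [N hN] := hy _ e2; have [N' hN'] := inv_small (divr_gt0 e0 M1).
  set k := (N + N')%N.
  have h1 := hN k (leq_addr _ _); have h2 := hN' k (leq_addl _ _).
  have [h3 h4] := hun k.
  apply: le_trans (nr_tri _ (un k).2 _) _; rewrite nrBC.
  have h5 := GB _ _ _ _ h3 Guw; have h6 := nr_tri (un k).1 x u.
  rewrite [nr ((un k).1 - x)]nrBC in h6.
  have h7 := ler_wpM2l M0 h6; have h8 := ler_wpM2l M0 (le_trans h4 h2).
  have h9 : M * (e / (2 * M + 1)) <= e / 2 by rewrite mulrA ler_pdivrMr//; nra.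
  by rewrite mulrDr in h7; lra.
pose F x := sval (cid (ex x)).
have FP x u w : G u w -> nr (F x - w) <= M * nr (x - u) by rewrite /F; case: cid => y /= h /h.
exists F; split.
- move=> u w h; apply/eqP; rewrite -subr_eq0 -nr_eq0; apply/eqP/le_anti.
  by rewrite nr_ge0 andbT; have := FP u _ _ h; rewrite subrr nr0 mulr0.
- move=> a x y; apply: (eq_eps (M := 2 * M * (nr a + 1))) => e e0.
  have [u [w [h1 h2]]] := Gd x e e0; have [u' [w' [h3 h4]]] := Gd y e e0.
  apply: le_trans (nr_tri _ (s a *: w + w') _) _.
  have h5 := FP (a *: x + y) _ _ (Gl a _ _ _ _ h1 h3).
  have h6 : nr (a *: x + y - (a *: u + u')) <= (nr a + 1) * e.
    rewrite opprD addrACA -scalerBr; apply: le_trans (nrD _ _) _.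
    by rewrite nrZ mulrDl mul1r lerD// ler_wpM2l ?nr_ge0.
  have h7 : nr (s a *: w + w' - (s a *: F x + F y)) <= M * ((nr a + 1) * e).
    rewrite opprD addrACA -scalerBr; apply: le_trans (nrD _ _) _.
    rewrite nrZ ns mulrDl mul1r mulrDr; apply: lerD.
      rewrite mulrCA ler_wpM2l ?nr_ge0// nrBC.
      by apply: le_trans (FP x _ _ h1) _; rewrite ler_wpM2l.
    by rewrite nrBC; apply: le_trans (FP y _ _ h3) _; rewrite ler_wpM2l.
  have h8 := le_trans h5 (ler_wpM2l M0 h6).
  by apply: le_trans (lerD h8 h7) _; rewrite le_eqVlt; apply/orP; left; apply/eqP; ring.
- move=> x; have G00 : G 0 0.
    have [u [w [h _]]] := Gd 0 1 ltr01; have := Gl (-1) _ _ _ _ h h.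
    by rewrite rmorphN1 !scaleN1r !addNr.
  by have := FP x _ _ G00; rewrite !subr0.
Qed.

Lemma bopP (H : hilbertType R) (T : H -> H) : bop T <-> blin T.
Proof.
split=> [[lT cT]|[lT [M hM]]]; split=> //.
  have T0 : T 0 = 0.
    by have := lT (-1) 0 0; rewrite scaleN1r oppr0 addr0 scaleN1r addNr.
  have := cT 0; rewrite /continuous_at T0 => /cvgrPdist_le /(_ 1 ltr01) /nbhs_ballP[d /= /gtc0P[r r0 ->] hd].
  (* Rescaled to norm r / 2, the vector x falls into the ball of radius r, on which T is bounded by
     1. *)
  exists (2 / r) => x; have [->|x0] := eqVneq x 0; first by rewrite T0 !nr0 mulr0.
  have p0 : 0 < nr x by rewrite nr_gt0.
  have TZ a u : T (a *: u) = a *: T u by have := lT a u 0; rewrite T0 !addr0.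
  have := hd ((r / 2 / nr x)%:C *: x).
  have rr : `|r / 2 / nr x| = r / 2 / nr x by rewrite ger0_norm// ltW// !divr_gt0.
  rewrite -ball_normE/= sub0r normrN nrE ltcR nrZ nrC rr mulfVK ?gt_eqF//.
  have -> : r / 2 < r by lra.
  move=> /(_ isT); rewrite sub0r normrN TZ nrE lecR nrZ nrC rr.
  by rewrite mulrAC ler_pdivrMr// mul1r -ler_pdivlMl ?divr_gt0// invf_div.
move=> x; apply/cvgrPdist_le => e /gtc0P[r r0 ->].
have TB u v : T (u - v) = T u - T v.
  by rewrite addrC -scaleN1r lT scaleN1r addrC.
have M1 : 0 < `|M| + 1 by have := normr_ge0 M; lra.
apply/nbhs_ballP; exists (r / (`|M| + 1))%:C; first by rewrite /= ltcR divr_gt0.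
move=> y; rewrite -ball_normE/= !nrE ltcR lecR -TB => h.
apply: le_trans (hM _) _; apply: le_trans (ler_wpM2r (nr_ge0 _) (ler_norm M)) _.
apply: le_trans (ler_wpM2l (normr_ge0 M) (ltW h)) _.
by rewrite mulrA ler_pdivrMr//; have := normr_ge0 M; nra.
Qed.

Lemma form_op_eq (H : hilbertType R) (b : H -> H -> C) (T : H -> H) :
  (forall u v, ip u (T v) = b u v) -> form_op b = T.
Proof.
move=> h; rewrite /form_op; case: xgetP => [S _ hS|/(_ T)]; last by case.
by apply/funext => v; apply: ip_ext => u; rewrite hS h.
Qed.

Lemma adj_ad (H : hilbertType R) (T : op H H) : adj T = ad T.
Proof. by apply: form_op_eq => u v; rewrite adr. Qed.

End Extension.

(** * Hilbert space tensor products *)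

Section Tensors.
Variable R : realType.
Local Notation C := R[i].
Implicit Types H K L N P Q : hilbertType R.

Lemma ext_fam (V : normedModType C) (W : completeNormedModType C) (I : Type)
    (s : {rmorphism C -> C}) (v : I -> V) (w : I -> W) (M : R) :
  (forall c, nr (s c) = nr c) -> 0 <= M -> total (range v) ->
  (forall n (c : 'I_n -> C) (i : 'I_n -> I),
     nr (\sum_k s (c k) *: w (i k)) <= M * nr (\sum_k c k *: v (i k))) ->
  exists F : V -> W, [/\ (forall i, F (v i) = w i),
    (forall a x y, F (a *: x + y) = s a *: F x + F y) &
    (forall x, nr (F x) <= M * nr x)].
Proof.
move=> ns M0 /totalP tv hb.
pose G x y := exists n (c : 'I_n -> C) (i : 'I_n -> I),
  x = \sum_k c k *: v (i k) /\ y = \sum_k s (c k) *: w (i k).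
have [|||F [WtQ Wt_Q F3]] := @ext_rel _ V W s G M ns M0; last first.
  exists F; split=> // i; apply: WtQ; exists 1%N, (fun=> 1), (fun=> i).
  by rewrite !big_ord1 rmorph1 !scale1r.
- move=> x e e0; have [y [n [c [t [ht ->]]]] hy] := tv x e e0.
  have /choice[i hi] : forall k, exists j, v j = t k by move=> k; have [j _ <-] := ht k; exists j.
  exists (\sum_k c k *: v (i k)), (\sum_k s (c k) *: w (i k)); split; first by exists n, c, i.
  rewrite (eq_bigr (fun k => c k *: t k))// => k _.
  by rewrite hi.
- by move=> x y [n [c [i [-> ->]]]]; apply: hb.
- move=> a x y x' y' [n [c [i [-> ->]]]] [m [d [j [-> ->]]]].
  exists (n + m)%N,
    (fun k : 'I_(n+m) => match fintype.split k with inl l => a * c l | inr l => d l end),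
    (fun k : 'I_(n+m) => match fintype.split k with inl l => i l | inr l => j l end).
  rewrite !big_split_ord/= !scaler_sumr; split; congr (_ + _); apply: eq_bigr => k _;
    rewrite ?(unsplitK (inl k)) ?(unsplitK (inr k))//.
    by rewrite scalerA.
  by rewrite scalerA rmorphM.
Qed.

Lemma lin_comb (V W : lmodType C) (f : V -> W) (I : Type) (r : seq I) (a : I -> C) (v : I -> V) :
  linear f -> f (\sum_(i <- r) a i *: v i) = \sum_(i <- r) a i *: f (v i).
Proof.
move=> lf; have f0 : f 0 = 0.
  by have := lf (-1) 0 0; rewrite scaleN1r oppr0 addr0 scaleN1r addNr.
elim: r => [|i r IH]; first by rewrite !big_nil.
by rewrite !big_cons lf IH.
Qed.

(* Gram-Schmidt in the second factor. *)
Lemma orth_rep H K n (c : 'I_n -> C) (x : 'I_n -> H) (y : 'I_n -> K) :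
  exists (X : nat -> H) (f : nat -> K), [/\ onf f, (forall k, f k = 0 -> X k = 0) &
    forall (V : lmodType C) (g : H -> K -> V),
      (forall y, linear (g^~ y)) -> (forall x, linear (g x)) ->
      \sum_i c i *: g (x i) (y i) = \sum_(k < n) g (X k) (f k)].
Proof.
pose g (k : nat) := if insub k is Some i then y i else 0.
pose f := gs g.
pose X k := \sum_i (c i * ip (f k) (y i)) *: x i.
exists X, f; split=> [|k fk|V h hl hr]; first exact: gs_onf.
  by rewrite /X big1// => i _; rewrite fk ip0l mulr0 scale0r.
have gy (i : 'I_n) : y i = \sum_(k < n) ip (f k) (y i) *: f k.
  by have := gs_span g (ltn_ord i); rewrite {1 3}/g valK.
under [RHS]eq_bigr => k _ do rewrite /X (lin_comb _ _ _ (hl _)).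
rewrite exchange_big/=; apply: eq_bigr => i _.
rewrite {1}gy (lin_comb _ _ _ (hr _)) scaler_sumr.
by apply: eq_bigr => k _; rewrite scalerA.
Qed.

Definition simple H K N (m : H -> K -> N) : set N := range (fun p : H * K => m p.1 p.2).

Record tens H K N (m : H -> K -> N) : Prop := Tens {
  tens_l : forall y, linear (m^~ y);
  tens_r : forall x, linear (m x);
  tens_ip : forall x y x' y', ip (m x y) (m x' y') = ip x x' * ip y y';
  tens_total : total (simple m)
}.

(* The space N is a parameter, so that one space can carry several tensor
   decompositions: leg numbering then amounts to a choice of [tmap], and
   exchanging or regrouping legs never changes the space. *)
Record tmap H K N := TMap { tm :> H -> K -> N; tmP : tens tm }.

Section OneMap.
Variables (H K N : hilbertType R) (m : tmap H K N).

Lemma tml y : linear (m^~ y). Proof. exact: tens_l (tmP m) y. Qed.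
Lemma tmr x : linear (m x). Proof. exact: tens_r (tmP m) x. Qed.
Lemma tmip x y x' y' : ip (m x y) (m x' y') = ip x x' * ip y y'.
Proof. exact: (tens_ip (tmP m)). Qed.
Lemma tmT : total (simple m). Proof. exact: tens_total (tmP m). Qed.

Lemma nr_tm x y : nr (m x y) = nr x * nr y.
Proof.
apply/eqP; rewrite -(eqrXn2 (n := 2)) ?mulr_ge0 ?nr_ge0//; apply/eqP/complexI.
by rewrite -ip_nr tmip !ip_nr -rmorphM exprMn.
Qed.

Lemma nr_orth_sum n (X : nat -> H) (f : nat -> K) : onf f -> (forall k, f k = 0 -> X k = 0) ->
  nr (\sum_(k < n) m (X k) (f k)) ^+ 2 = \sum_(k < n) nr (X k) ^+ 2.
Proof.
move=> [O U] h; apply: complexI; rewrite -ip_nr ip_suml rmorph_sum/=.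
apply: eq_bigr => k _; rewrite ip_sumr (bigD1 k)//= big1 ?addr0.
  rewrite tmip -ip_nr; case: (U k) => [/h ->|->]; last by rewrite mulr1.
  by rewrite ip0l mul0r.
by move=> j jk; rewrite tmip O ?mulr0// eq_sym.
Qed.

Lemma tsw_tens : tens (fun y x => m x y).
Proof.
split; [exact: tmr|exact: tml|by move=> *; rewrite tmip mulrC|].
rewrite /total (_ : simple _ = simple m); first exact: tmT.
by apply/seteqP; split=> _ [[a b] _ <-] /=; [exists (b, a)|exists (b, a)].
Qed.
Definition tsw : tmap K H N := TMap tsw_tens.

Lemma ketl_blin x : blin (m x).
Proof.
by split; [exact: tmr|exists (nr x) => y; rewrite nr_tm].
Qed.
Definition ketl x : op K N := Op (ketl_blin x).

Lemma ketr_blin y : blin (m^~ y).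
Proof.
by split; [exact: tml|exists (nr y) => x; rewrite nr_tm mulrC].
Qed.
Definition ketr y : op H N := Op (ketr_blin y).

Lemma ketlE x y : ketl x y = m x y. Proof. by []. Qed.
Lemma ketrE x y : ketr y x = m x y. Proof. by []. Qed.

Lemma ketlP a x x' : ketl (a *: x + x') = a *: ketl x + ketl x'.
Proof. by apply: op_ext => y; rewrite opDE opZE !ketlE tml. Qed.
Lemma ketrP a y y' : ketr (a *: y + y') = a *: ketr y + ketr y'.
Proof. by apply: op_ext => x; rewrite opDE opZE !ketrE tmr. Qed.
Lemma bral x x' y : ad (ketl x) (m x' y) = ip x x' *: y.
Proof. by apply: ip_ext => z; rewrite adr ketlE tmip ipZr. Qed.
Lemma brar y x y' : ad (ketr y) (m x y') = ip y y' *: x.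
Proof. by apply: ip_ext => z; rewrite adr ketrE tmip ipZr mulrC. Qed.

Lemma ketl_ad x x' : ad (ketl x) ** ketl x' = ip x x' *: oid K.
Proof. by apply: op_ext => y; rewrite ocE bral. Qed.
Definition sl x x' (T : op N N) : op K K := ad (ketl x) ** T ** ketl x'.
Definition sr y y' (T : op N N) : op H H := ad (ketr y) ** T ** ketr y'.

Lemma slE x x' T y y' : ip y (sl x x' T y') = ip (m x y) (T (m x' y')).
Proof. by rewrite /sl !ocE adr. Qed.
Lemma srE x x' T y y' : ip x (sr y y' T x') = ip (m x y) (T (m x' y')).
Proof. by rewrite /sr !ocE adr. Qed.

Lemma tm_op_ext (W : normedModType C) (S T : op N W) :
  (forall x y, S (m x y) = T (m x y)) -> S = T.
Proof. by move=> h; apply: (op_eq_total tmT) => _ [[x y] _ <-]. Qed.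

Lemma tm_ip_ext (u v : N) : (forall x y, ip (m x y) u = ip (m x y) v) -> u = v.
Proof. by move=> h; apply: (ip_eq_total tmT) => _ [[x y] _ <-]. Qed.

End OneMap.

Lemma ad_sl H K N (m : tmap H K N) x x' T : ad (sl m x x' T) = sl m x' x (ad T).
Proof. by rewrite /sl !adM adK ocA. Qed.
Lemma ad_sr H K N (m : tmap H K N) y y' T : ad (sr m y y' T) = sr m y' y (ad T).
Proof. by rewrite /sr !adM adK ocA. Qed.
Lemma sl_sw H K N (m : tmap H K N) x x' T : sl (tsw m) x x' T = sr m x x' T.
Proof. by apply: op_ext_ip => u v; rewrite slE srE. Qed.
Lemma sr_sw H K N (m : tmap H K N) x x' T : sr (tsw m) x x' T = sl m x x' T.
Proof. by apply: op_ext_ip => u v; rewrite slE srE. Qed.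

(** Once the second legs of a finite sum of simple tensors are made orthonormal, its squared norm is
    the sum of the squared norms of the first legs. There S acts term by term, so the bound of S
    survives. *)
Lemma amp_exists H H' K N N' (m : tmap H K N) (m' : tmap H' K N') (S : op H H') (M : R) :
  0 <= M -> (forall x, nr (S x) <= M * nr x) ->
  exists2 A : op N N', (forall x y, A (m x y) = m' (S x) y) &
    forall u, nr (A u) <= M * nr u.
Proof.
move=> M0 hM.
have [||||F [WtQ Wt_Q F3]] := @ext_fam N N' (H * K)%type idfun (fun p => m p.1 p.2)
    (fun p => m' (S p.1) p.2) M.
- by [].
- by [].
- exact: tmT.
- move=> n c i /=.
  have [X [f [of_ hX hg]]] := orth_rep c (fun k => (i k).1) (fun k => (i k).2).
  rewrite (hg _ m (tml m) (tmr m)).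
  rewrite (hg _ (fun x y => m' (S x) y)); last 2 first.
  + by move=> y a u v; rewrite opLP tml.
  + by move=> x; exact: tmr.
  have h2 : nr (\sum_(k < n) m' (S (X k)) (f k)) ^+ 2 <= M ^+ 2 * nr (\sum_(k < n) m (X k) (f k)) ^+ 2.
    rewrite (nr_orth_sum m _ of_ hX) (nr_orth_sum m' (X := fun k => S (X k)) _ of_); last first.
      by move=> k /hX ->; rewrite opL0.
    rewrite mulr_sumr; apply: ler_sum => k _; rewrite -exprMn ler_pXn2r// ?nnegrE ?mulr_ge0 ?nr_ge0//.
  by rewrite -exprMn ler_pXn2r// ?nnegrE ?mulr_ge0 ?nr_ge0// in h2.
have bF : blin F by split=> //; exists M.
by exists (Op bF) => // x y; exact: (WtQ (x, y)).
Qed.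

(* S (x) 1; accordingly [amp (tsw m) (tsw m) T] is 1 (x) T. *)
Definition amp H H' K N N' (m : tmap H K N) (m' : tmap H' K N') (S : op H H') : op N N' :=
  xget 0 [set A : op N N' | forall x y, A (m x y) = m' (S x) y].

Section Amp.
Variables (H H' K N N' : hilbertType R) (m : tmap H K N) (m' : tmap H' K N').
Implicit Types S T : op H H'.

Lemma ampE S x y : amp m m' S (m x y) = m' (S x) y.
Proof.
have [A hA _] := amp_exists m m' (opb_ge0 S) (opbP S).
by rewrite /amp; case: xgetP => [B _ ->//|/(_ A)[]].
Qed.

Lemma amp_uniq S (A : op N N') : (forall x y, A (m x y) = m' (S x) y) -> A = amp m m' S.
Proof. by move=> h; apply: (tm_op_ext (m := m)) => x y; rewrite h ampE. Qed.

Lemma amp_bnd S M : 0 <= M -> (forall x, nr (S x) <= M * nr x) ->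
  forall u, nr (amp m m' S u) <= M * nr u.
Proof.
by move=> M0 hM; have [A /amp_uniq <-] := amp_exists m m' M0 hM.
Qed.

Lemma ampP a S T : amp m m' (a *: S + T) = a *: amp m m' S + amp m m' T.
Proof.
apply/esym/amp_uniq => x y; rewrite opDE opZE !ampE.
by rewrite -(tml m') opDE opZE.
Qed.

Lemma amp_ketr S y : amp m m' S ** ketr m y = ketr m' y ** S.
Proof. by apply: op_ext => x; rewrite !ocE ampE. Qed.
Lemma amp_ketl S x : amp m m' S ** ketl m x = ketl m' (S x).
Proof. by apply: op_ext => y; rewrite !ocE ampE. Qed.
Lemma bra_amp S y : ad (ketr m' y) ** amp m m' S = S ** ad (ketr m y).
Proof.
by apply: (tm_op_ext (m := m)) => x y'; rewrite !ocE ampE !brar opLZ.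
Qed.
End Amp.

Lemma ad_amp H H' K N N' (m : tmap H K N) (m' : tmap H' K N') (S : op H H') :
  ad (amp m m' S) = amp m' m (ad S).
Proof.
apply: amp_uniq => x y; apply: (tm_ip_ext (m := m)) => u v.
by rewrite adr ampE !tmip adr.
Qed.

Lemma bral_amp H H' K N N' (m : tmap H K N) (m' : tmap H' K N') (S : op H H') x :
  ad (ketl m' x) ** amp m m' S = ad (ketl m (ad S x)).
Proof. by rewrite -[amp _ _ _]adK -adM ad_amp amp_ketl. Qed.

Lemma ampM H1 H2 H3 K N1 N2 N3 (m1 : tmap H1 K N1) (m2 : tmap H2 K N2) (m3 : tmap H3 K N3)
    (S : op H2 H3) (T : op H1 H2) :
  amp m2 m3 S ** amp m1 m2 T = amp m1 m3 (S ** T).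
Proof. by apply: amp_uniq => x y; rewrite ocE !ampE. Qed.

Lemma amp1 H K N (m : tmap H K N) : amp m m (oid H) = oid N.
Proof. by apply/esym/amp_uniq. Qed.

Lemma ampZ H H' K N N' (m : tmap H K N) (m' : tmap H' K N') a (S : op H H') :
  amp m m' (a *: S) = a *: amp m m' S.
Proof.
by apply/esym/amp_uniq => x y; rewrite opZE ampE -(opLZ (ketr m' y)).
Qed.

Lemma amp_comm H H' K K' N11 N12 N21 N22 (m11 : tmap H K N11) (m12 : tmap H K' N12)
    (m21 : tmap H' K N21) (m22 : tmap H' K' N22) (S : op H H') (T : op K K') :
  amp m12 m22 S ** amp (tsw m11) (tsw m12) T = amp (tsw m21) (tsw m22) T ** amp m11 m21 S.
Proof.
apply: (tm_op_ext (m := m11)) => x y; rewrite !ocE ampE/=.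
have -> : amp (tsw m11) (tsw m12) T (m11 x y) = m12 x (T y) by exact: (ampE (tsw m11)).
by rewrite ampE; apply/esym; exact: (ampE (tsw m21)).
Qed.

Section Assoc.
Variables (A B D AB BD N : hilbertType R).
Variables (mAB : tmap A B AB) (mBD : tmap B D BD) (n : tmap AB D N).

(** As u need not be a simple tensor, x is adjoined to it by letting the ket y |-> x (x) y act on
    its first leg. *)
Definition asm x u : N := amp mBD n (ketl mAB x) u.

Lemma asmE x y z : asm x (mBD y z) = n (mAB x y) z.
Proof. by rewrite /asm ampE. Qed.

Lemma as_tens : tens asm.
Proof.
split.
- by move=> u a x x'; rewrite /asm ketlP ampP.
- by move=> x a u v; rewrite /asm opLP.
- move=> x u x' u'; rewrite -[ip x x' * _]ipZr /asm -adr -ocE ad_amp ampM ketl_ad ampZ amp1.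
  by rewrite opZE oidE.
- apply: total_orth => v hv; apply: (tm_ip_ext (m := n)) => w z; rewrite ip0r.
  suff -> : ip (n w z) v = ip w (ad (ketr n z) v).
    suff -> : ad (ketr n z) v = 0 by rewrite ip0r.
    apply: (tm_ip_ext (m := mAB)) => x y; rewrite ip0r adr ketrE -asmE; apply: hv.
    by exists (x, mBD y z).
  by rewrite adr.
Qed.

Definition tas : tmap A BD N := TMap as_tens.
Lemma tasE x y z : tas x (mBD y z) = n (mAB x y) z. Proof. exact: asmE. Qed.
End Assoc.

Section Triple.
Variables (A B D AB AD BD N : hilbertType R).
Variables (mAB : tmap A B AB) (mAD : tmap A D AD) (mBD : tmap B D BD) (n : tmap AB D N).
Definition t23 : tmap BD A N := tsw (tas mAB mBD n).
Definition t13 : tmap AD B N := tsw (tas (tsw mAB) mAD n).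
Lemma t23E x y z : t23 (mBD y z) x = n (mAB x y) z. Proof. exact: tasE. Qed.
Lemma t13E x y z : t13 (mAD x z) y = n (mAB x y) z. Proof. exact: (tasE (tsw mAB)). Qed.
End Triple.

Lemma ht_tens H K (t : htensor H K) : tens (@ht_map R H K t).
Proof.
split; [exact: ht_linl|exact: ht_linr|exact: ht_ip|exact: ht_dense].
Qed.
Definition htm H K (t : htensor H K) : tmap H K t := TMap (ht_tens t).

End Tensors.

(** * Existence of tensor products *)

Section Kolmogorov.
Variable R : realType.
Local Notation C := R[i].

Lemma R_complete (u : nat -> R) :
  (forall e, 0 < e -> exists N, forall n m, (N <= n)%N -> (N <= m)%N -> `|u n - u m| <= e) ->
  exists l, forall e, 0 < e -> exists N, forall n, (N <= n)%N -> `|u n - l| <= e.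
Proof.
move=> cu; have : cvg (u @ \oo).
  apply/cauchy_cvgP/cauchy_exP => e e0.
  have [N hN] := cu (e / 2) (divr_gt0 e0 (ltr0Sn _ _)).
  exists (u N); exists N => // n /= nN.
  by rewrite /= -ball_normE/=; apply: le_lt_trans (hN _ _ (leqnn _) nN) _; lra.
move=> c; exists (lim (u @ \oo)) => e e0.
have /cvgrPdist_le/(_ e e0)[N _ hN] := c; exists N => n nN.
by rewrite distrC; apply: hN.
Qed.

Lemma Re_nr (c : C) : `|complex.Re c| <= nr c.
Proof. by rewrite ler_norml Re_le_nr andbT -[nr c]nrN lerNl -raddfN Re_le_nr. Qed.

Lemma Im_nr (c : C) : `|complex.Im c| <= nr c.
Proof.
have -> : complex.Im c = complex.Re (- (c * 'i)).
  by rewrite raddfN /= ReiNIm opprK.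
apply: le_trans (Re_nr _) _; rewrite nrN nrM; suff -> : nr ('i : C) = 1 by rewrite mulr1.
by rewrite /nr normc_def/= expr0n expr1n add0r sqrtr1.
Qed.

Lemma nr_ReIm (c : C) : nr c <= `|complex.Re c| + `|complex.Im c|.
Proof.
rewrite -(ler_pXn2r (n := 2))// ?nnegrE ?addr_ge0 ?nr_ge0 ?normr_ge0//.
have -> : nr c ^+ 2 = `|complex.Re c| ^+ 2 + `|complex.Im c| ^+ 2.
  by rewrite /nr normc_def/= sqr_sqrtr ?addr_ge0 ?sqr_ge0// !real_normK ?num_real.
rewrite sqrrD; have := mulr_ge0 (normr_ge0 (complex.Re c)) (normr_ge0 (complex.Im c)).
by rewrite mulr2n; lra.
Qed.

Lemma C_complete (u : nat -> C) : cauchys u -> exists l, tends u l.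
Proof.
move=> cu.
have [|a ha] := @R_complete (fun n => complex.Re (u n)).
  move=> e /cu[N hN]; exists N => n m nN mN; rewrite -raddfB.
  exact: le_trans (Re_nr _) (hN _ _ nN mN).
have [|b hb] := @R_complete (fun n => complex.Im (u n)).
  move=> e /cu[N hN]; exists N => n m nN mN; rewrite -raddfB.
  exact: le_trans (Im_nr _) (hN _ _ nN mN).
exists (Complex a b) => e e0; have e2 : 0 < e / 2 by lra.
have [N hN] := ha _ e2; have [N' hN'] := hb _ e2.
exists (N + N')%N => n nn.
have := hN n (leq_trans (leq_addr _ _) nn); have := hN' n (leq_trans (leq_addl _ _) nn).
move=> h1 h2; apply: le_trans (nr_ReIm _) _.
by rewrite !raddfB/=; lra.
Qed.

Lemma Re_tail (u : nat -> C) (x : C) (M : R) :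
  tends u x -> (exists N, forall n, (N <= n)%N -> complex.Re (u n) <= M) -> complex.Re x <= M.
Proof.
move=> h [N hN]; apply: nr_le_eps => e e0; have [N' hN'] := h _ e0.
have := hN (N + N')%N ltac:(lia); have := hN' (N + N')%N ltac:(lia).
have := Re_le_nr (x - u (N + N')%N); rewrite nrBC raddfB/=.
by move: (complex.Re _) (complex.Re _) => a c; lra.
Qed.

(** A positive definite kernel, from which a Hilbert space is completed that has generators with
    this Gram matrix (Kolmogorov). The hypotheses of the theorem provide only some tensor products;
    the spaces with three and four legs are obtained in this way. *)
Record kern (I : Type) := Kern {
  kf :> I -> I -> C;
  kherm : forall i j, kf j i = cj (kf i j);
  kpos : forall s : seq (C * I),
    0 <= complex.Re (\sum_(a <- s) \sum_(b <- s) cj a.1 * b.1 * kf a.2 b.2)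
}.

Lemma nr_tri_le (V : normedZmodType C) (x y z : V) a b :
  nr (x - y) <= a -> nr (y - z) <= b -> nr (x - z) <= a + b.
Proof. by move=> h1 h2; apply: le_trans (nr_tri _ y _) (lerD h1 h2). Qed.

Lemma psd_CS (a b : R) (z : C) : 0 <= b ->
  (forall c : C, 0 <= a + 2 * complex.Re (c * z) + nr c ^+ 2 * b) -> nr z ^+ 2 <= a * b.
Proof.
move=> b0 h.
have h2 r : 0 <= a - 2 * r * nr z ^+ 2 + r ^+ 2 * nr z ^+ 2 * b.
  have := h (- (r%:C * cj z)); rewrite nrN nrM nr_conj nrC exprMn real_normK ?num_real//.
  have -> : - (r%:C * cj z) * z = (- (r * nr z ^+ 2))%:C.
    by rewrite mulNr -mulrA conj_mul_nr -rmorphM rmorphN.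
  by rewrite /=; move: (nr z ^+ 2) => t; nra.
have [b1|b1] := eqVneq b 0; last first.
  have bp : 0 < b by rewrite lt_neqAle eq_sym b1.
  have := h2 b^-1; rewrite -(pmulr_rge0 _ bp).
  have -> : b * (a - 2 / b * nr z ^+ 2 + b^-1 ^+ 2 * nr z ^+ 2 * b) = a * b - nr z ^+ 2 by field.
  by rewrite subr_ge0.
rewrite b1 mulr0; apply: nr_le_eps => e e0; rewrite add0r.
have a0 : 0 <= a by have := h2 0; rewrite mulr0 mul0r subr0 expr0n !mul0r addr0.
(* For b = 0 the inequality 2 r |z|^2 <= a holds for every r, and this r turns it into |z|^2 <=
   e. *)
have := h2 ((a + 1) / (2 * e)); rewrite b1 mulr0 addr0.
have -> : 2 * ((a + 1) / (2 * e)) = (a + 1) / e by field; rewrite gt_eqF.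
rewrite subr_ge0 mulrAC ler_pdivrMr//; move: (nr z ^+ 2) => t; nra.
Qed.

Section Space.
Variables (I : Type) (k : kern I).
Implicit Types (s t : seq (C * I)) (u v w : nat -> seq (C * I)).

Definition kprod s t : C := \sum_(a <- s) \sum_(b <- t) cj a.1 * b.1 * k a.2 b.2.
Local Notation kp := kprod.
Definition ksc (c : C) s := [seq (c * a.1, a.2) | a <- s].
Definition kev (i : I) : seq (C * I) := [:: (1, i)].
Definition ksub s t := s ++ ksc (-1) t.
Definition kq s : R := complex.Re (kp s s).
Definition knr s : R := Num.sqrt (kq s).
Local Notation kn := knr.

Lemma kpDl s s' t : kp (s ++ s') t = kp s t + kp s' t.
Proof. by rewrite /kprod big_cat. Qed.
Lemma kpC s t : kp t s = cj (kp s t).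
Proof.
rewrite /kprod rmorph_sum/= exchange_big/=; apply: eq_bigr => a _.
rewrite rmorph_sum/=; apply: eq_bigr => b _.
by rewrite !rmorphM/= conjcK -kherm mulrAC mulrC mulrA.
Qed.
Lemma kpDr s t t' : kp s (t ++ t') = kp s t + kp s t'.
Proof. by rewrite kpC kpDl rmorphD/= -!kpC. Qed.
Lemma kpZr c s t : kp s (ksc c t) = c * kp s t.
Proof.
rewrite /kprod mulr_sumr; apply: eq_bigr => a _; rewrite big_map mulr_sumr.
by apply: eq_bigr => b _ /=; ring.
Qed.
Lemma kpZl c s t : kp (ksc c s) t = cj c * kp s t.
Proof. by rewrite kpC kpZr rmorphM/= -kpC. Qed.
Lemma kpBl s s' t : kp (ksub s s') t = kp s t - kp s' t.
Proof. by rewrite kpDl kpZl rmorphN rmorph1 mulN1r. Qed.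
Lemma kpBr s t t' : kp s (ksub t t') = kp s t - kp s t'.
Proof. by rewrite kpDr kpZr mulN1r. Qed.

Lemma kq_ge0 s : 0 <= kq s. Proof. exact: kpos. Qed.
Lemma kn_ge0 s : 0 <= kn s. Proof. exact: sqrtr_ge0. Qed.
Lemma kn_sq s : kn s ^+ 2 = kq s. Proof. by rewrite sqr_sqrtr// kq_ge0. Qed.
Lemma kp_kq s : kp s s = (kq s)%:C.
Proof.
have := kpC s s; rewrite /kq; case: (kp s s) => a b [] h.
by apply/eqP; rewrite eq_complex/= eqxx/=; apply/eqP; lra.
Qed.

Lemma kq_comb c s t : kq (s ++ ksc c t) = kq s + 2 * complex.Re (c * kp s t) + nr c ^+ 2 * kq t.
Proof.
have E : (2 * complex.Re (c * kp s t))%:C = c * kp s t + cj (c * kp s t) :> C.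
  by rewrite addcJ rmorphM rmorph_nat.
have E2 : (nr c ^+ 2 * kq t)%:C = cj c * c * kp t t :> C.
  by rewrite conj_mul_nr kp_kq rmorphM.
apply: complexI; rewrite 2!rmorphD /= E E2 -!kp_kq kpDl !kpDr !kpZl !kpZr (kpC s t).
by rewrite [cj (c * _)]rmorphM; ring.
Qed.

Lemma kCS s t : nr (kp s t) <= kn s * kn t.
Proof.
have : nr (kp s t) ^+ 2 <= kq s * kq t.
  apply: psd_CS; first exact: kq_ge0.
  by move=> c; rewrite -kq_comb kq_ge0.
rewrite -!kn_sq -exprMn ler_pXn2r// ?nnegrE ?mulr_ge0 ?nr_ge0 ?kn_ge0//.
Qed.

Lemma kn_tri r s t : kn (ksub r t) <= kn (ksub r s) + kn (ksub s t).
Proof.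
rewrite -(ler_pXn2r (n := 2))// ?nnegrE ?addr_ge0 ?kn_ge0// kn_sq.
have E : kp (ksub r t) (ksub r t) = kp (ksub r s) (ksub r s) + kp (ksub s t) (ksub s t)
   + (kp (ksub r s) (ksub s t) + cj (kp (ksub r s) (ksub s t))).
  by rewrite -kpC !kpBl !kpBr; ring.
move: E; rewrite addcJ !kp_kq; set x := kp _ _.
have -> : 2 * (complex.Re x)%:C = (2 * complex.Re x)%:C :> C by rewrite rmorphM rmorph_nat.
rewrite -!rmorphD => /complexI ->; rewrite sqrrD -!kn_sq; have := Re_le_nr x; have := kCS (ksub r s) (ksub s t); rewrite -/x.
move: (kn _) (kn _) (nr x) (complex.Re x) => a b c d; rewrite mulr2n; lra.
Qed.

Lemma kn_le s t : kn s <= kn (ksub s t) + kn t.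
Proof.
have := kn_tri s t [::]; rewrite /ksub /= cats0.
by have -> : t ++ ksc (-1) [::] = t by rewrite cats0.
Qed.

Definition kcauchy u := forall e : R, 0 < e ->
  exists N, forall n m, (N <= n)%N -> (N <= m)%N -> kn (ksub (u n) (u m)) <= e.

Lemma kcauchy_bnd u : kcauchy u -> exists N (M : R), 0 <= M /\ forall n, (N <= n)%N -> kn (u n) <= M.
Proof.
move=> h; have [N hN] := h 1 ltr01; exists N, (1 + kn (u N)); split.
  by rewrite addr_ge0 ?kn_ge0.
by move=> n nN; apply: le_trans (kn_le _ (u N)) _; rewrite lerD2r hN.
Qed.

Lemma kp_diff s s' t t' :
  nr (kp s t - kp s' t') <= kn (ksub s s') * kn t + kn s' * kn (ksub t t').
Proof.
have -> : kp s t - kp s' t' = kp (ksub s s') t + kp s' (ksub t t').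
  by rewrite kpBl kpBr; ring.
by apply: le_trans (nrD _ _) (lerD (kCS _ _) (kCS _ _)).
Qed.

Lemma kp_cvg u v : kcauchy u -> kcauchy v -> exists l, tends (fun n => kp (u n) (v n)) l.
Proof.
move=> hu hv; apply: C_complete => e e0.
have [N1 [M1 [M10 h1]]] := kcauchy_bnd hu; have [N2 [M2 [M20 h2]]] := kcauchy_bnd hv.
have Mp : 0 < M1 + M2 + 1 by lra.
have d0 := divr_gt0 e0 Mp.
have [N3 h3] := hu _ d0; have [N4 h4] := hv _ d0.
exists (N1 + N2 + N3 + N4)%N => n m nN mN.
apply: le_trans (kp_diff _ _ _ _) _.
have a1 := h1 m ltac:(lia); have a2 := h2 n ltac:(lia).
have a3 := h3 n m ltac:(lia) ltac:(lia); have a4 := h4 n m ltac:(lia) ltac:(lia).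
have b1 := ler_pM (kn_ge0 _) (kn_ge0 _) a3 a2; have b2 := ler_pM (kn_ge0 _) (kn_ge0 _) a1 a4.
apply: le_trans (lerD b1 b2) _.
have : e / (M1 + M2 + 1) * (M1 + M2 + 1) = e by rewrite divfK// gt_eqF.
by move: d0; move: (e / _) => d d0 hd; nra.
Qed.

(** Write (w_n | w_n) = (w_n - w_N | w_n) + (w_N | w_n). The first term is small by the Cauchy
    property; in the second w_N is a fixed finite combination of generators, so weak convergence on
    generators applies. Hence inner products with the generators determine a point of the
    completion. *)
Lemma kq_null w : kcauchy w -> (forall i, tends (fun n => kp (kev i) (w n)) 0) ->
  forall e : R, 0 < e -> exists N, forall n, (N <= n)%N -> kn (w n) <= e.
Proof.
move=> hw h0.
have h1 s : tends (fun n => kp s (w n)) 0.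
  elim: s => [|[c i] s IH].
    by move=> e e0; exists 0%N => n _; rewrite /kprod big_nil subrr nr0 ltW.
  rewrite -[0](addr0 0); have E n : kp ((c, i) :: s) (w n) = cj c * kp (kev i) (w n) + kp s (w n).
    rewrite /kprod big_cons /kev big_seq1; congr (_ + _); rewrite mulr_sumr.
    apply: eq_bigr => b _; rewrite (_ : cj (1, i).1 = 1) ?mul1r ?mulrA//.
    exact: rmorph1.
  have := tendsD (u := fun n => cj c * kp (kev i) (w n)) _ IH.
  move=> /(_ 0) h e e0; have [|N hN] := h _ e e0.
    by apply: (tends_bnd (nr_ge0 (cj c)) (h0 i)) => n; rewrite !subr0 nrM.
  by exists N => n /hN; rewrite E.
move=> e e0; have [N1 [M [M0 hM]]] := kcauchy_bnd hw.
have Mp : 0 < M + 1 by lra.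
have e2 : 0 < e ^+ 2 / 2 by rewrite divr_gt0// exprn_gt0.
have [N2 h2] := hw _ (divr_gt0 e2 Mp).
set N := (N1 + N2)%N; have [N3 h3] := h1 (w N) _ e2.
exists (N + N3)%N => n nN.
suff : kn (w n) ^+ 2 <= e ^+ 2 by rewrite ler_pXn2r// ?nnegrE ?kn_ge0 ?ltW.
rewrite kn_sq; have -> : kq (w n) = complex.Re (kp (ksub (w n) (w N)) (w n)) + complex.Re (kp (w N) (w n)).
  by rewrite -raddfD /= kpBl subrK.
have a1 := Re_le_nr (kp (ksub (w n) (w N)) (w n)).
have a2 := kCS (ksub (w n) (w N)) (w n).
have a3 := h2 n N ltac:(lia) ltac:(lia); have a4 := hM n ltac:(lia).
have a5 := ler_pM (kn_ge0 _) (kn_ge0 _) a3 a4.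
have a6 := h3 n ltac:(lia); rewrite subr0 in a6.
have a7 := Re_le_nr (kp (w N) (w n)).
have a8 : e ^+ 2 / 2 / (M + 1) * M <= e ^+ 2 / 2.
  by rewrite mulrAC ler_pdivrMr//; move: e2; move: (e ^+ 2 / 2) => t t0; nra.
have b1 := le_trans a1 (le_trans a2 (le_trans a5 a8)); have b2 := le_trans a7 a6.
by apply: le_trans (lerD b1 b2) _; rewrite -splitr.
Qed.

Lemma kcauchyD u v : kcauchy u -> kcauchy v -> kcauchy (fun n => u n ++ v n).
Proof.
move=> hu hv e e0; have e2 : 0 < e / 2 by lra.
have [N hN] := hu _ e2; have [N' hN'] := hv _ e2.
exists (N + N')%N => n m nN mN.
have := hN n m ltac:(lia) ltac:(lia); have := hN' n m ltac:(lia) ltac:(lia).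
have := kn_tri (u n ++ v n) (u m ++ v n) (u m ++ v m).
have -> : kn (ksub (u n ++ v n) (u m ++ v n)) = kn (ksub (u n) (u m)).
  by congr Num.sqrt; congr complex.Re; rewrite !kpBl !kpBr !kpDl !kpDr; ring.
have -> : kn (ksub (u m ++ v n) (u m ++ v m)) = kn (ksub (v n) (v m)).
  by congr Num.sqrt; congr complex.Re; rewrite !kpBl !kpBr !kpDl !kpDr; ring.
lra.
Qed.

Lemma kcauchyZ c u : kcauchy u -> kcauchy (fun n => ksc c (u n)).
Proof.
move=> hu e e0; have c1 : 0 < nr c + 1 by have := nr_ge0 c; lra.
have [N hN] := hu _ (divr_gt0 e0 c1); exists N => n m nN mN.
have -> : kn (ksub (ksc c (u n)) (ksc c (u m))) = nr c * kn (ksub (u n) (u m)).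
  rewrite /knr -[nr c]ger0_norm ?nr_ge0// -sqrtr_sqr -sqrtrM ?sqr_ge0//.
  congr Num.sqrt; apply: complexI.
  have -> : (nr c ^+ 2 * kq (ksub (u n) (u m)))%:C =
      cj c * c * kp (ksub (u n) (u m)) (ksub (u n) (u m)) :> C.
    by rewrite conj_mul_nr kp_kq rmorphM.
  rewrite -kp_kq; by rewrite !kpBl !kpBr !kpZl !kpZr; ring.
apply: le_trans (ler_wpM2l (nr_ge0 _) (hN _ _ nN mN)) _.
by rewrite mulrA ler_pdivrMr//; have := nr_ge0 c; nra.
Qed.

Lemma kcauchy_cst s : kcauchy (fun=> s).
Proof.
move=> e e0; exists 0%N => n m _ _.
have -> : kn (ksub s s) = 0 by rewrite /knr /kq kpBl !kpBr !subrr sqrtr0.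
exact: ltW.
Qed.

(* An element of the completion is represented by its inner products with the
   generators, so that no quotient is needed. *)
Definition krep u (F : I -> C) := kcauchy u /\ forall i, tends (fun n => kp (kev i) (u n)) (F i).

Lemma krepP u F v G a : krep u F -> krep v G -> krep (fun n => ksc a (u n) ++ v n) (a *: F + G).
Proof.
move=> [cu hu] [cv hv]; split; first by apply: kcauchyD => //; apply: kcauchyZ.
move=> i; have h1 : tends (fun n => a * kp (kev i) (u n)) (a * F i).
  by apply: (tends_bnd (nr_ge0 a) (hu i)) => n; rewrite -mulrBr nrM.
have := tendsD h1 (hv i) => h e /h[N hN]; exists N => n /hN.
by rewrite kpDr kpZr.
Qed.

Lemma krep_cst s : krep (fun=> s) (fun i => kp (kev i) s).
Proof. by split; [exact: kcauchy_cst|move=> i; exact: tends_cst]. Qed.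

Definition kmem : {pred I -> C} := [pred F | `[< exists u, krep u F >]].

Lemma kmem_submod : submod_closed kmem.
Proof.
split.
  apply/asboolP; exists (fun=> [::]); split; first exact: kcauchy_cst.
  move=> i e e0; exists 0%N => n _.
  by rewrite /kprod big_seq1 big_nil subrr nr0 ltW.
by move=> a F G /asboolP[u hu] /asboolP[v hv]; apply/asboolP; exists (fun n => ksc a (u n) ++ v n); apply: krepP.
Qed.

HB.instance Definition _ := GRing.isSubmodClosed.Build C (I -> C) kmem kmem_submod.

End Space.

Definition kspace (I : Type) (k : kern I) := {F : I -> C | F \in kmem k}.
HB.instance Definition _ (I : Type) (k : kern I) := [isSub of kspace k for sval].
HB.instance Definition _ (I : Type) (k : kern I) := [Choice of kspace k by <:].
HB.instance Definition _ (I : Type) (k : kern I) := [SubChoice_isSubLmodule of kspace k by <:].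

Section KHilbert.
Variables (I : Type) (k : kern I).
Local Notation T := (kspace k).
Local Notation kp := (kprod k).
Local Notation kn := (knr k).
Implicit Types (F G : T) (u v : nat -> seq (C * I)).

Definition kseq F : nat -> seq (C * I) := sval (cid (asboolW (valP F))).
Lemma kseqP F : krep k (kseq F) (val F).
Proof. by rewrite /kseq; case: cid. Qed.

Lemma krep_eq u u' v (F : I -> C) : krep k u F -> krep k u' F -> kcauchy k v ->
  forall l, tends (fun n => kp (u n) (v n)) l -> tends (fun n => kp (u' n) (v n)) l.
Proof.
move=> [cu hu] [cu' hu'] cv l hl.
have cw : kcauchy k (fun n => ksub (u' n) (u n)) by apply: kcauchyD => //; apply: kcauchyZ.
have [N1 [M [M0 hM]]] := kcauchy_bnd cv; move=> e e0.
have M1 : 0 < M + 1 by lra.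
have e2 : 0 < e / 2 by lra.
have [i|N2 h2] := kq_null cw _ (divr_gt0 e2 M1).
  move=> d d0; have d2 : 0 < d / 2 by lra.
  have [N3 h3] := hu i _ d2; have [N4 h4] := hu' i _ d2.
  exists (N3 + N4)%N => n nn; rewrite subr0 kpBr.
  have := h3 n ltac:(lia); have := h4 n ltac:(lia).
  have := nr_tri (kp (kev i) (u' n)) (F i) (kp (kev i) (u n)).
  by rewrite [nr (F i - _)]nrBC; lra.
have [N3 h3] := hl _ e2; exists (N1 + N2 + N3)%N => n nn.
have a1 := h3 n ltac:(lia); have a2 := h2 n ltac:(lia); have a3 := hM n ltac:(lia).
have a4 := kCS k (ksub (u' n) (u n)) (v n); rewrite kpBl in a4.
have a5 := ler_pM (kn_ge0 _ _) (kn_ge0 _ _) a2 a3.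
have a6 : e / 2 / (M + 1) * M <= e / 2 by rewrite mulrAC ler_pdivrMr//; nra.
have := nr_tri (kp (u' n) (v n)) (kp (u n) (v n)) l.
by have := le_trans a4 (le_trans a5 a6); lra.
Qed.

Lemma kip_ex F G : exists l, tends (fun n => kp (kseq F n) (kseq G n)) l.
Proof. by apply: kp_cvg; [exact: (kseqP F).1|exact: (kseqP G).1]. Qed.
Definition kip F G : C := sval (cid (kip_ex F G)).

Lemma tends_conj (u : nat -> C) l : tends u l -> tends (fun n => cj (u n)) (cj l).
Proof.
by move=> h; apply: (tends_bnd ler01 h) => n; rewrite mul1r -rmorphB nr_conj.
Qed.

Lemma kipP F G u v : krep k u (val F) -> krep k v (val G) ->
  tends (fun n => kp (u n) (v n)) (kip F G).
Proof.
move=> hu hv; rewrite /kip; case: cid => l /= hl.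
have h1 := krep_eq (kseqP F) hu (kseqP G).1 hl.
have h2 : tends (fun n => kp (kseq G n) (u n)) (cj l).
  by have := tends_conj h1 => h e /h[N hN]; exists N => n /hN; rewrite -kpC.
have h3 := krep_eq (kseqP G) hv hu.1 h2.
have := tends_conj h3; rewrite conjcK => h e /h[N hN].
by exists N => n /hN; rewrite -kpC.
Qed.

Lemma kval_lin c (F G : T) : val (c *: F + G) = c *: val F + val G. Proof. by []. Qed.

Lemma kipPr c (F G L : T) : kip F (c *: G + L) = c * kip F G + kip F L.
Proof.
have r := krepP c (kseqP G) (kseqP L); rewrite -kval_lin in r.
apply: (tends_uniq (kipP (kseqP F) r)).
have h1 : tends (fun n => c * kp (kseq F n) (kseq G n)) (c * kip F G).
  by apply: (tends_bnd (nr_ge0 c) (kipP (kseqP F) (kseqP G))) => n; rewrite -mulrBr nrM.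
have := tendsD h1 (kipP (kseqP F) (kseqP L)) => h2 e /h2[N hN]; exists N => n /hN.
by rewrite kpDr kpZr.
Qed.

Lemma kipC F G : kip G F = cj (kip F G).
Proof.
apply: (tends_uniq (kipP (kseqP G) (kseqP F))).
have := tends_conj (kipP (kseqP F) (kseqP G)) => h e /h[N hN]; exists N => n /hN.
by rewrite -kpC.
Qed.

Definition ksq F : R := complex.Re (kip F F).
Lemma kip_ksq F : kip F F = (ksq F)%:C.
Proof.
have := kipC F F; rewrite /ksq; case: (kip F F) => a b [] h.
by apply/eqP; rewrite eq_complex/= eqxx/=; apply/eqP; lra.
Qed.
Lemma ksq_ge0 F : 0 <= ksq F.
Proof.
rewrite -oppr_le0 -raddfN /=.
have h := kipP (kseqP F) (kseqP F).
apply: nr_le_eps => e e0; rewrite add0r; have [N hN] := h _ e0.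
have := Re_le_nr (kp (kseq F N) (kseq F N) - kip F F).
have := hN N (leqnn _); have := kq_ge0 k (kseq F N).
rewrite raddfB /= /kq raddfN /=.
by move: (complex.Re _) (complex.Re _) => a b; lra.
Qed.

Lemma kipPl c (F G L : T) : kip (c *: F + G) L = cj c * kip F L + kip G L.
Proof. by rewrite kipC kipPr rmorphD rmorphM /= -!kipC. Qed.

Lemma ksq_comb c F G : ksq (c *: G + F) = ksq F + 2 * complex.Re (c * kip F G) + nr c ^+ 2 * ksq G.
Proof.
have E : (2 * complex.Re (c * kip F G))%:C = c * kip F G + cj (c * kip F G) :> C.
  by rewrite addcJ rmorphM rmorph_nat.
have E2 : (nr c ^+ 2 * ksq G)%:C = cj c * c * kip G G :> C.
  by rewrite conj_mul_nr kip_ksq rmorphM.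
apply: complexI; rewrite 2!rmorphD /= E E2 -!kip_ksq kipPl !kipPr (kipC F G).
by rewrite [cj (c * _)]rmorphM; ring.
Qed.

Lemma kip_CS F G : nr (kip F G) ^+ 2 <= ksq F * ksq G.
Proof.
by apply: psd_CS; [exact: ksq_ge0|move=> c; rewrite -ksq_comb ksq_ge0].
Qed.

Definition knorm F : C := (Num.sqrt (ksq F))%:C.

Lemma knormD F G : knorm (F + G) <= knorm F + knorm G.
Proof.
rewrite /knorm -rmorphD lecR -(ler_pXn2r (n := 2))// ?nnegrE ?addr_ge0 ?sqrtr_ge0//.
rewrite sqrrD !sqr_sqrtr ?ksq_ge0//.
have := ksq_comb 1 G F; rewrite scale1r mul1r nr1 expr1n mul1r => ->.
have := Re_le_nr (kip G F); have := kip_CS G F.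
have : nr (kip G F) ^+ 2 <= ksq G * ksq F -> nr (kip G F) <= Num.sqrt (ksq F) * Num.sqrt (ksq G).
  move=> h; rewrite -(ler_pXn2r (n := 2))// ?nnegrE ?mulr_ge0 ?nr_ge0 ?sqrtr_ge0//.
  by rewrite exprMn !sqr_sqrtr ?ksq_ge0// mulrC.
move=> h1 /h1; move: (nr _) (complex.Re _) (ksq F) (ksq G) (Num.sqrt _ * _) => a b c d m.
by rewrite mulr2n; lra.
Qed.

Lemma kip0 F : kip F 0 = 0.
Proof.
have := kipPr 1 F 0 0; rewrite scale1r addr0 mul1r => h.
by apply: (addrI (kip F 0)); rewrite -h addr0.
Qed.

Lemma knormZ c F : knorm (c *: F) = `|c| * knorm F.
Proof.
rewrite /knorm nrE -rmorphM; congr (_%:C).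
have := ksq_comb c 0 F; rewrite addr0 => ->.
rewrite kipC kip0 rmorph0 mulr0 mulr0 addr0 {1}/ksq kip0 add0r.
by rewrite sqrtrM ?sqr_ge0// sqrtr_sqr ger0_norm ?nr_ge0.
Qed.

Lemma kev_mem i : (fun j => kp (kev j) (kev i)) \in kmem k.
Proof. by apply/asboolP; exists (fun=> kev i); apply: krep_cst. Qed.
Definition kgen i : T := exist (fun g : I -> C => g \in kmem k) _ (kev_mem i).

Lemma kgenE i F : kip (kgen i) F = val F i.
Proof.
exact: tends_uniq (kipP (F := kgen i) (krep_cst k (kev i)) (kseqP F)) ((kseqP F).2 i).
Qed.

Lemma knorm0 F : knorm F = 0 -> F = 0.
Proof.
move=> /complexI h; have s0 : ksq F = 0.
  by have := sqr_sqrtr (ksq_ge0 F); rewrite h expr0n.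
apply: val_inj; apply/funext => i; apply/eqP; rewrite -nr_eq0 -sqrf_eq0; apply/eqP/le_anti.
rewrite sqr_ge0 andbT -kgenE; apply: le_trans (kip_CS _ _) _.
by rewrite s0 mulr0.
Qed.

HB.instance Definition _ := Lmodule_isNormed.Build C T knormD knormZ knorm0.

Lemma nr_kn F : nr F = Num.sqrt (ksq F).
Proof. by []. Qed.

Lemma kgen_gram i j : kip (kgen i) (kgen j) = k i j.
Proof.
by rewrite kgenE /= /kprod !big_seq1 mulr1 (_ : cj 1 = 1) ?mul1r//; exact: rmorph1.
Qed.

Lemma kfin_ex (s : seq (C * I)) : exists2 F : T, lin_span (range kgen) F & krep k (fun=> s) (val F).
Proof.
elim: s => [|[c i] s [F hF rF]].
  exists 0; first exact: lin_span0.
  split; first exact: kcauchy_cst.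
  move=> i e e0; exists 0%N => n _.
  by rewrite /kprod big_seq1 big_nil subrr nr0 ltW.
exists (c *: kgen i + F).
  apply: lin_spanD => //; apply: lin_spanZ; apply: lin_span_sub; by exists i.
have := krepP c (krep_cst k (kev i)) rF.
by rewrite kval_lin /= mulr1.
Qed.

Definition kfin s : T := sval (cid2 (kfin_ex s)).
Lemma kfin_rep s : krep k (fun=> s) (val (kfin s)).
Proof. by rewrite /kfin; case: cid2. Qed.
Lemma kfin_span s : lin_span (range kgen) (kfin s).
Proof. by rewrite /kfin; case: cid2. Qed.

Lemma kfin_dist F u : krep k u (val F) -> forall e : R, 0 < e ->
  exists N, forall n, (N <= n)%N -> nr (F - kfin (u n)) <= e.
Proof.
move=> ru e e0; have e2 : 0 < e / 2 by lra.
have [N hN] := ru.1 _ e2; exists N => n nN.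
have E : F - kfin (u n) = (-1) *: kfin (u n) + F by rewrite scaleN1r addrC.
have rn : krep k (fun m => ksc (-1) (u n) ++ u m) (val (F - kfin (u n))).
  by rewrite E kval_lin; apply: krepP => //; exact: kfin_rep.
rewrite nr_kn -[e]gtr0_norm// -sqrtr_sqr ler_wsqrtr//.
apply: (Re_tail (kipP rn rn)); exists N => m mN.
have -> : complex.Re (kp (ksc (-1) (u n) ++ u m) (ksc (-1) (u n) ++ u m)) = kq k (ksub (u m) (u n)).
  by congr complex.Re; rewrite !kpBl !kpBr !kpDl !kpDr !kpZl !kpZr rmorphN1; ring.
rewrite -kn_sq; have := hN m n mN nN; have := kn_ge0 k (ksub (u m) (u n)).
by move: (kn _) => t *; nra.
Qed.

Lemma kfin_sub s t : nr (kfin s - kfin t) = kn (ksub s t).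
Proof.
have E : kfin s - kfin t = (-1) *: kfin t + kfin s by rewrite scaleN1r addrC.
have r : krep k (fun m => ksc (-1) t ++ s) (val (kfin s - kfin t)).
  by rewrite E kval_lin; apply: krepP; exact: kfin_rep.
rewrite nr_kn /knr; congr Num.sqrt; congr complex.Re.
apply: (tends_uniq (kipP r r)).
have -> : kp (ksub s t) (ksub s t) = kp (ksc (-1) t ++ s) (ksc (-1) t ++ s).
  by rewrite !kpBl !kpBr !kpDl !kpDr !kpZl !kpZr rmorphN1; ring.
exact: tends_cst.
Qed.

Lemma kcomplete (f : nat -> T) : cauchys f -> exists l, tends f l.
Proof.
move=> cf.
have /choice[v hv] : forall n, exists s, nr (f n - kfin s) <= n.+1%:R^-1.
  move=> n; have n0 : 0 < n.+1%:R^-1 :> R by rewrite invr_gt0.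
  by have [N hN] := kfin_dist (kseqP (f n)) n0; exists (kseq (f n) N); apply: hN.
have cv : kcauchy k v.
  move=> e e0; have e3 : 0 < e / 3 by lra.
  have [N hN] := cf _ e3; have [N' hN'] := inv_small e3.
  exists (N + N')%N => n m nN mN; rewrite -kfin_sub.
  have t3 := hN n m ltac:(lia) ltac:(lia).
  have t4 := le_trans (hv n) (hN' n ltac:(lia)); have t5 := le_trans (hv m) (hN' m ltac:(lia)).
  rewrite nrBC in t4; apply: le_trans (nr_tri_le t4 (nr_tri_le t3 t5)) _.
  by clear -e0; lra.
have /choice[G hG] : forall i, exists l, tends (fun n => kp (kev i) (v n)) l.
  by move=> i; apply: kp_cvg => //; exact: kcauchy_cst.
have mG : G \in kmem k by apply/asboolP; exists v.
pose G' : T := exist (fun g : I -> C => g \in kmem k) G mG.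
exists G' => e e0; have e2 : 0 < e / 2 by lra.
have [N hN] := kfin_dist (F := G') (conj cv hG) e2; have [N' hN'] := inv_small e2.
exists (N + N')%N => n nn.
have t2 := hN n ltac:(lia); rewrite (nrBC G') in t2.
have t3 := le_trans (hv n) (hN' n ltac:(lia)).
by apply: le_trans (nr_tri_le t3 t2) _; clear -e0; lra.
Qed.

End KHilbert.

Lemma complete_of_seq (T : normedModType C) (F : set_system T) :
  (forall u : nat -> T, cauchys u -> exists l, tends u l) ->
  ProperFilter F -> cauchy F -> cvg F.
Proof.
move=> h PF cF.
have cF' : cauchy_ex F by apply/cauchyP.
have /choice[u hu] : forall n, exists x, F (ball x (n.+1%:R^-1)%:C).
  by move=> n; apply: cF'; rewrite ltcR invr_gt0.
have hb x n y : ball x (n.+1%:R^-1)%:C y <-> nr (x - y) < n.+1%:R^-1.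
  by rewrite -ball_normE/= nrE ltcR.
have [|l hl] := h u.
  apply: (seq_cauchy (M := 1)) => // n m.
  have [y [/hb a /hb b]] := filter_ex (filterI (hu n) (hu m)).
  have := nr_tri (u n) y (u m); rewrite (nrBC y); move: a b; rewrite mul1r.
  by move: (_^-1) (_^-1) => c d; lra.
apply/cvg_ex; exists l; apply/cvgrPdist_le => e /gtc0P[r r0 ->].
have r2 : 0 < r / 2 by lra.
have [N hN] := hl _ r2; have [N' hN'] := inv_small r2.
set n := (N + N')%N; have := hu n; apply: filterS => y /hb hy.
rewrite nrE lecR; have := hN n ltac:(lia); have := hN' n ltac:(lia).
have := nr_tri l (u n) y; rewrite (nrBC l (u n)); move: hy.
by move: (_^-1) => c; lra.
Qed.

Lemma kcauchy_cvg (I : Type) (k : kern I) (F : set_system (kspace k)) :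
  ProperFilter F -> cauchy F -> cvg F.
Proof. by apply: complete_of_seq; exact: kcomplete. Qed.

HB.instance Definition _ (I : Type) (k : kern I) :=
  Uniform_isComplete.Build (kspace k) (@kcauchy_cvg I k).

Lemma knorm_kip (I : Type) (k : kern I) (F : kspace k) : `|F| ^+ 2 = kip F F.
Proof. by rewrite nrE nr_kn -rmorphXn /= sqr_sqrtr ?ksq_ge0// kip_ksq. Qed.

HB.instance Definition _ (I : Type) (k : kern I) :=
  isHilbert.Build R (kspace k) (@kipPr I k) (@kipC I k) (@knorm_kip I k).

Lemma kgen_total (I : Type) (k : kern I) : total (range (@kgen I k)).
Proof.
apply/totalP => F e e0; have [N hN] := kfin_dist (kseqP F) e0.
by exists (kfin k (kseq F N)); [exact: kfin_span|exact: hN].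
Qed.

Section TensorExists.
Variables H K : hilbertType R.

Let tk (p q : H * K) : C := ip p.1 q.1 * ip p.2 q.2.

Let tkherm p q : tk q p = cj (tk p q).
Proof. by rewrite /tk rmorphM /= -!ipC. Qed.

(** Positivity of the product of two Gram kernels: [orth_rep] makes the second legs orthonormal, and
    the double sum becomes a sum of squares. *)
Let tkpos (s : seq (C * (H * K))) :
  0 <= complex.Re (\sum_(a <- s) \sum_(b <- s) cj a.1 * b.1 * tk a.2 b.2).
Proof.
rewrite big_tnth; set n := size s; set a := fun i : 'I_n => tnth (in_tuple s) i.
have [X [f [[O U] hX hg]]] := orth_rep (fun i => (a i).1) (fun i => (a i).2.1) (fun i => (a i).2.2).
have E x y : \sum_(i < n) (a i).1 * (ip x (a i).2.1 * ip y (a i).2.2) =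
   \sum_(l < n) ip x (X l) * ip y (f l).
  apply: (hg C^o (fun u v => ip x u * ip y v)).
    by move=> v b u u'; rewrite /= ipDr ipZr mulrDl -mulrA.
  by move=> u b v v'; rewrite /= ipDr ipZr mulrDr mulrCA.
have -> : \sum_(i < n) \sum_(b <- s) cj (a i).1 * b.1 * tk (a i).2 b.2 =
    \sum_(l < n) (nr (X l) ^+ 2)%:C.
  transitivity (\sum_(i < n) \sum_(l < n) cj (a i).1 * (ip (a i).2.1 (X l) * ip (a i).2.2 (f l))).
    apply: eq_bigr => i _; rewrite -mulr_sumr -E big_tnth mulr_sumr.
    by apply: eq_bigr => j _; exact: esym (mulrA _ _ _).
  rewrite exchange_big/=; apply: eq_bigr => l _.
  transitivity (cj (\sum_(i < n) (a i).1 * (ip (X l) (a i).2.1 * ip (f l) (a i).2.2))).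
    by rewrite rmorph_sum; apply: eq_bigr => i _; rewrite !rmorphM /= -!ipC.
  rewrite E (bigD1 l)//= big1 ?addr0.
    rewrite rmorphM /= -!ipC -ip_nr; case: (U l) => [/hX ->|->]; last by rewrite mulr1.
    by rewrite ip0l mul0r.
  by move=> j jl; rewrite O ?mulr0// eq_sym.
rewrite raddf_sum; apply: sumr_ge0 => l _ /=; exact: sqr_ge0.
Qed.

Let tkern := Kern tkherm tkpos.
Let tg (x : H) (y : K) : kspace tkern := kgen tkern (x, y).

Let tg_ip x y (F : kspace tkern) : ip (tg x y) F = val F (x, y). Proof. exact: kgenE. Qed.

Let tg_gram x y x' y' : ip (tg x y) (tg x' y') = ip x x' * ip y y'.
Proof. exact: kgen_gram. Qed.

Let tg_tens : tens tg.
Proof.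
split.
- move=> y c u v; apply: val_inj; apply/funext => -[x' y'].
  by rewrite -!tg_ip ipDr ipZr !tg_gram ipDr ipZr mulrDl mulrA.
- move=> x c u v; apply: val_inj; apply/funext => -[x' y'].
  by rewrite -!tg_ip ipDr ipZr !tg_gram ipDr ipZr mulrDr mulrCA.
- exact: tg_gram.
- rewrite (_ : simple tg = range (kgen tkern)); first exact: kgen_total.
  by apply/seteqP; split=> _ [[x y] _ <-]; exists (x, y).
Qed.

Lemma tensor_exists : exists (N : hilbertType R) (m : tmap H K N), True.
Proof. by exists (kspace tkern), (TMap tg_tens). Qed.

End TensorExists.

End Kolmogorov.

(** * Three legs *)

Section Legs.
Variable R : realType.
Local Notation C := R[i].

Lemma tswK (H K N : hilbertType R) (m : tmap H K N) : tsw (tsw m) = m.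
Proof.
rewrite /tsw; case: m => m p /=.
by move: (tsw_tens _) => q; rewrite (Prop_irrelevance q p).
Qed.

(* N = A (x) B (x) D with the legs 12, 13 or 23 grouped together; the remaining
   leg always comes last. *)
Definition tri (A B D AB AD BD N : hilbertType R) (mAB : tmap A B AB) (mAD : tmap A D AD) (mBD : tmap B D BD)
    (n12 : tmap AB D N) (n13 : tmap AD B N) (n23 : tmap BD A N) :=
  (forall x y z, n23 (mBD y z) x = n12 (mAB x y) z) /\
  (forall x y z, n13 (mAD x z) y = n12 (mAB x y) z).

Section Tri.
Variables (A B D AB AD BD N : hilbertType R).
Variables (mAB : tmap A B AB) (mAD : tmap A D AD) (mBD : tmap B D BD)
  (n12 : tmap AB D N) (n13 : tmap AD B N) (n23 : tmap BD A N).

Lemma tri_mk : tri mAB mAD mBD n12 (t13 mAB mAD n12) (t23 mAB mBD n12).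
Proof. by split=> x y z; [exact: t23E|exact: t13E]. Qed.

Hypothesis T : tri mAB mAD mBD n12 n13 n23.

Lemma tri_sw12 : tri (tsw mAB) mBD mAD n12 n23 n13.
Proof. by split=> y x z; [exact: T.2|exact: T.1]. Qed.

Lemma tri_sw23 : tri mAD mAB (tsw mBD) n13 n12 n23.
Proof. by split=> x z y; rewrite [RHS]T.2 ?T.1//=; rewrite T.1. Qed.

Lemma tri_total : total (range (fun p : A * B * D => n12 (mAB p.1.1 p.1.2) p.2)).
Proof.
apply: total_orth => v hv; apply: (tm_ip_ext (m := n12)) => u z; rewrite ip0r.
suff E : ad (ketr n12 z) v = 0 by have := adr (ketr n12 z) v u; rewrite E ip0r ketrE => <-.
apply: (tm_ip_ext (m := mAB)) => x y; rewrite ip0r adr ketrE.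
by apply: hv; exists ((x, y), z).
Qed.

Lemma tri_ext (S S' : op N N) : (forall x y z x' y' z',
    ip (n12 (mAB x y) z) (S (n12 (mAB x' y') z')) =
    ip (n12 (mAB x y) z) (S' (n12 (mAB x' y') z'))) -> S = S'.
Proof.
move=> h; apply: (op_eq_mx tri_total tri_total) => _ _ [[[x y] z] _ <-] [[[x' y'] z'] _ <-].
exact: h.
Qed.

Lemma legform u z v x : ip (n12 u z) (n23 v x) = ip (ad (ketl mAB x) u) (ad (ketr mBD z) v).
Proof.
rewrite adl -[n12 u z]/(ketr n12 z u) -adr; congr (ip u _).
suff E : ad (ketr n12 z) ** ketr n23 x = ketl mAB x ** ad (ketr mBD z).
  by have := f_equal (fun S : op BD AB => S v) E.
apply: (tm_op_ext (m := mBD)) => y z'; apply: (tm_ip_ext (m := mAB)) => x' y'.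
rewrite !ocE adr !ketrE T.1 brar opLZ ipZr ketlE !tmip.
by rewrite [RHS]mulrC.
Qed.

Variables (S : op AB AB) (U : op BD BD).
Local Notation S12 := (amp n12 n12 S).
Local Notation U23 := (amp n23 n23 U).

(** Legs 12 and 23 meet in leg 2 alone. With legs 1 and 3 sliced away the composite is a product of
    two operators on leg 2, and the order of this product is what transposition reverses. *)
Lemma leg_mx x y z x' y' z' :
  ip (n12 (mAB x y) z) (S12 (U23 (n12 (mAB x' y') z'))) =
  ip y (sl mAB x x' S (sr mBD z z' U y')).
Proof.
rewrite -adl ad_amp ampE -T.1 ampE legform /sl /sr !ocE.
by rewrite [RHS]adr -[RHS]adl -[RHS]adl.
Qed.

Lemma leg_mx' x y z x' y' z' :
  ip (n12 (mAB x y) z) (U23 (S12 (n12 (mAB x' y') z'))) =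
  ip y (sr mBD z z' U (sl mAB x x' S y')).
Proof.
rewrite -adl ad_amp -{1}T.1 !ampE ipC legform -ipC /sl /sr !ocE.
by rewrite [RHS]adr -[RHS]adl -[RHS]adl.
Qed.

End Tri.
End Legs.

(** * Transposition along a positive operator *)

Section Transposition.
Variable R : realType.
Local Notation C := R[i].

Lemma total_tmr (H K N : hilbertType R) (m : tmap H K N) (S : set K) : total S ->
  total [set m p.1 p.2 | p in [set p : H * K | S p.2]].
Proof.
move=> tS; apply: total_orth => v hv; apply: (tm_ip_ext (m := m)) => x y; rewrite ip0r.
suff E : ad (ketl m x) v = 0 by have := adr (ketl m x) v y; rewrite E ip0r => <-.
apply: (ip_eq_total tS) => s Ss; rewrite ip0r adr ketlE.
by apply: hv; exists (x, s).
Qed.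

Variables (H : hilbertType R) (Hb : hconj H).
Local Notation c := (@hc_map R H Hb).

Lemma hcZ a x : c (a *: x) = cj a *: c x.
Proof.
have c0 : c 0 = 0.
  have := hc_lin Hb (-1) 0 0; rewrite scaleN1r oppr0 addr0 rmorphN1 scaleN1r.
  by rewrite addNr.
by have := hc_lin Hb a x 0; rewrite c0 !addr0.
Qed.

Lemma nr_hc x : nr (c x) = nr x.
Proof.
apply/eqP; rewrite -(eqrXn2 (n := 2)) ?nr_ge0//; apply/eqP/complexI.
by rewrite -!ip_nr hc_ip.
Qed.

Lemma total_hc (S : set H) : total S -> total [set c x | x in S].
Proof.
move=> tS; apply: total_orth => v hv; have [x xv] := hc_surj v.
rewrite -xv in hv *.
suff -> : x = 0 by rewrite -(scale0r 0) hcZ rmorph0 scale0r.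
by apply: (ip_eq_total tS) => s Ss; rewrite ip0r -(hc_ip Hb) ipC hv ?rmorph0//; exists s.
Qed.

Variables (dom : set H) (Q : H -> H).
Hypothesis Qsa : selfadjoint dom Q.
Hypothesis Qinj : forall x, dom x -> Q x = 0 -> x = 0.

Lemma dom_total : total dom.
Proof.
have [h1 h2 _ _] := Qsa; rewrite /total; apply/seteqP; split=> // x _.
suff : closure dom x by apply: closure_subset => y; exact: lin_span_sub.
by rewrite h2.
Qed.

Lemma Qsym x y : dom x -> dom y -> ip (Q x) y = ip x (Q y).
Proof.
by move=> dx dy; have [_ _ _ h] := Qsa; exact: (h y (Q y)).1 (conj dy erefl) x dx.
Qed.

(** A vector orthogonal to the range lies in the domain of the adjoint, which is Q itself, and is
    killed by Q; injectivity concludes. *)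
Lemma ran_total : total [set Q x | x in dom].
Proof.
apply: total_orth => v hv; have [_ _ _ h] := Qsa.
have [|dv Qv] := (h v 0).2; last exact: Qinj.
by move=> x dx; rewrite ip0r hv//; exists x.
Qed.

(* [S'] is the transpose of [Q S Q^-1]. *)
Definition qtr (S : op H H) (S' : op Hb Hb) :=
  forall p e, dom p -> dom e -> ip (Q p) (S e) = ip (c (Q e)) (S' (c p)).

(** The relation for T shows, by selfadjointness, that T maps dom Q into itself and that Q (T e) is
    read off from T'. This is what makes the composite meaningful although Q is unbounded. *)
Lemma qtr_comp S S' T T' : qtr S S' -> qtr T T' -> qtr (S ** T) (T' ** S').
Proof.
move=> hS hT p e dp de; have [_ _ _ h] := Qsa.
have [w hw] := hc_surj (ad T' (c (Q e))).
have [dT QT] : dom (T e) /\ Q (T e) = w.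
  by apply/h => x dx; rewrite hT// -adl -hw hc_ip.
by rewrite ocE hS// QT hw adl.
Qed.

Lemma qtr_id a : qtr (a *: oid H) (a *: oid Hb).
Proof. by move=> p e dp de; rewrite !opZE !oidE !ipZr hc_ip Qsym. Qed.

Section Spectator.
Variables (P N Nt : hilbertType R) (m : tmap P H N) (mt : tmap P Hb Nt).

Record qtr3 (M : op N N) (M' : op Nt Nt) : Prop := Qtr3 {
  qtr3E : forall p e, dom p -> dom e -> sr m (Q p) e M = sr mt (c (Q e)) (c p) M' }.

(** The vectors c (Q e) and c p are total in Hb, so the relation is functional: two expressions of
    one operator on N have equal transposes. Every transposed pentagon equation is obtained in this
    way. *)
Lemma qtr3_uniq M M1 M2 : qtr3 M M1 -> qtr3 M M2 -> M1 = M2.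
Proof.
move=> h1 h2.
have t1 := total_tmr mt (total_hc ran_total); have t2 := total_tmr mt (total_hc dom_total).
apply: (op_eq_mx t1 t2).
move=> _ _ [[x _] /= [_ [e de <-] <-] <-] [[x' _] /= [p dp <-] <-].
by rewrite -!srE -(qtr3E h1)// (qtr3E h2).
Qed.

Lemma qtr3_spectl A M M' : qtr3 M M' -> qtr3 (amp m m A ** M) (amp mt mt A ** M').
Proof.
move=> h; split=> p e dp de; have := qtr3E h dp de; rewrite /sr !ocA !bra_amp -!ocA.
by move=> ->.
Qed.

Lemma qtr3_spectr A M M' : qtr3 M M' -> qtr3 (M ** amp m m A) (M' ** amp mt mt A).
Proof.
move=> h; split=> p e dp de; have := qtr3E h dp de; rewrite /sr -!ocA !amp_ketr !ocA.
by move=> ->.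
Qed.
End Spectator.

Section Middle.
Variables (A D AH HD AD N AHb HbD Nt : hilbertType R).
Variables (mAH : tmap A H AH) (mAD : tmap A D AD) (mHD : tmap H D HD).
Variables (n12 : tmap AH D N) (n13 : tmap AD H N) (n23 : tmap HD A N).
Variables (mAHb : tmap A Hb AHb) (mHbD : tmap Hb D HbD).
Variables (k12 : tmap AHb D Nt) (k13 : tmap AD Hb Nt) (k23 : tmap HbD A Nt).
Hypothesis T : tri mAH mAD mHD n12 n13 n23.
Hypothesis Tt : tri mAHb mAD mHbD k12 k13 k23.

Lemma qtr3_mx (M : op N N) (M' : op Nt Nt) :
  (forall x z x' z', exists2 S : op H H * op Hb Hb, qtr S.1 S.2 &
    (forall y y', ip (n12 (mAH x y) z) (M (n12 (mAH x' y') z')) = ip y (S.1 y')) /\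
    (forall y y', ip (k12 (mAHb x y) z) (M' (k12 (mAHb x' y') z')) = ip y (S.2 y'))) ->
  qtr3 n13 k13 M M'.
Proof.
move=> h; split=> p e dp de; apply: (op_eq_mx (tmT mAD) (tmT mAD)).
move=> _ _ [[x z] _ <-] [[x' z'] _ <-] /=; rewrite !srE !T.2 !Tt.2.
by have [S hS [h1 h2]] := h x z x' z'; rewrite h1 h2 hS.
Qed.

Variables (S : op AH AH) (S' : op AHb AHb) (U : op HD HD) (U' : op HbD HbD).
Hypothesis hS : forall x x', qtr (sl mAH x x' S) (sl mAHb x x' S').
Hypothesis hU : forall z z', qtr (sr mHD z z' U) (sr mHbD z z' U').

Lemma qtr3_SU : qtr3 n13 k13 (amp n12 n12 S ** amp n23 n23 U) (amp k23 k23 U' ** amp k12 k12 S').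
Proof.
apply: qtr3_mx => x z x' z'.
exists (sl mAH x x' S ** sr mHD z z' U, sr mHbD z z' U' ** sl mAHb x x' S').
  exact: qtr_comp.
by split=> y y'; [rewrite ocE (leg_mx T)|rewrite ocE (leg_mx' Tt)].
Qed.

Lemma qtr3_US : qtr3 n13 k13 (amp n23 n23 U ** amp n12 n12 S) (amp k12 k12 S' ** amp k23 k23 U').
Proof.
apply: qtr3_mx => x z x' z'.
exists (sr mHD z z' U ** sl mAH x x' S, sl mAHb x x' S' ** sr mHbD z z' U').
  exact: qtr_comp.
by split=> y y'; [rewrite ocE (leg_mx' T)|rewrite ocE (leg_mx Tt)].
Qed.

Lemma qtr3_S : qtr3 n13 k13 (amp n12 n12 S) (amp k12 k12 S').
Proof.
apply: qtr3_mx => x z x' z'.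
exists (sl mAH x x' S ** (ip z z' *: oid H), (ip z z' *: oid Hb) ** sl mAHb x x' S').
  by apply: qtr_comp => //; exact: qtr_id.
split=> y y'; rewrite ampE tmip !ocE !opZE !oidE ?opLZ ipZr slE mulrC//.
Qed.

Lemma qtr3_U : qtr3 n13 k13 (amp n23 n23 U) (amp k23 k23 U').
Proof.
apply: qtr3_mx => x z x' z'.
exists (sr mHD z z' U ** (ip x x' *: oid H), (ip x x' *: oid Hb) ** sr mHbD z z' U').
  by apply: qtr_comp => //; exact: qtr_id.
split=> y y'.
  by rewrite -!T.1 ampE tmip -srE mulrC -ipZr -opLZ.
by rewrite -!Tt.1 ampE tmip -srE mulrC -ipZr.
Qed.

End Middle.
End Transposition.

(** * Closed spans of operators *)

Section ClosedSpans.
Variable R : realType.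
Local Notation C := R[i].

Lemma ocl_total (V W X : normedModType C) (S : set (op W X)) (s : {rmorphism C -> C})
    (B : set V) (f : V -> op W X) (M : R) : total B ->
  (forall a u v, f (a *: u + v) = s a *: f u + f v) ->
  (forall v x, nr (f v x) <= M * nr v * nr x) ->
  (forall v, B v -> ocl S (f v)) -> forall v, ocl S (f v).
Proof.
move=> /totalP tB fl fM hB v; apply: ocl_lim => e e0.
have M1 : 0 < `|M| + 1 by have := normr_ge0 M; lra.
have [b Bb hb] := tB v _ (divr_gt0 e0 M1).
have f0 : f 0 = 0.
  by have := fl (-1) 0 0; rewrite scaleN1r oppr0 addr0 rmorphN1 scaleN1r addNr.
have fB u w : f (u - w) = f u - f w.
  by rewrite addrC -scaleN1r fl rmorphN1 scaleN1r addrC.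
exists (f b).
  elim/lin_span_ind: b / Bb {hb} => [|a u w Bu hw]; first by rewrite f0; exact: ocl0.
  by rewrite fl; apply: oclD => //; apply: oclZ; apply: hB.
move=> x; rewrite -opBE -fB; apply: le_trans (fM _ _) _; rewrite ler_wpM2r ?nr_ge0//.
apply: le_trans (ler_wpM2r (nr_ge0 _) (ler_norm M)) _.
rewrite ler_pdivlMr// in hb; have := nr_ge0 (v - b).
by move: (nr _) hb => a; nra.
Qed.

Lemma ocl_idem (V W : normedModType C) (S : set (op V W)) : ocl (ocl S) `<=` ocl S.
Proof. exact: ocl_le. Qed.

Lemma ocl_eq (V W : normedModType C) (S S' : set (op V W)) :
  S `<=` ocl S' -> S' `<=` ocl S -> ocl S = ocl S'.
Proof. by move=> h h'; apply/seteqP; split; exact: ocl_le. Qed.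

Variables (H K N : hilbertType R) (n : tmap H K N) (V W : hilbertType R).
Implicit Types (P : op N W) (Q : op V K) (S : set (op V W)).

Lemma ocl_ketl S P Q (B : set H) : total B ->
  (forall v, B v -> ocl S (P ** ketl n v ** Q)) -> forall v, ocl S (P ** ketl n v ** Q).
Proof.
move=> tB; apply: (@ocl_total _ _ _ S idfun B _ (opb P * opb Q)) => // [a u v|v x].
  by rewrite ketlP ocDr ocDl ocZr ocZl.
rewrite !ocE; apply: le_trans (opbP _ _) _; rewrite ketlE nr_tm -!mulrA ler_wpM2l ?opb_ge0//.
by rewrite mulrCA ler_wpM2l ?nr_ge0 ?opbP.
Qed.

Lemma ocl_bral S (P : op K W) (Q : op V N) (B : set H) : total B ->
  (forall v, B v -> ocl S (P ** ad (ketl n v) ** Q)) -> forall v, ocl S (P ** ad (ketl n v) ** Q).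
Proof.
move=> tB; apply: (@ocl_total _ _ _ S (@conjc R : {rmorphism C -> C}) B _ (opb P * opb Q)) => // [a u v|v x].
  by rewrite ketlP adD adZ ocDr ocDl ocZr ocZl.
rewrite !ocE; apply: le_trans (opbP _ _) _; rewrite -!mulrA ler_wpM2l ?opb_ge0//.
rewrite mulrCA; apply: le_trans (ad_bnd (M := nr v) (nr_ge0 _) _ _) _.
  by move=> y; rewrite ketlE nr_tm.
by rewrite ler_wpM2l ?nr_ge0 ?opbP.
Qed.

Lemma ketl_sw x : ketl (tsw n) x = ketr n x. Proof. exact: op_ext. Qed.
Lemma ketr_sw x : ketr (tsw n) x = ketl n x. Proof. exact: op_ext. Qed.

Lemma ocl_sl (T : op N N) (S : set (op K K)) (B B' : set H) : total B -> total B' ->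
  (forall x x', B x -> B' x' -> ocl S (sl n x x' T)) -> forall x x', ocl S (sl n x x' T).
Proof.
move=> tB tB' h x x'.
have h1 v : B' v -> forall x, ocl S (sl n x v T).
  move=> Bv; have E y : sl n y v T = oid K ** ad (ketl n y) ** (T ** ketl n v).
    by rewrite o1c ocA.
  apply: (@ocl_total _ _ _ S (@conjc R : {rmorphism C -> C}) B _ (opb T * nr v)) => // [a u w|u y|u Bu].
  - by rewrite !E ketlP adD adZ ocDr ocZr ocDl ocZl.
  - rewrite /sl !ocE; apply: le_trans (ad_bnd (M := nr u) (nr_ge0 _) _ _) _.
      by move=> z; rewrite ketlE nr_tm.
    rewrite [_ * nr u]mulrC -mulrA ler_wpM2l ?nr_ge0//; apply: le_trans (opbP _ _) _.
    by rewrite ketlE nr_tm mulrA.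
  - exact: h.
apply: (@ocl_total _ _ _ S idfun B' (fun u => sl n x u T) (nr x * opb T)) => // [a u w|u y|u Bu].
- by rewrite /sl ketlP ocDr ocZr.
- rewrite /sl !ocE; apply: le_trans (ad_bnd (M := nr x) (nr_ge0 _) _ _) _.
    by move=> z; rewrite ketlE nr_tm.
  rewrite -!mulrA ler_wpM2l ?nr_ge0//; apply: le_trans (opbP _ _) _.
  by rewrite ketlE nr_tm.
- exact: h1.
Qed.

End ClosedSpans.

Definition unitary (R : realType) (H : hilbertType R) (U : op H H) :=
  ad U ** U = oid H /\ U ** ad U = oid H.

Section Unitary.
Variable R : realType.
Variables (H K N : hilbertType R).
Implicit Types U V : op H H.

Lemma unitary_ad U : unitary U -> unitary (ad U).
Proof. by case=> a b; split; rewrite adK. Qed.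
Lemma unitaryM U V : unitary U -> unitary V -> unitary (U ** V).
Proof.
move=> [a b] [c d]; split; rewrite adM.
  by rewrite ocA -(ocA (ad V)) a oc1.
by rewrite ocA -(ocA U) d oc1.
Qed.
Lemma unitary_amp (m : tmap H K N) U : unitary U -> unitary (amp m m U).
Proof. by move=> [a b]; split; rewrite ad_amp ampM ?a ?b amp1. Qed.
Lemma unitaryKl U (X : op K H) : unitary U -> ad U ** (U ** X) = X.
Proof. by move=> [a _]; rewrite ocA a o1c. Qed.
Lemma unitaryKl' U (X : op K H) : unitary U -> U ** (ad U ** X) = X.
Proof. by move=> [_ a]; rewrite ocA a o1c. Qed.
Lemma unitaryKr U (X : op H K) : unitary U -> X ** U ** ad U = X.
Proof. by move=> [_ a]; rewrite -ocA a oc1. Qed.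
Lemma ocK U V : U ** V = oid H -> forall x, U (V x) = x.
Proof. by move=> h x; have := f_equal (fun S : op H H => S x) h. Qed.
End Unitary.

Section MoreSpans.
Variable R : realType.
Local Notation C := R[i].

Lemma ocl_prod (V W X : normedModType C) (S : set (op W X)) (T : set (op V W)) (U : set (op V X)) :
  (forall s t, S s -> T t -> ocl U (s ** t)) -> forall s t, ocl S s -> ocl T t -> ocl U (s ** t).
Proof.
move=> h s t Ss Tt; apply: ocl_compr Ss => {}s Ss.
by apply: ocl_compl Tt => {}t Tt; apply: h.
Qed.

Lemma ocl_ad (H K : hilbertType R) (S : set (op H K)) (S' : set (op K H)) :
  (forall s, S s -> ocl S' (ad s)) -> forall s, ocl S s -> ocl S' (ad s).
Proof.
move=> h s hs; apply: ocl_lim => e e0; have [t St ht] := hs e e0; exists (ad t).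
  elim/lin_span_ind: t / St {ht} => [|a u v Su hv]; first by rewrite ad0; exact: ocl0.
  by rewrite adD adZ; apply: oclD => //; apply: oclZ; apply: h.
by move=> x; rewrite -opBE -adB; apply: ad_bnd; [exact: ltW|move=> y; rewrite opBE].
Qed.

Lemma ocl_amp (H H' K N N' : hilbertType R) (m : tmap H K N) (m' : tmap H' K N')
    (S : set (op H H')) (S' : set (op N N')) :
  (forall T, S T -> ocl S' (amp m m' T)) -> forall T, ocl S T -> ocl S' (amp m m' T).
Proof.
apply: (@ocl_map _ _ _ _ _ _ _ idfun _ 1) => [a T U|T e e0 h x]; first exact: ampP.
by rewrite mul1r; apply: amp_bnd.
Qed.

Lemma total_unitary (H : hilbertType R) (U : op H H) (B : set H) : unitary U -> total B ->
  total [set U x | x in B].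
Proof.
move=> UU tB; apply: total_orth => v hv.
suff E : ad U v = 0 by rewrite -[v](ocK UU.2) E opL0.
apply: (ip_eq_total tB) => x Bx; rewrite ip0r adr; apply: hv.
by exists x.
Qed.

Definition stable (V W : normedModType C) (U : op W W) (S : set (op V W)) :=
  forall T, S T -> ocl S (U ** T).

Lemma stableP (V W : normedModType C) (U : op W W) (S : set (op V W)) T :
  stable U S -> ocl S T -> ocl S (U ** T).
Proof. by move=> h; exact: ocl_compl. Qed.

Lemma stableM (V W : normedModType C) (U U' : op W W) (S : set (op V W)) :
  stable U S -> stable U' S -> stable (U ** U') S.
Proof. by move=> h h' T /h' hT; rewrite -ocA; apply: stableP. Qed.

End MoreSpans.

Section EqualOnSpans.
Variable R : realType.

Lemma ocl0P (V W : normedModType R[i]) (T : op V W) : ocl [set 0] T -> T = 0.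
Proof.
move=> h; apply: op_ext => x; rewrite op0E -[T x]subr0.
apply/eqP; rewrite subr0 -nr_eq0; apply/eqP/le_anti; rewrite nr_ge0 andbT.
apply: (le0_eps (M := nr x)) => e e0; have [s Ss hs] := h e e0.
have s0 : s = 0 by elim/lin_span_ind: s / Ss {hs} => // a u v -> ->; rewrite scaler0 addr0.
by have := hs x; rewrite s0 op0E subr0 mulrC.
Qed.

Lemma ocl_eqmap (V W V' W' : normedModType R[i]) (S : set (op V W)) (F : op V W -> op V' W') (M : R) :
  linear F ->
  (forall (T : op V W) (e : R), 0 <= e -> (forall x, nr (T x) <= e * nr x) ->
     forall x, nr (F T x) <= M * e * nr x) ->
  (forall T, S T -> F T = 0) -> forall T, ocl S T -> F T = 0.
Proof.
move=> lF bF h T hT; apply: ocl0P; apply: (@ocl_map _ _ _ _ _ S [set 0] idfun F M) => // U SU.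
by rewrite h//; exact: ocl0.
Qed.

Variables (H K N : hilbertType R) (m : tmap H K N).

Lemma amp_total (S : set (op H H)) : total [set v | exists t x, S t /\ v = t x] ->
  total [set v | exists t x, [set amp m m s | s in S] t /\ v = t x].
Proof.
move=> h; apply: total_orth => v hv; apply: (tm_ip_ext (m := m)) => x y; rewrite ip0r.
rewrite -(ketrE m x y) -adr; suff -> : ad (ketr m y) v = 0 by rewrite ip0r.
apply: (ip_eq_total h) => _ [t [z [St ->]]]; rewrite ip0r adr ketrE -(ampE m m).
by apply: hv; exists (amp m m t), (m z y); split=> //; exists t.
Qed.

End EqualOnSpans.

Notation legr m := (amp (tsw m) (tsw m)).

Definition ketset (R : realType) (L H N : hilbertType R) (A : set (op H H)) (m : tmap L H N) : set (op H N) :=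
  [set T | exists z a, A a /\ T = ketl m z ** a].

Definition regset (R : realType) (L H N : hilbertType R) (A : set (op H H)) (m : tmap L H N) (U : op N N) :
  set (op H N) := [set T | exists a z, A a /\ T = legr m a ** U ** ketl m z].

(** * Comparison of pit and pi through mixed matrix elements *)

Section Lambda.
Variable R : realType.
Variables (H H2 : hilbertType R) (m2 : tmap H H H2) (W : op H2 H2) (A : set (op H H)).
Hypothesis A_ad : forall a, A a -> A (ad a).
Hypothesis A_mul : forall a b, A a -> A b -> A (a ** b).
Hypothesis A_AA : A `<=` ocl [set r | exists s t, [/\ A s, A t & r = s ** t]].
Variables (L N2 N1 : hilbertType R) (n2 : tmap L H N2) (nas nbs : tmap N2 H N1) (UU : op N1 N1).
Hypothesis Lne : forall u : H, u != 0 -> exists p : L, ip p p != 0.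
Local Notation Ta := (legr nbs).
Local Notation Ab := (legr nas).
Local Notation kets := (ketset A nas).
Hypothesis UUU : unitary UU.
Hypothesis kets_UU : stable UU kets.
Hypothesis kets_adUU : stable (ad UU) kets.
Hypothesis regU_kets : regset A nas UU `<=` ocl kets.
Hypothesis kets_regU : kets `<=` ocl (regset A nas UU).
Hypothesis Ta_Ab : forall t b, Ta t ** Ab b = Ab b ** Ta t.
Hypothesis UU_conj_mx : forall t p u' u q v' v, (forall a, A a -> A (t ** a)) ->
  ip (UU (nas (n2 p u') u)) (Ta t (UU (nas (n2 q v') v))) =
  ip p q * ip (m2 u u') (W (amp m2 m2 t (ad W (m2 v v')))).
Hypothesis Ta_mx : forall t p u' u q v' v,
  ip (nas (n2 p u') u) (Ta t (nas (n2 q v') v)) = ip p q * ip u v * ip u' (t v').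
Variables (K KH P : hilbertType R) (kh : tmap K H KH) (pK : tmap K N1 P).

(** K is grouped with leg a of N1, so that an operator on K (x) H acts on K and leg a, while legs s
    and b are spectators. *)
Definition kP : tmap KH N2 P := tsw (tas nbs (tsw kh) (tsw pK)).
Lemma kPE x a z : kP (kh x a) z = pK x (nbs z a). Proof. exact: (tasE nbs (tsw kh)). Qed.

Local Notation ampK := (amp (tsw kh) (tsw pK)).
Lemma ampKE (Y : op H N1) x u : ampK Y (kh x u) = pK x (Y u).
Proof. exact: (ampE (tsw kh)). Qed.

Lemma sl_kP x x' (T : op KH KH) : sl pK x x' (amp kP kP T) = Ta (sl kh x x' T).
Proof.
apply: (amp_uniq (m := tsw nbs)) => a s; apply: (tm_ip_ext (m := nbs)) => s' a'.
by rewrite slE /= -!kPE ampE !tmip slE mulrC.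
Qed.

(* The operator with matrix elements (X u | T[x, x'] (x) 1 | Y v), where T[x, x']
   is the slice of T by x and x'. *)
Definition Lam (T : op KH KH) (X Y : op H N1) : op KH KH := ad (ampK X) ** amp kP kP T ** ampK Y.

Lemma LamE T X Y x u x' v :
  ip (kh x u) (Lam T X Y (kh x' v)) = ip (X u) (Ta (sl kh x x' T) (Y v)).
Proof. by rewrite /Lam !ocE adr !ampKE -slE sl_kP. Qed.

Lemma Lam_l (S : set (op H N1)) (S' : set (op KH KH)) T Y :
  (forall X, S X -> ocl S' (Lam T X Y)) -> forall X, ocl S X -> ocl S' (Lam T X Y).
Proof.
move=> h X hX; rewrite /Lam -ocA.
apply: (ocl_compr (S := [set ad V | V in [set ampK X | X in S]])) => [_ [_ [Z hZ <-] <-]|].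
  by rewrite ocA; exact: h.
apply: (ocl_ad (S := [set ampK X | X in S])) => [V hV|]; first by apply: ocl_sub; exists V.
by apply: (ocl_amp _ hX) => V hV; apply: ocl_sub; exists V.
Qed.

Lemma Lam_r (S : set (op H N1)) (S' : set (op KH KH)) T X :
  (forall Y, S Y -> ocl S' (Lam T X Y)) -> forall Y, ocl S Y -> ocl S' (Lam T X Y).
Proof.
move=> h Y hY; rewrite /Lam.
apply: (ocl_compl (S := [set ampK Y | Y in S])) => [_ [Z hZ <-]|]; first exact: h.
by apply: (ocl_amp _ hY) => V hV; apply: ocl_sub; exists V.
Qed.

Local Notation La := (legr kh).

Lemma Lam_ar T X Y a : Lam T X Y ** La a = Lam T X (Y ** a).
Proof. by rewrite /Lam -ocA ampM. Qed.
Lemma Lam_al T X Y a : La a ** Lam T X Y = Lam T (X ** ad a) Y.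
Proof. by rewrite /Lam !ocA -(ampM (tsw kh) (tsw kh)) [in RHS]adM [ad (legr kh _)]ad_amp adK. Qed.

Lemma Lam_mx T (S : op KH KH) (X Y : op H N1) :
  (forall x u x' v, ip (X u) (Ta (sl kh x x' T) (Y v)) = ip (kh x u) (S (kh x' v))) -> Lam T X Y = S.
Proof.
move=> h; apply: (op_eq_mx (tmT kh) (tmT kh)) => _ _ [[x u] _ <-] [[x' v] _ <-].
by rewrite LamE h.
Qed.

(** Slices of T act on leg a and b acts on another leg; they commute, so b crosses from the right
    ket to the left one. *)
Lemma Lam_Ab T X Y b : Lam T X (Ab b ** Y) = Lam T (Ab (ad b) ** X) Y.
Proof.
apply: Lam_mx => x u x' v; rewrite LamE !ocE -ad_amp adl; congr (ip _ _).
exact: (f_equal (fun S : op N1 N1 => S (Y v)) (Ta_Ab _ b)).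
Qed.

Variables (D : Type) (pit : D -> op KH KH) (al : H -> H -> D -> D) (pi : D -> op K K).
Hypothesis pi_al : forall u v d, pi (al u v d) = sr kh u v (pit d).
Hypothesis pit_mult : forall d x x' a, A a -> A (sl kh x x' (pit d) ** a).
Hypothesis pit_al : forall d x u x' v u' v', ip (kh x u) (pit (al u' v' d) (kh x' v)) =
  ip (m2 u u') (W (amp m2 m2 (sl kh x x' (pit d)) (ad W (m2 v v')))).

(** With UU on both sides the slice t of pit d turns into W (t (x) 1) W^*, whose matrix elements are
    those of pit at an element of the image of alpha. The spectator leg s contributes (p | q). In
    [Lam_ket], without UU, t is merely evaluated on leg a and leaves pi tensored with 1. *)
Lemma Lam_UU d p u q v :
  Lam (pit d) (UU ** ketl nas (n2 p u)) (UU ** ketl nas (n2 q v)) = ip p q *: pit (al u v d).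
Proof.
apply: Lam_mx => x u0 x' v0; rewrite opZE ipZr pit_al.
by rewrite [LHS]UU_conj_mx// => a; exact: pit_mult.
Qed.

Lemma Lam_ket d p u q v :
  Lam (pit d) (ketl nas (n2 p u)) (ketl nas (n2 q v)) = ip p q *: amp kh kh (pi (al u v d)).
Proof.
apply: Lam_mx => x u0 x' v0; rewrite opZE ipZr ampE tmip pi_al srE.
by rewrite [LHS]Ta_mx slE; ring.
Qed.

Definition pitA := [set T | exists u v d a, A a /\ T = pit (al u v d) ** La a].
Definition piA := [set T | exists u v d a, A a /\ T = amp kh kh (pi (al u v d)) ** La a].
(** The intermediate span, with UU in front of the left ket only; [pitA] and [piA] are both compared
    with it. *)
Definition lamA := [set T | exists d z w a, A a /\
  T = Lam (pit d) (UU ** ketl nas z) (ketl nas w ** a)].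

Lemma pitA_lamA : pitA `<=` ocl lamA.
Proof.
move=> _ [u [v [d [a [hA ->]]]]].
have [u0|u0] := eqVneq u 0.
  rewrite (_ : pit _ = 0) ?oc0l; first exact: ocl0.
  apply: (op_eq_mx (tmT kh) (tmT kh)) => _ _ [[x y] _ <-] [[x' y'] _ <-].
  by rewrite op0E ip0r pit_al u0 -ketlE opL0 ip0l.
have [p pp] := Lne u0.
suff : ocl lamA (ip p p *: pit (al u v d) ** La a).
  rewrite ocZl => /(oclZ (ip p p)^-1); rewrite scalerA mulVf ?scale1r//.
rewrite -Lam_UU Lam_ar -ocA.
apply: (Lam_r (S := kets)); last by apply: kets_UU; exists (n2 p v), a.
by move=> _ [w [b [hB ->]]]; apply: ocl_sub; exists d, (n2 p u), w, b.
Qed.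

Lemma ket_simple (V : op N1 N1) z : ocl [set T | exists p u, T = V ** ketl nas (n2 p u)] (V ** ketl nas z).
Proof.
rewrite -[_ ** _]oc1; move: z; apply: (ocl_ketl (tmT n2)) => _ [[p u] _ <-].
by rewrite oc1; apply: ocl_sub; exists p, u.
Qed.

Lemma lamA_pitA : lamA `<=` ocl pitA.
Proof.
move=> _ [d [z [w [a [hA ->]]]]]; move: (ket_simple UU z); apply: Lam_l => _ [p [u ->]].
(* The right ket is written as UU applied to its image under the adjoint of UU, which again lies in
   the closed span of the kets; then both sides carry UU. *)
have hY : ocl kets (ad UU ** (ketl nas w ** a)) by apply: kets_adUU; exists w, a.
rewrite -[ketl nas w ** a](unitaryKl' _ UUU); move: (ad UU ** _) hY => Y hY.
have : ocl [set UU ** T | T in kets] (UU ** Y).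
  by apply: (ocl_compl _ hY) => T hT; apply: ocl_sub; exists T.
apply: Lam_r => _ [_ [{}w [b [hB ->]]] <-]; rewrite ocA -Lam_ar.
apply: (ocl_compr (S := [set Lam (pit d) (UU ** ketl nas (n2 p u)) X | X in
  [set T | exists q v, T = UU ** ketl nas (n2 q v)]])).
  move=> _ [_ [q [v ->]] <-]; rewrite Lam_UU ocZl; apply: oclZ.
  by apply: ocl_sub; exists u, v, d, b.
move: (ket_simple UU w); apply: Lam_r => X hX.
by apply: ocl_sub; exists X.
Qed.

(** Factor the element of A on the right as b a. Then b crosses to the left as b^* in front of UU
    |z>, and regularity puts b^* UU |z> into the closed span of the |z'> t with t in A. Now UU is
    gone, and t^* leaves on the left and commutes with the operators pi tensored with 1. *)
Lemma lamA_piA : lamA `<=` ocl piA.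
Proof.
move=> _ [d [z [w [a [hA ->]]]]].
have : ocl [set ketl nas w ** t | t in [set r | exists s t, [/\ A s, A t & r = s ** t]]] (ketl nas w ** a).
  by apply: (ocl_compl _ (A_AA hA)) => t ht; apply: ocl_sub; exists t.
apply: Lam_r => _ [_ [b [{}a [hB {}hA ->]]] <-].
have -> : ketl nas w ** (b ** a) = Ab b ** (ketl nas w ** a).
  rewrite !ocA; congr (_ ** _); apply: op_ext => x.
  by rewrite !ocE /=; apply/esym; exact: (ampE (tsw nas)).
rewrite Lam_Ab ocA.
have : ocl kets (Ab (ad b) ** UU ** ketl nas z).
  by apply: regU_kets; exists (ad b), z; split=> //; exact: A_ad.
apply: Lam_l => _ [{}z [t [At ->]]].
rewrite -Lam_ar -[t]adK -Lam_al.
suff h : ocl [set La (ad t) ** amp kh kh (pi (al u v d)) | u in setT & v in setT]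
   (La (ad t) ** Lam (pit d) (ketl nas z) (ketl nas w)).
  apply: (ocl_compr _ h) => _ [u _ [v _ <-]].
  have -> : La (ad t) ** amp kh kh (pi (al u v d)) ** La a = amp kh kh (pi (al u v d)) ** La (ad t ** a).
    by rewrite -(ampM (tsw kh) (tsw kh)) ocA; congr (_ ** _); exact/esym/amp_comm.
  by apply: ocl_sub; exists u, v, d, (ad t ** a); split=> //; apply: A_mul => //; exact: A_ad.
have E y : ketl nas y = oid N1 ** ketl nas y by rewrite o1c.
have h1 := ket_simple (oid N1) z; have h2 := ket_simple (oid N1) w; rewrite -!E in h1 h2.
apply: (ocl_compl (S := [set Lam (pit d) (ketl nas (n2 x.1.1 x.1.2)) (ketl nas (n2 x.2.1 x.2.2)) | x in setT])).
  move=> _ [[[p u] [q v]] _ <-]; rewrite Lam_ket ocZr; apply: oclZ.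
  by apply: ocl_sub; exists u => //; exists v.
move: h1; apply: Lam_l => _ [p [u ->]]; move: h2; apply: Lam_r => _ [q [v ->]].
by rewrite -!E; apply: ocl_sub; exists ((p, u), (q, v)).
Qed.

(** The same path backwards: a factor b of the element of A is brought to the left ket, |p (x) u>
    b^* is approximated by sums of t UU |z>, and t returns to the right. *)
Lemma piA_lamA : piA `<=` ocl lamA.
Proof.
move=> _ [u [v [d [a [hA ->]]]]].
have [u0|u0] := eqVneq u 0.
  rewrite (_ : pi _ = 0).
    rewrite (_ : amp kh kh 0 = 0) ?oc0l; first exact: ocl0.
    by apply/esym/amp_uniq => x y; rewrite !op0E -ketrE opL0.
  rewrite pi_al u0; apply: op_ext_ip => x y.
  by rewrite srE op0E ip0r -ketlE opL0 ip0l.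
have [p pp] := Lne u0.
suff : ocl lamA (ip p p *: amp kh kh (pi (al u v d)) ** La a).
  rewrite ocZl => /(oclZ (ip p p)^-1); rewrite scalerA mulVf ?scale1r//.
have : ocl [set amp kh kh (pi (al u v d)) ** La t | t in [set r | exists s t, [/\ A s, A t & r = s ** t]]]
    (amp kh kh (pi (al u v d)) ** La a).
  apply: (ocl_compl (S := [set La t | t in [set r | exists s t, [/\ A s, A t & r = s ** t]]])).
    by move=> _ [t ht <-]; apply: ocl_sub; exists t.
  by apply: (ocl_amp _ (A_AA hA)) => t ht; apply: ocl_sub; exists t.
rewrite ocZl => h; apply: oclZ; move: h; apply: ocl_le => _ [_ [b [{}a [hB {}hA ->]]] <-].
have -> : amp kh kh (pi (al u v d)) ** La (b ** a) =
    La b ** amp kh kh (pi (al u v d)) ** La a.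
  rewrite -(ampM (tsw kh) (tsw kh)) ocA; congr (_ ** _); exact: amp_comm.
suff : ocl lamA (La b ** (ip p p *: amp kh kh (pi (al u v d))) ** La a).
  rewrite ocZr ocZl => /(oclZ (ip p p)^-1); rewrite scalerA mulVf ?scale1r//.
rewrite -Lam_ket Lam_al Lam_ar.
have : ocl (regset A nas UU) (ketl nas (n2 p u) ** ad b).
  by apply: kets_regU; exists (n2 p u), (ad b); split=> //; exact: A_ad.
apply: Lam_l => _ [t [z [At ->]]]; rewrite -ocA -[t]adK -Lam_Ab ocA.
have -> : Ab (ad t) ** ketl nas (n2 p v) = ketl nas (n2 p v) ** ad t.
  by apply: op_ext => x; rewrite !ocE /=; exact: (ampE (tsw nas)).
rewrite -ocA; apply: ocl_sub; exists d, z, (n2 p v), (ad t ** a); split=> //.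
by apply: A_mul => //; exact: A_ad.
Qed.

Lemma ocl_pitA : ocl pitA = ocl piA.
Proof.
by apply: ocl_eq => T; [move=> /pitA_lamA|move=> /piA_lamA]; apply: ocl_le;
  [exact: lamA_piA|exact: lamA_pitA].
Qed.

End Lambda.

(** * Regular multiplicative unitaries *)

Section TriSlices.
Variable R : realType.
Variables (A B D AB AD BD N : hilbertType R).
Variables (mAB : tmap A B AB) (mAD : tmap A D AD) (mBD : tmap B D BD)
  (n12 : tmap AB D N) (n13 : tmap AD B N) (n23 : tmap BD A N).
Hypothesis T : tri mAB mAD mBD n12 n13 n23.

Lemma tri_bra y x : ad (ketr n13 y) ** ketr n23 x = ketl mAD x ** ad (ketl mBD y).
Proof.
apply: (tm_op_ext (m := mBD)) => b d.
by rewrite !ocE bral ketrE T.1 -T.2 brar ketlE -[LHS](opLZ (ketl mAD x)).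
Qed.

Lemma tri_ket x b : ketl n12 (mAB x b) = ketr n23 x ** ketl mBD b.
Proof. by apply: op_ext => d; rewrite ocE ketlE ketrE ketlE T.1. Qed.

Lemma tri_slice_amp y x (S : op AB AB) :
  ad (ketr n13 y) ** amp n12 n12 S ** ketr n23 x =
  amp mBD mAD (ad (ketr mAB y) ** S ** ketl mAB x).
Proof.
apply: amp_uniq => b d; rewrite !ocE ketrE T.1 ampE !ketlE.
suff E : ad (ketr n13 y) ** ketr n12 d = ketr mAD d ** ad (ketr mAB y).
  have := f_equal (fun F : op AB AD => F (S (mAB x b))) E.
  by rewrite !ocE !ketrE.
apply: (tm_op_ext (m := mAB)) => x' b'.
by rewrite !ocE brar !ketrE -T.2 brar -[LHS](opLZ (ketr mAD d)).
Qed.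

Lemma sr23_12 x x' (S : op AB AB) :
  sr n23 x x' (amp n12 n12 S) = amp mBD mBD (sl mAB x x' S).
Proof.
apply: amp_uniq => b d; apply: (tm_ip_ext (m := mBD)) => b' d'.
by rewrite srE !T.1 ampE !tmip slE.
Qed.

Lemma sr23_13 x x' (S : op AD AD) :
  sr n23 x x' (amp n13 n13 S) = amp (tsw mBD) (tsw mBD) (sl mAD x x' S).
Proof.
apply: amp_uniq => d b; apply: (tm_ip_ext (m := mBD)) => b' d'.
by rewrite srE !T.1 -!T.2 ampE !tmip slE mulrC.
Qed.

End TriSlices.

Section SliceAmp.
Variable R : realType.
Variables (H K N : hilbertType R) (m : tmap H K N).

Lemma sr_amp y y' (S S' : op H H) (U : op N N) :
  sr m y y' (amp m m S ** U ** amp m m S') = S ** sr m y y' U ** S'.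
Proof.
by rewrite /sr -!ocA amp_ketr !ocA bra_amp.
Qed.

Lemma sr_ampl y y' (S : op H H) (U : op N N) :
  sr m y y' (amp m m S ** U) = S ** sr m y y' U.
Proof. by rewrite /sr !ocA bra_amp. Qed.

Lemma sr_ext (U V : op N N) : (forall y y', sr m y y' U = sr m y y' V) -> U = V.
Proof.
move=> h; apply: (op_eq_mx (tmT m) (tmT m)) => _ _ [[x y] _ <-] [[x' y'] _ <-] /=.
by rewrite -!srE h.
Qed.

Lemma sr_ampr y y' (S : op H H) (U : op N N) :
  sr m y y' (U ** amp m m S) = sr m y y' U ** S.
Proof. by rewrite /sr -!ocA amp_ketr !ocA. Qed.

Lemma sl_ampl x x' (S : op H H) (U : op N N) :
  sl m x x' (amp m m S ** U) = sl m (ad S x) x' U.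
Proof. by rewrite /sl !ocA bral_amp. Qed.

Lemma sl_ampr x x' (S : op H H) (U : op N N) :
  sl m x x' (U ** amp m m S) = sl m x (S x') U.
Proof. by rewrite /sl -!ocA amp_ketl. Qed.

End SliceAmp.

(** * Transposed pentagon equations, the implementing unitary and regularity *)

Section Core.
Variable R : realType.
Local Notation C := R[i].
Variables (H H2 : hilbertType R) (m2 : tmap H H H2) (W : op H2 H2).
Hypothesis UW : unitary W.
Variables (N0 : hilbertType R) (n0 : tmap H2 H N0) (n013 : tmap H2 H N0) (n023 : tmap H2 H N0).
Hypothesis T0 : tri m2 m2 m2 n0 n013 n023.
Hypothesis P0 : amp n023 n023 W ** amp n0 n0 W = amp n0 n0 W ** amp n013 n013 W ** amp n023 n023 W.
Variables (Hb : hconj H) (dom : set H) (Q : H -> H).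
Local Notation c := (@hc_map R H Hb).
Hypothesis Qsa : selfadjoint dom Q.
Hypothesis Qinj : forall x, dom x -> Q x = 0 -> x = 0.
Variables (N2 : hilbertType R) (n2 : tmap Hb H N2) (Wt : op N2 N2).
Hypothesis UWt : unitary Wt.
Hypothesis WtQ : forall x z u v, dom u -> dom v ->
  ip (m2 x u) (W (m2 z (Q v))) = ip (n2 (c z) (Q u)) (Wt (n2 (c x) v)).
Hypothesis WQ : forall x u z y, dom x -> dom u -> dom z -> dom y ->
  ip (m2 (Q x) (Q u)) (W (m2 z y)) = ip (m2 x u) (W (m2 (Q z) (Q y))).
Variables (N1 : hilbertType R) (nas : tmap N2 H N1) (nab : tmap H2 Hb N1) (nbs : tmap N2 H N1).
Hypothesis T1 : tri (tsw n2) m2 n2 nas nab nbs.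

(* WtQ transposes the second leg of W up to Q; WQ moves Q to the first leg. *)
Lemma Wt_Q x z u y : dom x -> dom z ->
  ip (m2 (Q x) u) (W (m2 z y)) = ip (n2 (c (Q z)) u) (Wt (n2 (c x) y)).
Proof.
move=> dx dz.
suff E : sl m2 (Q x) z W = sl n2 (c (Q z)) (c x) Wt by rewrite -!slE E.
apply: (op_eq_mx (ran_total Qsa Qinj) (dom_total Qsa)) => _ y' [u' du <-] dy.
by rewrite !slE WQ// WtQ.
Qed.

Lemma qtrW z z' : qtr dom Q (sr m2 z z' W) (sr n2 z z' Wt).
Proof. by move=> p e dp de; rewrite !srE Wt_Q. Qed.

(** The flip of the two legs followed by conjugation of both. It exists because the Gram matrix of
    the vectors c y (x) x is the complex conjugate of that of the c x (x) y. *)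
Lemma J_exists : exists J : N2 -> N2, [/\ (forall x y, J (n2 (c x) y) = n2 (c y) x),
  (forall a u v, J (a *: u + v) = cj a *: J u + J v),
  (forall u, nr (J u) <= nr u) & (forall u, J (J u) = u)].
Proof.
pose v (p : H * H) := n2 (c p.1) p.2; pose w (p : H * H) := n2 (c p.2) p.1.
have tv : total (range v).
  rewrite /total (_ : range v = simple n2); first exact: tmT.
  apply/seteqP; split=> _ [[x y] _ <-]; first by exists (c x, y).
  by have [x' <-] := hc_surj x; exists (x', y).
have [||||J [J1 J2 J3]] := @ext_fam R N2 N2 (H * H)%type (@conjc R : {rmorphism C -> C}) v w 1.
- exact: nr_conj.
- exact: ler01.
- exact: tv.
- move=> n a i; rewrite mul1r le_eqVlt; apply/orP; left.
  rewrite -(eqrXn2 (n := 2)) ?nr_ge0//; apply/eqP/complexI.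
  rewrite -!ip_nr [RHS]ipC !ip_suml rmorph_sum; apply: eq_bigr => k _.
  rewrite !ip_sumr rmorph_sum; apply: eq_bigr => l _.
  rewrite !ipZl !ipZr /v /w !tmip !hc_ip !rmorphM /= -!ipC.
  by rewrite [ip (i l).2 _ * _]mulrC.
have J3' u : nr (J u) <= nr u by rewrite -[nr u]mul1r.
have J2' a x y : J (a *: x + y) = cj a *: J x + J y := J2 a x y.
exists J; split=> // [x y|u]; first exact: (J1 (x, y)).
have bl : blin (fun u => J (J u)).
  split; first by move=> a x y; rewrite !J2' cjK.
  by exists 1 => x; rewrite mul1r; apply: le_trans (J3' _) (J3' _).
suff E : Op bl = oid N2 by have := f_equal (fun S : op N2 N2 => S u) E.
apply: (op_eq_total tv) => _ [p _ <-] /=.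
by rewrite (J1 p) (J1 (p.2, p.1)).
Qed.

Definition J := sval (cid J_exists).
Lemma JE x y : J (n2 (c x) y) = n2 (c y) x. Proof. by rewrite /J; case: cid => j /= []. Qed.
Lemma JP a u v : J (a *: u + v) = cj a *: J u + J v. Proof. by rewrite /J; case: cid => j /= []. Qed.
Lemma J_le u : nr (J u) <= nr u. Proof. by rewrite /J; case: cid => j /= []. Qed.
Lemma JK u : J (J u) = u. Proof. by rewrite /J; case: cid => j /= []. Qed.

(** Polarization: norms give the real parts, and i v in place of v gives the imaginary ones. *)
Lemma ipJ u v : ip (J u) (J v) = ip v u.
Proof.
have nJ w : nr (J w) = nr w.
  by apply/eqP; rewrite eq_le J_le -{1}[w]JK J_le.
have Re_pol a b : complex.Re (ip (J a) (J b)) = complex.Re (ip a b).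
  have := nrDsq (J a) (J b); have := nrDsq a b.
  have -> : J a + J b = J (a + b) by have := JP 1 a b; rewrite !scale1r rmorph1 scale1r.
  by rewrite !nJ => ->; lra.
have JZ a w : J (a *: w) = cj a *: J w.
  have J0 : J 0 = 0 by apply: nr0_eq0; rewrite nJ nr0.
  by have := JP a w 0; rewrite J0 !addr0.
have h1 := Re_pol u v; have h2 := Re_pol u ('i%C *: v).
move: h2; rewrite JZ !ipZr (ipC u v); move: h1.
case: (ip (J u) (J v)) (ip u v) => a b [a' b'] /= -> h; congr (Complex _ _).
by lra.
Qed.

Lemma J_op_blin (T : op N2 N2) : blin (fun u => J (T (J u))).
Proof.
split; first by move=> a u v; rewrite JP opLP JP cjK.
exists (opb T) => u; apply: le_trans (J_le _) _; apply: le_trans (opbP _ _) _.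
by rewrite ler_wpM2l ?opb_ge0// J_le.
Qed.
Definition Jop (T : op N2 N2) : op N2 N2 := Op (J_op_blin T).

(** Up to Q, this is W^* with its second leg transposed; see [qtrX]. *)
Definition X := Jop Wt.

Lemma XE x y z w :
  ip (n2 (c y) x) (X (n2 (c w) z)) = cj (ip (n2 (c x) y) (Wt (n2 (c z) w))).
Proof. by rewrite /X /= JE -[n2 (c y) x]JE ipJ ipC. Qed.

Lemma UX : unitary X.
Proof.
have h1 u : ad Wt (Wt u) = u by exact: ocK UWt.1 u.
have h2 u : Wt (ad Wt u) = u by exact: ocK UWt.2 u.
have E : ad X = Jop (ad Wt).
  by apply/esym/ad_uniq => u v; rewrite /X /= -[u in LHS]JK ipJ adl -[v in RHS]JK ipJ.
by split; rewrite E; apply: op_ext => u; rewrite /X; [change (J (ad Wt (J (J (Wt (J u))))) = u)|change (J (Wt (J (J (ad Wt (J u))))) = u)]; rewrite JK ?h1 ?h2 JK.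
Qed.

Lemma qtrX z x : qtr dom Q (sl m2 z x (ad W)) (sl (tsw n2) z x X).
Proof.
by move=> p e dp de; rewrite !slE /= XE -WtQ// adr ipC.
Qed.

Local Notation Wab := (amp nab nab W).
Local Notation Wtas := (amp nas nas Wt).
Local Notation Wtbs := (amp nbs nbs Wt).
Local Notation Xas := (amp nas nas X).
Local Notation Xbs := (amp nbs nbs X).

(* On H (x) H (x) Hb, with legs a, b and s, these are the pentagon equation with
   one of its legs transposed: the transposition reverses the order of the
   factors acting on that leg. *)
Lemma pentagon_Wt : Wab ** Wtas = Wtbs ** Wtas ** Wab.
Proof.
have hS x x' : qtr dom Q (sl (tsw m2) x x' W) (sl (tsw n2) x x' Wt).
  by rewrite !sl_sw; exact: qtrW.
have h1 := qtr3_spectl W (qtr3_S Qsa (tri_sw12 T0) T1 hS).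
have h2 := qtr3_spectr W (qtr3_SU Qsa (tri_sw12 T0) T1 hS qtrW).
rewrite -P0 in h2. exact (qtr3_uniq Qsa Qinj h1 h2).
Qed.

(** The pentagon equation as W_13 W_23 W_12^* = W_12^* W_23, transposed in its second leg;
    [pentagon_Wt] transposes the first leg and [pentagon_X] the third. What remains of the other two
    legs is named a and b. *)
Lemma pentagon_X_Wt : Wab ** Xas ** Wtbs = Wtbs ** Xas.
Proof.
have h1 := qtr3_spectl W (qtr3_US Qsa T0 T1 qtrX qtrW).
have h2 := qtr3_SU Qsa T0 T1 qtrX qtrW.
have E : amp n013 n013 W ** (amp n023 n023 W ** amp n0 n0 (ad W)) =
    amp n0 n0 (ad W) ** amp n023 n023 W.
  have U12 := unitary_amp n0 UW; rewrite -(ad_amp n0 n0).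
  rewrite -[LHS](unitaryKl _ U12); congr (_ ** _).
  by rewrite !ocA -P0 (unitaryKr _ U12).
rewrite E in h1; rewrite -ocA; exact (qtr3_uniq Qsa Qinj h1 h2).
Qed.

Lemma pentagon_X : ad Wab ** Xbs ** Wab = Xas ** Xbs.
Proof.
have hU z z' : qtr dom Q (sr (tsw m2) z z' (ad W)) (sr n2 z z' X).
  by have := qtrX z z'; rewrite sl_sw sr_sw.
have h1 := qtr3_spectr W (qtr3_spectl (ad W) (qtr3_U Qsa (tri_sw23 T0) T1 hU)).
have h2 := qtr3_US Qsa (tri_sw23 T0) T1 qtrX hU.
have E : amp n0 n0 (ad W) ** amp n023 n023 (ad W) ** amp n0 n0 W =
    amp n023 n023 (ad W) ** amp n013 n013 (ad W).
  have := f_equal (@ad R _ _) P0; rewrite !adM -!ad_amp => ->.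
  by rewrite -!ocA (unitary_amp n0 UW).1 oc1.
rewrite E in h1; rewrite ad_amp; exact (qtr3_uniq Qsa Qinj h1 h2).
Qed.

(** By [Z_slice] this intertwines slices of W on H with slices of X on Hb, and so lets a slice of W
    travel from a leg H to the leg Hb. *)
Definition Z := ad Wt ** X.
Lemma UZ : unitary Z. Proof. exact: unitaryM (unitary_ad UWt) UX. Qed.

Local Notation Zbs := (amp nbs nbs Z).
Local Notation Zas := (amp nas nas Z).

Lemma Z_conj : Zbs ** Wab = Xas ** Zbs.
Proof.
have UWab := unitary_amp nab UW; have UWtbs := unitary_amp nbs UWt.
have h4 : Xbs ** Wab = Wab ** Xas ** Xbs.
  by rewrite -ocA -pentagon_X -ocA (unitaryKl' _ UWab).
have h3 : Wab ** Xas = Wtbs ** Xas ** ad Wtbs by rewrite -pentagon_X_Wt (unitaryKr _ UWtbs).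
rewrite /Z -(ampM nbs nbs nbs) -ad_amp -ocA h4 h3 -!ocA.
by rewrite (unitaryKl _ UWtbs).
Qed.

Lemma Z_slice x x' : Z ** amp (tsw n2) (tsw n2) (sl m2 x x' W) =
  amp n2 n2 (sl (tsw n2) x x' X) ** Z.
Proof.
have := f_equal (sr nbs x x') Z_conj.
by rewrite sr_ampl sr_ampr (sr23_13 T1) (sr23_12 T1).
Qed.

(** Slices of Wt_bs X_as Wt_bs^* = W_ab X_as. The vector on the right is the one of [W_conj_slice]:
    conjugation by Wt changes slices of X exactly as conjugation by W changes slices of W. *)
Lemma Wt_conj_slice x x' z z' :
  sr n2 z z' (Wt ** amp n2 n2 (sl (tsw n2) x x' X) ** ad Wt) =
  sl (tsw n2) (ad (sr m2 z z' W) x) x' X.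
Proof.
have UWtbs := unitary_amp nbs UWt.
have h3 : Wtbs ** Xas ** ad Wtbs = Wab ** Xas by rewrite -pentagon_X_Wt (unitaryKr _ UWtbs).
have := f_equal (sr nbs x x') h3.
rewrite ad_amp sr_amp (sr23_12 T1) => ->.
have T2 := tri_sw12 (tri_sw23 T1).
apply: op_ext_ip => q q'; rewrite srE srE.
have E y a r : nbs (n2 r y) a = nab (tsw m2 y a) r by rewrite T1.1 -T1.2.
rewrite !E ocE (leg_mx T2) sl_sw -adl srE slE; done.
Qed.

Lemma W_conj_slice x x' z z' :
  sl m2 z z' (W ** amp m2 m2 (sl m2 x x' W) ** ad W) = sl m2 (ad (sr m2 z z' W) x) x' W.
Proof.
have U23 := unitary_amp n023 UW.
have h : amp n023 n023 W ** amp n0 n0 W ** ad (amp n023 n023 W) = amp n0 n0 W ** amp n013 n013 W.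
  by rewrite P0 (unitaryKr _ U23).
have := f_equal (sr n023 x x') h.
rewrite ad_amp sr_amp (sr23_12 T0) => ->.
have T2 := tri_sw12 T0.
apply: op_ext_ip => q q'; rewrite slE srE.
have E y a r : n023 (m2 y r) a = n0 (tsw m2 y a) r by rewrite T0.1.
rewrite !E ocE (leg_mx T2) sl_sw -adl srE slE; done.
Qed.

Definition nba : tmap H2 Hb N1 := t23 n2 m2 nbs.
Lemma Tba : tri (tsw n2) m2 n2 nbs nba nas.
Proof.
split=> b p a; last exact: t23E.
by rewrite /= T1.1.
Qed.

Local Notation Ta := (legr nbs).
Lemma Ta_as t : Ta t = amp nas nas (amp (tsw n2) (tsw n2) t).
Proof.
apply: (tri_ext (mAB := tsw n2) (n12 := nas)) => x y z x' y' z'; congr (ip _ _).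
have h1 : amp (tsw n2) (tsw n2) t (n2 y' x') = n2 y' (t x') by exact: (ampE (tsw n2)).
by rewrite ampE h1 -(T1.1 x' y' z') [LHS](ampE (tsw nbs)) [LHS](T1.1 (t x') y' z').
Qed.

(* Conjugation by UU implements t |-> W (t (x) 1) W^*; see [UU_conj]. *)
Definition UU := ad Zas ** ad Wtbs ** Zas.
Lemma UUU : unitary UU.
Proof.
have h1 := unitary_amp nas UZ; have h2 := unitary_ad (unitary_amp nbs UWt).
exact: unitaryM (unitaryM (unitary_ad h1) h2) h1.
Qed.

Definition Psi (t : op H H) := amp nba nba (W ** amp m2 m2 t ** ad W).

Lemma UU_conj_slice x x' : ad UU ** Ta (sl m2 x x' W) ** UU = Psi (sl m2 x x' W).
Proof.
set t := sl m2 x x' W; set d := sl (tsw n2) x x' X.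
(* The slice t on leg a becomes the slice d of X on leg s. Leg a is then free, and d can be
   regrouped with leg b, where Wt acts. *)
have h1 : Zas ** Ta t ** ad Zas = amp nbs nbs (amp n2 n2 d).
  rewrite Ta_as ad_amp !ampM Z_slice (unitaryKr _ UZ).
  have E r y w : nas (n2 r y) w = nbs (n2 r w) y by rewrite T1.1.
  apply: (tri_ext (mAB := n2) (n12 := nas)) => p a b p' a' b'; congr (ip _ _).
  by rewrite ampE ampE E E !ampE.
have h2 : ad UU ** Ta t ** UU =
    ad Zas ** amp nbs nbs (Wt ** amp n2 n2 d ** ad Wt) ** Zas.
  rewrite /UU !adM !adK -!ocA; congr (_ ** _).
  rewrite -!(ampM nbs nbs nbs) -h1 -ad_amp -!ocA; congr (_ ** _).
rewrite h2; apply: (sr_ext (m := nas)) => z z'.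
rewrite ad_amp sr_amp (sr23_13 (tri_sw12 (tri_sw23 T1))) tswK sl_sw Wt_conj_slice.
rewrite /Psi (sr23_13 Tba) W_conj_slice -ocA -Z_slice.
by rewrite (unitaryKl _ UZ).
Qed.

Definition Aop : set (op H H) := ocl [set t | exists x x', t = sl m2 x x' W].

Lemma A_sl x x' : Aop (sl m2 x x' W).
Proof. by apply: ocl_sub; exists x, x'. Qed.

Lemma Wt_sl_Q x z : dom x -> dom z -> sl m2 (Q x) z W = sl n2 (c (Q z)) (c x) Wt.
Proof. by move=> dx dz; apply: op_ext_ip => u y; rewrite !slE Wt_Q. Qed.

Lemma Wt_sl p p' : Aop (sl n2 p p' Wt).
Proof.
move: p p'; apply: (ocl_sl (total_hc Hb (ran_total Qsa Qinj)) (total_hc Hb (dom_total Qsa))).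
move=> _ _ [_ [z dz <-] <-] [x dx <-].
by rewrite -Wt_sl_Q//; exact: A_sl.
Qed.

Lemma sl_nas_Wab p x p' x' : sl nas (n2 p x) (n2 p' x') Wab = ip p p' *: sl m2 x x' W.
Proof.
have E r y b : nas (n2 r y) b = nab (m2 y b) r by rewrite T1.2.
apply: op_ext_ip => b b'; rewrite slE !E ampE tmip opZE ipZr slE.
by rewrite mulrC.
Qed.

Lemma A_sl_nas u v : Aop (sl nas u v Wab).
Proof.
move: u v; apply: (ocl_sl (tmT n2) (tmT n2)) => _ _ [[p x] _ <-] [[p' x'] _ <-].
by rewrite sl_nas_Wab; apply: oclZ; exact: A_sl.
Qed.

Lemma Tsba : tri n2 n2 (tsw m2) nbs nas nab.
Proof. by split=> s b a /=; rewrite T1.1 -?T1.2. Qed.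

Lemma sl_AstA y x y' x' : sl nas (n2 y x) (n2 y' x') (ad Wtbs ** Wab) =
  ad (sl n2 y' y Wt) ** sl m2 x x' W.
Proof.
apply: op_ext_ip => b b'; rewrite slE !ad_sl ocE.
have E r u z : nas (n2 r u) z = nbs (n2 r z) u by rewrite T1.1.
by rewrite !E ad_amp (leg_mx Tsba) sr_sw.
Qed.

Lemma ad_Wtbs_Wab : ad Wtbs ** Wab = Wtas ** Wab ** ad Wtas.
Proof.
have U1 := unitary_amp nas UWt; have U2 := unitary_amp nbs UWt.
rewrite -[RHS](unitaryKl _ U2); congr (_ ** _).
by rewrite !ocA -pentagon_Wt (unitaryKr _ U1).
Qed.

Lemma sl_AstA' u v : sl nas u v (ad Wtbs ** Wab) = sl nas (ad Wt u) (ad Wt v) Wab.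
Proof. by rewrite ad_Wtbs_Wab ad_amp sl_ampr sl_ampl. Qed.

Lemma Wt_slC : ocl [set t | exists p p', t = sl n2 p p' Wt] = Aop.
Proof.
apply/seteqP; split.
  by apply: ocl_le => _ [p [p' ->]]; exact: Wt_sl.
apply: ocl_le => _ [x [x' ->]]; move: x x'.
apply: (ocl_sl (ran_total Qsa Qinj) (dom_total Qsa)) => _ x' [x dx <-] dx'.
by rewrite Wt_sl_Q//; apply: ocl_sub; exists (c (Q x')), (c x).
Qed.

(* In Wt_bs^* W_ab = Wt_as W_ab Wt_as^*, the slices of the left hand side are the
   products s^* t of slices of Wt and of W, both of which generate A, and those
   of the right hand side generate A; thus A^* A = A. *)
Lemma A_adM s t : Aop s -> Aop t -> Aop (ad s ** t).
Proof.
move=> As; have : ocl [set ad r | r in [set t | exists p p', t = sl n2 p p' Wt]] (ad s).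
  move: As; rewrite -Wt_slC; apply: ocl_ad => r hr.
  by apply: ocl_sub; exists r.
move: {s As} (ad s) => s hs ht; apply: (ocl_prod _ hs ht) => _ _ [_ [p [p' ->]] <-] [x [x' ->]].
by rewrite -sl_AstA sl_AstA'; exact: A_sl_nas.
Qed.

Lemma A_span : Aop `<=` ocl [set r | exists s t, [/\ Aop s, Aop t & r = ad s ** t]].
Proof.
apply: ocl_le => _ [x [x' ->]].
have h u v : ocl [set r | exists s t, [/\ Aop s, Aop t & r = ad s ** t]] (sl nas u v Wab).
  have -> : sl nas u v Wab = sl nas (Wt u) (Wt v) (ad Wtbs ** Wab).
    have K z : ad Wt (Wt z) = z by exact: ocK UWt.1 z.
    by rewrite sl_AstA' !K.
  move: (Wt u) (Wt v); apply: (ocl_sl (tmT n2) (tmT n2)) => _ _ [[p y] _ <-] [[p' y'] _ <-].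
  rewrite sl_AstA; apply: ocl_sub; exists (sl n2 p' p Wt), (sl m2 y y' W); split=> //.
    exact: Wt_sl.
  exact: A_sl.
have [->|x0] := eqVneq x 0.
  rewrite (_ : sl _ _ _ _ = 0); first exact: ocl0.
  by apply: op_ext_ip => a b; rewrite slE -ketrE opL0 ip0l ip0r.
have := oclZ (ip (c x) (c x))^-1 (h (n2 (c x) x) (n2 (c x) x')).
rewrite sl_nas_Wab scalerA mulVf ?scale1r// hc_ip ip_nr.
by rewrite fmorph_eq0 expf_eq0 nr_eq0.
Qed.

Lemma A_ad s : Aop s -> Aop (ad s).
Proof.
move=> /A_span; apply: ocl_ad => _ [r [t [Ar At ->]]].
by rewrite adM adK; exact: A_adM.
Qed.

Lemma A_mul s t : Aop s -> Aop t -> Aop (s ** t).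
Proof. by move=> /A_ad As At; rewrite -[s]adK; apply: A_adM. Qed.

Lemma A_AA : Aop `<=` ocl [set r | exists s t, [/\ Aop s, Aop t & r = s ** t]].
Proof.
move=> r /A_span; apply: ocl_le => _ [s [t [As At ->]]]; apply: ocl_sub.
by exists (ad s), t; split=> //; exact: A_ad.
Qed.

(** If v is orthogonal to A H, then y (x) v is orthogonal to the range of W for every y. As W is
    onto, y = v gives v = 0. *)
Lemma A_total : total [set v | exists t x, Aop t /\ v = t x].
Proof.
apply: total_orth => v hv.
have h y w : ip (m2 y v) (W w) = 0.
  have : ip (ad W (m2 y v)) w = ip 0 w.
    suff -> : ad W (m2 y v) = 0 by [].
    apply: (tm_ip_ext (m := m2)) => x' u; rewrite ip0r adr ipC -slE.
    have -> : ip v (sl m2 y x' W u) = 0.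
      by rewrite ipC hv ?rmorph0//; exists (sl m2 y x' W), u; split=> //; exact: A_sl.
    by rewrite rmorph0.
  by rewrite adl ip0l.
have := h v (ad W (m2 v v)); rewrite (ocK UW.2) tmip ip_nr -rmorphM => /complexI/eqP.
by rewrite mulf_eq0 !expf_eq0/= !nr_eq0 orbb => /eqP.
Qed.

Local Notation mkets := (ketset Aop m2).
Hypothesis Hreg : ocl (regset Aop m2 (ad W)) = ocl mkets.

Definition rks : set (op H H) := [set T | exists x y, T = rk x y].
(* By regularity the slices of W^* span the compact operators; the pentagon
   equation in the form W12^* W23 W12 = W13 W23 then shows that W preserves the
   closed span of the operators |x> (x) a. *)
Definition Bop p x := ad (ketr m2 p) ** ad W ** ketl m2 x.
Definition Bops : set (op H H) := [set T | exists p x, T = Bop p x].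

Lemma bra_reg q x a : ad (ketr m2 q) ** (amp (tsw m2) (tsw m2) a ** ad W ** ketl m2 x) = Bop (ad a q) x.
Proof. by rewrite /Bop !ocA -!ketl_sw bral_amp. Qed.

Lemma bra_mket q x (a : op H H) : ad (ketr m2 q) ** (ketl m2 x ** a) = rk x (ad a q).
Proof. by apply: op_ext => v; rewrite !ocE brar /= adl. Qed.

(** Pair the first leg of nothing but the ket, and the second with t q, where t is in A: such
    vectors are total by [A_total], and t supplies the element of A that [Hreg] needs. Its two sides
    become slices of W^* and rank one operators. *)
Lemma rk_Bop x y : ocl Bops (rk x y).
Proof.
move: y; apply: (@ocl_total _ _ _ _ _ (@conjc R : {rmorphism C -> C}) _ _ (nr x) A_total).
- by move=> a u v; apply: op_ext => z; rewrite opDE opZE/= ipDl ipZl scalerDl scalerA.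
- by move=> v z /=; rewrite nrZ [leLHS]mulrC -mulrA ler_wpM2l ?nr_ge0// CauchySchwarz.
move=> _ [t [q [At ->]]].
have : ocl mkets (ketl m2 x ** ad t) by apply: ocl_sub; exists x, (ad t); split=> //; exact: A_ad.
rewrite -Hreg => /(ocl_compl (U := ad (ketr m2 q)) (S' := Bops)); rewrite bra_mket adK; apply.
by move=> _ [a [y [Aa ->]]]; rewrite bra_reg; apply: ocl_sub; exists (ad a q), y.
Qed.

Lemma Bop_rk p x : ocl rks (Bop p x).
Proof.
move: p; apply: (@ocl_total _ _ _ _ _ (@conjc R : {rmorphism C -> C}) _ _ (opb (ad W) * nr x) A_total).
- by move=> a u v; rewrite /Bop ketrP adD adZ !ocDl !ocZl.
- move=> v z; rewrite /Bop !ocE; apply: le_trans (ad_bnd (M := nr v) (nr_ge0 _) _ _) _.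
    by move=> y; rewrite ketrE nr_tm mulrC.
  rewrite [_ * nr v]mulrC -mulrA ler_wpM2l ?nr_ge0// -mulrA -(nr_tm m2); exact: opbP.
move=> _ [t [q [At ->]]].
have h : ocl mkets (amp (tsw m2) (tsw m2) (ad t) ** ad W ** ketl m2 x).
  by rewrite -Hreg; apply: ocl_sub; exists (ad t), x; split=> //; exact: A_ad.
have := ocl_compl (U := ad (ketr m2 q)) (S' := rks) _ h.
rewrite bra_reg adK; apply => _ [y [a [Aa ->]]].
by rewrite bra_mket; apply: ocl_sub; exists y, (ad a q).
Qed.

Local Notation W23 := (amp n023 n023 W).
Local Notation W12 := (amp n0 n0 W).
Local Notation W13 := (amp n013 n013 W).
(** Evaluated at x (x) q this exhibits a slice of W^*, and at W (x (x) q), by the pentagon equation,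
    the operator W |x> a with a a slice of W. Both families of arguments are total, so the two kinds
    of values have the same closed span. *)
Definition Phi p z := ad (ketr n013 p) ** ad W12 ** W23 ** ketl n0 z.

Lemma Phi_simple p x q : Phi p (m2 x q) = amp m2 m2 (Bop p x) ** W ** ketl m2 q.
Proof.
rewrite /Phi (tri_ket T0) -(ocA _ W23) [W23 ** (_ ** _)]ocA amp_ketr !ocA ad_amp.
by rewrite (tri_slice_amp T0).
Qed.

Lemma Phi_W p x q : Phi p (W (m2 x q)) = W ** ketl m2 x ** sl m2 p q W.
Proof.
have U12 := unitary_amp n0 UW.
have E : ad W12 ** W23 ** W12 = W13 ** W23 by rewrite -ocA P0 -ocA (unitaryKl _ U12).
have -> : Phi p (W (m2 x q)) = ad (ketr n013 p) ** (ad W12 ** W23 ** W12) ** ketl n0 (m2 x q).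
  by rewrite /Phi -(amp_ketl n0 n0) !ocA.
rewrite E (tri_ket T0) -!ocA [W23 ** (_ ** _)]ocA amp_ketr -!ocA [ad _ ** _]ocA bra_amp -!ocA.
by rewrite [ad _ ** (ketr _ _ ** _)]ocA (tri_bra T0) /sl !ocA.
Qed.

Lemma Phi_tot (S : set (op H H2)) (B : set H2) p : total B -> (forall z, B z -> ocl S (Phi p z)) ->
  forall z, ocl S (Phi p z).
Proof.
move=> tB h z; rewrite -[Phi p z]oc1; move: z; apply: (ocl_ketl tB) => z Bz.
by rewrite oc1; exact: h.
Qed.

Lemma amp_rk y r q : amp m2 m2 (rk y r) ** W ** ketl m2 q = ketl m2 y ** sl m2 r q W.
Proof.
rewrite /sl !ocA; congr (_ ** _ ** _).
by apply: (tm_op_ext (m := m2)) => x z; rewrite !ocE ampE bral opLZ -(opLZ (ketr m2 z)).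
Qed.

(** For a slice a of W the operator W |x> a is a value of [Phi]. Expanding its argument in simple
    tensors produces slices of W^*, hence rank one operators, and a rank one operator in front of W
    |r> leaves a ket times a slice of W. *)
Lemma mkets_W : stable W mkets.
Proof.
move=> _ [x [a [Aa ->]]]; rewrite ocA.
apply: (ocl_compl _ Aa) => _ [p [q ->]]; rewrite -Phi_W.
move: (W _); apply: (Phi_tot (tmT m2)) => _ [[y r] _ <-]; rewrite Phi_simple -ocA.
apply: (ocl_compr (S := [set amp m2 m2 b | b in rks])).
  move=> _ [_ [u [v ->]] <-]; rewrite ocA amp_rk; apply: ocl_sub.
  by exists u, (sl m2 v r W); split=> //; exact: A_sl.
apply: (ocl_amp (S := rks)) (Bop_rk _ _) => b hb.
by apply: ocl_sub; exists b.
Qed.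

Lemma mkets_adW : stable (ad W) mkets.
Proof.
suff h y r q : ocl [set W ** T | T in mkets] (ketl m2 y ** sl m2 r q W).
  move=> _ [x [a [Aa ->]]]; have : ocl [set W ** T | T in mkets] (ketl m2 x ** a).
    by apply: (ocl_compl _ Aa) => _ [p [q ->]]; exact: h.
  apply: ocl_compl => _ [T hT <-]; rewrite (unitaryKl _ UW).
  exact: ocl_sub.
rewrite -amp_rk -ocA; apply: (ocl_compr (S := [set amp m2 m2 b | b in Bops])); last first.
  apply: (ocl_amp (S := Bops)) (rk_Bop _ _) => b hb.
  by apply: ocl_sub; exists b.
move=> _ [_ [p [x ->]] <-]; rewrite ocA -Phi_simple; move: (m2 x q).
apply: (Phi_tot (total_unitary UW (tmT m2))) => _ [_ [[u v] _ <-] <-].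
rewrite Phi_W -ocA; apply: ocl_sub; eexists; last by [].
by exists u, (sl m2 p v W); split=> //; exact: A_sl.
Qed.

Local Notation kets := (ketset Aop nas).

Lemma ket_ab p x : ketl nas (n2 p x) = ketr nab p ** ketl m2 x.
Proof. by apply: op_ext => b; rewrite ocE ketlE ketrE ketlE T1.2. Qed.
Lemma ket_bs p x : ketl nas (n2 p x) = ketr nbs x ** ketl n2 p.
Proof. by apply: op_ext => b; rewrite ocE ketlE ketrE ketlE T1.1. Qed.

Lemma kets_tot (S : set (op H N1)) (U : op N1 N1) :
  (forall p x a, Aop a -> ocl S (U ** (ketl nas (n2 p x) ** a))) ->
  forall T, ocl kets T -> ocl S (U ** T).
Proof.
move=> h; apply: ocl_compl => _ [z [a [Aa ->]]]; rewrite ocA; move: z.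
apply: (ocl_ketl (tmT n2)) => _ [[p x] _ <-].
by rewrite -ocA; apply: h.
Qed.

Lemma kets_as (V : op N2 N2) : stable (amp nas nas V) kets.
Proof.
move=> _ [z [a [Aa ->]]]; rewrite ocA amp_ketl.
by apply: ocl_sub; exists (V z), a.
Qed.

Lemma kets_ab (V : op H2 H2) : stable V mkets -> stable (amp nab nab V) kets.
Proof.
move=> hV T hT; apply: (kets_tot _ (ocl_sub hT)) => p x a Aa.
rewrite ket_ab !ocA amp_ketr -!ocA.
apply: (ocl_compl (S := mkets)); last by apply: hV; exists x, a.
move=> _ [y [b [Ab ->]]]; rewrite ocA -ket_ab.
by apply: ocl_sub; exists (n2 p y), b.
Qed.

(** [ad_Wtbs_Wab] writes Wt_bs^* as a product of W_ab, its adjoint and operators on legs a and s;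
    the latter only change the vector z of a ket. *)
Lemma kets_adWtbs : stable (ad Wtbs) kets.
Proof.
have UWab := unitary_amp nab UW; rewrite -[ad Wtbs](unitaryKr _ UWab) ad_Wtbs_Wab ad_amp.
rewrite ad_amp; apply: stableM (kets_ab mkets_adW).
by apply: stableM (kets_as _); apply: stableM (kets_as _) (kets_ab mkets_W).
Qed.

Lemma kets_Wtbs : stable Wtbs kets.
Proof.
have UWtas := unitary_amp nas UWt.
have -> : Wtbs = Wab ** Wtas ** ad Wab ** ad Wtas.
  have E := f_equal (@ad _ _ _) ad_Wtbs_Wab; rewrite !adM !adK in E.
  have UWab := unitary_amp nab UW.
  rewrite -[LHS](unitaryKl' _ UWab) E -!ocA; congr (_ ** _); by rewrite !ocA.
rewrite !ad_amp; apply: stableM (kets_as _); rewrite -ad_amp ad_amp.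
apply: stableM (kets_ab mkets_adW).
exact: stableM (kets_ab mkets_W) (kets_as _).
Qed.

Lemma kets_UU : stable UU kets.
Proof.
rewrite /UU ad_amp; apply: stableM (kets_as _).
exact: stableM (kets_as _) kets_adWtbs.
Qed.

Lemma kets_adUU : stable (ad UU) kets.
Proof.
rewrite /UU !adM !adK ad_amp; apply: stableM; first exact: kets_as.
exact: stableM kets_Wtbs (kets_as _).
Qed.

Lemma adX : ad X = Jop (ad Wt).
Proof.
by apply/esym/ad_uniq => u v; rewrite /X /= -[u in LHS]JK ipJ adl -[v in RHS]JK ipJ.
Qed.

Lemma J_adX u : J (ad X u) = ad Wt (J u).
Proof. by rewrite adX /= JK. Qed.

Lemma JZ a u : J (a *: u) = cj a *: J u.
Proof.
have J0 : J 0 = 0 by apply: nr0_eq0; apply/le_anti; rewrite nr_ge0 andbT -[leRHS](nr0 N2) J_le.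
by have := JP a u 0; rewrite J0 !addr0.
Qed.

Lemma J_amp y y' w : J (amp n2 n2 (sl (tsw n2) y y' X) w) =
  amp (tsw n2) (tsw n2) (sl n2 (c y) (c y') Wt) (J w).
Proof.
suff E : Jop (amp n2 n2 (sl (tsw n2) y y' X)) = amp (tsw n2) (tsw n2) (sl n2 (c y) (c y') Wt).
  by rewrite -E /= JK.
apply: amp_uniq => x r; have [q <-] := hc_surj r; rewrite /= JE ampE.
have [z hz] := hc_surj (sl (tsw n2) y y' X (c x)); rewrite -hz JE; congr (n2 _ _).
apply: ip_ext => v; rewrite -(hc_ip Hb) hz ipC (slE (tsw n2)) slE /= XE.
by rewrite cjK.
Qed.

Lemma amp_s (d : op Hb Hb) : amp nas nas (amp n2 n2 d) = amp nbs nbs (amp n2 n2 d).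
Proof.
have E r y w : nas (n2 r y) w = nbs (n2 r w) y by rewrite T1.1.
apply: (tri_ext (mAB := n2) (n12 := nas)) => p a b p' a' b'; congr (ip _ _).
by rewrite ampE ampE E E !ampE.
Qed.

Lemma amp_b (t : op H H) : amp nab nab (amp (tsw m2) (tsw m2) t) = amp nbs nbs (amp (tsw n2) (tsw n2) t).
Proof.
apply: (tri_ext (mAB := tsw m2) (n12 := nab)) => b a s b' a' s'; congr (ip _ _).
have E v u w : nab (tsw m2 v u) w = nbs (tsw n2 v w) u by rewrite /= T1.2 T1.1.
by rewrite ampE (ampE (tsw m2)) !E ampE (ampE (tsw n2)).
Qed.

Lemma Ab_bs (t : op H H) : amp (tsw nas) (tsw nas) t = amp nbs nbs (amp (tsw n2) (tsw n2) t).
Proof.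
apply: (tri_ext (mAB := n2) (n12 := nas)) => s a b s' a' b'; congr (ip _ _).
have -> : nas (n2 s' a') b' = nbs (n2 s' b') a' by rewrite T1.1.
rewrite ampE (ampE (tsw n2)) /=.
by rewrite !T1.1; exact: (ampE (tsw nas)).
Qed.

Lemma Jc_blin (T : op Hb N2) : blin (fun u => J (T (c u))).
Proof.
split; first by move=> a u v; rewrite hc_lin opLP JP cjK.
exists (opb T) => u; apply: le_trans (J_le _) _; apply: le_trans (opbP _ _) _.
by rewrite nr_hc.
Qed.
Definition Jc (T : op Hb N2) : op H N2 := Op (Jc_blin T).

(* Conjugation by Z, followed by that with the antiunitary J, carries the
   regularity of W to Wt. *)
Definition Fr b (T : op H H2) : op H N2 :=
  Jc (ad (ketr nas b) ** (Zbs ** amp (tsw n2) nab T ** ad Z) ** ketr n2 b).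

Lemma FrE b T u :
  Fr b T u = J (ad (ketr nas b) (Zbs (amp (tsw n2) nab T (ad Z (n2 (c u) b))))).
Proof. by []. Qed.

Lemma Fr_lin b a S T : Fr b (a *: S + T) = cj a *: Fr b S + Fr b T.
Proof.
apply: op_ext => u; rewrite opDE opZE !FrE.
by rewrite ampP opDE opZE !opLP JP.
Qed.

Lemma Fr_bnd b (T : op H H2) e : 0 <= e -> (forall x, nr (T x) <= e * nr x) ->
  forall x, nr (Fr b T x) <= opb (ad (ketr nas b) ** Zbs) * opb (ad Z ** ketr n2 b) * e * nr x.
Proof.
move=> e0 hT x; rewrite FrE; apply: le_trans (J_le _) _.
apply: le_trans (opbP (ad (ketr nas b) ** Zbs) _) _.
rewrite -!mulrA ler_wpM2l ?opb_ge0//; apply: le_trans (amp_bnd _ _ e0 hT _) _.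
rewrite mulrCA ler_wpM2l// -(nr_hc Hb x); exact: (opbP (ad Z ** ketr n2 b)).
Qed.

Lemma amp_ket x : amp (tsw n2) nab (ketl m2 x) = ketr nbs x.
Proof. by apply/esym/amp_uniq => b s; rewrite ketrE ketlE T1.1 -T1.2. Qed.

Lemma Fr_ket b x y y' : Fr b (ketl m2 x ** sl m2 y y' W) =
  ip b b *: (ketl n2 (c x) ** sl n2 (c y) (c y') Wt).
Proof.
apply: op_ext => u; rewrite /Fr.
have -> : Zbs ** amp (tsw n2) nab (ketl m2 x ** sl m2 y y' W) ** ad Z =
    ketr nbs x ** amp n2 n2 (sl (tsw n2) y y' X).
  move: (Z_slice y y') UZ; move: Z => z hz uz.
  rewrite -(ampM (tsw n2) (tsw n2)) amp_ket ocA amp_ketr -!ocA; congr (_ ** _).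
  by rewrite ocA hz (unitaryKr _ uz).
rewrite -[LHS]/(J (ad (ketr nas b) (nbs (amp n2 n2 (sl (tsw n2) y y' X) (n2 (c u) b)) x))) ampE.
have -> : nbs (n2 (sl (tsw n2) y y' X (c u)) b) x = nas (n2 (sl (tsw n2) y y' X (c u)) x) b.
  by rewrite T1.1.
rewrite brar -(ampE n2 n2) JZ J_amp JE (ampE (tsw n2)) opZE ocE ketlE.
by rewrite ip_nr conjR.
Qed.

Lemma Fr_reg b x y y' : Fr b (amp (tsw m2) (tsw m2) (sl m2 y y' W) ** ad W ** ketl m2 x) =
  ip b b *: (amp (tsw n2) (tsw n2) (sl n2 (c y) (c y') Wt) ** ad Wt ** ketl n2 (c x)).
Proof.
apply: op_ext => u; rewrite /Fr.
have -> : Zbs ** amp (tsw n2) nab (amp (tsw m2) (tsw m2) (sl m2 y y' W) ** ad W ** ketl m2 x) ** ad Z =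
    amp nas nas (amp n2 n2 (sl (tsw n2) y y' X)) ** (amp nas nas (ad X) ** ketr nbs x).
  move: (Z_slice y y') UZ Z_conj; move: Z => z hz uz pz.
  rewrite -(ampM (tsw n2) nab nab) amp_ket -(ampM nab nab nab) amp_b !ocA ampM hz -(ampM nbs nbs nbs) -amp_s.
  have h : amp nbs nbs z ** amp nab nab (ad W) = amp nas nas (ad X) ** amp nbs nbs z.
    have E := f_equal (fun T => ad Xas ** T ** ad Wab) pz.
    rewrite (unitaryKl _ (unitary_amp nas UX)) in E; rewrite -!ad_amp -E.
    by rewrite !ocA (unitaryKr _ (unitary_amp nab UW)).
  by rewrite -(ocA _ (amp nbs nbs z)) h -!ocA [amp nbs nbs z ** _]ocA amp_ketr -!ocA uz.2 oc1.
rewrite -[LHS]/(J (ad (ketr nas b) (amp nas nas (amp n2 n2 (sl (tsw n2) y y' X))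
  (amp nas nas (ad X) (nbs (n2 (c u) b) x))))).
have -> : nbs (n2 (c u) b) x = nas (n2 (c u) x) b by rewrite T1.1.
rewrite ampE ampE brar JZ J_amp J_adX JE opZE !ocE ketlE.
by rewrite ip_nr conjR.
Qed.

Local Notation kets2 := (ketset Aop n2).
Local Notation reg2 := (regset Aop n2 (ad Wt)).

Lemma kets2_reg2 (b : H) : b != 0 -> kets2 `<=` ocl reg2.
Proof.
move=> b0 _ [p [a [Aa ->]]]; have [x <-] := hc_surj p; rewrite -Wt_slC in Aa.
apply: (ocl_compl _ Aa) => _ [q [q' ->]]; have [y <-] := hc_surj q; have [y' <-] := hc_surj q'.
have bb : ip b b != 0 by rewrite ip_nr fmorph_eq0 expf_eq0 nr_eq0.
suff : ocl reg2 (Fr b (ketl m2 x ** sl m2 y y' W)).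
  by rewrite Fr_ket => /(oclZ (ip b b)^-1); rewrite scalerA mulVf ?scale1r.
have : ocl mkets (ketl m2 x ** sl m2 y y' W).
  by apply: ocl_sub; exists x, (sl m2 y y' W); split=> //; exact: A_sl.
rewrite -Hreg => h.
pose mreg0 := [set T | exists y y' x, T = amp (tsw m2) (tsw m2) (sl m2 y y' W) ** ad W ** ketl m2 x].
have {}h : ocl mreg0 (ketl m2 x ** sl m2 y y' W).
  move: h; apply: ocl_le => _ [t [z [At ->]]]; rewrite -ocA.
  apply: (ocl_compr (S := [set amp (tsw m2) (tsw m2) s | s in [set s | exists y y', s = sl m2 y y' W]])).
    by move=> _ [_ [u [v ->]] <-]; rewrite ocA; apply: ocl_sub; exists u, v, z.
  by apply: (ocl_amp _ At) => s hs; apply: ocl_sub; exists s.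
apply: (ocl_map (s := @conjc R) (Fr_lin b) (@Fr_bnd b) _ h) => _ [u [v [z ->]]].
rewrite Fr_reg; apply: oclZ; apply: ocl_sub; exists (sl n2 (c u) (c v) Wt), (c z); split=> //.
exact: Wt_sl.
Qed.

Lemma reg2_kets2 (b : H) : b != 0 -> reg2 `<=` ocl kets2.
Proof.
move=> b0 _ [a [p [Aa ->]]]; have [x <-] := hc_surj p; rewrite -Wt_slC in Aa.
rewrite -ocA.
apply: (ocl_compr (S := [set amp (tsw n2) (tsw n2) s | s in [set s | exists p p', s = sl n2 p p' Wt]])); last first.
  by apply: (ocl_amp _ Aa) => s hs; apply: ocl_sub; exists s.
move=> _ [_ [q [q' ->]] <-]; have [y <-] := hc_surj q; have [y' <-] := hc_surj q'; rewrite ocA.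
have bb : ip b b != 0 by rewrite ip_nr fmorph_eq0 expf_eq0 nr_eq0.
suff : ocl kets2 (Fr b (amp (tsw m2) (tsw m2) (sl m2 y y' W) ** ad W ** ketl m2 x)).
  by rewrite Fr_reg => /(oclZ (ip b b)^-1); rewrite scalerA mulVf ?scale1r.
have h : ocl mkets (amp (tsw m2) (tsw m2) (sl m2 y y' W) ** ad W ** ketl m2 x).
  by rewrite -Hreg; apply: ocl_sub; exists (sl m2 y y' W), x; split=> //; exact: A_sl.
pose mkets0 := [set T | exists x y y', T = ketl m2 x ** sl m2 y y' W].
have {}h : ocl mkets0 (amp (tsw m2) (tsw m2) (sl m2 y y' W) ** ad W ** ketl m2 x).
  move: h; apply: ocl_le => _ [z [t [At ->]]].
  by apply: (ocl_compl _ At) => _ [u [v ->]]; apply: ocl_sub; exists z, u, v.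
apply: (ocl_map (s := @conjc R) (Fr_lin b) (@Fr_bnd b) _ h) => _ [z [u [v ->]]].
rewrite Fr_ket; apply: oclZ; apply: ocl_sub; exists (c z), (sl n2 (c u) (c v) Wt); split=> //.
exact: Wt_sl.
Qed.

Local Notation Ab := (legr nas).
Local Notation regU := (regset Aop nas UU).

Lemma Ab_as a (V : op N2 N2) : Ab a ** amp nas nas V = amp nas nas V ** Ab a.
Proof. exact/esym/amp_comm. Qed.

Lemma Ab_Wt a p x : Ab a ** ad Wtbs ** ketl nas (n2 p x) =
  ketr nbs x ** (amp (tsw n2) (tsw n2) a ** ad Wt ** ketl n2 p).
Proof. by rewrite ket_bs Ab_bs ad_amp ampM ocA amp_ketr -!ocA. Qed.

Lemma Ab_UU a z : Ab a ** UU ** ketl nas z = ad Zas ** (Ab a ** ad Wtbs ** ketl nas (Z z)).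
Proof. by rewrite /UU !ocA ad_amp Ab_as -!ocA amp_ketl. Qed.

(** Of the three factors of UU the outer ones act on legs a and s: they commute with the element of
    A on leg b and preserve the kets. The middle factor acts on s and b, and there the claim is the
    regularity of Wt. *)
Lemma regU_kets : regU `<=` ocl kets.
Proof.
move=> _ [a [z [Aa ->]]]; rewrite Ab_UU ad_amp; apply: stableP (kets_as _) _.
move: (Z z) => {}z; rewrite -[_ ** _]oc1; move: z.
apply: (ocl_ketl (tmT n2)) => _ [[p x] _ <-]; rewrite oc1 Ab_Wt /=.
have [p0|p0] := eqVneq p 0.
  rewrite (_ : ketl n2 p = 0) ?oc0r ?oc0r; first exact: ocl0.
  by apply: op_ext => v; rewrite p0 ketlE -ketrE opL0.
have [b bp] := hc_surj p; have b0 : b != 0.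
  by apply: contra p0 => /eqP b0; rewrite -bp -nr_eq0 nr_hc b0 nr0.
apply: (ocl_compl (S := kets2)) => [_ [q [t [At ->]]]|].
  by rewrite ocA -ket_bs; apply: ocl_sub; exists (n2 q x), t.
by apply: (reg2_kets2 b0); exists a, p.
Qed.

Lemma kets_regU : kets `<=` ocl regU.
Proof.
have key p x a : Aop a -> ocl [set T | exists a z, Aop a /\ T = Ab a ** ad Wtbs ** ketl nas z]
    (ketl nas (n2 p x) ** a).
  move=> Aa; rewrite ket_bs -ocA.
  have [p0|p0] := eqVneq p 0.
    rewrite (_ : ketl n2 p = 0) ?oc0l ?oc0r; first exact: ocl0.
    by apply: op_ext => v; rewrite p0 ketlE -ketrE opL0.
  have [b bp] := hc_surj p; have b0 : b != 0.
    by apply: contra p0 => /eqP b0; rewrite -bp -nr_eq0 nr_hc b0 nr0.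
  apply: (ocl_compl (S := reg2)) => [_ [t [q [At ->]]]|].
    by rewrite -Ab_Wt; apply: ocl_sub; exists t, (n2 q x).
  by apply: (kets2_reg2 b0); exists p, a.
move=> _ [z [a [Aa ->]]].
have -> : ketl nas z ** a = amp nas nas (ad Z) ** (ketl nas (Z z) ** a).
  by rewrite ocA amp_ketl (ocK UZ.1).
move: (Z z) => {}z; rewrite ocA; move: z; apply: (ocl_ketl (tmT n2)) => _ [[p x] _ <-].
rewrite -ocA; apply: (ocl_compl _ (key p x a Aa)) => _ [t [z [At ->]]].
have -> : ketl nas z = ketl nas (Z (ad Z z)) by rewrite (ocK UZ.2).
rewrite -ad_amp -Ab_UU; apply: ocl_sub.
by exists t, (ad Z z).
Qed.

Lemma TaM s t : Ta (s ** t) = Ta s ** Ta t. Proof. by rewrite ampM. Qed.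
Lemma PsiM s t : Psi (s ** t) = Psi s ** Psi t.
Proof.
rewrite /Psi ampM -(ampM m2 m2 m2); congr (amp _ _ _).
by rewrite -!ocA (unitaryKl _ UW).
Qed.

Lemma UU_conj_A t : Aop t -> ad UU ** Ta t ** UU = Psi t.
Proof.
move=> At; apply/eqP; rewrite -subr_eq0; apply/eqP; move: t At.
apply: (ocl_eqmap (M := opb (ad UU) * opb UU + opb W * opb (ad W))).
- move=> a S T; rewrite /Psi !ampP ocDr ocZr ocDl ocZl (ocDr _ _ W) (ocZr _ _ W) ocDl ocZl ampP.
  by rewrite scalerBr opprD addrACA.
- move=> T e e0 hT x; rewrite opBE; apply: le_trans (nrB _ _) _.
  rewrite !mulrDl; apply: lerD.
    rewrite !ocE; apply: le_trans (opbP _ _) _; rewrite -!mulrA ler_wpM2l ?opb_ge0//.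
    apply: le_trans (amp_bnd _ _ e0 hT _) _; rewrite mulrCA ler_wpM2l//; exact: (opbP UU).
  rewrite /Psi; apply: amp_bnd => [|y]; first by rewrite !mulr_ge0 ?opb_ge0.
  rewrite !ocE; apply: le_trans (opbP _ _) _; rewrite -!mulrA ler_wpM2l ?opb_ge0//.
  apply: le_trans (amp_bnd _ _ e0 hT _) _; rewrite mulrCA ler_wpM2l//; exact: opbP.
by move=> _ [x [x' ->]]; rewrite UU_conj_slice subrr.
Qed.

(** Slices of pit d are only left multipliers of A. Multiplied by an element of A they fall under
    [UU_conj_A], and the factor Psi a is cancelled because A acts nondegenerately. *)
Lemma UU_conj t : (forall a, Aop a -> Aop (t ** a)) -> ad UU ** Ta t ** UU = Psi t.
Proof.
move=> ht; have tot := amp_total nba (amp_total m2 A_total).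
have UV := unitary_amp nba UW.
have h a : Aop a -> ad UU ** Ta t ** UU ** Psi a = Psi t ** Psi a.
  move=> Aa; rewrite -PsiM -(UU_conj_A (ht a Aa)) TaM -(UU_conj_A Aa).
  by move: UUU; move: UU => u uu; rewrite -!ocA (unitaryKl' _ uu).
apply: (op_eq_total (total_unitary UV tot)) => _ [_ [_ [x [[_ [a Aa <-] <-] ->]]] <-].
have := f_equal (fun S : op N1 N1 => S (amp nba nba W x)) (h a Aa).
rewrite !ocE.
have -> : Psi a (amp nba nba W x) = amp nba nba W (amp nba nba (amp m2 m2 a) x).
  rewrite -[LHS]/((Psi a ** amp nba nba W) x) /Psi -(ampM nba nba nba) -ad_amp -!ocA.
  by rewrite (UV.1) oc1 -(ampM nba nba nba) ocE.
by [].
Qed.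

Lemma nas_nba p u' u : nas (n2 p u') u = nba (m2 u u') p.
Proof. by rewrite Tba.1 -Tba.2. Qed.

Lemma UU_conj_mx t p u' u q v' v : (forall a, Aop a -> Aop (t ** a)) ->
  ip (UU (nas (n2 p u') u)) (Ta t (UU (nas (n2 q v') v))) =
  ip p q * ip (m2 u u') (W (amp m2 m2 t (ad W (m2 v v')))).
Proof.
move=> ht; rewrite -adr -[X in ip _ X]/((ad UU ** Ta t ** UU) (nas (n2 q v') v)) UU_conj//.
by rewrite !nas_nba /Psi ampE tmip mulrC !ocE.
Qed.

Lemma Ta_mx t p u' u q v' v :
  ip (nas (n2 p u') u) (Ta t (nas (n2 q v') v)) = ip p q * ip u v * ip u' (t v').
Proof.
rewrite Ta_as ampE.
have -> : amp (tsw n2) (tsw n2) t (n2 q v') = n2 q (t v') by exact: (ampE (tsw n2)).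
by rewrite !tmip mulrAC.
Qed.

Lemma core_pitA (K KH P : hilbertType R) (kh : tmap K H KH) (pK : tmap K N1 P)
    (D : Type) (pit : D -> op KH KH) (al : H -> H -> D -> D) (pi : D -> op K K) :
  (forall u v d, pi (al u v d) = sr kh u v (pit d)) ->
  (forall d x x' a, Aop a -> Aop (sl kh x x' (pit d) ** a)) ->
  (forall d x u x' v u' v', ip (kh x u) (pit (al u' v' d) (kh x' v)) =
    ip (m2 u u') (W (amp m2 m2 (sl kh x x' (pit d)) (ad W (m2 v v'))))) ->
  ocl (pitA Aop kh pit al) = ocl (piA Aop kh al pi).
Proof.
apply: (ocl_pitA A_ad A_mul A_AA _ UUU kets_UU kets_adUU regU_kets kets_regU _ UU_conj_mx Ta_mx pK).
  by move=> u u0; exists (c u); rewrite hc_ip ip_nr fmorph_eq0 expf_eq0 nr_eq0.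
by move=> t b; rewrite Ta_as Ab_as.
Qed.

End Core.

(** * Representations of C*-algebras *)

Section CStar.
Variable R : realType.
Local Notation C := R[i].
Variable D : cstarType R.
Implicit Types x y z d k : D.
Local Notation "x *' y" := (cmul x y) (at level 40, left associativity).
Local Notation st := cstar.

Lemma cmulDl x y z : (x + y) *' z = x *' z + y *' z.
Proof. by have := cmulPl 1 x y z; rewrite !scale1r. Qed.
Lemma cmulDr x y z : z *' (x + y) = z *' x + z *' y.
Proof. by have := cmulPr 1 x y z; rewrite !scale1r. Qed.
Lemma cmul0l x : 0 *' x = 0.
Proof. by apply: (addrI (0 *' x)); rewrite -cmulDl !addr0. Qed.
Lemma cmul0r x : x *' 0 = 0.
Proof. by apply: (addrI (x *' 0)); rewrite -cmulDr !addr0. Qed.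
Lemma cmulZl c x y : (c *: x) *' y = c *: (x *' y).
Proof. by have := cmulPl c x 0 y; rewrite cmul0l !addr0. Qed.
Lemma cmulZr c x y : x *' (c *: y) = c *: (x *' y).
Proof. by have := cmulPr c y 0 x; rewrite cmul0r !addr0. Qed.
Lemma cstarD x y : st (x + y) = st x + st y.
Proof. by have := cstarP 1 x y; rewrite !scale1r rmorph1 scale1r. Qed.
Lemma cstar0 : st (0 : D) = 0.
Proof. by apply: (addrI (st 0)); rewrite -cstarD !addr0. Qed.
Lemma cstarZ c x : st (c *: x) = cj c *: st x.
Proof. by have := cstarP c x 0; rewrite cstar0 !addr0. Qed.
Lemma cmulNl x y : (- x) *' y = - (x *' y). Proof. by rewrite -scaleN1r cmulZl scaleN1r. Qed.
Lemma cmulNr x y : x *' (- y) = - (x *' y). Proof. by rewrite -scaleN1r cmulZr scaleN1r. Qed.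
Lemma cstarN x : st (- x) = - st x.
Proof. by rewrite -scaleN1r cstarZ rmorphN1 scaleN1r. Qed.

Lemma nr_cmul x y : nr (x *' y) <= nr x * nr y.
Proof. by have := cnormM x y; rewrite !nrE -rmorphM lecR. Qed.
Lemma nr_cstar_mul x : nr (st x *' x) = nr x ^+ 2.
Proof. by apply: complexI; rewrite -nrE cnorm_star nrE rmorphXn. Qed.
Lemma nr_cstar x : nr (st x) = nr x.
Proof.
suff h y : nr y <= nr (st y) by apply/le_anti; rewrite h -{2}[x]cstarK h.
have [->|y0] := eqVneq y 0; first by rewrite cstar0.
have := nr_cmul (st y) y; rewrite nr_cstar_mul expr2 ler_pM2r// nr_gt0//.
Qed.

Lemma lmul_blin d : blin (cmul d).
Proof.
split; first by move=> a x y; exact: cmulPr.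
by exists (nr d) => x; exact: nr_cmul.
Qed.
(* l + d in the unitization of D, acting on D. *)
Definition um (l : R) d : op D D := l%:C *: oid D + Op (lmul_blin d).

Lemma umE l d z : um l d z = l%:C *: z + d *' z. Proof. by []. Qed.

Lemma umM l d l' d' : um l d ** um l' d' = um (l * l') (l%:C *: d' + l'%:C *: d + d *' d').
Proof.
apply: op_ext => z; rewrite ocE !umE scalerDr cmulDr !cmulDl scalerA -rmorphM -addrA.
by rewrite cmulZr !cmulZl -cmulA !addrA.
Qed.

Definition ucontr l d := forall z, nr (um l d z) <= nr z.

Lemma um_sa l d x y : st d = d -> st (um l d x) *' y = st x *' um l d y.
Proof.
move=> sd; rewrite !umE cstarD cstarZ cstarM sd conjR cmulDl cmulDr cmulZl cmulZr.
by rewrite -cmulA.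
Qed.

(* The iteration Y <- (F + Y^2) / 2 converges to Y with (1 - Y)^2 = 1 - F. *)
Fixpoint tseq n : R := if n is n'.+1 then (1 + tseq n' ^+ 2) / 2 else 0.

Lemma tseq01 n : 0 <= tseq n <= 1.
Proof. by elim: n => [|n IH] /=; [rewrite lexx ler01|move: IH; move: (tseq n) => t; nra]. Qed.

Lemma tseqS n : tseq n <= tseq n.+1.
Proof. by move=> /=; have := sqr_ge0 (tseq n - 1); nra. Qed.

Lemma tseq_cauchy e : 0 < e -> exists N, forall n, (N <= n)%N -> tseq n - tseq N <= e.
Proof.
move=> e0; have hs : has_sup (range tseq).
  by split; [exists (tseq 0), 0%N|exists 1 => _ [n _ <-]; have /andP[] := tseq01 n].
have [_ [N _ <-] hN] := sup_adherent e0 hs; exists N => n _.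
have := ub_le_sup (E := range tseq) hs.2 (x := tseq n) (ex_intro2 _ _ n I erefl); lra.
Qed.

Lemma tendsS (V : normedZmodType C) (u : nat -> V) l : tends u l -> tends (fun n => u n.+1) l.
Proof. by move=> h e /h[N hN]; exists N => n nN; apply: hN; exact: leqW. Qed.

Lemma tends_bil (V W X : normedZmodType C) (B : V -> W -> X) u (x : V) v (y : W) :
  (forall a b c, B (a - b) c = B a c - B b c) -> (forall a b c, B c (a - b) = B c a - B c b) ->
  (forall a b, nr (B a b) <= nr a * nr b) ->
  tends u x -> tends v y -> tends (fun n => B (u n) (v n)) (B x y).
Proof.
move=> Bl Br Bn hu hv e e0; pose s := 1 + nr x + nr y.
have s0 : 0 < s by have := nr_ge0 x; have := nr_ge0 y; rewrite /s; lra.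
pose t := Num.min 1 (e / s).
have t0 : 0 < t by rewrite /t lt_min ltr01 divr_gt0.
have [N hN] := hu _ t0; have [N' hN'] := hv _ t0; exists (N + N')%N => n nN.
have := hN n (leq_trans (leq_addr _ _) nN); have := hN' n (leq_trans (leq_addl _ _) nN).
have -> : B (u n) (v n) - B x y = B (u n - x) (v n - y) + B (u n - x) y + B x (v n - y).
  by rewrite (Br _ _ (u n - x)) subrK Bl Br addrA subrK.
move=> h1 h2; apply: le_trans (nrD _ _) _; apply: le_trans (lerD (nrD _ _) (lexx _)) _.
have := Bn (u n - x) (v n - y); have := Bn (u n - x) y; have := Bn x (v n - y).
have t1 : t <= 1 by rewrite /t ge_min lexx.
have te : t * s <= e by rewrite -ler_pdivlMr// /t ge_min lexx orbT.
move: (nr_ge0 x) (nr_ge0 y) (nr_ge0 (u n - x)) (nr_ge0 (v n - y)) h1 h2 te; rewrite /s.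
move: (nr (u n - x)) (nr (v n - y)) (nr x) (nr y) (nr (B _ _)) (nr (B _ _)) (nr (B _ _)) => a b p q f g h.
move=> p0 q0 a0 b0 hb ha te h1 h2 h3.
have : a * b <= t by rewrite -[t]mul1r; apply: ler_pM => //; apply: le_trans t1.
have : a * q <= t * q by apply: ler_wpM2r.
have : p * b <= p * t by apply: ler_wpM2l.
by nra.
Qed.

Lemma addrCross (V : zmodType) (p q r s : V) : p + q - (r + s) - (p - r) = q - s.
Proof. by rewrite opprD addrACA [X in X - _]addrC addrK. Qed.

Section Sqrt.
Variables (l : R) (d : D).
Hypotheses (l1 : `|l| <= 1) (sd : st d = d) (Fc : ucontr l d).

(** The iteration in the unitization, an element m + y being stored as the pair (m, y). The numbers
    [tseq], which are its values at F = 1, dominate both the norms and the increments. *)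
Fixpoint yseq n : R * D := if n is n'.+1 then
  ((l + (yseq n').1 ^+ 2) / 2,
   (2^-1)%:C *: (d + ((2 * (yseq n').1)%:C *: (yseq n').2 + (yseq n').2 *' (yseq n').2))) else (0, 0).
Local Notation mu n := (yseq n).1.
Local Notation ys n := (yseq n).2.
Local Notation Y n := (um (mu n) (ys n)).

Lemma yseqS n z : Y n.+1 z = (2^-1)%:C *: (um l d z + Y n (Y n z)).
Proof.
rewrite -[Y n (Y n z)]/((Y n ** Y n) z) umM !umE /=; move: (yseq n) => [m y] /=.
rewrite cmulZl !cmulDl !scalerDr scalerA !cmulZl.
have -> : ((l + m ^+ 2) / 2)%:C = 2^-1%:C * l%:C + 2^-1%:C * (m * m)%:C :> C.
  by rewrite -!rmorphM -rmorphD; congr (_%:C); rewrite expr2; field.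
rewrite [RHS]addrACA !scalerA scalerDl; congr (_ + (_ + (_ + _))).
rewrite -scalerDl -mulrDr; congr ((_ * _) *: _).
by rewrite -rmorphD; congr (_%:C); ring.
Qed.

Lemma yseq_star n : st (ys n) = ys n.
Proof.
elim: n => [|n IH] /=; first exact: cstar0.
by rewrite cstarZ !cstarD cstarZ cstarM IH sd !conjR.
Qed.

Lemma yseq_comm k n : k *' d = d *' k -> k *' ys n = ys n *' k.
Proof.
move=> kd; elim: n => [|n IH] /=; first by rewrite cmul0r cmul0l.
by rewrite cmulZr cmulZl !cmulDr !cmulDl kd cmulZr cmulZl !cmulA IH -!cmulA IH.
Qed.

Lemma muS n : mu n.+1 = (l + mu n ^+ 2) / 2. Proof. by []. Qed.
Lemma tseqE n : tseq n.+1 = (1 + tseq n ^+ 2) / 2. Proof. by []. Qed.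

Lemma mu_bnd n : `|mu n| <= tseq n /\ `|mu n.+1 - mu n| <= tseq n.+1 - tseq n.
Proof.
have step m : `|mu m| <= tseq m -> `|mu m.+1| <= tseq m.+1.
  move=> h /=; rewrite normrM (ger0_norm (x := 2^-1)) ?invr_ge0//.
  rewrite ler_pM2r ?invr_gt0//; apply: le_trans (ler_normD _ _) (lerD l1 _).
  by rewrite normrX lerXn2r ?nnegrE// ; have /andP[] := tseq01 m.
have b m : `|mu m| <= tseq m by elim: m => [|m /step//]; rewrite normr0.
split=> //; elim: n => [|n IH].
  by rewrite /= !expr0n /= !addr0 !subr0 normrM (ger0_norm (x := 2^-1)) ?invr_ge0// ler_pM2r ?invr_gt0.
have -> : mu n.+2 - mu n.+1 = (mu n.+1 - mu n) * (mu n.+1 + mu n) / 2.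
  by rewrite (muS n.+1); move: (muS n) => E; lra.
have -> : tseq n.+2 - tseq n.+1 = (tseq n.+1 - tseq n) * (tseq n.+1 + tseq n) / 2.
  by rewrite (tseqE n.+1); move: (tseqE n) => E; lra.
rewrite normrM (ger0_norm (x := 2^-1)) ?invr_ge0// ler_pM2r ?invr_gt0// normrM.
by apply: ler_pM => //; apply: le_trans (ler_normD _ _) (lerD (b _) (b _)).
Qed.

Lemma Y_bnd n z : nr (Y n z) <= tseq n * nr z.
Proof.
elim: n z => [|n IH] z; first by rewrite umE scale0r cmul0l addr0 nr0 mul0r.
rewrite yseqS nrZ nrC (ger0_norm (x := 2^-1)) ?invr_ge0//=.
rewrite mulrC mulrAC ler_pM2r ?invr_gt0//; apply: le_trans (nrD _ _) _.
rewrite mulrDl mul1r; apply: lerD; first exact: Fc.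
have /andP[t0 _] := tseq01 n.
by apply: le_trans (IH _) _; rewrite expr2 -mulrA ler_wpM2l ?IH.
Qed.

Lemma Y_diff n z : nr (Y n.+1 z - Y n z) <= (tseq n.+1 - tseq n) * nr z.
Proof.
elim: n z => [|n IH] z.
  have -> : Y 0 z = 0 by rewrite umE scale0r cmul0l addr0.
  by rewrite !subr0; exact: Y_bnd.
have -> : Y n.+2 z - Y n.+1 z =
    (2^-1)%:C *: (Y n.+1 (Y n.+1 z - Y n z) + (Y n.+1 (Y n z) - Y n (Y n z))).
  rewrite (yseqS n.+1) [X in _ - X](yseqS n) -scalerBr opprD addrACA subrr add0r; congr (_ *: _).
  by rewrite opLB addrA subrK.
have -> : tseq n.+2 - tseq n.+1 = 2^-1 * (tseq n.+1 * (tseq n.+1 - tseq n) + (tseq n.+1 - tseq n) * tseq n).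
  by rewrite (tseqE n.+1); move: (tseqE n) => E; lra.
rewrite nrZ nrC (ger0_norm (x := 2^-1)) ?invr_ge0// -mulrA ler_pM2l ?invr_gt0//.
apply: le_trans (nrD _ _) _; rewrite mulrDl; apply: lerD.
  apply: le_trans (Y_bnd _ _) _; rewrite -mulrA ler_wpM2l//.
  by have /andP[] := tseq01 n.+1.
apply: le_trans (IH _) _; rewrite -mulrA ler_wpM2l ?Y_bnd// subr_ge0.
exact: tseqS.
Qed.

Lemma tele_bnd (V : normedZmodType C) (u : nat -> V) (M : R) :
  (forall n, nr (u n.+1 - u n) <= M * (tseq n.+1 - tseq n)) -> 0 <= M -> cauchys u.
Proof.
move=> h M0; have h2 n (k : nat) : nr (u (n + k)%N - u n) <= M * (tseq (n + k)%N - tseq n).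
  elim: k => [|k IH]; first by rewrite addn0 !subrr nr0 mulr0.
  rewrite addnS; apply: le_trans (nr_tri _ (u (n + k)%N) _) _.
  apply: le_trans (lerD (h _) IH) _; rewrite -mulrDr; apply: ler_wpM2l => //; lra.
move=> e e0; have e1 : 0 < e / (2 * (M + 1)) by rewrite divr_gt0// mulr_gt0//; lra.
have [N hN] := tseq_cauchy e1; exists N => n m nN mN.
apply: le_trans (nr_tri _ (u N) _) _; rewrite (nrBC (u N)).
have k j : (N <= j)%N -> nr (u j - u N) <= e / 2.
  move=> jN; have := h2 N (j - N)%N; rewrite subnKC// => h3; apply: le_trans h3 _.
  apply: le_trans (ler_wpM2l M0 (hN j jN)) _.
  rewrite mulrA ler_pdivrMr ?mulr_gt0//; last by lra.
  by rewrite mulrA divfK// ; nra.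
by have := k _ nN; have := k _ mN; lra.
Qed.

(** The square root 1 - (m + y) of 1 - F for a selfadjoint contraction F = l + d. The equations for
    l and d are the scalar part and the D part of (1 - (m + y))^2 = 1 - F. *)
Lemma csqrt : exists m y, [/\ `|m| <= 1, 2 * m - m ^+ 2 = l, st y = y, ucontr m y &
  (2 * (1 - m))%:C *: y - y *' y = d /\ forall k, k *' d = d *' k -> k *' y = y *' k].
Proof.
have cm : cauchys (fun n => (mu n)%:C : C).
  apply: (tele_bnd (M := 1)) => // n; rewrite mul1r -rmorphB nrC.
  exact: (mu_bnd n).2.
have cy : cauchys (fun n => ys n).
  apply: (tele_bnd (M := 2)) => // n; set z := ys n.+1 - ys n.
  have [->|z0] := eqVneq z 0; first by rewrite nr0 mulr_ge0// subr_ge0 tseqS.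
  (* [Y_diff] bounds an increment as a multiplier. Applied to z^*, and after removal of the scalar
     part, which costs the second summand of the factor 2, it bounds z itself by the C*-identity. *)
  have h : nr (z *' (st z)) <= 2 * (tseq n.+1 - tseq n) * nr (st z).
    have -> : z *' (st z) = (Y n.+1 (st z) - Y n (st z)) - (mu n.+1 - mu n)%:C *: (st z).
      by rewrite !umE rmorphB scalerBl addrCross /z cmulDl cmulNl.
    apply: le_trans (nrB _ _) _; rewrite nrZ nrC.
    apply: le_trans (lerD (Y_diff n _) (ler_wpM2r (nr_ge0 _) (mu_bnd n).2)) _.
    by rewrite -mulrDl; apply: ler_wpM2r; [exact: nr_ge0|lra].
  move: h; rewrite -{1}(cstarK z) nr_cstar_mul nr_cstar expr2 ler_pM2r//.
  by rewrite nr_gt0.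
have [z0 hz0] := C_complete cm; have [y hy] := tends_complete cy.
pose m := complex.Re z0.
have hm : tends (fun n => (mu n)%:C : C) m%:C.
  apply: (tends_bnd ler01 hz0) => n; rewrite mul1r -rmorphB nrC ler_norml.
  have := Re_le_nr ((mu n)%:C - z0); have := Re_le_nr (- ((mu n)%:C - z0)); rewrite nrN.
  by rewrite raddfN raddfB /= -/m; move: (nr _) => r h1 h2; apply/andP; split; lra.
have hsq : tends (fun n => (mu n)%:C * (mu n)%:C : C) (m%:C * m%:C).
  apply: (tends_bil (B := fun a b : C => a * b) _ _ _ hm hm) => [a b c|a b c|a b].
  - exact: mulrBl.
  - exact: mulrBr.
  - by rewrite nrM.
have hZ : tends (fun n => (mu n)%:C *: ys n) (m%:C *: y).
  apply: (tends_bil (B := fun (a : C) (b : D) => a *: b) _ _ _ hm hy) => [a b c|a b c|a b].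
  - exact: scalerBl.
  - exact: scalerBr.
  - by rewrite nrZ.
have hM : tends (fun n => ys n *' ys n) (y *' y).
  apply: (tends_bil (B := fun a b : D => a *' b) _ _ _ hy hy) => [a b c|a b c|a b].
  - by rewrite cmulDl cmulNl.
  - by rewrite cmulDr cmulNr.
  - exact: nr_cmul.
exists m, y; split.
- have := tends_le hm (M := 1); rewrite nrC; apply=> n; rewrite nrC.
  by apply: le_trans (mu_bnd n).1 _; have /andP[] := tseq01 n.
- have : m%:C = ((l + m ^+ 2) / 2)%:C :> C.
    apply: tends_uniq (tendsS hm) _; apply: (tends_bnd ler01 hsq) => n.
    rewrite muS mul1r -!rmorphM -!rmorphB !nrC -[leRHS]mul1r.
    have -> : (l + mu n ^+ 2) / 2 - (l + m ^+ 2) / 2 = 2^-1 * (mu n * mu n - m * m) by field.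
    by rewrite normrM ler_wpM2r// ger0_norm ?invr_ge0//; lra.
  by move/complexI => E; lra.
- apply: tends_uniq (hy); apply: (tends_bnd ler01 hy) => n.
  by rewrite -{1}(yseq_star n) -cstarN -cstarD nr_cstar mul1r.
- move=> z; apply: (tends_le (u := fun n => Y n z)) => [|n]; last first.
    apply: le_trans (Y_bnd n z) _; rewrite -[leRHS]mul1r ler_wpM2r ?nr_ge0//.
    by have /andP[] := tseq01 n.
  apply: tendsD.
    apply: (tends_bnd (nr_ge0 z) hm) => n; rewrite -scalerBl nrZ mulrC//.
  apply: (tends_bnd (nr_ge0 z) hy) => n; rewrite -cmulNl -cmulDl mulrC; exact: nr_cmul.
split; last first.
  move=> k kd; have h1 : tends (fun n => k *' ys n) (k *' y).
    by apply: (tends_bnd (nr_ge0 k) hy) => n; rewrite -cmulNr -cmulDr nr_cmul.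
  apply: tends_uniq h1 _; apply: (tends_bnd (nr_ge0 k) hy) => n.
  by rewrite yseq_comm// -cmulNl -cmulDl mulrC nr_cmul.
have hS : tends (fun n => ys n.+1) ((2^-1)%:C *: (d + ((2 * m)%:C *: y + y *' y))).
  apply: (tends_bnd (M := 1) ler01 (tendsD hZ (tendsD hZ hM))) => n.
  rewrite mul1r /= -scalerBr nrZ nrC ger0_norm ?invr_ge0//.
  rewrite opprD addrACA subrr add0r !rmorphM -!scalerA.
  have E (a b : D) : 2%:C *: a + b = a + (a + b).
    by rewrite (_ : 2%:C = 1 + 1 :> C) ?scalerDl ?scale1r ?addrA// -rmorphD.
  by rewrite !E; move: (nr_ge0 ((mu n)%:C *: ys n + ((mu n)%:C *: ys n + ys n *' ys n) - (m%:C *: y + (m%:C *: y + y *' y)))); lra.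
have E : y = (2^-1)%:C *: (d + ((2 * m)%:C *: y + y *' y)) by exact: tends_uniq (tendsS hy) hS.
have E2 : 2%:C *: y = d + ((2 * m)%:C *: y + y *' y).
  have h2 : 2%:C * (2^-1)%:C = 1 :> C by rewrite -rmorphM mulfV ?pnatr_eq0.
  by rewrite {1}E scalerA h2 scale1r.
rewrite mulrBr mulr1 rmorphB scalerBl E2.
by rewrite -addrA -opprD addrK.
Qed.
End Sqrt.
End CStar.

Section Homs.
Variable R : realType.
Local Notation C := R[i].
Variable D : cstarType R.
Implicit Types x y z d k h : D.
Local Notation "x *' y" := (cmul x y) (at level 40, left associativity).
Local Notation st := cstar.

Lemma umsq l d z : um l d (um l d z) = um (l * l) ((2 * l)%:C *: d + d *' d) z.
Proof.
rewrite -[LHS]/((um l d ** um l d) z) umM; congr (um _ (_ + _) z).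
by rewrite -scalerDl -rmorphD; congr (_%:C *: _); ring.
Qed.

(** F = l + d and F' = l' + d' are commuting and selfadjoint with F^2 + F'^2 = c. So F + i F' and F
    - i F' both multiply norms by sqrt c, and F is half their sum. *)
Lemma circle_bnd l d l' d' e (c : R) z : st d = d -> st d' = d' -> d *' d' = d' *' d ->
  l * l + l' * l' = c -> (2 * l)%:C *: d + d *' d = e -> (2 * l')%:C *: d' + d' *' d' = - e ->
  nr (um l d z) ^+ 2 <= c * nr z ^+ 2.
Proof.
move=> sd sd' dd' cl hd hd'; set a := um l d z; set b := um l' d' z.
have ab : st a *' b = st b *' a.
  rewrite /a /b !um_sa//; congr (_ *' _).
  rewrite -[LHS]/((um l d ** um l' d') z) -[RHS]/((um l' d' ** um l d) z) !umM.
  by rewrite [l' * l]mulrC dd' [l'%:C *: _ + _]addrC.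
have aabb : st a *' a + st b *' b = c%:C *: (st z *' z).
  rewrite /a /b !um_sa// -cmulDr !umsq hd hd' !umE cmulNl addrACA subrr addr0.
  by rewrite -scalerDl -rmorphD cl cmulZr.
clearbody a b; have key (i : C) : cj i = - i -> i * i = -1 -> nr (a + i *: b) ^+ 2 = c * nr z ^+ 2.
  move=> ci ii; have c0 : 0 <= c by rewrite -cl addr_ge0// -expr2 sqr_ge0.
  rewrite -[LHS](nr_cstar_mul (a + i *: b)) cstarD cstarZ ci cmulDl !cmulDr scaleNr !cmulNl !cmulZl.
  rewrite !cmulZr scalerA ii scaleN1r opprK ab -addrA addNKr.
  by rewrite aabb nrZ nrC ger0_norm// nr_cstar_mul.
have ci : cj 'i%C = - 'i%C :> C by apply/eqP; rewrite eq_complex/= oppr0 !eqxx.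
have ii : 'i%C * 'i%C = -1 :> C by rewrite -expr2 sqr_i.
have h1 := key 'i%C ci ii.
have h2 : nr (a - 'i%C *: b) ^+ 2 = c * nr z ^+ 2.
  rewrite -scaleNr; apply: key; first by rewrite rmorphN; congr (- _); exact: ci.
  by rewrite mulrNN.
have E : nr (a + 'i%C *: b) = nr (a - 'i%C *: b).
  by apply/eqP; rewrite -(eqrXn2 (n := 2)) ?nr_ge0// h1 h2.
rewrite -h1 ler_pXn2r ?nnegrE ?nr_ge0//.
have : nr (2%:C *: a) <= nr (a + 'i%C *: b) + nr (a - 'i%C *: b).
  apply: le_trans (nrD _ _); rewrite addrACA subrr addr0.
  by rewrite (_ : 2%:C = 1 + 1 :> C) ?scalerDl ?scale1r// -rmorphD.
by rewrite -E nrZ nrC ger0_norm//; lra.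
Qed.

Section OneHom.
Variable V : hilbertType R.
Record shom (phi : D -> op V V) : Prop := Shom {
  sh_lin : linear phi;
  sh_mul : forall x y, phi (x *' y) = phi x ** phi y;
  sh_star : forall x, phi (st x) = ad (phi x) }.

Variable phi : D -> op V V.
Hypothesis Hphi : shom phi.

Lemma shD x y : phi (x + y) = phi x + phi y.
Proof. by have := sh_lin Hphi 1 x y; rewrite !scale1r. Qed.
Lemma sh0 : phi 0 = 0.
Proof. by apply: (addrI (phi 0)); rewrite -shD !addr0. Qed.
Lemma shZ c x : phi (c *: x) = c *: phi x.
Proof. by have := sh_lin Hphi c x 0; rewrite sh0 !addr0. Qed.
Lemma shN x : phi (- x) = - phi x. Proof. by rewrite -scaleN1r shZ scaleN1r. Qed.
Lemma shB x y : phi (x - y) = phi x - phi y. Proof. by rewrite shD shN. Qed.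

Definition pm (l : R) d : op V V := l%:C *: oid V + phi d.

Lemma pmM l d l' d' : pm l d ** pm l' d' = pm (l * l') (l%:C *: d' + l'%:C *: d + d *' d').
Proof.
rewrite /pm ocDl !ocDr ocZl ocZr oc1 scalerA -rmorphM -addrA; congr (_ + _).
by rewrite ocZl o1c ocZr oc1 !shD !shZ (sh_mul Hphi) !addrA.
Qed.

Lemma pm_ad l d : st d = d -> ad (pm l d) = pm l d.
Proof. by move=> sd; rewrite /pm adD adZ ad1 -(sh_star Hphi) sd conjR. Qed.

(** The homomorphism respects the square root S of 1 - F^2, F = l + d; in the representation this
    reads |F v|^2 + |S v|^2 = |v|^2. *)
Lemma hom_um l d v : `|l| <= 1 -> st d = d -> ucontr l d -> nr (pm l d v) <= nr v.
Proof.
move=> l1 sd Fc; set d2 := (2 * l)%:C *: d + d *' d.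
have [||z|m [y [m1 ml sy _ [yd _]]]] := @csqrt R D (l * l) d2.
- by rewrite normrM; apply: mulr_ile1.
- by rewrite /d2 cstarD cstarZ cstarM sd conjR.
- by rewrite -umsq; apply: le_trans (Fc _) (Fc _).
have E : oid V - pm l d ** pm l d = pm (1 - m) (- y) ** pm (1 - m) (- y).
  rewrite !pmM -scalerDl -rmorphD (_ : l + l = 2 * l); last by ring.
  rewrite -/d2 -yd -scalerDl -rmorphD (_ : 1 - m + (1 - m) = 2 * (1 - m)); last by ring.
  rewrite cmulNl cmulNr opprK scalerN /pm opprD addrA -{1}[oid V]scale1r -[1]/(1%:C) -scalerBl -rmorphB -ml.
  congr (_%:C *: _ + _); first by ring.
  by rewrite -shN opprB addrC.
have sy' : st (- y) = - y by rewrite cstarN sy.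
have : (nr (pm l d v) ^+ 2)%:C + (nr (pm (1 - m) (- y) v) ^+ 2)%:C = (nr v ^+ 2)%:C :> C.
  have sq (T : op V V) : ad T = T -> (nr (T v) ^+ 2)%:C = ip v ((T ** T) v).
    by move=> hT; rewrite -ip_nr -{1}hT adl.
  rewrite (sq _ (pm_ad l sd)) (sq _ (pm_ad (1 - m) sy')) -E opBE ipBr addrCA subrr addr0.
  exact: ip_nr.
rewrite -rmorphD => /complexI.
move=> h; rewrite -(ler_pXn2r (n := 2)) ?nnegrE ?nr_ge0// -h lerDl.
exact: sqr_ge0.
Qed.

Lemma ip_hom x v : ip v (phi (st x *' x) v) = (nr (phi x v) ^+ 2)%:C.
Proof. by rewrite (sh_mul Hphi) (sh_star Hphi) ocE adr ip_nr. Qed.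

Lemma hom_contr x v : nr (phi x v) <= nr x * nr v.
Proof.
have [->|x0] := eqVneq x 0; first by rewrite sh0 op0E !nr0 mul0r.
have c0 : 0 < nr x by rewrite nr_gt0.
have c2 : 0 < nr x ^+ 2 by rewrite exprn_gt0.
pose d := ((nr x ^+ 2)^-1)%:C *: (st x *' x).
have nd : nr d = 1.
  by rewrite nrZ nrC ger0_norm ?invr_ge0 ?ltW// nr_cstar_mul mulVf// gt_eqF.
have h : nr (pm 0 d v) <= nr v.
  apply: hom_um; rewrite ?normr0//.
    by rewrite /d cstarZ conjR cstarM cstarK.
  by move=> z; rewrite umE scale0r add0r -[leRHS]mul1r -nd nr_cmul.
have {}h : nr (phi d v) <= nr v by move: h; rewrite /pm opDE opZE scale0r add0r.
have : nr (ip v (phi d v)) <= nr v * nr v.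
  by apply: le_trans (CauchySchwarz _ _) _; rewrite ler_wpM2l ?nr_ge0.
rewrite /d shZ opZE ipZr ip_hom nrM !nrC !ger0_norm ?invr_ge0 ?sqr_ge0// mulrC ler_pdivrMr//.
move=> h2; rewrite -(ler_pXn2r (n := 2)) ?nnegrE ?mulr_ge0 ?nr_ge0//.
by rewrite exprMn mulrC.
Qed.

Hypothesis phi_inj : injective phi.

(** Put h = k^2 and choose r with rho^2 < r < 1. Let r - y be the root of (r - h)^2 given by
    [csqrt]. The representation sees h below r, and injectivity then forces h = y. Hence r - h is
    itself a square, and k^2 + (r - h) = r bounds multiplication by k by sqrt r < 1. *)
Lemma isom_key k (rho : R) : st k = k -> nr k = 1 -> 0 <= rho < 1 ->
  (forall v, nr (phi k v) <= rho * nr v) -> False.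
Proof.
move=> sk nk /andP[rho0 rho1] hk; pose h := k *' k.
have sh : st h = h by rewrite /h cstarM sk.
have nh : nr h = 1 by rewrite /h -{1}sk nr_cstar_mul nk expr1n.
have kh : k *' h = h *' k by rewrite /h cmulA.
have h0 : ucontr 0 h.
  by move=> z; rewrite umE scale0r add0r -[leRHS]mul1r -nh nr_cmul.
(* The root 1 - y of 1 - h satisfies (1 - y)^2 + k^2 = 1, so it is a contraction, and so is its
   square. *)
have h1 : ucontr 1 (- h).
  have [|m [y [m1 m2 sy _ [yd yk]]]] := csqrt _ sh h0; first by rewrite normr0.
  have m0 : m = 0.
    have : m * (2 - m) = 0 by rewrite -m2; ring.
    by move/eqP; rewrite mulf_eq0 => /orP[/eqP//|/eqP]; move: m1; rewrite ler_norml; lra.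
  rewrite {}m0 subr0 in yd.
  have sy' : st (- y) = - y by rewrite cstarN sy.
  have w z : nr (um 1 (- y) z) <= nr z.
    rewrite -(ler_pXn2r (n := 2)) ?nnegrE ?nr_ge0// -[leRHS]mul1r.
    apply: (@circle_bnd 1 (- y) 0 k (- h)) => //.
    - by rewrite cmulNl cmulNr yk.
    - by ring.
    - by rewrite -yd opprB scalerN cmulNl cmulNr opprK addrC.
    - by rewrite mulr0 scale0r add0r opprK.
  move=> z; have -> : um 1 (- h) z = um 1 (- y) (um 1 (- y) z).
    by rewrite umsq mulr1 -yd scalerN cmulNl cmulNr opprK opprB addrC.
  exact: le_trans (w _) (w _).
pose r := (rho ^+ 2 + 1) / 2.
have rr : rho ^+ 2 < r by rewrite /r; nra.
have r1 : r < 1 by rewrite /r; nra.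
have r0 : 0 < r by rewrite /r; nra.
(* h - r is (1 - r) h - r (1 - h), a combination of two contractions with coefficients of total size
   1. *)
have hS : ucontr (- r) h.
  move=> z; have -> : um (- r) h z = (1 - r)%:C *: um 0 h z - r%:C *: um 1 (- h) z.
    rewrite !umE scale0r add0r scale1r cmulNl scalerBr opprB addrA -scalerDl -rmorphD subrK scale1r.
    by rewrite rmorphN scaleNr addrC.
  apply: le_trans (nrB _ _) _; rewrite !nrZ !nrC gtr0_norm ?subr_gt0// gtr0_norm//.
  by have := h0 z; have := h1 z; have := nr_ge0 z; nra.
pose e := (2 * - r)%:C *: h + h *' h.
have se : st e = e by rewrite /e cstarD cstarZ conjR cstarM sh.
have he : h *' e = e *' h by rewrite /e cmulDr cmulDl cmulZr cmulZl cmulA.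
have c1 : ucontr (1 - r * r) (- e).
  have [||m [y [m1 m2 sy _ [yd yh]]]] := @csqrt R D (r * r) e _ se.
  - by rewrite ger0_norm; nra.
  - by move=> z; rewrite -[r * r]mulrNN -umsq; apply: le_trans (hS _) (hS _).
  have sy' : st (- y) = - y by rewrite cstarN sy.
  have w z : nr (um (1 - m) (- y) z) <= nr z.
    rewrite -(ler_pXn2r (n := 2)) ?nnegrE ?nr_ge0// -[leRHS]mul1r.
    apply: (@circle_bnd (1 - m) (- y) (- r) h (- e)) => //.
    - by rewrite cmulNl cmulNr yh.
    - by nra.
    - by rewrite -yd opprB scalerN cmulNl cmulNr opprK addrC.
    - by rewrite opprK.
  move=> z; have -> : um (1 - r * r) (- e) z = um (1 - m) (- y) (um (1 - m) (- y) z).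
    have E : (2 * (1 - m))%:C *: - y + - y *' - y = - e.
      by rewrite -yd scalerN cmulNl cmulNr opprK opprB addrC.
    by rewrite umsq E (_ : 1 - r * r = (1 - m) * (1 - m))//; nra.
  exact: le_trans (w _) (w _).
have [||m [y [m1 m2 sy yc [yd yh]]]] := @csqrt R D (1 - r * r) (- e) _ _ c1.
- by rewrite ger0_norm; nra.
- by rewrite cstarN se.
have mr : m = 1 - r.
  have : (m - (1 - r)) * (m - (1 + r)) = 0 by nra.
  move/eqP; rewrite mulf_eq0 !subr_eq0 => /orP[/eqP//|/eqP]; move: m1; rewrite ler_norml; lra.
(* (r - h)^2 = (r - y)^2 means that 2 r - (y + h) kills h - y. Under phi, y is at most r and h at
   most rho^2 < r, so that this factor is strictly positive and phi (h - y) vanishes. *)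
have hy : h = y.
  apply: phi_inj; apply/eqP; rewrite -subr_eq0 -shB; apply/eqP.
  apply: op_ext => v; rewrite op0E; set w := phi (h - y) v.
  have yh' : h *' y = y *' h by apply: yh; rewrite cmulNl cmulNr he.
  have Z : pm (2 * r) (- (y + h)) w = 0.
    have -> : w = pm 0 (h - y) v by rewrite /pm opDE opZE scale0r add0r.
    rewrite -[LHS]/((pm (2 * r) (- (y + h)) ** pm 0 (h - y)) v) pmM mulr0 scale0r addr0.
    suff -> : (2 * r)%:C *: (h - y) + (- (y + h)) *' (h - y) = 0.
      by rewrite /pm scale0r add0r sh0 op0E.
    have yd' : (2 * r)%:C *: h = (2 * r)%:C *: y - y *' y + h *' h.
      rewrite mr (_ : 1 - (1 - r) = r) in yd; last by ring.
      by rewrite yd /e opprD -scaleNr -rmorphN subrK; congr (_%:C *: _); ring.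
    have E : (y + h) *' (h - y) = h *' h - y *' y.
      by rewrite cmulDl !cmulDr !cmulNr yh' addrC addrA subrK.
    rewrite scalerBr cmulNl E yd'; move: (_ *: y) (y *' y) (h *' h) => b p q.
    by rewrite -addrA -opprD addrA [b - p + q]addrAC subrr.
  have l1 : `|1 - r| <= 1 by rewrite ger0_norm; lra.
  rewrite mr in yc; have yw := hom_um w l1 sy yc.
  have : complex.Re (ip w (pm (1 - r) y w)) <= nr w ^+ 2.
    apply: le_trans (Re_le_nr _) _; apply: le_trans (CauchySchwarz _ _) _.
    by rewrite expr2 ler_wpM2l ?nr_ge0.
  have hh : h = st k *' k by rewrite sk.
  have e1 : ip w (pm (2 * r) (- (y + h)) w) =
      (2 * r * nr w ^+ 2)%:C - ip w (phi y w) - (nr (phi k w) ^+ 2)%:C.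
    rewrite /pm opDE opZE oidE ipDr ipZr ip_nr -rmorphM shN opNE ipNr shD opDE ipDr opprD addrA.
    by rewrite hh ip_hom.
  have e2 : ip w (pm (1 - r) y w) = ((1 - r) * nr w ^+ 2)%:C + ip w (phi y w).
    by rewrite /pm opDE opZE oidE ipDr ipZr ip_nr -rmorphM.
  move: (f_equal (@complex.Re _) e1); rewrite Z ip0r raddfB raddfB /= e2 raddfD /=; have := hk w.
  move: (complex.Re _) (nr_ge0 (phi k w)) => Y.
  move: (nr_gt0 w); move: (nr (phi k w)) (nr w) (nr_ge0 w) => K N N0 Ngt K0 hK E1 E2.
  apply/eqP; rewrite -[_ == _]negbK -Ngt -leNgt.
  have : K * K <= (rho * N) * (rho * N) by apply: ler_pM.
  move=> KK; have : (r - rho ^+ 2) * N ^+ 2 <= 0 by nra.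
  rewrite pmulr_rle0 ?subr_gt0// => N2.
  by rewrite leNgt; apply/negP => N1; move: N2; rewrite leNgt exprn_gt0.
rewrite -hy mr in yc.
have [|m' [y' [m1' m2' sy' _ [yd' yk']]]] := @csqrt R D (1 - r) h _ sh yc.
- by rewrite ger0_norm; lra.
(* Multiplication by k is applied to k itself, where it yields h, of norm 1. *)
have : nr (um 0 k k) ^+ 2 <= r * nr k ^+ 2.
  apply: (@circle_bnd 0 k (1 - m') (- y') h) => //.
  - by rewrite cstarN sy'.
  - by rewrite cmulNl cmulNr yk'.
  - by nra.
  - by rewrite mulr0 scale0r add0r.
  - by rewrite -yd' opprB scalerN cmulNl cmulNr opprK addrC.
by rewrite umE scale0r add0r -/h nh nk; lra.
Qed.

Lemma hom_isom x M : 0 <= M -> (forall v, nr (phi x v) <= M * nr v) -> nr x <= M.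
Proof.
move=> M0 hM; rewrite leNgt; apply/negP => Mx.
have x0 : 0 < nr x by apply: le_lt_trans Mx.
have x2 : 0 < nr x ^+ 2 by rewrite exprn_gt0.
apply: (@isom_key (((nr x ^+ 2)^-1)%:C *: (st x *' x)) (M ^+ 2 / nr x ^+ 2)).
- by rewrite cstarZ conjR cstarM cstarK.
- by rewrite nrZ nrC ger0_norm ?invr_ge0 ?ltW// nr_cstar_mul mulVf// gt_eqF.
- by rewrite divr_ge0 ?sqr_ge0//= ltr_pdivrMr// mul1r ltrXn2r.
have h v : nr (phi (st x *' x) v) <= M ^+ 2 * nr v.
  rewrite (sh_mul Hphi) (sh_star Hphi) ocE; apply: le_trans (ad_bnd M0 hM _) _.
  by rewrite expr2 -mulrA ler_wpM2l.
move=> v; rewrite shZ opZE nrZ nrC gtr0_norm ?invr_gt0//.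
apply: le_trans (ler_wpM2l _ (h v)) _; first by rewrite invr_ge0 ltW.
by rewrite mulrA [_ * M ^+ 2]mulrC.
Qed.

End OneHom.
End Homs.

(** * Closed spans in D and density of products *)

Section NormClosure.
Variable R : realType.
Local Notation C := R[i].

Definition ncl (V : normedModType C) (S : set V) : set V := closure (lin_span S).

Lemma nclP (V : normedModType C) (S : set V) x :
  ncl S x <-> forall e : R, 0 < e -> exists2 s, lin_span S s & nr (x - s) <= e.
Proof. exact: closure_nrP. Qed.

Lemma ncl_sub (V : normedModType C) (S : set V) : S `<=` ncl S.
Proof. by move=> x Sx; apply: subset_closure; exact: lin_span_sub. Qed.

Lemma ncl0 (V : normedModType C) (S : set V) : ncl S 0.
Proof. by apply: subset_closure; exact: lin_span0. Qed.

Lemma ncl_lin (V : normedModType C) (S : set V) a u v : ncl S u -> ncl S v -> ncl S (a *: u + v).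
Proof.
move=> /nclP hu /nclP hv; apply/nclP => e e0.
have a1 : 0 < nr a + 1 by have := nr_ge0 a; lra.
have s1 : 0 < e / (2 * (nr a + 1)) by rewrite divr_gt0// mulr_gt0.
have s2 : 0 < e / 2 by lra.
have [s Ss hs] := hu _ s1; have [t St ht] := hv _ s2.
exists (a *: s + t); first by apply: lin_spanD => //; exact: lin_spanZ.
rewrite opprD addrACA -scalerBr; apply: le_trans (nrD _ _) _; rewrite nrZ.
suff : nr a * nr (u - s) <= e / 2 by lra.
rewrite ler_pdivlMr ?mulr_gt0// in hs; have := nr_ge0 (u - s); have := nr_ge0 a.
by move: hs; move: (nr _) (nr _) => x y; nra.
Qed.

Lemma ncl_lim (V : normedModType C) (S : set V) x :
  (forall e : R, 0 < e -> exists2 s, ncl S s & nr (x - s) <= e) -> ncl S x.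
Proof.
move=> h; apply/nclP => e e0; have e2 : 0 < e / 2 by lra.
have [s /nclP Ss hs] := h _ e2; have [t St ht] := Ss _ e2; exists t => //.
by apply: le_trans (nr_tri _ s _) _; lra.
Qed.

Lemma ncl_span (V : normedModType C) (S : set V) : lin_span (ncl S) `<=` ncl S.
Proof. by apply: lin_span_ind => [|a u v hu hv]; [exact: ncl0|exact: ncl_lin]. Qed.

Lemma ncl_le (V : normedModType C) (S S' : set V) : S `<=` ncl S' -> ncl S `<=` ncl S'.
Proof.
move=> h x /nclP hx; apply: ncl_lim => e /hx[s Ss hs]; exists s => //.
by apply: ncl_span; move: s Ss {hs}; apply: lin_span_le => y /h hy; exact: lin_span_sub.
Qed.

End NormClosure.

Section Products.
Variables (R : realType) (D : cstarType R) (V : hilbertType R) (phi : D -> op V V).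
Hypothesis Hphi : shom phi.
Hypothesis phi_inj : injective phi.
Local Notation C := R[i].
Local Notation "x *' y" := (cmul x y) (at level 40, left associativity).
Definition prods : set D := [set x | exists a b, x = a *' b].

(** The elements x_n = k (1 - k^2)^n differ from k by sums of products and tend to 0; their norms
    are estimated in the faithful representation, which is isometric. *)
Lemma prods_sa k : cstar k = k -> nr k <= 1 -> ncl prods k.
Proof.
move=> sk nk; pose K := phi k.
have aK : ad K = K by rewrite /K -(sh_star Hphi) sk.
have nK v : nr (K v) <= nr v.
  apply: le_trans (hom_contr Hphi k v) _; rewrite -[leRHS]mul1r.
  by rewrite ler_wpM2r ?nr_ge0.
pose G := oid V - K ** K.
have GE v : G v = v - K (K v) by [].
have hG v : nr (G v) ^+ 2 <= nr v ^+ 2 - nr (K v) ^+ 2.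
  have := nrDsq v (- K (K v)); rewrite nrN -GE => ->.
  have -> : ip v (- K (K v)) = - (nr (K v) ^+ 2)%:C by rewrite ipNr -{1}aK adr ip_nr.
  have : nr (K (K v)) ^+ 2 <= nr (K v) ^+ 2 by rewrite ler_pXn2r ?nnegrE ?nr_ge0.
  rewrite raddfN /=; move: (nr _ ^+ 2) (nr _ ^+ 2) (nr _ ^+ 2) => *; lra.
have nG v : nr (G v) <= nr v.
  rewrite -(ler_pXn2r (n := 2)) ?nnegrE ?nr_ge0//; apply: le_trans (hG v) _.
  by rewrite lerBlDr lerDl sqr_ge0.
have GK v : K (G v) = G (K v) by rewrite !GE opLB.
pose x n := iter n (fun y => y - y *' k *' k) k.
have xE n v : phi (x n) v = K (iter n G v).
  elim: n v => [|n IH] v //=.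
  rewrite (shB Hphi) !(sh_mul Hphi) opBE !ocE.
  by rewrite -opLB -[_ - _]/(G v) IH -iterSr.
(* Since |G w|^2 + |K w|^2 <= |w|^2, each step gains a term |K G^n v|^2. These terms decrease, so n
   copies of the last one fit below |v|^2 and the norm of x_n is at most n^(-1/2). *)
have hx n v : n%:R * nr (phi (x n) v) ^+ 2 + nr (iter n G v) ^+ 2 <= nr v ^+ 2.
  elim: n => [|n IH]; first by rewrite mul0r add0r.
  apply: le_trans IH; rewrite !xE /= GK -natr1.
  have := hG (iter n G v); have : nr (G (K (iter n G v))) ^+ 2 <= nr (K (iter n G v)) ^+ 2.
    by rewrite ler_pXn2r ?nnegrE ?nr_ge0.
  have : 0 <= n%:R :> R by [].
  move: (n%:R) (nr _ ^+ 2) (nr _ ^+ 2) (nr (K _) ^+ 2) (nr _ ^+ 2) => a b c d f; nra.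
have kx n : ncl prods (k - x n).
  elim: n => [|n IH]; first by rewrite subrr; exact: ncl0.
  have -> : k - x n.+1 = 1 *: (k - x n) + x n *' k *' k.
    by rewrite scale1r /= opprB addrCA addrC.
  by apply: ncl_lin => //; apply: ncl_sub; exists (x n *' k), k.
apply: ncl_lim => e e0; pose N := Num.trunc (e ^+ 2)^-1.
exists (k - x N.+1) => //; rewrite opprB addrC subrK.
apply: (hom_isom Hphi phi_inj); first exact: ltW.
move=> v; rewrite -(ler_pXn2r (n := 2)) ?nnegrE ?mulr_ge0 ?nr_ge0 ?(ltW e0)//.
have := hx N.+1 v; have : (e ^+ 2)^-1 < N.+1%:R by rewrite /N truncnS_gt.
rewrite exprMn; have e2 : 0 < e ^+ 2 by rewrite exprn_gt0.
rewrite -[X in X < _]mul1r ltr_pdivrMr// => h1 h2.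
have a0 := sqr_ge0 (nr (phi (x N.+1) v)); have b0 := sqr_ge0 (nr (iter N.+1 G v)).
move: h1 h2 a0 b0 e2; set b := nr _ ^+ 2; set c := nr (iter _ _ _) ^+ 2; set d := nr v ^+ 2.
move: (N.+1%:R) (e ^+ 2) b c d => a f b c d h1 h2 b0 c0 f0.
have h3 : b <= (a * f) * b by rewrite -[leLHS]mul1r ler_wpM2r// ltW.
have h4 : f * (a * b + c) <= f * d by rewrite ler_wpM2l// ltW.
have h5 : 0 <= f * c by rewrite mulr_ge0// ltW.
by nra.
Qed.

Lemma prods_dense x : ncl prods x.
Proof.
have sa k : cstar k = k -> ncl prods k.
  move=> sk; have [->|k0] := eqVneq k 0; first exact: ncl0.
  have n0 : 0 < nr k by rewrite nr_gt0.
  have -> : k = (nr k)%:C *: (((nr k)^-1)%:C *: k) + 0.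
    by rewrite addr0 scalerA -rmorphM mulfV ?gt_eqF// scale1r.
  apply: ncl_lin (ncl0 _); apply: prods_sa; first by rewrite cstarZ conjR sk.
  by rewrite nrZ nrC gtr0_norm ?invr_gt0// mulVf// gt_eqF.
have ci : cj 'i%C = - 'i%C :> C by apply/eqP; rewrite eq_complex/= oppr0 !eqxx.
have ii : 'i%C * 'i%C = -1 :> C by rewrite -expr2 sqr_i.
have h1 : ncl prods (x + cstar x) by apply: sa; rewrite cstarD cstarK addrC.
have h2 : ncl prods ('i%C *: (cstar x - x)).
  by apply: sa; rewrite cstarZ cstarD cstarN cstarK ci scaleNr -scalerN opprB.
have -> : x = (2^-1)%:C *: ('i%C *: ('i%C *: (cstar x - x)) + (x + cstar x)) + 0.
  rewrite addr0 scalerA ii scaleN1r opprB [x + _]addrC addrA subrK.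
  have E : x + x = 2%:C *: x by rewrite (_ : 2%:C = 1 + 1 :> C) ?scalerDl ?scale1r// -rmorphD.
  have h0 : (2^-1)%:C * 2%:C = 1 :> C by rewrite -rmorphM mulVf ?pnatr_eq0.
  by rewrite E scalerA h0 scale1r.
by apply: ncl_lin (ncl0 _); exact: ncl_lin.
Qed.

End Products.

(** * Matrices over D *)

Section PowerTrick.
Variables (R : realType) (V : hilbertType R).

Lemma pow_unbounded (q c : R) : 1 < q -> exists k, c < q ^+ (2 ^ k)%N.
Proof.
move=> q1; pose k := Num.trunc (c / (q - 1)); exists k.+1.
have q0 : 0 < q - 1 by lra.
have bern n : 1 + n%:R * (q - 1) <= q ^+ n.
  elim: n => [|n IH]; first by rewrite mul0r addr0 expr0.
  rewrite exprS -natr1; have : 0 <= n%:R :> R by [].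
  have : q * (1 + n%:R * (q - 1)) <= q * q ^+ n by rewrite ler_wpM2l//; lra.
  move=> h1 h2; have := mulr_ge0 h2 (sqr_ge0 (q - 1)); move: h1 h2.
  by move: (n%:R) (q * q ^+ n) => a b; nra.
apply: lt_le_trans (bern _).
have h : c / (q - 1) < k.+1%:R by rewrite /k truncnS_gt.
rewrite ltr_pdivrMr// in h; apply: lt_le_trans h _.
have : k.+1%:R <= (2 ^ k.+1)%:R :> R by rewrite ler_nat; exact/ltnW/ltn_expl.
by move: (_%:R) (_%:R) => a b; nra.
Qed.

(** For selfadjoint operators the ratios a_k = |H_k v| / |v| satisfy a_k^2 <= a_(k+1). So a_0 to the
    power 2^k stays below c N^(2^k) for all k, and the constant c disappears in the limit. *)
Lemma pow_trick (Hs : nat -> op V V) (c N : R) : 0 <= c -> 0 <= N ->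
  (forall k, ad (Hs k) = Hs k) -> (forall k, Hs k.+1 = Hs k ** Hs k) ->
  (forall k v, nr (Hs k v) <= c * N ^+ (2 ^ k) * nr v) -> forall v, nr (Hs 0 v) <= N * nr v.
Proof.
move=> c0 N0 sa sq hb v; rewrite leNgt; apply/negP => hv.
have v0 : 0 < nr v.
  rewrite nr_gt0; apply/eqP => v0; move: hv; rewrite v0 opL0 !nr0 mulr0 ltxx//.
pose a k := nr (Hs k v) / nr v.
have aa k : a k ^+ 2 <= a k.+1.
  have h : nr (ip v (Hs k (Hs k v))) <= nr v * nr (Hs k (Hs k v)) by exact: CauchySchwarz.
  have E : ip v (Hs k (Hs k v)) = (nr (Hs k v) ^+ 2)%:C by rewrite -ip_nr -adr sa.
  rewrite E nrC ger0_norm ?sqr_ge0// in h.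
  rewrite /a expr_div_n ler_pdivrMr ?exprn_gt0// sq ocE [X in _ * X]expr2 mulrA divfK ?gt_eqF//.
  by rewrite mulrC.
have ak k : a 0 ^+ (2 ^ k) <= a k.
  elim: k => [|k IH]; first by rewrite expr1.
  rewrite expnSr exprM; apply: le_trans (aa k).
  by rewrite lerXn2r// nnegrE ?exprn_ge0 ?divr_ge0 ?nr_ge0.
have a0 : N < a 0 by rewrite /a ltr_pdivlMr.
have bk k : a k <= c * N ^+ (2 ^ k) by rewrite /a ler_pdivrMr.
have [N00|N00] := eqVneq N 0.
  by have := bk 0%N; rewrite N00 expr1 mulr0; move: a0; rewrite N00; lra.
have Np : 0 < N by rewrite lt_neqAle eq_sym N00.
have q1 : 1 < a 0 / N by rewrite ltr_pdivlMr// mul1r.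
have [k hk] := pow_unbounded c q1.
have := le_trans (ak k) (bk k); rewrite leNgt => /negP; apply.
by rewrite -ltr_pdivlMr ?exprn_gt0// -expr_div_n.
Qed.

End PowerTrick.

Section Matrices.
Variables (R : realType) (D : cstarType R) (H : hilbertType R).
Local Notation C := R[i].
Local Notation "x *' y" := (cmul x y) (at level 40, left associativity).
Variables (f : nat -> H) (n : nat).
Hypothesis of_ : onf f.
Local Notation mat := ('I_n -> 'I_n -> D).

(** The weight is 1 or 0 for an orthonormal family with zeros: indices at which f vanishes are left
    out of the product. *)
Definition mmul (x y : mat) : mat := fun i j => \sum_(k < n) ip (f k) (f k) *: (x i k *' y k j).
Definition mstar (x : mat) : mat := fun i j => cstar (x j i).

Section Mop.
Variables (V N : hilbertType R) (m : tmap V H N) (phi : D -> op V V).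
Hypothesis Hphi : shom phi.

Definition mop (x : mat) : op N N :=
  \sum_(i < n) \sum_(j < n) amp m m (phi (x i j)) ** legr m (rk (f i) (f j)).

Lemma mopE x v u : mop x (m v u) = \sum_(i < n) \sum_(j < n) ip (f j) u *: m (phi (x i j) v) (f i).
Proof.
rewrite /mop op_sumE; apply: eq_bigr => i _; rewrite op_sumE; apply: eq_bigr => j _.
have E : legr m (rk (f i) (f j)) (m v u) = m v (rk (f i) (f j) u) by exact: (ampE (tsw m)).
by rewrite ocE E ampE /= -(opLZ (ketl m _)).
Qed.

Lemma phi_sum (I : Type) (r : seq I) (P : pred I) (F : I -> D) :
  phi (\sum_(i <- r | P i) F i) = \sum_(i <- r | P i) phi (F i).
Proof. exact: (big_morph _ (shD Hphi) (sh0 Hphi)). Qed.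

Lemma mopM x y : mop (mmul x y) = mop x ** mop y.
Proof.
apply: (tm_op_ext (m := m)) => v u; rewrite ocE !mopE opL_sum exchange_big/=.
under [RHS]eq_bigr do rewrite opL_sum; rewrite [RHS]exchange_big/=.
apply: eq_bigr => l _; rewrite [RHS](eq_bigr (fun k : 'I_n => \sum_(i < n) ip (f l) u *:
    (ip (f k) (f k) *: m (phi (x i k *' y k l) v) (f i)))); last first.
  move=> k _; rewrite opLZ mopE scaler_sumr; apply: eq_bigr => i _.
  rewrite (bigD1 k)//= big1 ?addr0; first by rewrite (sh_mul Hphi).
  by move=> j jk; rewrite of_.1// scale0r.
rewrite exchange_big/=; apply: eq_bigr => i _; rewrite -scaler_sumr; congr (_ *: _).
rewrite /mmul phi_sum op_sumE -[m _ _]/(ketr m (f i) _) opL_sum; apply: eq_bigr => k _.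
by rewrite (shZ Hphi) opZE opLZ.
Qed.

Lemma mop_star x : mop (mstar x) = ad (mop x).
Proof.
rewrite /mop ad_sum exchange_big/=; apply: eq_bigr => i _; rewrite ad_sum; apply: eq_bigr => j _.
rewrite adM !ad_amp ad_rk -(sh_star Hphi); exact: amp_comm.
Qed.

Lemma mop_entry x (i j : 'I_n) : ip (f i) (f i) = 1 -> ip (f j) (f j) = 1 ->
  sr m (f i) (f j) (mop x) = phi (x i j).
Proof.
move=> fi fj; apply: op_ext_ip => v w; rewrite srE mopE ip_sumr (bigD1 i)//= [X in _ + X]big1 ?addr0.
  rewrite ip_sumr (bigD1 j)//= [X in _ + X]big1 ?addr0; first by rewrite fj scale1r tmip fi mulr1.
  by move=> k kj; rewrite of_.1// scale0r ip0r.
move=> k ki; rewrite ip_sumr big1// => l _.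
by rewrite ipZr tmip (of_.1 i k) ?mulr0// eq_sym.
Qed.

Lemma mop_bnd x (M : R) z : 0 <= M ->
  (forall i j : 'I_n, ip (f i) (f i) = 1 -> ip (f j) (f j) = 1 -> nr (x i j) <= M) ->
  nr (mop x z) <= (n%:R * n%:R * M) * nr z.
Proof.
move=> M0 hx; rewrite /mop op_sumE; apply: le_trans (nr_sum _ _ _) _.
have -> : n%:R * n%:R * M * nr z = \sum_(i < n) \sum_(j < n) M * nr z.
  under eq_bigr do rewrite sumr_const card_ord; rewrite sumr_const card_ord -mulrnA.
  by rewrite -[RHS]mulr_natr natrM; ring.
apply: ler_sum => i _; rewrite op_sumE; apply: le_trans (nr_sum _ _ _) _.
apply: ler_sum => j _; rewrite ocE.
have z0 : 0 <= M * nr z by rewrite mulr_ge0 ?nr_ge0.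
case: (of_.2 i) => [fi|fi].
  rewrite fi (_ : rk 0 _ = 0); last by apply: op_ext => v; rewrite /= scaler0.
  by rewrite (_ : legr m 0 = 0) ?opL0 ?nr0//; apply/esym/(amp_uniq (m := tsw m)) => u v; rewrite /= -ketlE opL0.
case: (of_.2 j) => [fj|fj].
  rewrite fj (_ : rk _ 0 = 0); last by apply: op_ext => v; rewrite /= ip0l scale0r.
  by rewrite (_ : legr m 0 = 0) ?opL0 ?nr0//; apply/esym/(amp_uniq (m := tsw m)) => u v; rewrite /= -ketlE opL0.
apply: le_trans (amp_bnd _ _ M0 _ _) _.
  by move=> v; apply: le_trans (hom_contr Hphi _ _) _; rewrite ler_wpM2r ?nr_ge0// hx.
have n1 k : ip (f k) (f k) = 1 -> nr (f k) = 1.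
  by rewrite ip_nr => /complexI/eqP; rewrite sqrp_eq1 ?nr_ge0// => /eqP.
rewrite ler_wpM2l// -[leRHS]mul1r; apply: amp_bnd => // v /=.
rewrite nrZ n1// mulr1 mul1r; apply: le_trans (CauchySchwarz _ _) _.
by rewrite n1// mul1r.
Qed.

End Mop.

Variables (K KH L LH : hilbertType R) (kh : tmap K H KH) (lh : tmap L H LH).
Variables (pi : D -> op K K) (rho : D -> op L L).
Hypotheses (Hpi : shom pi) (pi_inj : injective pi) (Hrho : shom rho).

(* Compare the norms of h^(2^k) for h = x^* x. *)
Lemma mop_contr x (M : R) : 0 <= M -> (forall z, nr (mop kh pi x z) <= M * nr z) ->
  forall z, nr (mop lh rho x z) <= M * nr z.
Proof.
move=> M0 hM z.
have [N NE] : exists N, N = M ^+ 2 by exists (M ^+ 2).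
have N0 : 0 <= N by rewrite NE exprn_ge0.
pose xs k := iter k (fun y => mmul y y) (mmul (mstar x) x).
have sa (V V2 : hilbertType R) (m : tmap V H V2) (phi : D -> op V V) (Hphi : shom phi) k :
    ad (mop m phi (xs k)) = mop m phi (xs k).
  elim: k => [|k IH] /=; first by rewrite mopM// adM mop_star// adK.
  by rewrite mopM// adM IH.
have sq (V V2 : hilbertType R) (m : tmap V H V2) (phi : D -> op V V) (Hphi : shom phi) k :
    mop m phi (xs k.+1) = mop m phi (xs k) ** mop m phi (xs k) by rewrite /= mopM.
have hpi k y : nr (mop kh pi (xs k) y) <= N ^+ (2 ^ k) * nr y.
  elim: k y => [|k IH] y.
    rewrite expr1 /= mopM// mop_star// ocE; apply: le_trans (ad_bnd M0 hM _) _.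
    by rewrite NE expr2 -mulrA ler_wpM2l.
  rewrite sq// ocE; apply: le_trans (IH _) _; rewrite expnSr exprM expr2 -mulrA ler_wpM2l//.
  exact: exprn_ge0.
(* Each entry is bounded by the norm of the matrix in pi, because pi is isometric on D. Adding up
   the entries costs n^2, a factor that [pow_trick] removes. *)
have hrho k y : nr (mop lh rho (xs k) y) <= (n%:R * n%:R) * N ^+ (2 ^ k) * nr y.
  apply: mop_bnd => // [|i j fi fj]; first exact: exprn_ge0.
  apply: (hom_isom Hpi pi_inj); first exact: exprn_ge0.
  move=> v; rewrite -(mop_entry kh pi _ fi fj) /sr !ocE.
  have n1 k' : ip (f k') (f k') = 1 -> nr (f k') = 1.
    by rewrite ip_nr => /complexI/eqP; rewrite sqrp_eq1 ?nr_ge0// => /eqP.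
  apply: le_trans (ad_bnd (M := 1) ler01 _ _) _.
    by move=> w; rewrite ketrE nr_tm n1// mulr1 mul1r.
  by rewrite mul1r; apply: le_trans (hpi _ _) _; rewrite ketrE nr_tm n1// mulr1.
have h0 := pow_trick (mulr_ge0 (ler0n _ n) (ler0n _ n)) N0
  (sa _ _ lh rho Hrho) (sq _ _ lh rho Hrho) hrho z.
rewrite -(ler_pXn2r (n := 2)) ?nnegrE ?mulr_ge0 ?nr_ge0//.
have E : ip z (mop lh rho (xs 0) z) = (nr (mop lh rho x z) ^+ 2)%:C.
  by rewrite /= mopM// mop_star// ocE adr ip_nr.
have := CauchySchwarz z (mop lh rho (xs 0) z); rewrite E nrC ger0_norm ?sqr_ge0//.
move=> h; apply: le_trans h _; rewrite exprMn.
by rewrite -NE mulrC [nr z ^+ 2]expr2 mulrA; apply: ler_wpM2r; [exact: nr_ge0|].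
Qed.

End Matrices.

(** * Change of the faithful representation *)

Section LocalForms.
Variable R : realType.
Local Notation C := R[i].

Lemma nr_le_span (H : hilbertType R) (S : set H) (y : H) (B : R) : total S -> 0 <= B ->
  (forall z, lin_span S z -> nr (ip z y) <= B * nr z) -> nr y <= B.
Proof.
move=> /totalP tS B0 h; have [->|y0] := eqVneq y 0; first by rewrite nr0.
have yp : 0 < nr y by rewrite nr_gt0.
suff : nr y * nr y <= B * nr y by rewrite ler_pM2r.
rewrite -subr_le0; apply: (le0_eps (M := nr y + B)) => e e0.
have [z Sz hz] := tS y e e0; have := h z Sz.
have : nr y * nr y <= nr (ip (y - z) y) + nr (ip z y).
  have -> : nr y * nr y = nr (ip y y) by rewrite ip_nr nrC ger0_norm ?sqr_ge0// expr2.
  have -> : ip y y = ip (y - z) y + ip z y by rewrite -ipDl subrK.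
  exact: nrD.
have := CauchySchwarz (y - z) y; have : nr z <= nr y + e.
  by have := nr_tri z y 0; rewrite !subr0 nrBC; lra.
move: hz (nr_ge0 z); move: (nr (y - z)) (nr (ip _ _)) (nr (ip _ _)) (nr z) => a b c d h1 h2 h3 h4 h5 h6.
have : a * nr y <= e * nr y by rewrite ler_wpM2r// ltW.
have : B * d <= B * (nr y + e) by rewrite ler_wpM2l.
by nra.
Qed.

Variables (L H N : hilbertType R) (m : tmap L H N) (b : L -> H -> L -> H -> C) (M : R).
Hypothesis M0 : 0 <= M.
Hypothesis loc : forall us : seq H, exists2 S : op N N, (forall z, nr (S z) <= M * nr z) &
  forall l' u' l u, u' \in us -> u \in us -> ip (m l' u') (S (m l u)) = b l' u' l u.

(** A bound on finite sums involves finitely many vectors of H only, so operators that realize b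
    locally with a common bound M bound the form globally. *)
Lemma op_of_local : exists2 S : op N N, (forall z, nr (S z) <= M * nr z) &
  forall l' u' l u, ip (m l' u') (S (m l u)) = b l' u' l u.
Proof.
have sum_loc n (c : 'I_n -> C) (i : 'I_n -> L * H) k (d : 'I_k -> C) (j : 'I_k -> L * H) :
    nr (\sum_p \sum_q cj (c p) * (d q * b (i p).1 (i p).2 (j q).1 (j q).2)) <=
    nr (\sum_p c p *: m (i p).1 (i p).2) * (M * nr (\sum_q d q *: m (j q).1 (j q).2)).
  pose us := [seq (i p).2 | p <- enum 'I_n] ++ [seq (j q).2 | q <- enum 'I_k].
  have ui p : (i p).2 \in us.
    by rewrite mem_cat; apply/orP; left; apply/mapP; exists p; rewrite ?mem_enum.
  have uj q : (j q).2 \in us.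
    by rewrite mem_cat; apply/orP; right; apply/mapP; exists q; rewrite ?mem_enum.
  have [S hS hb] := loc us.
  have -> : \sum_p \sum_q cj (c p) * (d q * b (i p).1 (i p).2 (j q).1 (j q).2) =
      ip (\sum_p c p *: m (i p).1 (i p).2) (S (\sum_q d q *: m (j q).1 (j q).2)).
    rewrite ip_suml; apply: eq_bigr => p _; rewrite opL_sum ip_sumr; apply: eq_bigr => q _.
    by rewrite opLZ ipZl ipZr hb.
  by apply: le_trans (CauchySchwarz _ _) _; rewrite ler_wpM2l ?nr_ge0.
(* A fixed unit vector e carries scalar values, so that [ext_fam] with target N also extends
   functionals. Without one, N is zero. *)
have [[e e1]|ne] := pselect (exists e : N, ip e e = 1); last first.
  have z0 (z : N) : z = 0.
    apply/eqP; apply/negPn/negP => z0; apply: ne; exists (((nr z)^-1)%:C *: z).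
    have n0 : nr z != 0 by rewrite nr_eq0.
    rewrite ip_nr nrZ nrC ger0_norm ?invr_ge0 ?nr_ge0// mulVf// expr1n//.
  exists 0 => [z|l' u' l u]; first by rewrite op0E nr0 mulr_ge0 ?nr_ge0.
  have [S _ hb] := loc [:: u'; u].
  by rewrite -hb ?inE ?eqxx ?orbT// [m l' u']z0 !ip0l.
have ne : nr e = 1.
  by move: e1; rewrite ip_nr => /complexI/eqP; rewrite sqrp_eq1 ?nr_ge0// => /eqP.
have hw (p : L * H) : exists w : N, forall l' u', ip (m l' u') w = b l' u' p.1 p.2.
  have [||||F [WtQ Wt_Q F3]] := @ext_fam R N N (L * H)%type idfun (fun q => m q.1 q.2)
     (fun q => cj (b q.1 q.2 p.1 p.2) *: e) (M * nr (m p.1 p.2)).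
  - by [].
  - by rewrite mulr_ge0 ?nr_ge0.
  - exact: tmT.
  - move=> n c i /=; rewrite mulrC.
    have := @sum_loc n c i 1%N (fun=> 1) (fun=> p); rewrite big_ord1 scale1r => h; apply: le_trans h.
    rewrite le_eqVlt; apply/orP; left; apply/eqP.
    under eq_bigr do rewrite scalerA; rewrite -scaler_suml nrZ ne mulr1 -nr_conj rmorph_sum.
    congr (nr _); apply: eq_bigr => k _; rewrite big_ord1 mul1r rmorphM; congr (_ * _).
    exact: cjK.
  have [|z|w hw] := @Riesz R N (fun z => ip e (F z)) (M * nr (m p.1 p.2)).
  - by move=> a u v; rewrite Wt_Q ipPr.
  - by apply: le_trans (CauchySchwarz _ _) _; rewrite ne mul1r.
  exists w => l' u'; rewrite ipC -hw (WtQ (l', u')) ipZr e1 mulr1.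
  exact: cjK.
have [w hw'] := choice hw.
have [||||F [WtQ Wt_Q F3]] := @ext_fam R N N (L * H)%type idfun (fun q => m q.1 q.2) w M.
- by [].
- by [].
- exact: tmT.
- move=> n c i /=; apply: (nr_le_span (tmT m)); first by rewrite mulr_ge0 ?nr_ge0.
  move=> _ [k [d [s [hs ->]]]].
  have /choice[j hj] : forall q, exists p, m p.1 p.2 = s q by move=> q; have [p _ <-] := hs q; exists p.
  rewrite [leRHS]mulrC; have := sum_loc k d j n c i.
  rewrite (eq_bigr (fun q => d q *: s q)); last by move=> q _; rewrite hj.
  move=> h; apply: le_trans h; rewrite le_eqVlt; apply/orP; left; apply/eqP; congr (nr _).
  rewrite ip_suml; apply: eq_bigr => p _; rewrite ip_sumr; apply: eq_bigr => q _.
  by rewrite ipZl ipZr -hj hw'.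
have bF : blin F by split=> //; exists M.
by exists (Op bF) => // l' u' l u /=; rewrite (WtQ (l, u)) hw'.
Qed.

End LocalForms.

Section Fubini.
Variables (R : realType) (D : cstarType R) (H K KH L LH : hilbertType R).
Variables (kh : tmap K H KH) (lh : tmap L H LH) (pi : D -> op K K) (rho : D -> op L L).
Hypotheses (Hpi : shom pi) (pi_inj : injective pi) (Hrho : shom rho).
Local Notation C := R[i].

(* T and S are the images under pi (x) id and rho (x) id of the same element
   of the Fubini tensor product of D and B(H). *)
Definition fub (T : op KH KH) (S : op LH LH) :=
  forall u v, exists d, sr kh u v T = pi d /\ sr lh u v S = rho d.

Lemma sr_sum (V N : hilbertType R) (m : tmap V H N) n (a b : 'I_n -> C) (f : 'I_n -> H) (T : op N N) :
  sr m (\sum_i a i *: f i) (\sum_j b j *: f j) T =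
  \sum_i \sum_j (cj (a i) * b j) *: sr m (f i) (f j) T.
Proof.
apply: op_ext_ip => x y; rewrite srE op_sumE ip_sumr -!(ketlE m) !opL_sum ip_suml.
apply: eq_bigr => i _; rewrite op_sumE !ip_sumr; apply: eq_bigr => j _.
by rewrite !opLZ ipZl ipZr opZE ipZr srE mulrA.
Qed.

Lemma mop_mx (V N : hilbertType R) (m : tmap V H N) (phi : D -> op V V) (Hphi : shom phi)
    (f : nat -> H) n (x : 'I_n -> 'I_n -> D) v' u' v u :
  ip (m v' u') (mop f m phi x (m v u)) =
  ip v' (phi (\sum_(i < n) \sum_(j < n) (cj (ip (f i) u') * ip (f j) u) *: x i j) v).
Proof.
rewrite mopE ip_sumr (phi_sum Hphi) op_sumE ip_sumr; apply: eq_bigr => i _.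
rewrite ip_sumr (phi_sum Hphi) op_sumE ip_sumr; apply: eq_bigr => j _.
by rewrite ipZr tmip (shZ Hphi) opZE ipZr -ipC; ring.
Qed.

Lemma fub_ex (T : op KH KH) (M : R) : 0 <= M -> (forall z, nr (T z) <= M * nr z) ->
  (forall u v, exists d, sr kh u v T = pi d) ->
  exists2 S, fub T S & forall z, nr (S z) <= M * nr z.
Proof.
move=> M0 hM hT.
have /choice[t0 ht0] : forall p : H * H, exists d, sr kh p.1 p.2 T = pi d by move=> p; exact: hT.
pose t u v := t0 (u, v); have ht u v : sr kh u v T = pi (t u v) by exact: (ht0 (u, v)).
have [//|us|S hS hb] := @op_of_local R L H LH lh (fun l' u' l u => ip l' (rho (t u' u) l)) M.
  pose g k := nth 0 us k; pose f := gs g; pose n := size us.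
  have of_ : onf f by exact: gs_onf.
  pose x (i j : 'I_n) := t (f i) (f j).
  have tE u u' : pi (\sum_(i < n) \sum_(j < n) (cj (ip (f i) u') * ip (f j) u) *: x i j) =
      sr kh (\sum_(i < n) ip (f i) u' *: f i) (\sum_(j < n) ip (f j) u *: f j) T.
    rewrite sr_sum (phi_sum Hpi); apply: eq_bigr => i _; rewrite (phi_sum Hpi).
    by apply: eq_bigr => j _; rewrite (shZ Hpi) ht.
  exists (mop f lh rho x).
    apply: (@mop_contr R D H f n of_ K KH L LH kh lh pi rho Hpi pi_inj Hrho x M M0).
    (* The projection onto the span of the chosen vectors; the matrix x is the compression of T by
       it and inherits the bound M. *)
    pose P := \sum_(i < n) rk (f i) (f i).
    have PE u : P u = \sum_(i < n) ip (f i) u *: f i by rewrite /P op_sumE.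
    have aP : ad P = P by rewrite /P ad_sum; apply: eq_bigr => i _; rewrite ad_rk.
    have PP u : P (P u) = P u.
      rewrite [in LHS](PE u) opL_sum [RHS]PE; apply: eq_bigr => i _; rewrite opLZ PE (bigD1 i)//= big1 ?addr0.
        by case: (of_.2 i) => ->; rewrite ?scaler0// scale1r.
      by move=> j ji; rewrite of_.1 ?scale0r.
    have nP u : nr (P u) <= nr u.
      have [->|p0] := eqVneq (P u) 0; first by rewrite nr0 nr_ge0.
      have p1 : 0 < nr (P u) by rewrite nr_gt0.
      rewrite -(ler_pM2r p1) -expr2; have := CauchySchwarz u (P u).
      by rewrite -{1}(PP u) -{1}aP adr ip_nr nrC ger0_norm ?sqr_ge0.
    have nL z : nr (legr kh P z) <= nr z.
      by rewrite -[leRHS]mul1r; apply: amp_bnd => // u; rewrite mul1r.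
    have -> : mop f kh pi x = ad (legr kh P) ** T ** legr kh P.
      apply: (op_eq_mx (tmT kh) (tmT kh)) => _ _ [[k' u'] _ <-] [[k u] _ <-].
      rewrite mop_mx// tE -!PE srE !ocE adr.
      have E y w : legr kh P (kh y w) = kh y (P w) by exact: (ampE (tsw kh)).
      by rewrite !E.
    move=> z; rewrite !ocE ad_amp aP; apply: le_trans (nL _) _; apply: le_trans (hM _) _.
    by rewrite ler_wpM2l.
  move=> l' u' l u hu' hu; rewrite mop_mx//; congr (ip _ (opf (rho _) _)).
  have uE w : w \in us -> \sum_(i < n) ip (f i) w *: f i = w.
    by move=> /(nthP 0)[k kn <-]; have := gs_span g kn; rewrite -/f => E; apply/esym.
  by apply: pi_inj; rewrite tE !uE// ht.
exists S => // u v; exists (t u v); split=> //.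
by apply: op_ext_ip => x y; rewrite srE hb.
Qed.

Lemma fub_uniq T S S' : fub T S -> fub T S' -> S = S'.
Proof.
move=> h h'; apply: (sr_ext (m := lh)) => u v; have [d [h1 ->]] := h u v.
by have [d' [h1' ->]] := h' u v; congr rho; apply: pi_inj; rewrite -h1 -h1'.
Qed.

Lemma fub_slice T S : fub T S -> forall u v, exists d, sr kh u v T = pi d.
Proof. by move=> h u v; have [d [h1 _]] := h u v; exists d. Qed.

Lemma fub_bnd T S (M : R) : fub T S -> 0 <= M -> (forall z, nr (T z) <= M * nr z) ->
  forall z, nr (S z) <= M * nr z.
Proof.
move=> h M0 hM; have [S' h' hb] := fub_ex M0 hM (fub_slice h).
by rewrite (fub_uniq h h').
Qed.

Lemma sr_lin (V N : hilbertType R) (m : tmap V H N) u v a (T T' : op N N) :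
  sr m u v (a *: T + T') = a *: sr m u v T + sr m u v T'.
Proof. by rewrite /sr ocDr ocZr ocDl ocZl. Qed.

Lemma fub_lin a T S T' S' : fub T S -> fub T' S' -> fub (a *: T + T') (a *: S + S').
Proof.
move=> h h' u v; have [d [h1 h2]] := h u v; have [d' [h1' h2']] := h' u v.
by exists (a *: d + d'); rewrite !sr_lin h1 h2 h1' h2' (sh_lin Hpi) (sh_lin Hrho).
Qed.

Lemma fubB T S T' S' : fub T S -> fub T' S' -> fub (T - T') (S - S').
Proof.
by move=> h h'; have := fub_lin (-1) h' h; rewrite !scaleN1r ![- _ + _]addrC.
Qed.

Lemma fub0 : fub 0 0.
Proof. by move=> u v; exists 0; rewrite /sr !oc0r !oc0l (sh0 Hpi) (sh0 Hrho). Qed.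

Lemma fub_ad T S : fub T S -> fub (ad T) (ad S).
Proof.
move=> h u v; have [d [h1 h2]] := h v u; exists (cstar d).
by rewrite -!ad_sr h1 h2 (sh_star Hpi) (sh_star Hrho).
Qed.

Lemma sr_legr (V N : hilbertType R) (m : tmap V H N) u v a (T : op N N) :
  sr m u v (T ** legr m a) = sr m u (a v) T.
Proof. by rewrite -!sl_sw sl_ampr. Qed.

Lemma fub_legr T S a : fub T S -> fub (T ** legr kh a) (S ** legr lh a).
Proof. by move=> h u v; rewrite !sr_legr; exact: h. Qed.

Lemma fub_simple T S d a : fub T S ->
  fub (T ** (amp kh kh (pi d) ** legr kh a)) (S ** (amp lh lh (rho d) ** legr lh a)).
Proof.
move=> h u v; rewrite !ocA !sr_legr !sr_ampr; have [e [-> ->]] := h u (a v).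
by exists (cmul e d); rewrite (sh_mul Hpi) (sh_mul Hrho).
Qed.

Lemma fub_elem d a : fub (amp kh kh (pi d) ** legr kh a) (amp lh lh (rho d) ** legr lh a).
Proof.
have E (V N : hilbertType R) (m : tmap V H N) (T : op V V) u v :
    sr m u v (amp m m T ** legr m a) = ip u (a v) *: T.
  rewrite sr_legr; apply: op_ext_ip => x y.
  by rewrite srE ampE tmip opZE ipZr mulrC.
by move=> u v; exists (ip u (a v) *: d); rewrite !E (shZ Hpi) (shZ Hrho).
Qed.

(** Slices of approximants come from a Cauchy sequence in D, again because pi is isometric. *)
Lemma slice_closed (T : op KH KH) :
  (forall e : R, 0 < e -> exists2 T', (forall u v, exists d, sr kh u v T' = pi d) &
     forall z, nr ((T - T') z) <= e * nr z) ->
  forall u v, exists d, sr kh u v T = pi d.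
Proof.
move=> h u v.
have hs (X : op KH KH) e : 0 <= e -> (forall z, nr (X z) <= e * nr z) ->
    forall x, nr (sr kh u v X x) <= nr u * nr v * e * nr x.
  move=> e0 hX x; rewrite /sr !ocE; apply: le_trans (ad_bnd (M := nr u) (nr_ge0 _) _ _) _.
    by move=> y; rewrite ketrE nr_tm mulrC.
  rewrite -!mulrA ler_wpM2l ?nr_ge0//; apply: le_trans (hX _) _.
  by rewrite ketrE nr_tm; move: (nr x) (nr v) => a b; rewrite le_eqVlt; apply/orP; left; apply/eqP; ring.
have /choice[d hd] : forall n : nat, exists d, forall x,
    nr ((sr kh u v T - pi d) x) <= nr u * nr v * n.+1%:R^-1 * nr x.
  move=> n; have n0 : 0 < n.+1%:R^-1 :> R by rewrite invr_gt0.
  have [T' hT' hT] := h _ n0; have [d hd] := hT' u v; exists d => x.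
  rewrite -hd -[sr kh u v T - _]addrC -scaleN1r -sr_lin scaleN1r addrC.
  by apply: hs => //; exact: ltW.
have B0 : 0 <= nr u * nr v by rewrite mulr_ge0 ?nr_ge0.
have [n m|l hl] := @tends_complete _ _ d (@seq_cauchy _ _ d _ B0 _).
  apply: (hom_isom Hpi pi_inj) => [|x]; first by rewrite mulr_ge0// addr_ge0// invr_ge0.
  rewrite (shB Hpi) opBE; apply: le_trans (nr_tri _ (sr kh u v T x) _) _.
  by rewrite nrBC mulrDr mulrDl; apply: lerD; exact: hd.
exists l; apply: op_ext => x.
have t1 : tends (fun n => pi (d n) x) (pi l x).
  apply: (tends_bnd (nr_ge0 x) hl) => n.
  by rewrite -opBE -(shB Hpi) mulrC; exact: hom_contr.
apply: tends_uniq t1; apply: (seq_tends (M := nr u * nr v * nr x)).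
  by rewrite mulr_ge0 ?nr_ge0.
by move=> n; rewrite nrBC mulrAC; exact: hd.
Qed.

(** The limit T has some counterpart S0 by [fub_ex]; counterparts obey the same bounds, so the
    approximants of S converge to S0 as well. *)
Lemma fub_lim T S :
  (forall e : R, 0 < e -> exists T' S', [/\ fub T' S', (forall z, nr ((T - T') z) <= e * nr z) &
     forall z, nr ((S - S') z) <= e * nr z]) -> fub T S.
Proof.
move=> h; have hT : forall u v, exists d, sr kh u v T = pi d.
  apply: slice_closed => e /h[T' [S' [h1 h2 _]]]; exists T' => //.
  exact: fub_slice h1.
have [S0 h0 _] := fub_ex (opb_ge0 T) (opbP T) hT.
suff -> : S = S0 by [].
apply: op_ext => z; apply: (eq_eps (M := 2 * nr z)) => e e0.
have [T' [S' [h1 h2 h3]]] := h e e0; apply: le_trans (nr_tri _ (S' z) _) _.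
have := h3 z; have := fub_bnd (fubB h0 h1) (ltW e0) h2 z; rewrite !opBE (nrBC (S0 z)); lra.
Qed.

Lemma fub_span (P : op KH KH -> op LH LH -> Prop) : (forall s s', P s s' -> fub s s') ->
  forall s, lin_span [set s | exists s', P s s'] s ->
  exists2 s', lin_span [set s' | exists s, P s s'] s' & fub s s'.
Proof.
move=> h s; elim/lin_span_ind: s / => [|a u v [u' Pu] [v' hv fv]].
  by exists 0; [exact: lin_span0|exact: fub0].
exists (a *: u' + v'); last by apply: fub_lin => //; exact: h.
by apply: lin_spanD => //; apply: lin_spanZ; apply: lin_span_sub; exists u.
Qed.

Lemma fub_ocl (P : op KH KH -> op LH LH -> Prop) T S : (forall s s', P s s' -> fub s s') ->
  ocl [set s | exists s', P s s'] T -> fub T S -> ocl [set s' | exists s, P s s'] S.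
Proof.
move=> h hT hTS e e0; have [s Ss hs] := hT e e0; have [s' Ss' f] := fub_span h Ss.
exists s' => // z; rewrite -opBE; exact: (fub_bnd (fubB hTS f) (ltW e0)).
Qed.

Variable A : set (op H H).
Definition elem (s : op KH KH) (s' : op LH LH) := exists d a, [/\ A a,
  s = amp kh kh (pi d) ** legr kh a & s' = amp lh lh (rho d) ** legr lh a].

Lemma elem_fub s s' : elem s s' -> fub s s'.
Proof. by move=> [d [a [_ -> ->]]]; exact: fub_elem. Qed.

(** Slices of a product are not expressed by slices of the factors. For X in the closed span of the
    pi (d) tensored with elements of A they are, term by term, and the limit is taken with
    [fub_lim]. *)
Lemma fub_mul T S X X' : fub T S -> ocl [set s | exists s', elem s s'] X -> fub X X' ->
  fub (T ** X) (S ** X').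
Proof.
move=> h hX fX; apply: fub_lim => e e0.
have m0 : 0 < opb T + opb S + 1 by have := opb_ge0 T; have := opb_ge0 S; lra.
have d0 := divr_gt0 e0 m0.
have [s Ss hs] := hX _ d0.
have [s' [Ss' f g]] : exists s', [/\ lin_span [set s' | exists s, elem s s'] s', fub s s' & fub (T ** s) (S ** s')].
  elim/lin_span_ind: s / Ss {hs} => [|a u v [u' hu] [v' [hv fv gv]]].
    by exists 0; split; [exact: lin_span0|exact: fub0|rewrite !oc0r; exact: fub0].
  exists (a *: u' + v'); split.
  - by apply: lin_spanD => //; apply: lin_spanZ; apply: lin_span_sub; exists u.
  - by apply: fub_lin => //; exact: elem_fub.
  - rewrite !ocDr !ocZr; apply: fub_lin => //; have [d [b [_ -> ->]]] := hu.
    exact: fub_simple.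
exists (T ** s), (S ** s'); split=> // z.
  rewrite -ocNr -ocDr ocE; apply: le_trans (opbP _ _) _.
  apply: le_trans (ler_wpM2l (opb_ge0 _) (hs z)) _; rewrite mulrA ler_wpM2r ?nr_ge0//.
  rewrite mulrA ler_pdivrMr// mulrC ler_wpM2l ?ltW//; have := opb_ge0 S; lra.
rewrite -ocNr -ocDr ocE; apply: le_trans (opbP _ _) _.
apply: le_trans (ler_wpM2l (opb_ge0 _) (fub_bnd (fubB fX f) (ltW d0) hs z)) _.
rewrite mulrA ler_wpM2r ?nr_ge0// mulrA ler_pdivrMr// mulrC ler_wpM2l ?ltW//.
by have := opb_ge0 T; lra.
Qed.

End Fubini.

(** * The coaction in another faithful representation *)

Section Transport.
Variables (R : realType) (D : cstarType R) (H K KH : hilbertType R).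
Variables (kh : tmap K H KH) (A : set (op H H)).
Hypothesis A_ad : forall a, A a -> A (ad a).
Hypothesis A_total : total [set v | exists t x, A t /\ v = t x].
Variables (pi : D -> op K K) (pit : D -> op KH KH) (al : H -> H -> D -> D).
Hypotheses (Hpi : shom pi) (pi_inj : injective pi) (Hpit : shom pit).
Hypothesis Hal : forall u v d, pi (al u v d) = sr kh u v (pit d).
Hypothesis HpitA : ocl (pitA A kh pit al) = ocl (piA A kh al pi).
Hypothesis Hgen : forall B : set D, cstar_sub B -> (forall u v d, B (al u v d)) -> B = setT.

Definition als : set D := [set x | exists u v d, x = al u v d].

Lemma al_bnd u v d : nr (al u v d) <= opb (pit d) * nr u * nr v.
Proof.
apply: (hom_isom Hpi pi_inj) => [|x]; first by rewrite !mulr_ge0 ?nr_ge0 ?opb_ge0.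
rewrite Hal /sr !ocE; apply: le_trans (ad_bnd (M := nr u) (nr_ge0 _) _ _) _.
  by move=> y; rewrite ketrE nr_tm mulrC.
have -> : opb (pit d) * nr u * nr v * nr x = nr u * (opb (pit d) * (nr x * nr v)) by ring.
by rewrite ler_wpM2l ?nr_ge0//; apply: le_trans (opbP _ _) _; rewrite ketrE nr_tm.
Qed.

Lemma al_linr u d a v v' : al u (a *: v + v') d = a *: al u v d + al u v' d.
Proof. by apply: pi_inj; rewrite (sh_lin Hpi) !Hal /sr ketrP ocDr ocZr. Qed.

Lemma ncl_map (V : normedModType R[i]) (W : normedModType R[i]) (S : set V) (T : set W)
    (s : {rmorphism R[i] -> R[i]}) (f : V -> W) (M : R) :
  (forall a x y, f (a *: x + y) = s a *: f x + f y) -> (forall x, nr (f x) <= M * nr x) ->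
  (forall x, S x -> ncl T (f x)) -> forall x, ncl S x -> ncl T (f x).
Proof.
move=> fl fM hS x /nclP hx; apply: ncl_lim => e e0.
have M1 : 0 < `|M| + 1 by have := normr_ge0 M; lra.
have [y Sy hy] := hx _ (divr_gt0 e0 M1).
have f0 : f 0 = 0.
  by have := fl (-1) 0 0; rewrite scaleN1r oppr0 addr0 rmorphN1 scaleN1r addNr.
exists (f y).
  by elim/lin_span_ind: y / Sy {hy} => [|a u v Su hv]; rewrite ?f0 ?fl; [exact: ncl0|apply: ncl_lin => //; exact: hS].
have -> : f x - f y = f (x - y).
  by rewrite addrC -[y in RHS]scale1r -scaleNr [x + _]addrC fl rmorphN1 scaleN1r.
apply: le_trans (fM _) _; apply: le_trans (ler_wpM2r (nr_ge0 _) (ler_norm M)) _.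
rewrite ler_pdivlMr// in hy; have := nr_ge0 (x - y); by move: (nr _) hy => a; nra.
Qed.

Lemma ocl_pi (S : set D) x : ocl [set pi e | e in S] (pi x) -> ncl S x.
Proof.
move=> h; apply/nclP => e e0; have [s Ss hs] := h e e0.
have [y Sy sy] : exists2 y, lin_span S y & s = pi y.
  elim/lin_span_ind: s / Ss {hs} => [|a _ v [w Sw <-] [y Sy ->]].
    by exists 0; rewrite ?(sh0 Hpi)//; exact: lin_span0.
  exists (a *: w + y); last by rewrite (sh_lin Hpi).
  by apply: lin_spanD => //; apply: lin_spanZ; exact: lin_span_sub.
exists y => //; apply: (hom_isom Hpi pi_inj); first exact: ltW.
by move=> v; rewrite (shB Hpi) opBE -sy.
Qed.

(** For v of the form a w, pi (al u v d) pi (y) is a slice of pit (d) times pi (y) tensored with a.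
    By [HpitA] the last factor is a limit of sums of pit (y') (1 (x) b); as pit is multiplicative,
    slices of pit (d y') result, which belong to the image of alpha. *)
Lemma al_mul u v d x : als x -> ncl als (cmul (al u v d) x).
Proof.
move=> [u' [v' [d' ->]]]; set y := al u' v' d'.
have av a w : A a -> ncl als (cmul (al u (a w) d) y).
  move=> hA; apply: ocl_pi; rewrite (sh_mul Hpi) Hal.
  have -> : sr kh u (a w) (pit d) ** pi y = sr kh u w (pit d ** (amp kh kh (pi y) ** legr kh a)).
    by rewrite ocA sr_legr sr_ampr.
  have : ocl (piA A kh al pi) (amp kh kh (pi y) ** legr kh a).
    by apply: ocl_sub; exists u', v', d', a.
  rewrite -HpitA.
  apply: (@ocl_map _ _ _ _ _ _ [set pi e | e in als] idfun (fun X => sr kh u w (pit d ** X))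
    (nr u * opb (pit d) * nr w)).
  - by move=> c T T'; rewrite ocDr ocZr sr_lin.
  - move=> T e e0 hT z; rewrite /sr !ocE; apply: le_trans (ad_bnd (M := nr u) (nr_ge0 _) _ _) _.
      by move=> q; rewrite ketrE nr_tm mulrC.
    rewrite -!mulrA ler_wpM2l ?nr_ge0//; apply: le_trans (opbP _ _) _.
    rewrite ler_wpM2l ?opb_ge0//; apply: le_trans (hT _) _.
    by rewrite ketrE nr_tm; move: (nr z) (nr w) => p q; rewrite le_eqVlt; apply/orP; left; apply/eqP; ring.
  - move=> _ [u1 [v1 [d1 [b [hB ->]]]]]; rewrite ocA sr_legr -(sh_mul Hpit) -Hal.
    by apply: ocl_sub; exists (al u (b w) (cmul d (al u1 v1 d1))) => //; exists u, (b w), (cmul d (al u1 v1 d1)).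
have : ncl [set w | exists t z, A t /\ w = t z] v by rewrite /ncl A_total.
apply: (@ncl_map _ _ _ _ idfun (fun w => cmul (al u w d) y) (opb (pit d) * nr u * nr y)).
- by move=> a w w'; rewrite al_linr cmulDl cmulZl.
- move=> w; apply: le_trans (nr_cmul _ _) _.
  apply: le_trans (ler_wpM2r (nr_ge0 _) (al_bnd _ _ _)) _.
  by rewrite mulrAC.
by move=> _ [a [w [hA ->]]]; exact: av.
Qed.

Lemma als_dense x : ncl als x.
Proof.
have sub : cstar_sub (ncl als).
  split; first exact: closed_closure.
  - exact: ncl_span.
  - move=> x1 y h1 h2.
    apply: (@ncl_map _ _ als _ idfun (fun z => cmul z y) (nr y)) h1 => [a w w'|w|z Sz].
    + by rewrite cmulDl cmulZl.
    + by rewrite mulrC nr_cmul.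
    apply: (@ncl_map _ _ als _ idfun (fun w => cmul z w) (nr z)) h2 => [a w w'|w|w Sw].
    + by rewrite cmulDr cmulZr.
    + exact: nr_cmul.
    by have [u [v [d ->]]] := Sz; exact: al_mul.
  - move=> x1; apply: (@ncl_map _ _ als _ (@conjc R : {rmorphism R[i] -> R[i]}) cstar 1) => [a w w'|w|z].
    + by rewrite cstarD cstarZ.
    + by rewrite mul1r nr_cstar.
    move=> [u [v [d ->]]]; apply: ncl_sub; exists v, u, (cstar d); apply: pi_inj.
    by rewrite (sh_star Hpi) !Hal (sh_star Hpit) ad_sr.
by rewrite (Hgen sub)// => u v d; apply: ncl_sub; exists u, v, d.
Qed.

Definition homA (V N : hilbertType R) (m : tmap V H N) (phi : D -> op N N) : set (op N N) :=
  [set T | exists d a, A a /\ T = phi d ** legr m a].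

Lemma homA_ncl (V N : hilbertType R) (m : tmap V H N) (phi : D -> op N N) (S : set (op N N)) :
  shom phi -> (forall u v d a, A a -> ocl S (phi (al u v d) ** legr m a)) ->
  homA m phi `<=` ocl S.
Proof.
move=> Hphi h _ [d [a [hA ->]]]; apply: ocl_lim => e e0.
have m0 : 0 < opb (legr m a) + 1 by have := opb_ge0 (legr m a); lra.
have hd := (nclP _ _).1 (@als_dense d); have [s Ss hs] := hd _ (divr_gt0 e0 m0).
exists (phi s ** legr m a).
  elim/lin_span_ind: s / Ss {hs} => [|c _ w [u [v [x ->]]] hw].
    by rewrite (sh0 Hphi) oc0l; exact: ocl0.
  by rewrite (sh_lin Hphi) ocDl ocZl; apply: oclD => //; apply: oclZ; exact: h.
move=> x; rewrite !ocE -opBE -(shB Hphi); apply: le_trans (hom_contr Hphi _ _) _.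
apply: le_trans (ler_wpM2l (nr_ge0 _) (opbP _ _)) _; rewrite mulrA ler_wpM2r ?nr_ge0//.
apply: le_trans (ler_wpM2r (opb_ge0 _) hs) _; rewrite mulrAC ler_pdivrMr// ler_wpM2l ?(ltW e0)//.
lra.
Qed.

Lemma amp_shom (V N : hilbertType R) (m : tmap V H N) (phi : D -> op V V) :
  shom phi -> shom (fun d => amp m m (phi d)).
Proof.
move=> Hphi; split=> [a x y|x y|x]; first by rewrite (sh_lin Hphi) ampP.
  by rewrite (sh_mul Hphi) ampM.
by rewrite (sh_star Hphi) ad_amp.
Qed.

Lemma homA_pit : ocl (homA kh pit) = ocl (homA kh (fun d => amp kh kh (pi d))).
Proof.
have h1 : ocl (homA kh pit) = ocl (pitA A kh pit al).
  apply: ocl_eq; last by move=> _ [u [v [d [a [hA ->]]]]]; apply: ocl_sub; exists (al u v d), a.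
  by apply: homA_ncl => // u v d a hA; apply: ocl_sub; exists u, v, d, a.
rewrite h1 HpitA; apply: ocl_eq; first by move=> _ [u [v [d [a [hA ->]]]]]; apply: ocl_sub; exists (al u v d), a.
apply: homA_ncl; first exact: amp_shom.
by move=> u v d a hA; apply: ocl_sub; exists u, v, d, a.
Qed.

Variables (L LH : hilbertType R) (lh : tmap L H LH) (rho : D -> op L L).
Hypotheses (Hrho : shom rho) (rho_inj : injective rho).
Local Notation fb := (fub kh lh pi rho).
Local Notation elemA := (elem kh lh pi rho A).

Lemma alt_ex d : exists S : op LH LH, fb (pit d) S.
Proof.
have [|S hS _] := fub_ex (kh := kh) lh Hpi pi_inj Hrho (opb_ge0 (pit d)) (opbP (pit d)); last by exists S.
by move=> u v; exists (al u v d); rewrite Hal.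
Qed.

Definition alt d : op LH LH := sval (cid (alt_ex d)).
Lemma altP d : fb (pit d) (alt d). Proof. by rewrite /alt; case: cid. Qed.

Lemma elem_homA : [set s | exists s', elemA s s'] = homA kh (fun d => amp kh kh (pi d)).
Proof.
apply/seteqP; split=> [s [s' [d [a [hA -> _]]]]|_ [d [a [hA ->]]]]; first by exists d, a.
by eexists; exists d, a.
Qed.

Lemma elem_homA' : [set s' | exists s, elemA s s'] = homA lh (fun d => amp lh lh (rho d)).
Proof.
apply/seteqP; split=> [s' [s [d [a [hA _ ->]]]]|_ [d [a [hA ->]]]]; first by exists d, a.
by eexists; exists d, a.
Qed.

Lemma alt_ocl : ocl (homA lh alt) = ocl (homA lh (fun d => amp lh lh (rho d))).
Proof.
pose P (s : op KH KH) (s' : op LH LH) := exists d a, [/\ A a, s = pit d ** legr kh a & s' = alt d ** legr lh a].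
have P1 : [set s | exists s', P s s'] = homA kh pit.
  apply/seteqP; split=> [s [s' [d [a [hA -> _]]]]|_ [d [a [hA ->]]]]; first by exists d, a.
  by eexists; exists d, a.
have P2 : [set s' | exists s, P s s'] = homA lh alt.
  apply/seteqP; split=> [s' [s [d [a [hA _ ->]]]]|_ [d [a [hA ->]]]]; first by exists d, a.
  by eexists; exists d, a.
have fP s s' : P s s' -> fb s s' by move=> [d [a [_ -> ->]]]; apply: fub_legr; exact: altP.
have fe s s' : elemA s s' -> fb s s' by exact: elem_fub.
apply: ocl_eq => [_ [d [a [hA ->]]]|_ [d [a [hA ->]]]].
  rewrite -elem_homA'.
  have h : ocl [set s | exists s', elemA s s'] (pit d ** legr kh a).
    by rewrite elem_homA -homA_pit; apply: ocl_sub; exists d, a.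
  exact: (fub_ocl Hpi pi_inj Hrho fe h (fub_legr a (altP d))).
rewrite -P2.
have h : ocl [set s | exists s', P s s'] (amp kh kh (pi d) ** legr kh a).
  by rewrite P1 homA_pit; apply: ocl_sub; exists d, a.
by have := @fub_ocl _ _ _ _ _ _ _ kh lh _ _ Hpi pi_inj Hrho P _ _ fP h (fub_elem kh lh Hpi Hrho d a).
Qed.

(** Linearity and the involution follow from uniqueness of counterparts. For products, [fub_mul]
    needs a factor 1 (x) a, which is cancelled at the end because A acts nondegenerately. *)
Lemma alt_shom : shom alt.
Proof.
have uq T S S' : fb T S -> fb T S' -> S = S' by exact: fub_uniq.
split=> [a x y|x y|x].
- by apply: uq (altP _) _; rewrite (sh_lin Hpit); apply: fub_lin => //; exact: altP.
- have hA a : A a -> alt (cmul x y) ** legr lh a = alt x ** alt y ** legr lh a.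
    move=> hA; apply: uq (fub_legr a (altP _)) _; rewrite (sh_mul Hpit) -!ocA.
    have h : ocl [set s | exists s', elemA s s'] (pit y ** legr kh a).
      by rewrite elem_homA -homA_pit; apply: ocl_sub; exists y, a.
    exact: (fub_mul Hpi pi_inj Hrho (altP x) h (fub_legr a (altP y))).
  apply: (op_eq_total (amp_total (tsw lh) A_total)) => _ [_ [z [[a ha <-] ->]]].
  by rewrite -!ocE hA.
- by apply: uq (altP _) _; rewrite (sh_star Hpit); apply: fub_ad => //; exact: altP.
Qed.

Lemma alt_slice u v d : sr lh u v (alt d) = rho (al u v d).
Proof.
have [e [h ->]] := altP d u v; congr rho; apply: pi_inj.
by rewrite -h Hal.
Qed.

Local Notation Y := (ocl (homA lh (fun d => amp lh lh (rho d)))).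

Lemma alt_mull d X : Y X -> Y (alt d ** X).
Proof.
rewrite -alt_ocl; apply: ocl_compl => _ [x [a [hA ->]]].
by rewrite ocA -(sh_mul alt_shom); apply: ocl_sub; exists (cmul d x), a.
Qed.

Lemma Y_ad X : Y X -> Y (ad X).
Proof.
apply: ocl_ad => _ [x [a [hA ->]]]; apply: ocl_sub; exists (cstar x), (ad a); split; first exact: A_ad.
rewrite adM !ad_amp -(sh_star Hrho); exact/esym/amp_comm.
Qed.

Lemma alt_mulr d X : Y X -> Y (X ** alt d).
Proof.
move=> /Y_ad hX; rewrite -[X ** _]adK adM -(sh_star alt_shom); apply: Y_ad.
exact: alt_mull.
Qed.

(** Products are dense in D, so alt (x) (1 (x) a) is a limit of sums of alt (u) alt (v) (1 (x)
    a). *)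
Lemma alt_nondeg : Y `<=` ocl [set T | exists d y, Y y /\ T = alt d ** y].
Proof.
rewrite -{1}alt_ocl; apply: ocl_le => _ [x [a [hA ->]]].
apply: ocl_lim => e e0.
have m0 : 0 < opb (legr lh a) + 1 by have := opb_ge0 (legr lh a); lra.
have hd := (nclP _ _).1 (prods_dense Hpi pi_inj (x := x)); have [s Ss hs] := hd _ (divr_gt0 e0 m0).
exists (alt s ** legr lh a).
  elim/lin_span_ind: s / Ss {hs} => [|c _ w [u [v ->]] hw].
    by rewrite (sh0 alt_shom) oc0l; exact: ocl0.
  rewrite (sh_lin alt_shom) ocDl ocZl; apply: oclD => //; apply: oclZ.
  rewrite (sh_mul alt_shom) -ocA; apply: ocl_sub; exists u, (alt v ** legr lh a); split=> //.
  by rewrite -alt_ocl; apply: ocl_sub; exists v, a.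
move=> z; rewrite !ocE -opBE -(shB alt_shom); apply: le_trans (hom_contr alt_shom _ _) _.
apply: le_trans (ler_wpM2l (nr_ge0 _) (opbP _ _)) _; rewrite mulrA ler_wpM2r ?nr_ge0//.
apply: le_trans (ler_wpM2r (opb_ge0 _) hs) _; rewrite mulrAC ler_pdivrMr// ler_wpM2l ?(ltW e0)//.
lra.
Qed.

End Transport.

(** * Normal functionals *)

Section Normal.
Variables (R : realType) (H : hilbertType R).
Local Notation C := R[i].
Implicit Types (mu : (H -> H) -> C) (xi eta : nat -> H) (T : op H H).

Definition vsum xi eta n (T : H -> H) : C := \sum_(k < n) ip (xi k) (T (eta k)).

Lemma normal_tends mu xi eta : (forall T, bop T ->
    (fun n => \sum_(k < n) ip (xi k) (T (eta k)) : C^o) @ \oo --> (mu T : C^o)) ->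
  forall T : op H H, tends (fun n => vsum xi eta n T) (mu T).
Proof.
move=> h T; have hb : bop T by apply/bopP; exact: opP.
by have /cvg_tends := h _ hb.
Qed.

Lemma vsum_normal xi eta n : normal_functional (vsum xi eta n).
Proof.
pose z (f : nat -> H) k := if (k < n)%N then f k else 0.
have zb f : exists M : C, forall m, \sum_(k < m) `|z f k| ^+ 2 <= M.
  exists (\sum_(k < n) `|f k| ^+ 2) => m.
  have -> : \sum_(k < n) `|f k| ^+ 2 = \sum_(k < maxn m n) `|z f k| ^+ 2 :> C.
    rewrite -(subnKC (leq_maxr m n)) big_split_ord/= [X in _ + X]big1 ?addr0 => [|i _].
      by apply: eq_bigr => i _; rewrite /z ltn_ord.
    by rewrite /z ltnNge leq_addr/= normr0 expr0n.
  rewrite -(subnKC (leq_maxl m n)) big_split_ord/= lerDl sumr_ge0// => i _.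
  by rewrite exprn_ge0.
exists (z xi), (z eta); split=> // T _; apply/cvg_tends => e e0; exists n => m nm.
suff -> : \sum_(k < m) ip (z xi k) (T (z eta k)) = vsum xi eta n T by rewrite subrr nr0 ltW.
rewrite -(subnKC nm) big_split_ord/= [X in _ + X]big1 ?addr0 => [|i _].
  by apply: eq_bigr => i _; rewrite /z ltn_ord.
by rewrite /z ltnNge leq_addr/= ip0l.
Qed.

Definition vecf u v : (H -> H) -> C := vsum (fun=> u) (fun=> v) 1.

Lemma vecfE u v T : vecf u v T = ip u (T v).
Proof. by rewrite /vecf /vsum big_ord1. Qed.

Lemma sq_bound_nr (f : nat -> H) : (exists M : C, forall n, \sum_(k < n) `|f k| ^+ 2 <= M) ->
  exists M : R, forall n, \sum_(k < n) nr (f k) ^+ 2 <= M.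
Proof.
move=> [M hM]; exists (complex.Re M) => n.
have : \sum_(k < n) `|f k| ^+ 2 = (\sum_(k < n) nr (f k) ^+ 2)%:C.
  by rewrite rmorph_sum; apply: eq_bigr => i _; rewrite nrE -rmorphXn.
by move=> q; have := hM n; rewrite q lecE/= => /andP[].
Qed.

Lemma sq_tail (f : nat -> R) (M : R) : (forall k, 0 <= f k) -> (forall n, \sum_(k < n) f k <= M) ->
  forall e, 0 < e -> exists N, forall n, (N <= n)%N -> \sum_(k < n) f k - \sum_(k < N) f k <= e.
Proof.
move=> f0 fM e e0; pose S := [set x | exists n : nat, x = \sum_(k < n) f k].
have hS : has_sup S.
  split; first by exists (\sum_(k < 0) f k), 0%N.
  by exists M => _ [n ->].
have [_ [N ->] hN] := sup_adherent e0 hS.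
exists N => n Nn; have := ub_le_sup hS.2 (ex_intro _ n erefl : S (\sum_(k < n) f k)).
by move: hN; move: (sup S) (\sum_(k < n) _) (\sum_(k < N) _) => *; lra.
Qed.

(** The tails of sum |xi_k| |eta_k| are dominated by those of sum (|xi_k|^2 + |eta_k|^2) / 2. The
    truncation error is thus uniform on bounded sets of operators, and vector functionals can stand
    for all normal ones. *)
Lemma normal_approx mu : normal_functional mu -> forall e : R, 0 < e ->
  exists n xi eta, forall T M, 0 <= M -> (forall x, nr (T x) <= M * nr x) ->
    nr (mu T - vsum xi eta n T) <= e * M.
Proof.
move=> [xi [eta [/sq_bound_nr[M1 h1] /sq_bound_nr[M2 h2] /normal_tends h]]] e e0.
pose f k := (nr (xi k) ^+ 2 + nr (eta k) ^+ 2) / 2.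
have f0 k : 0 <= f k by rewrite divr_ge0// addr_ge0// exprn_ge0// nr_ge0.
have [N hN] : exists N, forall n, (N <= n)%N -> \sum_(k < n) f k - \sum_(k < N) f k <= e.
  apply: (@sq_tail _ ((M1 + M2) / 2)) => // n.
  by rewrite -mulr_suml big_split/=; have := h1 n; have := h2 n; lra.
exists N, xi, eta => T M M0 hT; apply: nr_le_eps => d d0.
have [N' hN'] := h T _ d0; pose n := maxn N N'.
apply: le_trans (nr_tri _ (vsum xi eta n T) _) _.
rewrite addrC lerD//; last by rewrite nrBC; apply: hN'; exact: leq_maxr.
apply: le_trans _ (ler_wpM2r M0 (hN n (leq_maxl _ _))).
rewrite /vsum /n; have := leq_maxl N N'; move: (maxn N N') => m Nm.
rewrite -(subnKC Nm) !big_split_ord/= ![_ + _ - _]addrAC !subrr !add0r mulr_suml.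
apply: le_trans (nr_sum _ _ _) _; apply: ler_sum => k _.
apply: le_trans (CauchySchwarz _ _) _; apply: le_trans (ler_wpM2l (nr_ge0 _) (hT _)) _.
rewrite /f; move: (nr (xi _)) (nr (eta _)) => a b.
have : 0 <= (a - b) ^+ 2 * M by rewrite mulr_ge0// sqr_ge0.
by nra.
Qed.

Lemma normal_lin mu : normal_functional mu -> forall a T S, mu (a *: T + S : op H H) = a * mu T + mu S.
Proof.
move=> [xi [eta [_ _ /normal_tends h]]] a T S; apply: tends_uniq (h _) _.
have -> : (fun n => vsum xi eta n (a *: T + S : op H H)) = (fun n => a * vsum xi eta n T + vsum xi eta n S).
  apply/funext => n; rewrite /vsum mulr_sumr -big_split/=; apply: eq_bigr => k _.
  by rewrite ipDr ipZr.
apply: tendsD => //; apply: (tends_bnd (M := nr a) (nr_ge0 _) (h T)) => n.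
by rewrite -mulrBr nrM.
Qed.

Lemma normal_bnd mu : normal_functional mu ->
  exists2 B : R, 0 <= B & forall T M, 0 <= M -> (forall x, nr (T x) <= M * nr x) -> nr (mu T) <= B * M.
Proof.
move=> hmu; have [n [xi [eta h]]] := normal_approx hmu ltr01.
exists (1 + \sum_(k < n) nr (xi k) * nr (eta k)) => [|T M M0 hT].
  by rewrite addr_ge0// sumr_ge0// => k _; rewrite mulr_ge0// nr_ge0.
rewrite -[mu T](subrK (vsum xi eta n T)); apply: le_trans (nrD _ _) _; rewrite mulrDl lerD//.
  exact: h.
apply: le_trans (nr_sum _ _ _) _; rewrite mulr_suml; apply: ler_sum => k _.
apply: le_trans (CauchySchwarz _ _) _; rewrite mulrAC -mulrA ler_wpM2l ?nr_ge0//; exact: hT.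
Qed.

Lemma form_ex (b : H -> H -> C) (M : R) :
  (forall a u v w, b u (a *: v + w) = a * b u v + b u w) ->
  (forall a u v w, b (a *: u + w) v = cj a * b u v + b w v) -> 0 <= M ->
  (forall u v, nr (b u v) <= M * nr u * nr v) ->
  exists T : op H H, forall u v, ip u (T v) = b u v.
Proof.
move=> br bl M0 bM.
have h v : exists w, forall u, cj (b u v) = ip w u.
  apply: (@Riesz _ _ _ (M * nr v)) => [a u w|u]; first by rewrite bl rmorphD rmorphM/= cjK.
  by rewrite nr_conj mulrAC.
pose f v := sval (cid (h v)).
have fP u v : ip u (f v) = b u v.
  by rewrite ipC /f; case: cid => /= w <-; rewrite cjK.
have fl : blin f.
  split=> [a u v|]; first by apply: ip_ext => x; rewrite fP br ipDr ipZr !fP.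
  exists M => v; have [->|v0] := eqVneq (f v) 0; first by rewrite nr0 mulr_ge0// nr_ge0.
  have fv : 0 < nr (f v) by rewrite nr_gt0.
  rewrite -(ler_pM2l fv) -expr2; have := bM (f v) v; rewrite -fP ip_nr nrC ger0_norm ?sqr_ge0//.
  by rewrite mulrA [nr (f v) * M]mulrC.
by exists (Op fl) => /=.
Qed.

End Normal.

(** * Bundled operators and the operator sets of the statement *)

Section Bridge.
Variable R : realType.
Local Notation C := R[i].

Definition img (H : hilbertType R) (S : set (op H H)) : set (H -> H) := [set opf T | T in S].

Lemma opf_inj (V W : normedModType C) : injective (@opf R V W).
Proof. by move=> S T h; apply: op_ext => x; rewrite h. Qed.

Lemma imgP (H : hilbertType R) (S : set (op H H)) T : img S (opf T) <-> S T.
Proof. by split=> [[T' h /opf_inj <-]|h] //; exists T. Qed.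

Lemma lin_span_img (H : hilbertType R) (S : set (op H H)) : lin_span (img S) = img (lin_span S).
Proof.
apply/seteqP; split=> [f|_ [T hT <-]].
  elim/lin_span_ind => {f}; first by exists 0 => //; exact: lin_span0.
  move=> a _ _ [T ST <-] [T' ST' <-]; exists (a *: T + T') => //.
  by apply: lin_spanD => //; apply: lin_spanZ; exact: lin_span_sub.
elim/lin_span_ind: T / hT => [|a u v Su hv]; first exact: (@lin_span0 _ (H -> H)).
apply: (@lin_spanD _ (H -> H) _ (a *: opf u) (opf v)) => //; apply: lin_spanZ; apply: lin_span_sub.
by exists u.
Qed.

Lemma op_closureE (H : hilbertType R) (S : set (op H H)) :
  op_closure (img S) = img [set T | forall e : R, 0 < e ->
     exists2 s, S s & forall x, nr (T x - s x) <= e * nr x].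
Proof.
apply/seteqP; split=> [f [/bopP bf h]|_ [T hT <-]].
  exists (Op bf) => // e e0.
  have e0' : 0 < e%:C :> C by rewrite ltcR.
  have [_ [s Ss <-] hs] := h _ e0'; exists s => // x; have := hs x.
  by rewrite !nrE -rmorphM lecR.
split=> [|_ /gtc0P[e e0 ->]]; first by apply/bopP; exact: opP.
have [s Ss hs] := hT e e0; exists s => [|x]; first by exists s.
by rewrite !nrE -rmorphM lecR.
Qed.

Lemma op_cspanE (H : hilbertType R) (S : set (op H H)) : op_cspan (img S) = img (ocl S).
Proof. by rewrite /op_cspan lin_span_img op_closureE. Qed.

Lemma normal_sl (H K N : hilbertType R) (m : tmap H K N) mu (T : op N N) : normal_functional mu ->
  exists S : op H H, forall u v, ip u (S v) = mu (sl m u v T).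
Proof.
move=> hmu; have [B B0 hB] := normal_bnd hmu.
pose b u v := mu (sl m u v T).
have br a u v w : b u (a *: v + w) = a * b u v + b u w.
  by rewrite /b /sl ketlP ocDr ocZr normal_lin.
have bl a u v w : b (a *: u + w) v = cj a * b u v + b w v.
  by rewrite /b /sl ketlP adD adZ !ocDl !ocZl normal_lin.
have bM u v : nr (b u v) <= B * opb T * nr u * nr v.
  apply: le_trans (hB _ (opb T * nr u * nr v) _ _) _; first by rewrite !mulr_ge0 ?nr_ge0 ?opb_ge0.
    move=> x; rewrite /sl !ocE; apply: le_trans (ad_bnd (M := nr u) (nr_ge0 _) _ _) _.
      by move=> y; rewrite ketlE nr_tm.
    have -> : opb T * nr u * nr v * nr x = nr u * (opb T * (nr v * nr x)) by ring.
    by rewrite ler_wpM2l ?nr_ge0//; apply: le_trans (opbP _ _) _; rewrite ketlE nr_tm.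
  by rewrite !mulrA.
have [S hS] := form_ex br bl (mulr_ge0 B0 (opb_ge0 T)) bM.
by exists S.
Qed.

Section OneTensor.
Variables (H K : hilbertType R) (t : htensor H K).
Local Notation m := (htm t).

Lemma op_tensorE (S : op H H) (T : op K K) : op_tensor t S T = amp m m S ** legr m T.
Proof.
have hb : bop (amp m m S ** legr m T) by apply/bopP; exact: opP.
have hE x y : (amp m m S ** legr m T) (ht_map t x y) = ht_map t (S x) (T y).
  by rewrite ocE (ampE (tsw m) (tsw m) T y x) (ampE m m S x (T y)).
rewrite /op_tensor; case: xgetP => [U -> [/bopP bU hU]|/(_ _ (conj hb hE))//].
change (opf (Op bU) = amp m m S ** legr m T); congr opf; apply: (tm_op_ext (m := m)) => x y.
by rewrite hE -hU.
Qed.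

Lemma min_tensorE (X : set (op H H)) (Y : set (op K K)) :
  min_tensor t (img X) (img Y) =
  img (ocl [set U | exists x y, [/\ X x, Y y & U = amp m m x ** legr m y]]).
Proof.
rewrite -op_cspanE /min_tensor; congr op_cspan; apply/seteqP; split.
  move=> _ [_ [_ [[x hx <-] [y hy <-] ->]]]; rewrite op_tensorE.
  by eexists; first by exists x, y.
move=> _ [_ [x [y [hx hy ->]]] <-]; exists x, y; rewrite op_tensorE.
by split=> //; [exists x|exists y].
Qed.

Lemma slice_rE mu (T : op t t) : normal_functional mu ->
  exists2 S : op H H, slice_r mu T = S & forall u v, ip u (S v) = mu (sl m u v T).
Proof.
move=> hmu; have [S hS] := normal_sl m T hmu; exists S => //.
apply: form_op_eq => u v; rewrite hS; congr (mu _); apply/esym/form_op_eq => x y.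
by rewrite slE.
Qed.

Lemma slice_lE mu (T : op t t) : normal_functional mu ->
  exists2 S : op K K, slice_l mu T = S & forall u v, ip u (S v) = mu (sr m u v T).
Proof.
move=> hmu; have [S hS] := normal_sl (tsw m) T hmu; exists S => [|u v]; last by rewrite hS sl_sw.
apply: form_op_eq => u v; rewrite hS; congr (mu _); apply/esym/form_op_eq => x y.
by rewrite slE.
Qed.

Lemma slice_r_vecf x y (T : op t t) : slice_r (vecf x y) T = sr m x y T.
Proof.
apply: form_op_eq => u v; rewrite srE.
have -> : form_op (fun x0 y0 => ip (ht_map t u x0) (T (ht_map t v y0))) = sl m u v T.
  by apply: form_op_eq => x0 y0; rewrite slE.
by rewrite vecfE slE.
Qed.

End OneTensor.

End Bridge.

(** * Slices of the multiplicative unitary *)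

Section Functionals.
Variable R : realType.
Local Notation C := R[i].

Lemma nr_le_ip (V : hilbertType R) (z : V) (M : R) : 0 <= M ->
  (forall u, nr (ip u z) <= M * nr u) -> nr z <= M.
Proof.
move=> M0 h; have [->|z0] := eqVneq z 0; first by rewrite nr0.
have z1 : 0 < nr z by rewrite nr_gt0.
by rewrite -(ler_pM2r z1) -expr2; have := h z; rewrite ip_nr nrC ger0_norm ?sqr_ge0.
Qed.

Definition approx (H : hilbertType R) (mu : (H -> H) -> C) (e : R) n (xi eta : nat -> H) :=
  forall (T : op H H) M, 0 <= M -> (forall x, nr (T x) <= M * nr x) ->
    nr (mu T - vsum xi eta n T) <= e * M.

Lemma sl_bnd (H K N : hilbertType R) (m : tmap H K N) u v (T : op N N) x :
  nr (sl m u v T x) <= opb T * nr u * nr v * nr x.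
Proof.
rewrite /sl !ocE; apply: le_trans (ad_bnd (M := nr u) (nr_ge0 _) _ _) _.
  by move=> y; rewrite ketlE nr_tm.
have -> : opb T * nr u * nr v * nr x = nr u * (opb T * (nr v * nr x)) by ring.
by rewrite ler_wpM2l ?nr_ge0//; apply: le_trans (opbP _ _) _; rewrite ketlE nr_tm.
Qed.

Lemma vsum_slices (H K N : hilbertType R) (m : tmap H K N) (T : op N N) n (xi eta : nat -> H) u v :
  ip u ((\sum_(k < n) sl m (xi k) (eta k) T) v) = vsum xi eta n (sr m u v T).
Proof.
rewrite op_sumE ip_sumr; apply: eq_bigr => k _.
by rewrite slE srE.
Qed.

Lemma approx_slices (H K N : hilbertType R) (m : tmap H K N) (T : op N N) mu e n xi eta (S : op K K) :
  0 <= e -> approx mu e n xi eta -> (forall u v, ip u (S v) = mu (sr m u v T)) ->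
  forall x, nr (S x - (\sum_(k < n) sl m (xi k) (eta k) T) x) <= e * opb T * nr x.
Proof.
move=> e0 ha hS x; apply: nr_le_ip => [|u]; first by rewrite !mulr_ge0 ?nr_ge0 ?opb_ge0.
rewrite ipBr hS vsum_slices.
have -> : e * opb T * nr x * nr u = e * (opb T * nr u * nr x) by ring.
apply: ha => [|z]; first by rewrite !mulr_ge0 ?nr_ge0 ?opb_ge0.
by rewrite -sl_sw sl_bnd.
Qed.

(** A is defined by closing the slices over all normal functionals, with no span taken. Finite sums
    of vector functionals are normal, and they approximate every normal functional in norm, so the
    closed span of vector slices is the same set. *)
Lemma ocl_slices (H K N : hilbertType R) (m : tmap H K N) (T : op N N) :
  [set S : op K K | forall e : R, 0 < e ->
     exists2 s, [set s : op K K | exists2 mu, normal_functional mu &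
       forall u v, ip u (s v) = mu (sr m u v T)] s & forall x, nr (S x - s x) <= e * nr x] =
  ocl [set S | exists x x', S = sl m x x' T].
Proof.
apply/seteqP; split=> S hS.
  apply: ocl_lim => e e0; have [s [mu hmu hs] hSs] := hS _ e0; exists s => // {S hS hSs}.
  apply: ocl_lim => d d0; have T0 : 0 < opb T + 1 by have := opb_ge0 T; lra.
  have [n [xi [eta ha]]] := normal_approx hmu (divr_gt0 d0 T0).
  exists (\sum_(k < n) sl m (xi k) (eta k) T).
    by apply: ocl_sum => k _; apply: ocl_sub; exists (xi k), (eta k).
  move=> x; apply: le_trans (approx_slices (ltW (divr_gt0 d0 T0)) ha hs x) _.
  rewrite ler_wpM2r ?nr_ge0// mulrAC ler_pdivrMr// ler_wpM2l ?(ltW d0)//; lra.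
move=> e e0; have [s Ss hs] := hS e e0; exists s => // {hs hS}.
have [n [xi [eta ->]]] : exists n (xi eta : nat -> H), s = \sum_(k < n) sl m (xi k) (eta k) T.
  elim/lin_span_ind: s / Ss => [|a _ v [x [x' ->]] [n [xi [eta ->]]]].
    by exists 0%N, (fun=> 0), (fun=> 0); rewrite big_ord0.
  exists n.+1, (fun k => if k is k'.+1 then xi k' else x), (fun k => if k is k'.+1 then eta k' else a *: x').
  rewrite big_ord_recl/=; congr (_ + _); apply: op_ext => z; apply: ip_ext => w.
  by rewrite opZE ipZr !slE -[m (a *: x') z]/(ketr m z _) (opLZ (ketr m z)) (opLZ T) ipZr.
exists (vsum xi eta n); first exact: vsum_normal.
by move=> u v; rewrite vsum_slices.
Qed.

End Functionals.

Section QuantumGroupData.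
Variables (R : realType) (G : lcqg R).
Local Notation C := R[i].
Local Notation H := (qgH G).
Local Notation H2 := (qgH2 G).
Local Notation m2 := (htm H2).

Definition mopW : op H2 H2 :=
  Op ((bopP (@qgW R G)).1 (let: And3 b _ _ := (qgW_mult G).1 in b)).
Local Notation W := mopW.

Lemma unitary_opP (V : hilbertType R) (U : op V V) : unitary_op U -> unitary U.
Proof.
by move=> [_ h1 h2]; split; apply: op_ext => x; rewrite ocE -?adj_ad; [exact: h1|exact: h2].
Qed.

Lemma mopW_unitary : unitary W.
Proof. by apply: unitary_opP; have [] := qgW_mult G. Qed.

Local Notation A := (Aop m2 W).

Lemma qgA_img : qgA G = img A.
Proof.
rewrite /qgA /Aop -(ocl_slices m2 W) -op_closureE; congr op_closure; apply/seteqP; split.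
  move=> _ [mu hmu <-]; have [S hS h] := slice_lE (W : op H2 H2) hmu; exists S => //.
  by exists mu.
move=> _ [S [mu hmu h] <-]; exists mu => //; apply: form_op_eq => u v; rewrite h.
by congr (mu _); apply/esym/form_op_eq => x y; rewrite srE.
Qed.

Definition Ahat : set (op H H) := ocl [set S | exists x x', S = sr m2 x x' W].

Lemma qgAhat_img : qgAhat G = img Ahat.
Proof.
have E : [set S | exists x x', S = sr m2 x x' W] = [set S | exists x x', S = sl (tsw m2) x x' W].
  by apply/seteqP; split=> _ [x [x' ->]]; exists x, x'; rewrite sl_sw.
rewrite /qgAhat /Ahat E -(ocl_slices (tsw m2) W) -op_closureE; congr op_closure; apply/seteqP; split.
  move=> _ [mu hmu <-]; have [S hS h] := slice_rE (W : op H2 H2) hmu; exists S => //.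
  by exists mu => // u v; rewrite h sr_sw.
move=> _ [S [mu hmu h] <-]; exists mu => //; apply: form_op_eq => u v; rewrite h.
by congr (mu _); apply/esym/form_op_eq => x y; rewrite sr_sw slE.
Qed.

Lemma Ahat_total : total [set v | exists b z, Ahat b /\ v = ad b z].
Proof.
apply: total_orth => v hv.
suff : ip (m2 v v) (m2 v v) = 0.
  rewrite tmip ip_nr -rmorphM => /(congr1 (@complex.Re _))/= /eqP.
  by rewrite mulf_eq0 orbb sqrf_eq0 nr_eq0 => /eqP.
have [WW _] := mopW_unitary.
suff w0 : W (m2 v v) = 0 by rewrite -[X in ip _ X](ocK WW) w0 opL0 ip0r.
apply: (tm_ip_ext (m := m2)) => z u; rewrite ip0r -srE -adl.
by apply: hv; exists (sr m2 u v W), z; split=> //; apply: ocl_sub; exists u, v.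
Qed.

Lemma op_tensorl (V K : hilbertType R) (t : htensor V K) (T : op V V) : op_tensor t T id = amp (htm t) (htm t) T.
Proof. by rewrite -[id]/(opf (oid K)) op_tensorE amp1 oc1. Qed.

Lemma op_tensorr (V K : hilbertType R) (t : htensor V K) (T : op K K) : op_tensor t id T = legr (htm t) T.
Proof. by rewrite -[id]/(opf (oid V)) op_tensorE amp1 o1c. Qed.

Lemma regular_ocl : regular G ->
  ocl [set T | exists b a, [/\ Ahat b, A a & T = amp m2 m2 b ** W ** legr m2 a]] =
  ocl [set T | exists b a, [/\ Ahat b, A a & T = amp m2 m2 b ** legr m2 a]].
Proof.
rewrite /regular qgA_img qgAhat_img min_tensorE.
set S := [set T | _] : set (H2 -> H2).
have -> : S = img [set T | exists b a, [/\ Ahat b, A a & T = amp m2 m2 b ** W ** legr m2 a]].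
  apply/seteqP; split=> [_ [_ [_ [[b hb <-] [a ha <-] ->]]]|_ [_ [b [a [hb ha ->]]] <-]].
    by rewrite op_tensorl op_tensorr; exists (amp m2 m2 b ** W ** legr m2 a) => //; exists b, a.
  by exists b, a; rewrite op_tensorl op_tensorr; split=> //; [exists b|exists a].
by rewrite op_cspanE => h; apply/seteqP; split=> T hT; apply/imgP; [rewrite -h|rewrite h]; apply/imgP.
Qed.

Hypothesis A_ad : forall a, A a -> A (ad a).

(** A bra on the first leg absorbs the elements of Ahat, since the vectors b^* z with b in Ahat are
    total. Adjoints then turn bras into kets and W into W^*. *)
Lemma regularP : regular G -> ocl (regset A m2 (ad W)) = ocl (ketset A m2).
Proof.
move=> /regular_ocl h.
have bl z b (X : op H2 H2) : ad (ketl m2 (ad b z)) ** X = ad (ketl m2 z) ** (amp m2 m2 b ** X).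
  by rewrite ocA bral_amp.
have gen (S : set (op H2 H)) (X : op H2 H2) :
    (forall b z, Ahat b -> ocl S (ad (ketl m2 z) ** (amp m2 m2 b ** X))) ->
    forall z, ocl S (ad (ketl m2 z) ** X).
  move=> hS z; rewrite -[ad _]o1c.
  apply: (@ocl_bral _ _ _ _ m2 _ _ S (oid H) X _ Ahat_total) => _ [b [w [hb ->]]].
  by rewrite o1c bl; exact: hS.
pose P1 := [set T | exists z a, A a /\ T = ad (ketl m2 z) ** (W ** legr m2 a)].
pose P2 := [set T | exists z a, A a /\ T = ad (ketl m2 z) ** legr m2 a].
have q : ocl P1 = ocl P2.
  apply: ocl_eq => _ [z [a [ha ->]]]; move: z; apply: gen => b z hb.
    have : ocl [set T | exists b a, [/\ Ahat b, A a & T = amp m2 m2 b ** legr m2 a]]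
        (amp m2 m2 b ** (W ** legr m2 a)).
      by rewrite -h ocA; apply: ocl_sub; exists b, a.
    apply: ocl_compl => _ [b' [a' [_ ha' ->]]]; rewrite -bl.
    by apply: ocl_sub; exists (ad b' z), a'.
  have : ocl [set T | exists b a, [/\ Ahat b, A a & T = amp m2 m2 b ** W ** legr m2 a]]
      (amp m2 m2 b ** legr m2 a) by rewrite h; apply: ocl_sub; exists b, a.
  apply: ocl_compl => _ [b' [a' [_ ha' ->]]]; rewrite -[_ ** W ** _]ocA -bl.
  by apply: ocl_sub; exists (ad b' z), a'.
have ke z a : legr m2 a ** ketl m2 z = ketl m2 z ** a by rewrite -[ketl m2 z]ketr_sw amp_ketr.
have adl2 z a : ketl m2 z ** a = ad (ad (ketl m2 z) ** legr m2 (ad a)).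
  by rewrite adM adK ad_amp adK ke.
apply: ocl_eq => [_ [a [z [ha ->]]]|_ [z [a [ha ->]]]].
  have : ocl P2 (ad (ketl m2 z) ** (W ** legr m2 (ad a))).
    by rewrite -q; apply: ocl_sub; exists z, (ad a); split=> //; exact: A_ad.
  rewrite -[_ ** _ ** _]adK; move=> h2.
  have -> : ad (legr m2 a ** ad W ** ketl m2 z) = ad (ketl m2 z) ** (W ** legr m2 (ad a)).
    by rewrite !adM adK ad_amp.
  apply: ocl_ad h2 => _ [z' [a' [ha' ->]]]; apply: ocl_sub; exists z', (ad a'); split; first exact: A_ad.
  by rewrite adl2 adK.
have : ocl P1 (ad (ketl m2 z) ** legr m2 (ad a)).
  by rewrite q; apply: ocl_sub; exists z, (ad a); split=> //; exact: A_ad.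
rewrite adl2; apply: ocl_ad => _ [z' [a' [ha' ->]]]; apply: ocl_sub.
exists (ad a'), z'; split; first exact: A_ad.
by rewrite !adM adK ad_amp.
Qed.

End QuantumGroupData.

Section CoreData.
Variables (R : realType) (G : lcqg R).
Local Notation C := R[i].
Local Notation H := (qgH G).
Local Notation H2 := (qgH2 G).
Local Notation m2 := (htm H2).
Local Notation W := (mopW G).
Local Notation A := (Aop m2 W).

Section Pentagon.
Variable H3 : htensor H2 H.
Local Notation n0 := (htm H3).
Local Notation n013 := (t13 m2 m2 n0).
Local Notation n023 := (t23 m2 m2 n0).
Let T0 : tri m2 m2 m2 n0 n013 n023. Proof. exact: tri_mk. Qed.

Lemma leg12_amp (T : op H3 H3) : is_leg12 (@qgW R G) T -> T = amp n0 n0 W.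
Proof.
move=> [_ h]; apply: (tri_ext (mAB := m2) (n12 := n0)) => x y z x' y' z'.
by rewrite ampE tmip; exact: h.
Qed.

Lemma leg13_amp (T : op H3 H3) : is_leg13 (@qgW R G) T -> T = amp n013 n013 W.
Proof.
move=> [_ h]; apply: (tri_ext (mAB := m2) (n12 := n0)) => x y z x' y' z'.
by rewrite -!T0.2 ampE tmip !T0.2; exact: h.
Qed.

Lemma leg23_amp (T : op H3 H3) : is_leg23 (@qgW R G) T -> T = amp n023 n023 W.
Proof.
move=> [_ h]; apply: (tri_ext (mAB := m2) (n12 := n0)) => x y z x' y' z'.
by rewrite -!T0.1 ampE tmip !T0.1; exact: h.
Qed.
End Pentagon.

Lemma pentagon : exists H3 : htensor H2 H,
  let n0 := htm H3 in let n013 := t13 m2 m2 n0 in let n023 := t23 m2 m2 n0 in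
  amp n023 n023 W ** amp n0 n0 W = amp n0 n0 W ** amp n013 n013 W ** amp n023 n023 W.
Proof.
have [_ [H3 [W12 [W13 [W23 [h12 h13 h23 h]]]]]] := qgW_mult G; exists H3 => n0 n013 n023.
have b12 : blin W12 by apply/bopP; case: h12.
have b13 : blin W13 by apply/bopP; case: h13.
have b23 : blin W23 by apply/bopP; case: h23.
rewrite -(@leg12_amp _ (Op b12))// -(@leg13_amp _ (Op b13))// -(@leg23_amp _ (Op b23))//.
by apply: op_ext => x; exact: (congr1 (@^~ x) h).
Qed.

(** The symmetry of Q gives the identity on the simple vectors of the graph, and it persists in the
    closure because both sides are continuous. So W commutes with Q (x) Q in the weak sense on
    simple tensors. *)
Lemma graph_form (dom : set H) (Q : H -> H) : selfadjoint dom Q -> forall xi eta : H2,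
  graph_tensor dom Q (xi, eta) ->
  forall x u, dom x -> dom u -> ip (m2 (Q x) (Q u)) xi = ip (m2 x u) eta.
Proof.
move=> Qsa xi eta /closure_nrP h x u dx du.
pose q1 := m2 (Q x) (Q u); pose q2 := m2 x u.
apply: (@eq_eps _ _ _ _ (nr q1 + nr q2)) => e e0.
have [s Ss hs] := h e e0.
have E : ip q1 s.1 = ip q2 s.2.
  elim/lin_span_ind: s / Ss {hs} => [|a _ v [y [w [dy dw ->]]] hv]; first by rewrite !ip0r.
  rewrite /= !ipDr !ipZr hv; congr (a * _ + _).
  by rewrite !tmip (Qsym Qsa)// (Qsym Qsa du dw).
have -> : ip q1 xi - ip q2 eta = ip q1 (xi - s.1) - ip q2 (eta - s.2) by rewrite !ipBr E; ring.
have n1 : nr (xi - s.1) <= e.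
  by apply: le_trans _ hs; rewrite -lecR -!nrE {2}/Num.norm/= comparable_le_max ?real_comparable ?normr_real// lexx.
have n2 : nr (eta - s.2) <= e.
  by apply: le_trans _ hs; rewrite -lecR -!nrE {2}/Num.norm/= comparable_le_max ?real_comparable ?normr_real// lexx orbT.
apply: le_trans (nrB _ _) _; rewrite mulrDl; apply: lerD; apply: le_trans (CauchySchwarz _ _) _;
  by rewrite ler_wpM2l ?nr_ge0.
Qed.

(** The conclusions mention only A and W: the conjugate space, Wt, Q and the spaces with more legs
    are chosen inside. *)
Lemma lcqg_core : [/\ (forall a, A a -> A (ad a)),
  total [set v | exists t x, A t /\ v = t x] &
  regular G -> forall (K KH : hilbertType R) (kh : tmap K H KH) (D : Type)
    (pit : D -> op KH KH) (al : H -> H -> D -> D) (pi : D -> op K K),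
  (forall u v d, pi (al u v d) = sr kh u v (pit d)) ->
  (forall d x x' a, A a -> A (sl kh x x' (pit d) ** a)) ->
  (forall d x u x' v u' v', ip (kh x u) (pit (al u' v' d) (kh x' v)) =
    ip (m2 u u') (W (amp m2 m2 (sl kh x x' (pit d)) (ad W (m2 v v'))))) ->
  ocl (pitA A kh pit al) = ocl (piA A kh al pi)].
Proof.
have [H3 P0] := pentagon; have T0 := tri_mk m2 m2 m2 (htm H3).
have [Hb [HbH [dom [Q [Wt0 [Qsa [_ Qinj] UWt0 gr WtQ]]]]]] := qgW_manageable G.
have bWt : blin Wt0 by apply/bopP; case: UWt0.
pose Wt : op HbH HbH := Op bWt.
have UWt : unitary Wt by exact: unitary_opP.
have WQ x u z y : dom x -> dom u -> dom z -> dom y ->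
    ip (m2 (Q x) (Q u)) (W (m2 z y)) = ip (m2 x u) (W (m2 (Q z) (Q y))).
  move=> dx du dz dy; apply: (graph_form Qsa) => //; apply/(gr (m2 z y) (m2 (Q z) (Q y))).1.
  by apply: subset_closure; apply: lin_span_sub; exists z, y.
have [N1 [nas _]] := tensor_exists HbH H.
have T1 := tri_mk (tsw (htm HbH)) m2 (htm HbH) nas.
have WtQ' x z u v : dom u -> dom v ->
    ip (m2 x u) (W (m2 z (Q v))) = ip (htm HbH (hc_map Hb z) (Q u)) (Wt (htm HbH (hc_map Hb x) v)).
  exact: WtQ.
have hA := A_ad T0 P0 Qsa Qinj UWt WtQ' WQ T1.
split=> //; first exact: (A_total _ (mopW_unitary G)).
move=> Hreg K KH kh D pit al pi h1 h2 h3; have [P [pK _]] := tensor_exists K N1.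
exact: (core_pitA (mopW_unitary G) T0 P0 Qsa Qinj UWt WtQ' WQ T1 (regularP hA Hreg) pK h1 h2 h3).
Qed.

End CoreData.

Section Compactness.
Variables (R : realType) (V : hilbertType R).
Local Notation C := R[i].

Lemma line_continuous (x : V) : continuous (fun p : R * R => (Complex p.1 p.2 : C) *: x).
Proof.
move=> p; apply/cvgrPdist_le => _ /gtc0P[e e0 ->].
have d0 : 0 < e / (2 * (nr x + 1)) by rewrite divr_gt0// mulr_gt0//; have := nr_ge0 x; lra.
near=> q; rewrite nrE lecR -scalerBl nrZ.
have h1 : `|p.1 - q.1| < e / (2 * (nr x + 1)).
  near: q; exists (ball p.1 (e / (2 * (nr x + 1))), setT); last by move=> q [].
  by split; [exact: nbhsx_ballx|exact: filterT].
have h2 : `|p.2 - q.2| < e / (2 * (nr x + 1)).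
  near: q; exists (setT, ball p.2 (e / (2 * (nr x + 1)))); last by move=> q [].
  by split; [exact: filterT|exact: nbhsx_ballx].
apply: le_trans (ler_wpM2r (nr_ge0 _) (nr_ReIm _)) _ => /=.
move: h1 h2; rewrite !ltr_pdivlMr; try by have := nr_ge0 x; nra.
Unshelve. all: by end_near.
Qed.

(** The image of the unit ball lies in the multiples of x with coefficient in a square of half side
    nr y, a continuous image of a compact set. *)
Lemma compact_rk (x y : V) : @compact_ops R V (rk x y).
Proof.
split; first by apply/bopP; exact: opP.
pose Q := `[- nr y, nr y]%classic `*` `[- nr y, nr y]%classic.
have cQ : compact ((fun p : R * R => (Complex p.1 p.2 : C) *: x) @` Q).
  apply: continuous_compact; first by apply: continuous_subspaceT; exact: line_continuous.
  by apply: compact_setX; exact: segment_compact.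
apply: precompact_subset (compact_precompact (@norm_hausdorff _ V) cQ) => _ [v v1 <-].
have hy : nr (ip y v) <= nr y.
  apply: le_trans (CauchySchwarz _ _) _; rewrite ler_piMr ?nr_ge0//.
  by move: v1; rewrite /= nrE -[1]/(1%:C) lecR.
exists (complex.Re (ip y v), complex.Im (ip y v)); last by rewrite /=; case: (ip y v).
by split; rewrite /= in_itv/= -ler_norml; apply: le_trans hy; [exact: Re_nr|exact: Im_nr].
Qed.

End Compactness.

Section NormalTensor.
Variables (R : realType) (H K N : hilbertType R) (m : tmap H K N).
Local Notation C := R[i].

Lemma legr_rk y y' : legr m (rk y y') = ketr m y ** ad (ketr m y').
Proof.
apply: (tm_op_ext (m := m)) => a b; rewrite ocE brar (opLZ (ketr m y)) ketrE.
by rewrite (ampE (tsw m) (tsw m)) -[LHS]/(ketl m a (ip y' b *: y)) opLZ.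
Qed.

Definition onp (f : nat -> K) M : op K K := \sum_(k < M) rk (f k) (f k).

Lemma legr_onp f M : legr m (onp f M) = \sum_(k < M) ketr m (f k) ** ad (ketr m (f k)).
Proof.
apply: (tm_op_ext (m := m)) => a b; rewrite op_sumE (ampE (tsw m) (tsw m)).
rewrite -[LHS]/(ketl m a (onp f M b)) /onp op_sumE opL_sum; apply: eq_bigr => k _.
by rewrite -legr_rk (ampE (tsw m) (tsw m)).
Qed.

Lemma onp_bnd f M : onf f -> forall y, nr (onp f M y) <= 1 * nr y.
Proof.
move=> [O U] y; rewrite mul1r; set P := onp f M.
have fP (k : 'I_M) : ip (f k) (P y) = ip (f k) y.
  rewrite /P /onp op_sumE ip_sumr (bigD1 k)//= big1 ?addr0 => [|i ik]; last first.
    by rewrite ipZr O ?mulr0//; apply: contra ik => /eqP/val_inj->.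
  by rewrite ipZr; case: (U k) => ->; rewrite ?mulr1// !ip0l mul0r.
have PP q : (forall k : 'I_M, ip (f k) q = ip (f k) y) -> ip (P y) q = ip y (P y).
  move=> hq; rewrite /P /onp !op_sumE ip_suml ip_sumr.
  by apply: eq_bigr => k _; rewrite ipZl ipZr hq -ipC mulrC.
have [->|P0] := eqVneq (P y) 0; first by rewrite nr0 nr_ge0.
have p0 : 0 < nr (P y) by rewrite nr_gt0.
rewrite -(ler_pM2r p0) -expr2; apply: le_trans (CauchySchwarz _ _).
by rewrite -(PP _ fP) ip_nr nrC ger0_norm ?sqr_ge0.
Qed.

Lemma span_legr s : lin_span (simple m) s -> exists ys : seq K, forall P : op K K,
  (forall j, P (nth 0 ys j) = nth 0 ys j) -> legr m P s = s.
Proof.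
elim/lin_span_ind => {s} [|a _ v [[x y] _ <-] [ys h]]; first by exists [::] => P _; rewrite opL0.
exists (y :: ys) => P hP; rewrite opLP h => [|j]; last exact: (hP j.+1).
by rewrite (ampE (tsw m) (tsw m) P y x) (hP 0%N).
Qed.

(** z is a limit of finite sums of simple tensors. The second legs of all these sums are listed in
    one sequence, with [pickle] coding the pair of the sum and the position in it, and
    orthonormalized; a single sequence suffices although K may be nonseparable. *)
Lemma onp_cvg (z : N) : exists2 f, onf f & tends (fun M => legr m (onp f M) z) z.
Proof.
have h n : exists s, lin_span (simple m) s /\ nr (z - s) <= n.+1%:R^-1.
  have [s] := (totalP _).1 (tmT m) z _ (ltac:(by rewrite invr_gt0) : 0 < n.+1%:R^-1 :> R).
  by exists s.
have [s hs] := choice h.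
have [ys hys] := choice (fun n => span_legr (hs n).1).
pose g k := if @unpickle (nat * nat)%type k is Some p then nth 0 (ys p.1) p.2 else 0.
exists (gs g) => [|e e0]; first exact: gs_onf.
have [n0 hn0] := inv_small (ltac:(lra) : 0 < e / 2).
(* Beyond this rank all second legs of the approximant [s n0] lie in the range of the projection. *)
exists (\max_(j < size (ys n0)) (pickle (n0, val j)).+1)%N => M hM.
have fixP j : onp (gs g) M (nth 0 (ys n0) j) = nth 0 (ys n0) j.
  have [sj|sj] := leqP (size (ys n0)) j; first by rewrite nth_default ?opL0.
  have -> : nth 0 (ys n0) j = g (pickle (n0, j)) by rewrite /g pickleK.
  rewrite /onp op_sumE -gs_span//; apply: leq_trans hM.
  exact: (@leq_bigmax _ (fun j : 'I_(size (ys n0)) => (pickle (n0, val j)).+1) (Ordinal sj)).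
have d : nr (z - s n0) <= e / 2 by apply: le_trans (hs n0).2 (hn0 _ (leqnn _)).
have -> : legr m (onp (gs g) M) z - z = legr m (onp (gs g) M) (z - s n0) - (z - s n0).
  by rewrite opLB (hys n0 _ fixP) opprB addrA subrK.
apply: le_trans (nrB _ _) _.
have := amp_bnd (tsw m) (tsw m) ler01 (onp_bnd M (gs_onf g)) (z - s n0); lra.
Qed.

(* Expanding the second legs along an orthonormal family turns the vector
   functional of [a (x) 1] into a square summable series of vector functionals
   of [a]. *)
Lemma amp_normal (z z' : N) : exists2 mu, normal_functional mu &
  forall a : op H H, mu a = ip z (amp m m a z').
Proof.
have [f onF hf] := onp_cvg z'.
(* The value 0 off the bounded operators is a placeholder, since functionals are total functions on
   H -> H. *)
pose mu (T : H -> H) : C := if pselect (blin T) is left h then ip z (amp m m (Op h) z') else 0.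
have muE (a : op H H) : mu a = ip z (amp m m a z').
  rewrite /mu; case: pselect => [h|/(_ (opP a))//].
  by congr (ip z (amp m m _ z')); apply: op_ext.
exists mu => //; pose x (w : N) k := ad (ketr m (f k)) w.
have sumE (a : op H H) w w' M :
    \sum_(k < M) ip (x w k) (a (x w' k)) = ip w (amp m m a (legr m (onp f M) w')).
  rewrite legr_onp op_sumE opL_sum ip_sumr; apply: eq_bigr => k _.
  by rewrite adl ocE !ketrE ampE.
have xb w : exists B : C, forall n, \sum_(k < n) `|x w k| ^+ 2 <= B.
  exists ((nr w ^+ 2)%:C) => M; have := sumE (oid H) w w M; rewrite amp1 oidE => E.
  have -> : \sum_(k < M) `|x w k| ^+ 2 = ip w (legr m (onp f M) w).
    by rewrite -E; apply: eq_bigr => k _; rewrite oidE ip_norm.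
  have p : 0 <= ip w (legr m (onp f M) w).
    by rewrite -E; apply: sumr_ge0 => k _; rewrite oidE -ip_norm exprn_ge0.
  rewrite -(ger0_norm p) nrE lecR; apply: le_trans (CauchySchwarz _ _) _.
  rewrite expr2 ler_wpM2l ?nr_ge0//.
  by have := amp_bnd (tsw m) (tsw m) ler01 (onp_bnd M onF) w; rewrite mul1r.
exists (x z), (x z'); split=> // T /bopP bT; apply/cvg_tends.
have -> : (fun n => \sum_(k < n) ip (x z k) (T (x z' k))) =
    (fun M => ip z (amp m m (Op bT) (legr m (onp f M) z'))).
  by apply/funext => M; rewrite -sumE.
rewrite (muE (Op bT)).
have B0 : 0 <= nr z * opb (amp m m (Op bT)) by rewrite mulr_ge0 ?nr_ge0 ?opb_ge0.
apply: (tends_bnd B0 hf) => n; rewrite -ipBr -opLB; apply: le_trans (CauchySchwarz _ _) _.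
by rewrite -mulrA ler_wpM2l ?nr_ge0// opbP.
Qed.

End NormalTensor.

(** * Weak actions *)

Section Morphisms.
Variables (R : realType) (D : cstarType R).

Lemma Mor_shom (V : hilbertType R) (Y : set (V -> V)) (phi : D -> V -> V) : Mor Y phi ->
  exists2 phi' : D -> op V V, phi = (fun d => opf (phi' d)) & shom phi'.
Proof.
move=> [hl hm hs hY _].
have b d : blin (phi d) by apply/bopP; case: (hY d).
exists (fun d => Op (b d)) => //; split=> [a x y|x y|x]; apply: op_ext => v /=.
- by rewrite hl.
- by rewrite hm.
- by rewrite hs (adj_ad (Op (b x))).
Qed.

Lemma sh_sum (V : hilbertType R) (phi : D -> op V V) n (F : 'I_n -> D) : shom phi ->
  phi (\sum_k F k) = \sum_k phi (F k).
Proof. by move=> h; apply: big_morph => [x y|]; [exact: shD|exact: sh0]. Qed.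

Lemma multiplier_img (V : hilbertType R) (Y : set (op V V)) (T S : op V V) :
  multiplier (img Y) T -> Y S -> Y (T ** S).
Proof.
move=> [_ h] YS; have [h1 _] := h S ((imgP _ _).2 YS); apply/imgP.
by have -> : opf (T ** S) = opf T \o opf S by [].
Qed.

End Morphisms.

Section Actions.
Variables (R : realType) (G : lcqg R) (D : cstarType R) (alpha : (qgA G -> R[i]) -> D -> D).
Local Notation C := R[i].
Local Notation H := (qgH G).
Local Notation m2 := (htm (qgH2 G)).
Local Notation W := (mopW G).
Local Notation A := (Aop m2 W).

Lemma restrA_eq (mu nu : (H -> H) -> C) : (forall a : op H H, mu a = nu a) ->
  @restrA R G mu = @restrA R G nu.
Proof.
move=> h; apply/funext => -[f hf]; change (mu f = nu f).
have [a _ <-] : img A f by rewrite -qgA_img; exact: set_mem hf.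
exact: h.
Qed.

Lemma conv_vecf u v u' v' (a : op H H) :
  @conv R G (vecf u v) (vecf u' v') a = ip (m2 u u') (W (amp m2 m2 a (ad W (m2 v v')))).
Proof.
rewrite /conv /qgDelta op_tensorl -[@qgW R G]/(opf W) adj_ad.
have -> : opf W \o opf (amp m2 m2 a) \o opf (ad W) = opf (W ** amp m2 m2 a ** ad W) by [].
by rewrite slice_r_vecf vecfE srE.
Qed.

Lemma ocl_slice (V N : hilbertType R) (m : tmap V H N) (X : set (op V V)) (B : set (op H H)) x x' S :
  ocl [set U | exists k a, [/\ X k, B a & U = amp m m k ** legr m a]] S -> ocl B (sl m x x' S).
Proof.
move=> hS; rewrite /sl.
have : ocl [set U | exists k a, [/\ X k, B a & U = ad (ketl m x) ** (amp m m k ** legr m a)]]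
    (ad (ketl m x) ** S).
  by move: hS; apply: ocl_compl => _ [k [a [hk ha ->]]]; apply: ocl_sub; exists k, a.
apply: ocl_compr => _ [k [a [_ ha ->]]].
have -> : ad (ketl m x) ** (amp m m k ** legr m a) ** ketl m x' = ip x (k x') *: a.
  by rewrite -!ocA -[ketl m x']ketr_sw amp_ketr ketr_sw (ocA (amp m m k)) amp_ketl ocA ketl_ad ocZl o1c.
by apply: oclZ; exact: ocl_sub.
Qed.

Section Presentation.
Variables (K : hilbertType R) (KH : htensor K H) (pi : D -> op K K) (pit : D -> op KH KH).
Local Notation kh := (htm KH).
Hypotheses (Hpi : shom pi) (pi_inj : injective pi) (Hpit : shom pit).
Hypothesis Mpit : forall d, multiplier (min_tensor KH (@compact_ops R K) (qgA G)) (pit d).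
Hypothesis Hsl : forall d mu, normal_functional mu ->
  opf (pi (alpha (restrA mu) d)) = slice_r mu (pit d).
Hypothesis wa2 : forall d mu nu, normal_functional mu -> normal_functional nu ->
  alpha (restrA mu) (alpha (restrA nu) d) = alpha (restrA (conv mu nu)) d.
Hypothesis wa1 : forall B : set D, cstar_sub B ->
  closure (lin_span (action_image alpha)) `<=` B -> B = setT.

(** pit d multiplies the compact operators tensored with A. It is tested on a rank one operator
    fixing x', tensored with a, and the result is sliced by x and x'. *)
Lemma pit_multA d x x' a : A a -> A (sl kh x x' (pit d) ** a).
Proof.
move=> ha; have [->|x0] := eqVneq x' 0.
  have k0 : ketl kh 0 = 0 by apply: op_ext => y; rewrite ketlE -[LHS]/(ketr kh y 0) opL0.
  by rewrite /sl k0 oc0r oc0l; exact: ocl0.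
pose Kc := [set T : op K K | @compact_ops R K T].
have EK : @compact_ops R K = img Kc.
  apply/seteqP; split=> [T hT|_ [T hT <-]//].
  have bT : blin T by apply/bopP; case: hT.
  by exists (Op bT).
have := Mpit d; rewrite EK qgA_img min_tensorE => hM.
have n0 : ip x' x' != 0 by rewrite ip_nr; apply/eqP => -[/eqP]; rewrite sqrf_eq0 nr_eq0 (negbTE x0).
(* The scalar is conjugated because the inner product is conjugate linear in its first variable. *)
pose z := cj (ip x' x')^-1 *: x'.
have zx : rk x' z x' = x' by rewrite /rk/= ipZl cjK mulVf// scale1r.
have := multiplier_img (S := amp kh kh (rk x' z) ** legr kh a) hM.
have hS : ocl [set U | exists k a, [/\ Kc k, A a & U = amp kh kh k ** legr kh a]]
    (amp kh kh (rk x' z) ** legr kh a).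
  by apply: ocl_sub; exists (rk x' z), a; split=> //; exact: compact_rk.
move=> /(_ hS) /(ocl_slice x x') /ocl_idem; congr A.
rewrite /sl -!ocA -[ketl _ x']ketr_sw amp_ketr ketr_sw (ocA (amp _ _ _)) amp_ketl zx.
by rewrite !ocA.
Qed.

Definition alv u v d := alpha (restrA (vecf u v)) d.

Lemma alvP u v d : pi (alv u v d) = sr kh u v (pit d).
Proof. by apply: opf_inj; rewrite /alv Hsl ?slice_r_vecf//; exact: vsum_normal. Qed.

(** The convolution of two vector functionals is a |-> (W^* (u (x) u') | (a (x) 1) W^* (v (x) v')).
    By [amp_normal] it is normal, so the presentation can be applied to it once (WA2) has produced
    it. *)
Lemma alv_conv d x u x' v u' v' : ip (kh x u) (pit (alv u' v' d) (kh x' v)) =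
  ip (m2 u u') (W (amp m2 m2 (sl kh x x' (pit d)) (ad W (m2 v v')))).
Proof.
rewrite -srE -alvP /alv wa2; try exact: vsum_normal.
have [mu hmu muE] := amp_normal m2 (ad W (m2 u u')) (ad W (m2 v v')).
rewrite (@restrA_eq _ mu) => [|a]; last by rewrite conv_vecf muE adl.
have [S hS SE] := slice_rE (pit d) hmu.
by have := Hsl d hmu; rewrite hS => /opf_inj->; rewrite SE muE adl.
Qed.

Lemma alpha_approx mu n xi eta d e : normal_functional mu -> 0 <= e -> approx mu e n xi eta ->
  nr (alpha (restrA mu) d - \sum_(k < n) alv (xi k) (eta k) d) <= e * opb (pit d).
Proof.
move=> hmu e0 ha; apply: (hom_isom Hpi pi_inj) => [|x]; first by rewrite mulr_ge0 ?opb_ge0.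
have [S hS SE] := slice_rE (pit d) hmu.
have ES : pi (alpha (restrA mu) d) = S by apply: opf_inj; rewrite Hsl.
rewrite (shB Hpi) opBE ES (sh_sum _ Hpi).
have -> : \sum_(k < n) pi (alv (xi k) (eta k) d) = \sum_(k < n) sl (tsw kh) (xi k) (eta k) (pit d).
  by apply: eq_bigr => k _; rewrite sl_sw alvP.
by apply: (approx_slices e0 ha) => u v; rewrite sr_sw.
Qed.

Lemma alv_gen B : cstar_sub B -> (forall u v d, B (alv u v d)) -> B = setT.
Proof.
move=> hB h; have [cB lB _ _] := hB; apply: wa1 => //.
pose S : set D := [set x | exists u v d, x = alv u v d].
have SB : ncl S `<=` B.
  apply: subset_trans (_ : closure B `<=` B); last by rewrite -(closure_id _).1.
  apply: closure_subset => x hx; apply: lB; move: x hx; apply: lin_span_le => _ [u [v [d ->]]].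
  exact/lin_span_sub/h.
apply: subset_trans SB; apply: ncl_le => _ [_ [d [[mu hmu <-] ->]]].
apply/nclP => e e0; have d0 : 0 < opb (pit d) + 1 by have := opb_ge0 (pit d); lra.
have [n [xi [eta ha]]] := normal_approx hmu (divr_gt0 e0 d0).
exists (\sum_(k < n) alv (xi k) (eta k) d).
  by apply: lin_span_sum => k _; apply: lin_span_sub; exists (xi k), (eta k), d.
apply: le_trans (alpha_approx d hmu (ltW (divr_gt0 e0 d0)) ha) _.
rewrite mulrAC ler_pdivrMr// ler_wpM2l ?(ltW e0)//; lra.
Qed.

End Presentation.

End Actions.

(** * The coaction and its density condition in an arbitrary faithful representation *)

Section Main.
Variables (R : realType) (G : lcqg R) (D : cstarType R) (alpha : (qgA G -> R[i]) -> D -> D).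
Local Notation H := (qgH G).
Local Notation A := (Aop (htm (qgH2 G)) (mopW G)).

Lemma continuous_actionI (K : hilbertType R) (KH : htensor K H) (pi : D -> op K K)
    (pit : D -> op KH KH) :
  shom pi -> injective pi -> shom pit ->
  (forall d, multiplier (min_tensor KH (@compact_ops R K) (qgA G)) (pit d)) ->
  (forall d mu, normal_functional mu -> opf (pi (alpha (restrA mu) d)) = slice_r mu (pit d)) ->
  (forall d mu nu, normal_functional mu -> normal_functional nu ->
     alpha (restrA mu) (alpha (restrA nu) d) = alpha (restrA (conv mu nu)) d) ->
  (forall B : set D, cstar_sub B -> closure (lin_span (action_image alpha)) `<=` B -> B = setT) ->
  regular G -> continuous_action alpha.
Proof.
move=> Hpi pi_inj Hpit Mpit Hsl wa2 wa1 Hreg L LH rho0 Mrho rho0_inj.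
have [rho E Hrho] := Mor_shom Mrho; subst rho0.
have [A_ad A_tot core] := lcqg_core G.
pose kh := htm KH; pose lh := htm LH; pose al u v d := alv alpha u v d.
have Hal u v d : pi (al u v d) = sr kh u v (pit d) by exact: (@alvP _ _ _ alpha K KH pi pit Hsl).
have HpitA : ocl (pitA A kh pit al) = ocl (piA A kh al pi).
  apply: (core Hreg) => [//|d x x' a|d x u x' v u' v']; first exact: (@pit_multA _ G D K KH pit Mpit).
  exact: (@alv_conv _ G D alpha K KH pi pit Hsl wa2).
have Hgen B : cstar_sub B -> (forall u v d, B (al u v d)) -> B = setT.
  exact: (@alv_gen _ G D alpha K KH pi pit Hpi pi_inj Hsl wa1).
pose at_ := alt Hpi pi_inj Hal lh Hrho.
have Hat : shom at_ by exact: (alt_shom A_tot Hpi pi_inj Hpit Hal HpitA Hgen lh Hrho).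
pose Y := ocl (homA A lh (fun d => amp lh lh (rho d))).
have EY : min_tensor LH (range (fun d => opf (rho d))) (qgA G) = img Y.
  have -> : range (fun d => opf (rho d)) = img (range rho).
    by apply/seteqP; split=> [_ [d _ <-]|_ [_ [d _ <-] <-]]; [exists (rho d) => //; exists d|exists d].
  rewrite qgA_img min_tensorE; congr (img (ocl _)); apply/seteqP; split.
    by move=> _ [_ [a [[d _ <-] ha ->]]]; exists d, a.
  by move=> _ [d [a [ha ->]]]; exists (rho d), a; split=> //; exists d.
have Yl d X : Y X -> Y (at_ d ** X) by exact: (alt_mull A_tot Hpi pi_inj Hpit Hal HpitA Hgen Hrho).
have Yr d X : Y X -> Y (X ** at_ d) by exact: (alt_mulr A_ad A_tot Hpi pi_inj Hpit Hal HpitA Hgen Hrho).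
exists (fun d => opf (at_ d)); split.
- split; rewrite ?EY.
  + by move=> a x y; rewrite (sh_lin Hat).
  + by move=> x y; rewrite (sh_mul Hat).
  + by move=> x; rewrite (sh_star Hat) adj_ad.
  + move=> d; split; first by apply/bopP; exact: opP.
    move=> _ [X hX <-]; split; [exists (at_ d ** X) => //; exact: Yl|exists (X ** at_ d) => //; exact: Yr].
  + have -> : [set T | exists d y, img Y y /\ T = opf (at_ d) \o y] =
        img [set T | exists d y, Y y /\ T = at_ d ** y].
      apply/seteqP; split=> [_ [d [_ [[X hX <-] ->]]]|_ [_ [d [X [hX ->]]] <-]].
        by exists (at_ d ** X) => //; exists d, X.
      by exists d, X; split=> //; exists X.
    rewrite op_cspanE; congr img; apply/seteqP; split=> [T hT|].
      by apply: ocl_idem; move: hT; apply: ocl_le => _ [d [X [hX ->]]]; apply: ocl_sub; exact: Yl.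
    exact: (alt_nondeg A_tot Hpi pi_inj Hpit Hal HpitA Hgen).
(* [alt_slice] covers vector functionals only; both sides are compared through a finite sum of them
   that approximates mu. *)
- move=> d mu hmu; have [S hS SE] := slice_rE (at_ d) hmu; rewrite hS; congr opf.
  apply: op_ext => x; apply: (@eq_eps _ _ _ _ ((opb (pit d) + opb (at_ d)) * nr x)) => e e0.
  have [n [xi [eta ha]]] := normal_approx hmu e0.
  have Es : rho (\sum_(k < n) al (xi k) (eta k) d) = \sum_(k < n) sl (tsw lh) (xi k) (eta k) (at_ d).
    by rewrite (sh_sum _ Hrho); apply: eq_bigr => k _; rewrite sl_sw -(alt_slice Hpi pi_inj Hal lh Hrho).
  have h1 : nr (S x - rho (\sum_(k < n) al (xi k) (eta k) d) x) <= e * opb (at_ d) * nr x.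
    by rewrite Es; apply: (approx_slices (ltW e0) ha) => u v; rewrite sr_sw.
  have h2 : nr (rho (alpha (restrA mu) d) x - rho (\sum_(k < n) al (xi k) (eta k) d) x)
      <= e * opb (pit d) * nr x.
    rewrite -opBE -(shB Hrho); apply: le_trans (hom_contr Hrho _ _) _; rewrite ler_wpM2r ?nr_ge0//.
    exact: (@alpha_approx _ G D alpha K KH pi pit Hpi pi_inj Hsl _ _ _ _ d _ hmu (ltW e0) ha).
  rewrite nrBC in h1; apply: le_trans (nr_tri_le h2 h1) _.
  by rewrite le_eqVlt; apply/orP; left; apply/eqP; ring.
- rewrite EY.
  have -> : [set T | exists d a, qgA G a /\ T = opf (at_ d) \o op_tensor LH id a] = img (homA A lh at_).
    rewrite qgA_img; apply/seteqP; split=> [_ [d [_ [[a ha <-] ->]]]|_ [_ [d [a [ha ->]]] <-]].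
      by rewrite op_tensorr; exists (at_ d ** legr lh a) => //; exists d, a.
    by exists d, a; rewrite op_tensorr; split=> //; exists a.
  by rewrite op_cspanE (alt_ocl A_tot Hpi pi_inj Hpit Hal HpitA Hgen lh Hrho).
Qed.

End Main.

Theorem theorem3p3 (R : realType) (G : lcqg R) (D : cstarType R)
    (alpha : (qgA G -> R[i]%C) -> D -> D) :
  regular G -> weak_right_action alpha -> continuous_action alpha.
Proof.
move=> Hreg [_ _ [K [KH [pi0 [pit0 [Rpi pi0_inj Mpit Hsl]]]]] wa1 wa2].
have [pi Epi Hpi] := Mor_shom Rpi; subst pi0.
have [_ _ _ Mp _] := Mpit.
have [pit Epit Hpit] := Mor_shom Mpit; subst pit0.
apply: (continuous_actionI Hpi _ Hpit Mp Hsl wa2 wa1 Hreg).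
by move=> x y h; apply: pi0_inj; rewrite h.
Qed.
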